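(* Let $\kappa>0$, $\gamma>0$ and let $\lambda,\mu,\tau\in\mathbb R$. Consider the cubic medium, i.e. $\sigma_1=\sigma_2=0$ and $\tau_1=\tau_2=\tau$, whose elastic operator has the symbol $$A(\xi)=\begin{pmatrix}\tau\xi_1^2+\mu\xi_2^2&(\lambda+\mu)\xi_1\xi_2\\(\lambda+\mu)\xi_1\xi_2&\mu\xi_1^2+\tau\xi_2^2\end{pmatrix}.$$ Assume that $\mu>0$, $\tau>0$, $-\tau-2\mu<\lambda<\tau$, $(\lambda+\mu)(\tau-\mu)\neq0$ and $\gamma^2\notin\{-(\lambda+\mu),\,\mu-\tau\}$. Then the corresponding thermo-elastic system has the dispersive decay rate $t^{-1/2}$.
   Context: The type-1 system of thermo-elasticity in two space dimensions is $$U_{tt}+A(\mathrm D)U+\gamma\nabla\theta=0,\qquad \theta_t-\kappa\Delta\theta+\gamma\nabla\cdot U_t=0,$$ for the elastic displacement $U(t,x)\in\mathbb R^2$ and the temperature difference $\theta(t,x)\in\mathbb R$, $t\ge0$, $x\in\mathbb R^2$, with thermal conductivity $\kappa>0$ and thermo-elastic coupling $\gamma>0$. The elastic operator $A(\mathrm D)$ is the Fourier multiplier with symbol $A(\xi)=\mathbb D(\xi)^T\mathcal S\,\mathbb D(\xi)$, where $$\mathbb D(\xi)=\begin{pmatrix}\xi_1&0\\0&\xi_2\\ \xi_2&\xi_1\end{pmatrix},\qquad \mathcal S=\begin{pmatrix}\tau_1&\lambda&\sigma_1\\ \lambda&\tau_2&\sigma_2\\ \sigma_1&\sigma_2&\mu\end{pmatrix}.$$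 When $A(\xi)$ is positive definite for $\xi\ne0$, $\sqrt{A(\mathrm D)}$ denotes the Fourier multiplier with symbol the positive square root of $A(\xi)$. Solutions are those obtained by Fourier transform in $x$ from initial data $U(0,\cdot)\in H^1(\mathbb R^2)$, $U_t(0,\cdot)\in L^2(\mathbb R^2)$, $\theta(0,\cdot)\in L^2(\mathbb R^2)$. For $r\in\mathbb R$, $H^{1,r}$ denotes the Bessel potential (Sobolev) space over $L^1(\mathbb R^2)$ of order $r$, with norm $\|f\|_{H^{1,r}}=\|\langle\mathrm D\rangle^r f\|_{L^1(\mathbb R^2)}$. For $\chi\in C^\infty(\mathbb S^1)$, $\chi(\mathrm D)$ denotes the Fourier multiplier with the $0$-homogeneous symbol $\chi(\xi/|\xi|)$. For $\delta>0$, the medium (with the given $\kappa,\gamma$) has the dispersive decay rate $t^{-\delta}$ if every direction $\bar\eta\in\mathbb S^1$ has a neighbourhood $V\subset\mathbb S^1$ such that for every $\chi\in C^\infty(\mathbb S^1)$ supported in $V$ and every $r>2$ there is a constant $C$ such that all solutions satisfy, for all $t\ge0$, $$\|\chi(\mathrm D)(U_t,\sqrt{A(\mathrm D)}U,\theta)(t,\cdot)\|_{L^\infty}\le C(1+t)^{-\delta}\,\|\chi(\mathrm D)(U_t,\sqrt{A(\mathrm D)}U,\theta)(0,\cdot)\|_{H^{1,r}}$$ whenever the right-hand side is finite. *)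

(* Defs.v *)
From HB Require Import structures.
From mathcomp Require Import all_boot all_order all_algebra.
From mathcomp Require Import all_classical all_reals all_analysis.
From mathcomp Require Import complex ring.

Set Implicit Arguments.
Unset Strict Implicit.
Unset Printing Implicit Defensive.

Import Order.TTheory GRing.Theory Num.Theory.
Import numFieldNormedType.Exports.

Local Open Scope classical_set_scope.
Local Open Scope ring_scope.
Local Open Scope complex_scope.

(* Points and frequencies of the plane. *)
Notation plane R := (measurableTypeR R * measurableTypeR R)%type.

Definition leb2 (R : realType) : {measure set (plane R) -> \bar R} :=
  (@lebesgue_measure R \x @lebesgue_measure R)%E.

Definition dot2 (R : realType) (x y : plane R) : R := x.1 * y.1 + x.2 * y.2.

Definition norm2 (R : realType) (x : plane R) : R := Num.sqrt (dot2 x x).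

(* x / |x|; the value at the origin, (0, 0), is irrelevant. *)
Definition unit2 (R : realType) (x : plane R) : plane R :=
  (x.1 / norm2 x, x.2 / norm2 x).

Definition col2 (R : realType) (x : plane R) : 'cV[R]_2 :=
  \col_i [:: x.1; x.2]`_i.

(* The Japanese bracket. *)
Definition jap (R : realType) (x : plane R) : R :=
  Num.sqrt (1 + norm2 x ^+ 2).

(* The Euclidean norm of C^n. *)
Definition vnorm (R : realType) (n : nat) (v : 'cV[R[i]]_n) : R :=
  Num.sqrt (\sum_i (complex.Re (v i 0) ^+ 2 + complex.Im (v i 0) ^+ 2)).

Definition complexify (R : realType) (m n : nat) (A : 'M[R]_(m, n)) :
  'M[R[i]]_(m, n) := map_mx (real_complex R) A.

(* The norm ||f||_{L^p}, 1 <= p <= oo, of a C^n-valued function. *)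
Definition Lpnorm (R : realType) (n : nat) (p : \bar R)
    (f : plane R -> 'cV[R[i]]_n) : \bar R :=
  ('N[leb2 R]_p[(fun x => (vnorm (f x))%:E)])%E.

Definition in_Lp (R : realType) (n : nat) (p : \bar R)
    (f : plane R -> 'cV[R[i]]_n) : Prop :=
  (forall i, measurable_fun setT (fun x => complex.Re (f x i 0)) /\
             measurable_fun setT (fun x => complex.Im (f x i 0))) /\
  (Lpnorm p f < +oo)%E.

Definition cintegral (R : realType) (f : plane R -> R[i]) : R[i] :=
  (\int[leb2 R]_x complex.Re (f x)) +i* (\int[leb2 R]_x complex.Im (f x)).

(* The Fourier transform of f in L^1, normalised to be unitary on L^2. *)
Definition fourierL1 (R : realType) (n : nat) (f : plane R -> 'cV[R[i]]_n)
    (xi : plane R) : 'cV[R[i]]_n :=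
  \col_k ((2 * pi)^-1%:C *
    cintegral (fun x => (cos (dot2 x xi) -i* sin (dot2 x xi)) * f x k 0)).

Definition truncate (R : realType) (n k : nat) (f : plane R -> 'cV[R[i]]_n)
    (x : plane R) : 'cV[R[i]]_n :=
  if norm2 x <= k%:R then f x else 0.

(* F is the Fourier(-Plancherel) transform of f in L^2: the L^2-limit of the
   transforms of the truncations of f to the disks of radius k.  By
   Plancherel's theorem every f in L^2 has such an F, every F in L^2 has such
   an f, and each determines the other almost everywhere. *)
Definition is_fourierL2 (R : realType) (n : nat)
    (f F : plane R -> 'cV[R[i]]_n) : Prop :=
  [/\ in_Lp 2%:E f, in_Lp 2%:E F &
      (fun k : nat =>
         Lpnorm 2%:E (fun xi => F xi - fourierL1 (truncate k f) xi))
        @ \oo --> 0%E].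

(* g = m(D) f for the (matrix-valued) symbol m, with f and g in L^2. *)
Definition is_multiplier (R : realType) (p q : nat)
    (m : plane R -> 'M[R[i]]_(p, q))
    (f : plane R -> 'cV[R[i]]_q) (g : plane R -> 'cV[R[i]]_p) : Prop :=
  exists F, is_fourierL2 f F /\ is_fourierL2 g (fun xi => m xi *m F xi).

Definition in_H1 (R : realType) (n : nat) (f : plane R -> 'cV[R[i]]_n) : Prop :=
  exists F, is_fourierL2 f F /\ in_Lp 2%:E (fun xi => (jap xi)%:C *: F xi).

(* g = <D>^r f for f in L^2 and g in L^1, as tempered distributions. *)
Definition is_bessel (R : realType) (n : nat) (r : R)
    (f g : plane R -> 'cV[R[i]]_n) : Prop :=
  in_Lp 1%:E g /\
  exists F, is_fourierL2 f F /\
    {ae leb2 R, forall xi, fourierL1 g xi = (jap xi `^ r)%:C *: F xi}.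

(* The norm of f in H^{1,r}, for f in L^2.  A g as above is unique up to null
   sets, so this is the L^1 norm of <D>^r f when that lies in L^1, and +oo
   otherwise. *)
Definition H1rnorm (R : realType) (n : nat) (r : R)
    (f : plane R -> 'cV[R[i]]_n) : \bar R :=
  ereal_inf [set Lpnorm 1%:E g | g in is_bessel r f].

Definition strain_symbol (R : realType) (xi : plane R) : 'M[R]_(3, 2) :=
  \matrix_(i, j) (nth [::] [:: [:: xi.1; 0];
                               [:: 0; xi.2];
                               [:: xi.2; xi.1]] i)`_j.

Definition stiffness (R : realType) (tau1 tau2 lambda mu sigma1 sigma2 : R) :
  'M[R]_3 :=
  \matrix_(i, j) (nth [::] [:: [:: tau1; lambda; sigma1];
                               [:: lambda; tau2; sigma2];
                               [:: sigma1; sigma2; mu]] i)`_j.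

Definition elastic_symbol (R : realType) (S : 'M[R]_3) (xi : plane R) :
  'M[R]_2 := (strain_symbol xi)^T *m S *m strain_symbol xi.

Definition cubic_stiffness (R : realType) (tau lambda mu : R) : 'M[R]_3 :=
  stiffness tau tau lambda mu 0 0.

Lemma cubic_symbolE (R : realType) (tau lambda mu : R) (xi : plane R) :
  elastic_symbol (cubic_stiffness tau lambda mu) xi =
  \matrix_(i, j) (nth [::]
    [:: [:: tau * xi.1 ^+ 2 + mu * xi.2 ^+ 2; (lambda + mu) * xi.1 * xi.2];
        [:: (lambda + mu) * xi.1 * xi.2; mu * xi.1 ^+ 2 + tau * xi.2 ^+ 2]]
    i)`_j.
Proof.
apply/matrixP => i j; rewrite !mxE !big_ord_recl big_ord0 !mxE.
rewrite !big_ord_recl !big_ord0 !mxE /=.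
case: i => [[|[|//]] hi]; case: j => [[|[|//]] hj] /=;
  ring.
Qed.

(* The positive square root of a positive semidefinite matrix, which is unique;
   the default 0 is never used on the symbols of interest. *)
Definition sqrtmx (R : realType) (n : nat) (A : 'M[R]_n) : 'M[R]_n :=
  xget 0 [set B | [/\ B^T = B,
                      forall v : 'cV[R]_n, 0 <= (v^T *m B *m v) 0 0 &
                      B *m B = A]].

Definition has_derivative (R : realType) (n : nat) (f : R -> 'cV[R[i]]_n)
    (t : R) (l : 'cV[R[i]]_n) : Prop :=
  forall i, is_derive t 1 (fun s => complex.Re (f s i 0)) (complex.Re (l i 0)) /\
            is_derive t 1 (fun s => complex.Im (f s i 0)) (complex.Im (l i 0)).

Definition right_continuous0 (R : realType) (n : nat)
    (f : R -> 'cV[R[i]]_n) : Prop :=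
  forall i,
    (complex.Re (f t i 0) @[t --> (0 : R)^'+] --> complex.Re (f 0 i 0)) /\
    (complex.Im (f t i 0) @[t --> (0 : R)^'+] --> complex.Im (f 0 i 0)).

(* The Fourier transform in x of the type-1 system at frequency xi, for t > 0,
   as a first-order system for (u, v, theta) with v = u_t; the values at t = 0
   are attained continuously. *)
Definition fourier_system (R : realType) (A : plane R -> 'M[R]_2)
    (kappa gamma : R) (xi : plane R)
    (u v : R -> 'cV[R[i]]_2) (theta : R -> 'cV[R[i]]_1) : Prop :=
  [/\ [/\ right_continuous0 u, right_continuous0 v & right_continuous0 theta],
      forall t : R, 0 < t -> has_derivative u t (v t),
      forall t : R, 0 < t -> has_derivative v t
        (- (complexify (A xi) *m u t)
         - (gamma%:C * 'i) *: (complexify (col2 xi) *m theta t)) &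
      forall t : R, 0 < t -> has_derivative theta t
        (- ((kappa * norm2 xi ^+ 2)%:C *: theta t)
         - (gamma%:C * 'i) *: ((complexify (col2 xi))^T *m v t))].

(* U, its time derivative Ut, and theta solve the type-1 system with elastic
   operator A(D), with data U(0) in H^1 and Ut(0), theta(0) in L^2. *)
Definition thermo_solution (R : realType) (A : plane R -> 'M[R]_2)
    (kappa gamma : R) (U Ut : R -> plane R -> 'cV[R]_2)
    (theta : R -> plane R -> R) : Prop :=
  in_H1 (fun x => complexify (U 0 x)) /\
  exists (Uh Vh : R -> plane R -> 'cV[R[i]]_2)
         (thetah : R -> plane R -> 'cV[R[i]]_1),
    (forall t : R, 0 <= t ->
       [/\ is_fourierL2 (fun x => complexify (U t x)) (Uh t),
           is_fourierL2 (fun x => complexify (Ut t x)) (Vh t) &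
           is_fourierL2 (fun x => complexify (theta t x)%:M) (thetah t)]) /\
    {ae leb2 R, forall xi, fourier_system A kappa gamma xi
       (fun t => Uh t xi) (fun t => Vh t xi) (fun t => thetah t xi)}.

(* w = chi(D) (U_t, sqrt(A(D)) U, theta) (t, .), where chi(D) has the
   0-homogeneous symbol chi(xi / |xi|). *)
Definition is_localized_state (R : realType) (A : plane R -> 'M[R]_2)
    (chi : R * R -> R[i]) (U Ut : R -> plane R -> 'cV[R]_2)
    (theta : R -> plane R -> R) (t : R)
    (w : plane R -> 'cV[R[i]]_(2 + 2 + 1)) : Prop :=
  exists Y : plane R -> 'cV[R[i]]_2,
    is_multiplier (fun xi => complexify (sqrtmx (A xi)))
      (fun x => complexify (U t x)) Y /\
    is_multiplier (fun xi => (chi (unit2 xi))%:M)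
      (fun x => col_mx (col_mx (complexify (Ut t x)) (Y x))
                       (complexify (theta t x)%:M)) w.

Definition circle (R : realType) : set (R * R) :=
  [set x | x.1 ^+ 2 + x.2 ^+ 2 = 1].
Arguments circle R : clear implicits.

(* chi restricted to the unit circle is C^oo; only that restriction matters. *)
Definition smooth_on_circle (R : realType) (chi : R * R -> R[i]) : Prop :=
  forall (n : nat) (t : R),
    derivable (derive1n n (fun s => complex.Re (chi (cos s, sin s)))) t 1 /\
    derivable (derive1n n (fun s => complex.Im (chi (cos s, sin s)))) t 1.

Definition circle_support (R : realType) (chi : R * R -> R[i]) : set (R * R) :=
  closure [set x | circle R x /\ chi x != 0].

(* Since w0 and w are determined up to null sets, and exist by Plancherel's
   theorem, quantifying over them amounts to speaking of
   chi(D) (U_t, sqrt(A(D)) U, theta) at times 0 and t. *)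
Definition has_dispersive_decay (R : realType) (A : plane R -> 'M[R]_2)
    (kappa gamma delta : R) : Prop :=
  forall eta : R * R, circle R eta ->
  exists V : set (R * R),
    [/\ V `<=` circle R, within (circle R) (nbhs eta) V &
    forall chi : R * R -> R[i],
      smooth_on_circle chi -> circle_support chi `<=` V ->
    forall r : R, 2 < r ->
    exists C : R,
    forall (U Ut : R -> plane R -> 'cV[R]_2) (theta : R -> plane R -> R),
      thermo_solution A kappa gamma U Ut theta ->
    forall (t : R) (w0 w : plane R -> 'cV[R[i]]_(2 + 2 + 1)),
      0 <= t ->
      is_localized_state A chi U Ut theta 0 w0 ->
      is_localized_state A chi U Ut theta t w ->
      (H1rnorm r w0 < +oo)%E ->
      (Lpnorm +oo w <= (C * (1 + t) `^ (- delta))%:E * H1rnorm r w0)%E].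

(* Main.v *)
(* In Fourier space the system is, for each frequency xi = rho n with |n| = 1, a
   linear ODE.  With p = rho u, a Lyapunov functional shows that the energy
   |v|^2 + p.A(n)p + |theta|^2 decays like exp(- c d t rho^2 / (1 + rho^2)),
   uniformly in xi, where d is the square of
     det(n, A(n) n) = (lambda + 2 mu - tau) n1 n2 (n1^2 - n2^2).
   If lambda + 2 mu <> tau, the determinant vanishes to first order on four
   lines, and for every linear form l with such a zero line and every r > 2 the
   integral of exp(- c t l(xi)^2 / <xi>^2) <xi>^(-r) is O((1 + t)^(-1/2)); the
   bound follows by Fourier inversion.  In the isotropic case
   lambda + 2 mu = tau the longitudinal part and the temperature obey the same
   Lyapunov estimate with constant d, while the transversal part is an undamped
   wave of speed sqrt mu, whose kernel is O(t^(-1/2)) by van der Corput's lemma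
   in one frequency variable.  No cut-off is needed: V is the whole circle and
   chi(D) only multiplies the Fourier transforms. *)
Require Import Defs.
From HB Require Import structures.
From mathcomp Require Import all_boot all_order all_algebra.
From mathcomp Require Import all_classical all_reals all_analysis.
From mathcomp Require Import measurable_realfun ess_sup_inf.
From mathcomp Require Import complex ring lra.
Set Implicit Arguments.
Unset Strict Implicit.
Unset Printing Implicit Defensive.
Import Order.TTheory GRing.Theory Num.Theory.
Import numFieldNormedType.Exports.
Local Open Scope classical_set_scope.
Local Open Scope ring_scope.

(** Frequency bounds have to become an L^oo bound although the transform is only known as an L^2
    limit of truncations. Inversion is proved from that definition, without Plancherel's identity:
    both sides are averaged over boxes, whose transforms are visibly square integrable; damping by
    exp(- e |xi1| - e |xi2|) permits Fubini and turns the frequency integral into Poisson kernels,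
    whose integrals over intervals are arctangents. A pi-lambda argument passes from boxes to almost
    every point. The H^{1,r} norm enters in one way only: the transform of the initial state is
    <xi>^(-r) times that of some g in L^1, hence bounded by a multiple of <xi>^(-r) |g|_1, and r > 2
    makes the resulting weights integrable. Both cases share one statement: the state at time t
    differs from M(t, xi) times the initial state by a term that decays away from the four lines,
    with M = 0 outside the isotropic case. That remainder is integrated in absolute value. The term
    with M, which does not decay in modulus, becomes a convolution of g with an oscillatory kernel
    and is bounded by the supremum of the kernel. *)

Section real_integration.
Context d (T : measurableType d) (R : realType) (mu : {measure set T -> \bar R}).
Implicit Types (f g : T -> R).

Lemma rintegrable_le f g : measurable_fun setT f ->
  (forall x, `|f x| <= g x) -> mu.-integrable setT (EFin \o g) ->
  mu.-integrable setT (EFin \o f).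
Proof.
move=> mf fg ig; apply: le_integrable ig => //; first exact/measurable_EFinP.
by move=> x _ /=; rewrite lee_fin (le_trans (fg x))// ler_norm.
Qed.

Lemma rintegrable_measurable f : mu.-integrable setT (EFin \o f) ->
  measurable_fun setT f.
Proof. by move=> /measurable_int/measurable_EFinP. Qed.

Lemma rintegrableD f g : mu.-integrable setT (EFin \o f) ->
  mu.-integrable setT (EFin \o g) ->
  mu.-integrable setT (EFin \o (fun x => f x + g x)).
Proof. by move=> f1 g1; apply: (integrableD measurableT f1 g1). Qed.

Lemma rintegrableN f : mu.-integrable setT (EFin \o f) ->
  mu.-integrable setT (EFin \o (fun x => - f x)).
Proof. by move=> f1; have := integrableN f1; apply: eq_integrable. Qed.

Lemma rintegrableB f g : mu.-integrable setT (EFin \o f) ->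
  mu.-integrable setT (EFin \o g) ->
  mu.-integrable setT (EFin \o (fun x => f x - g x)).
Proof. by move=> f1 g1; have := integrableB measurableT f1 g1; apply: eq_integrable. Qed.

Lemma rintegrableZ (k : R) f : mu.-integrable setT (EFin \o f) ->
  mu.-integrable setT (EFin \o (fun x => k * f x)).
Proof. by move=> f1; have := integrableZl measurableT k f1; apply: eq_integrable. Qed.

Lemma rintegrable_norm f : mu.-integrable setT (EFin \o f) ->
  mu.-integrable setT (EFin \o (fun x => `|f x|)).
Proof. exact: integrable_norm. Qed.

Lemma rintegrable_sum (I : Type) (s : seq I) (h : I -> T -> R) :
  (forall i, mu.-integrable setT (EFin \o h i)) ->
  mu.-integrable setT (EFin \o (fun x => \sum_(i <- s) h i x)).
Proof.
move=> hi; elim: s => [|a s ih].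
  by under [X in _ \o X]eq_fun do rewrite big_nil; exact: integrable0.
under [X in _ \o X]eq_fun do rewrite big_cons.
exact: rintegrableD.
Qed.

Lemma rintegrable_indic (A : set T) : measurable A -> (mu A < +oo)%E ->
  mu.-integrable setT (EFin \o \1_A).
Proof.
move=> mA fA; apply/integrableP; split.
  by apply/measurable_EFinP; exact: measurable_indic.
under eq_integral do rewrite /= ger0_norm//.
by rewrite integral_indic// setIT.
Qed.

Lemma rintegrable_bmul (M : R) f g : measurable_fun setT f ->
  (forall x, `|f x| <= M) -> mu.-integrable setT (EFin \o g) ->
  mu.-integrable setT (EFin \o (fun x => f x * g x)).
Proof.
move=> mf fM ig; apply: (@rintegrable_le _ (fun x => M * `|g x|)).
- by apply: measurable_funM => //; exact: rintegrable_measurable.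
- by move=> x; rewrite normrM ler_wpM2r.
- exact/rintegrableZ/rintegrable_norm.
Qed.

Lemma EFin_Rintegral f : mu.-integrable setT (EFin \o f) ->
  (\int[mu]_x f x)%:E = (\int[mu]_x (f x)%:E)%E.
Proof. by move=> i; rewrite /Rintegral fineK// (integrable_fin_num _ i). Qed.

Lemma norm_Rintegral_le f g : mu.-integrable setT (EFin \o f) ->
  mu.-integrable setT (EFin \o g) -> (forall x, `|f x| <= g x) ->
  `|\int[mu]_x f x| <= \int[mu]_x g x.
Proof.
move=> i1 i2 fg; apply: le_trans (le_normr_Rintegral _ _) _ => //.
by apply: le_Rintegral => //; exact: rintegrable_norm.
Qed.

Lemma ge0_rintegrable f (M : R) : measurable_fun setT f -> (forall x, 0 <= f x) ->
  (\int[mu]_x (f x)%:E <= M%:E)%E -> mu.-integrable setT (EFin \o f).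
Proof.
move=> mf f0 h; apply/integrableP; split; first exact/measurable_EFinP.
under eq_integral do rewrite /= ger0_norm//.
exact: le_lt_trans h (ltry _).
Qed.

Lemma Rintegral_dominated (f_ : nat -> T -> R) f g :
  (forall n, measurable_fun setT (f_ n)) -> measurable_fun setT f ->
  {ae mu, forall x, f_ ^~ x @ \oo --> f x} ->
  (forall n x, `|f_ n x| <= g x) -> mu.-integrable setT (EFin \o g) ->
  mu.-integrable setT (EFin \o f) /\ \int[mu]_x f_ n x @[n --> \oo] --> \int[mu]_x f x.
Proof.
move=> mf_ mf cf fg ig.
have [] := @dominated_convergence _ _ _ mu setT measurableT (fun n => EFin \o f_ n) (EFin \o f) (EFin \o g) _ _ _ ig _.
- by move=> n; exact/measurable_EFinP.
- exact/measurable_EFinP.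
- apply: filterS cf => x fx _; apply: cvg_EFin => //.
  by near=> n.
- by apply: aeW => x n _; rewrite /= lee_fin.
move=> i1 _ c; split => //.
have e : (\int[mu]_x (EFin \o f) x)%E = (\int[mu]_x f x)%:E by rewrite EFin_Rintegral.
by rewrite e in c; exact: (fine_cvg c).
Unshelve. all: by end_near. Qed.
End real_integration.

(** * Fubini's theorem for functions bounded by a tensor product *)

Section real_fubini.
Context d1 d2 (T1 : measurableType d1) (T2 : measurableType d2) (R : realType).
Context (m1 : {sigma_finite_measure set T1 -> \bar R})
        (m2 : {sigma_finite_measure set T2 -> \bar R}).
Implicit Types (f : T1 * T2 -> R) (g : T1 -> R) (h : T2 -> R).

(** A tensor bound reduces integrability on the product to two one-variable checks; nearly all
    exchanges of integrals below are justified in this way. Only the product of [g] and [h] is known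
    to be non-negative, hence the absolute values in the proof. *)
Lemma integrable_tensor f g h : measurable_fun setT f ->
  m1.-integrable setT (EFin \o g) -> m2.-integrable setT (EFin \o h) ->
  (forall z, `|f z| <= g z.1 * h z.2) ->
  (m1 \x m2)%E.-integrable setT (EFin \o f).
Proof.
move=> mf ig ih fgh.
apply/integrable12ltyP; first exact/measurable_EFinP.
have mg := rintegrable_measurable ig; have mh := rintegrable_measurable ih.
apply: (@le_lt_trans _ _ ((\int[m1]_x `|g x|) * (\int[m2]_x `|h x|))%:E); last exact: ltry.
rewrite EFinM; have -> : ((\int[m1]_x `|g x|)%:E * (\int[m2]_x `|h x|)%:E =
   \int[m1]_x (`|g x|%:E * (\int[m2]_x `|h x|)%:E))%E.
  rewrite ge0_integralZr//; last 2 first.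
  - by apply/measurable_EFinP; exact: measurableT_comp.
  - by rewrite lee_fin Rintegral_ge0.
  by rewrite EFin_Rintegral//; exact: rintegrable_norm.
apply: ge0_le_integral => //.
- by move=> x _; apply: integral_ge0.
- apply: (measurable_fun_fubini_tonelli_F (fun z => `|(f z)%:E|%E)).
    by apply/measurable_EFinP; exact: measurableT_comp.
  by move=> z; exact: abse_ge0.
- by apply: emeasurable_funM => //; apply/measurable_EFinP; exact: measurableT_comp.
move=> x _; rewrite EFin_Rintegral; last exact: rintegrable_norm.
rewrite -ge0_integralZl//; last by apply/measurable_EFinP; exact: measurableT_comp.
apply: ge0_le_integral => //.
- by apply/measurable_EFinP; apply: measurableT_comp => //; exact: measurable_fun_pair2.
- by apply/measurable_EFinP; apply: measurable_funM => //; exact: measurableT_comp.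
by move=> y _; rewrite lee_fin (le_trans (fgh (x,y)))//= (le_trans (ler_norm _))// normrM.
Qed.

Lemma rintegrable_section1 f g h (y : T2) : measurable_fun setT f ->
  m1.-integrable setT (EFin \o g) -> (forall z, `|f z| <= g z.1 * h z.2) ->
  m1.-integrable setT (EFin \o (fun x => f (x, y))).
Proof.
move=> mf ig fgh; apply: (@rintegrable_le _ _ _ _ _ (fun x => h y * g x)).
- exact: measurable_fun_pair1.
- by move=> x; rewrite mulrC; exact: (fgh (x, y)).
- exact: rintegrableZ.
Qed.

Lemma rintegrable_section2 f g h (x : T1) : measurable_fun setT f ->
  m2.-integrable setT (EFin \o h) -> (forall z, `|f z| <= g z.1 * h z.2) ->
  m2.-integrable setT (EFin \o (fun y => f (x, y))).
Proof.
move=> mf ih fgh; apply: (@rintegrable_le _ _ _ _ _ (fun y => g x * h y)).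
- exact: measurable_fun_pair2.
- by move=> y; exact: (fgh (x, y)).
- exact: rintegrableZ.
Qed.

Lemma Rintegral_prod f g h : measurable_fun setT f ->
  m1.-integrable setT (EFin \o g) -> m2.-integrable setT (EFin \o h) ->
  (forall z, `|f z| <= g z.1 * h z.2) ->
  m1.-integrable setT (EFin \o (fun x => \int[m2]_y f (x, y))) /\
  \int[(m1 \x m2)%E]_z f z = \int[m1]_x \int[m2]_y f (x, y).
Proof.
move=> mf ig ih fgh; have i12 := integrable_tensor mf ig ih fgh.
have e x : (\int[m2]_y f (x, y))%:E = fubini_F m2 (EFin \o f) x.
  by rewrite EFin_Rintegral//; exact: rintegrable_section2 ih fgh.
have i1 : m1.-integrable setT (EFin \o (fun x => \int[m2]_y f (x, y))).
  have := integrable_fubini_F i12; apply: eq_integrable => // x _.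
  by rewrite -e.
split => //; apply: EFin_inj; rewrite !EFin_Rintegral//.
rewrite -[LHS](@integral12_prod_meas1 _ _ _ _ _ m1 m2 (EFin \o f))//.
by apply: eq_integral => x _; rewrite e.
Qed.

Lemma Rintegral_fubini f g h : measurable_fun setT f ->
  m1.-integrable setT (EFin \o g) -> m2.-integrable setT (EFin \o h) ->
  (forall z, `|f z| <= g z.1 * h z.2) ->
  \int[m1]_x \int[m2]_y f (x, y) = \int[m2]_y \int[m1]_x f (x, y).
Proof.
move=> mf ig ih fgh; have i12 := integrable_tensor mf ig ih fgh.
have [i1 _] := Rintegral_prod mf ig ih fgh.
have e x : (\int[m2]_y f (x, y))%:E = fubini_F m2 (EFin \o f) x.
  by rewrite EFin_Rintegral//; exact: rintegrable_section2 ih fgh.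
have e' y : (\int[m1]_x f (x, y))%:E = fubini_G m1 (EFin \o f) y.
  by rewrite EFin_Rintegral//; exact: rintegrable_section1 ig fgh.
rewrite [LHS]/Rintegral [RHS]/Rintegral; congr fine.
under eq_integral do rewrite e.
under [RHS]eq_integral do rewrite e'.
exact: (Fubini i12).
Qed.

Lemma Rintegral_tensor g h :
  m1.-integrable setT (EFin \o g) -> m2.-integrable setT (EFin \o h) ->
  (m1 \x m2)%E.-integrable setT (EFin \o (fun z => g z.1 * h z.2)) /\
  \int[(m1 \x m2)%E]_z (g z.1 * h z.2) = (\int[m1]_x g x) * (\int[m2]_y h y).
Proof.
move=> ig ih.
have mf : measurable_fun setT (fun z : T1 * T2 => g z.1 * h z.2).
  apply: measurable_funM.
    by apply: measurableT_comp (rintegrable_measurable ig) _; exact: measurable_fst.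
  by apply: measurableT_comp (rintegrable_measurable ih) _; exact: measurable_snd.
have b z : `|g z.1 * h z.2| <= `|g z.1| * `|h z.2| by rewrite normrM.
have ig' := rintegrable_norm ig; have ih' := rintegrable_norm ih.
split.
  exact: (@integrable_tensor _ (fun x => `|g x|) (fun x => `|h x|)).
have [_ ->] := @Rintegral_prod _ (fun x => `|g x|) (fun x => `|h x|) mf ig' ih' b.
rewrite -RintegralZr//; apply: eq_Rintegral => x _ /=.
by rewrite RintegralZl.
Qed.

End real_fubini.

(** * Derivatives of explicit expressions *)

Section real_derivatives.
Context (R : realType).
Implicit Types (f g : R -> R) (x a b : R).

Lemma is_derive1_cst x (c : R) : is_derive x 1 (fun _ => c) 0.
Proof. exact: is_derive_cst. Qed.

Lemma is_derive1_id x : is_derive x 1 (fun y : R => y) 1.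
Proof. exact: is_derive_id. Qed.

Lemma is_derive1_add f g x a b : is_derive x 1 f a -> is_derive x 1 g b ->
  is_derive x 1 (fun y => f y + g y) (a + b).
Proof. by move=> fa gb; have := is_deriveD fa gb. Qed.

Lemma is_derive1_opp f x a : is_derive x 1 f a ->
  is_derive x 1 (fun y => - f y) (- a).
Proof. by move=> fa; have := is_deriveN fa. Qed.

Lemma is_derive1_mul f g x a b : is_derive x 1 f a -> is_derive x 1 g b ->
  is_derive x 1 (fun y => f y * g y) (a * g x + f x * b).
Proof.
move=> fa gb; have := is_deriveM fa gb => h; apply: is_derive_eq.
by rewrite /GRing.scale/= addrC mulrC.
Qed.

Lemma is_derive1_exp f x a n : is_derive x 1 f a ->
  is_derive x 1 (fun y => f y ^+ n.+1) (n.+1%:R * f x ^+ n * a).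
Proof.
move=> fa; have := is_deriveX n.+1 fa.
rewrite (_ : f ^+ n.+1 = fun y => f y ^+ n.+1) //.
by apply/funext => y; elim: n.+1 => [|m ih]; rewrite ?expr0 // !exprS -ih.
Qed.

Lemma is_derive1_inv f x a : f x != 0 -> is_derive x 1 f a ->
  is_derive x 1 (fun y => (f y)^-1) (- (f x) ^- 2 * a).
Proof.
by move=> f0 fa; have := is_deriveV f0 fa.
Qed.

Lemma is_derive1_compo f g x a b : is_derive (g x) 1 f a -> is_derive x 1 g b ->
  is_derive x 1 (fun y => f (g y)) (a * b).
Proof. by move=> fa gb; exact: is_derive1_comp. Qed.

Lemma is_derive1_expR g x b : is_derive x 1 g b ->
  is_derive x 1 (fun y => expR (g y)) (expR (g x) * b).
Proof. by move=> gb; apply: is_derive1_compo. Qed.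

Lemma is_derive1_sin g x b : is_derive x 1 g b ->
  is_derive x 1 (fun y => sin (g y)) (cos (g x) * b).
Proof. by move=> gb; apply: is_derive1_compo. Qed.

Lemma is_derive1_cos g x b : is_derive x 1 g b ->
  is_derive x 1 (fun y => cos (g y)) (- sin (g x) * b).
Proof. by move=> gb; apply: is_derive1_compo. Qed.

Lemma is_derive1_atan g x b : is_derive x 1 g b ->
  is_derive x 1 (fun y => atan (g y)) ((1 + g x ^+ 2)^-1 * b).
Proof.
by move=> gb; apply: is_derive1_compo.
Qed.

Lemma is_derive1_continuous f x a : is_derive x 1 f a -> {for x, continuous f}.
Proof. by move=> fa; apply: differentiable_continuous; apply/derivable1_diffP. Qed.

End real_derivatives.

(** The derivative is left to unification, so that an expression can be differentiated merely to
    obtain its continuity through [is_derive1_continuous]. *)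
Ltac derive_auto := repeat first
  [ assumption
  | exact: is_derive1_id
  | exact: is_derive1_cst
  | apply: is_derive1_add
  | apply: is_derive1_opp
  | apply: is_derive1_mul
  | apply: is_derive1_expR
  | apply: is_derive1_sin
  | apply: is_derive1_cos
  | apply: is_derive1_atan
  | apply: is_derive1_exp
  | apply: is_derive1_inv ].

(** * Improper integrals over the half-line *)

Section half_line.
Context (R : realType).
Notation mu := (@lebesgue_measure R).

Lemma ge0_integralT_half (f : R -> R) : (forall x, 0 <= f x) -> continuous f ->
  (\int[mu]_x (f x)%:E = \int[mu]_(x in `[0%R, +oo[) (f x)%:E +
    \int[mu]_(x in `[0%R, +oo[) (f (- x))%:E)%E.
Proof.
move=> f0 cf.
have mf : measurable_fun [set: R] f by exact: continuous_measurable_fun.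
have m0 : measurable [set x : R | 0 <= x] by rewrite -set_itvcy.
rewrite -(setUv [set x : R | 0 <= x]) ge0_integral_setU//= ; last 4 first.
  exact: measurableC.
  by apply/measurable_EFinP; rewrite setUv.
  by move=> x _; rewrite lee_fin.
  exact/disj_setPCl.
congr (_ + _)%E; first by rewrite set_itvcy.
rewrite -set_itvcy// setCitvr.
rewrite integral_itv_bndo_bndc; last exact/measurable_EFinP/measurable_funTS.
rewrite -{1}oppr0 ge0_integration_by_substitutionNy//.
exact: continuous_subspaceT.
Qed.

Lemma ge0_integral_half_line (f F : R -> R) (l : R) :
  (forall x, 0 <= x -> 0 <= f x) -> continuous f ->
  (forall x : R, is_derive x 1 F (f x)) -> F x @[x --> +oo] --> l ->
  (\int[mu]_(x in `[0%R, +oo[) (f x)%:E = (l - F 0)%:E)%E.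
Proof.
move=> f0 cf dF Fl; rewrite (@ge0_continuous_FTC2y _ _ F _ l)// ?EFinB//.
- exact: continuous_subspaceT.
- by apply: cvg_at_right_filter; apply: differentiable_continuous; apply/derivable1_diffP.
- by move=> x _; rewrite derive1E derive_val.
Qed.

Lemma expR_decay (c : R) : 0 < c -> expR (- (c * x)) @[x --> +oo] --> (0 : R).
Proof.
move=> c0; apply: (@cvg_comp _ _ _ (fun x => c * x) (fun x => expR (- x)) _ +oo%R).
  apply/cvgryPge => A; near=> x.
  by rewrite -ler_pdivrMl//; near: x; exact: nbhs_pinfty_ge.
exact: cvgr_expR.
Unshelve. all: by end_near. Qed.

Lemma cvg0_dominated (U : Type) (F : set_system U) {FF : Filter F} (f g : U -> R) (K : R) :
  (forall x, `|f x| <= K * g x) -> g x @[x --> F] --> 0 -> f x @[x --> F] --> 0.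
Proof.
move=> fg g0; have Kg : K * g x @[x --> F] --> 0 by rewrite -(mulr0 K); exact: cvgMr.
apply: (@squeeze_cvgr _ _ _ _ (fun x => - (K * g x)) (fun x => K * g x)) => //.
  by apply: nearW => x; rewrite -ler_norml.
by rewrite -oppr0; exact: cvgN.
Qed.

(** The fundamental theorem on the half-line is applied to non-negative functions, hence the added
    constant 1 and the sign hypothesis; the damped cosine and sine are recovered later by
    subtracting the integral of the damping. *)
Lemma half_line_damped (e z a b : R) : 0 < e ->
  (forall x, 0 <= 1 + a * cos (z * x) + b * sin (z * x)) ->
  (\int[mu]_(x in `[0%R, +oo[) (expR (- (e * x)) * (1 + a * cos (z * x) + b * sin (z * x)))%:E
   = (e^-1 + (a * e + b * z) / (e ^+ 2 + z ^+ 2))%:E)%E.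
Proof.
move=> e0 h0.
have ez : e ^+ 2 + z ^+ 2 != 0 by rewrite gt_eqF// ltr_wpDr ?sqr_ge0// exprn_gt0.
have en0 : e != 0 by rewrite gt_eqF.
pose D := e ^+ 2 + z ^+ 2.
(* [p] and [q] solve z q - e p = a and - z p - e q = b, the equations that make [F] an
   antiderivative. *)
pose p := (b * - z - a * e) / D; pose q := (a * z - b * e) / D.
pose F x := expR (- (e * x)) * (- e^-1 + p * cos (z * x) + q * sin (z * x)).
pose f x := expR (- (e * x)) * (1 + a * cos (z * x) + b * sin (z * x)).
have dF (x : R) : is_derive x 1 F (f x).
  rewrite /F; apply: is_derive_eq; rewrite /GRing.scale/=.
  by rewrite /f /p /q /D; field; rewrite ez en0.
have cf : continuous f.
  by move=> x; apply: is_derive1_continuous; rewrite /f; derive_auto.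
rewrite (@ge0_integral_half_line f F 0)//.
- by congr EFin; rewrite /F !mulr0 oppr0 expR0 cos0 sin0 /p /q /D; field; rewrite ez en0.
- by move=> x _; rewrite mulr_ge0// expR_ge0.
- apply: (@cvg0_dominated _ _ _ _ (fun x => expR (- (e * x))) (`|e^-1| + `|p| + `|q|)); last exact: expR_decay.
  move=> x; rewrite normrM ger0_norm ?expR_ge0// mulrC ler_wpM2r ?expR_ge0//.
  apply: le_trans (ler_normD _ _) _; apply: lerD.
    apply: le_trans (ler_normD _ _) _; rewrite normrN lerD2l normrM ler_piMr//.
    by rewrite ler_norml cos_geN1 cos_le1.
  by rewrite normrM ler_piMr// ler_norml sin_geN1 sin_le1.
Qed.
End half_line.

(** * The damping factor and its Fourier transform *)

Section poisson.
Context (R : realType).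
Notation mu := (@lebesgue_measure R).

Definition damp (e x : R) : R := expR (- (e * `|x|)).

Lemma damp_ge0 e x : 0 <= damp e x. Proof. exact: expR_ge0. Qed.

Lemma damp_le1 e x : 0 < e -> damp e x <= 1.
Proof. by move=> e0; rewrite /damp -expR0 ler_expR oppr_le0 mulr_ge0// ltW. Qed.

Lemma continuous_damp (e : R) : continuous (damp e).
Proof.
move=> x; rewrite /damp; apply: continuous_comp; last exact: continuous_expR.
by apply: continuousN; apply: continuousM; [exact: cst_continuous|exact: norm_continuous].
Qed.

(** The sine is odd and [damp e] is even, so the two half-lines cancel the term in [b] and double
    the one in [a]. *)
Lemma integral_damp_trig (e z a b : R) : 0 < e ->
  (forall x, 0 <= 1 + a * cos (z * x) + b * sin (z * x)) ->
  (\int[mu]_x (damp e x * (1 + a * cos (z * x) + b * sin (z * x)))%:E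
   = (2 / e + 2 * a * e / (e ^+ 2 + z ^+ 2))%:E)%E.
Proof.
move=> e0 h0.
have cf : continuous (fun x => damp e x * (1 + a * cos (z * x) + b * sin (z * x))).
  move=> x; apply: continuousM; first exact: continuous_damp.
  by apply: (@is_derive1_continuous _ (fun x => 1 + a * cos (z * x) + b * sin (z * x))); derive_auto.
rewrite ge0_integralT_half//; last by move=> x; rewrite mulr_ge0// damp_ge0.
have -> : (\int[mu]_(x in `[0%R, +oo[) (damp e x * (1 + a * cos (z * x) + b * sin (z * x)))%:E =
   \int[mu]_(x in `[0%R, +oo[) (expR (- (e * x)) * (1 + a * cos (z * x) + b * sin (z * x)))%:E)%E.
  apply: eq_integral => x; rewrite inE/= in_itv/= andbT => x0.
  by rewrite /damp ger0_norm.
have -> : (\int[mu]_(x in `[0%R, +oo[) (damp e (- x) * (1 + a * cos (z * - x) + b * sin (z * - x)))%:E =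
   \int[mu]_(x in `[0%R, +oo[) (expR (- (e * x)) * (1 + a * cos (z * x) + (- b) * sin (z * x)))%:E)%E.
  apply: eq_integral => x; rewrite inE/= in_itv/= andbT => x0.
  by rewrite /damp normrN ger0_norm// mulrN cosN sinN mulrN mulNr.
rewrite !half_line_damped// -?EFinD; last first.
  by move=> x; have := h0 (- x); rewrite mulrN cosN sinN mulrN mulNr.
congr EFin; field.
by rewrite gt_eqF ?gt_eqF// ltr_wpDr ?sqr_ge0// exprn_gt0.
Qed.

Lemma integral_damp (e : R) : 0 < e -> (\int[mu]_x (damp e x)%:E = (2 / e)%:E)%E.
Proof.
move=> e0; have h0 x : 0 <= 1 + 0 * cos (0 * x) + 0 * sin (0 * x) :> R.
  by rewrite !mul0r !addr0.
have := integral_damp_trig e0 h0.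
under eq_integral do rewrite !mul0r !addr0 mulr1.
by rewrite mulr0 !mul0r addr0.
Qed.

Lemma integrable_damp (e : R) : 0 < e -> mu.-integrable setT (EFin \o damp e).
Proof.
move=> e0; apply: (@ge0_rintegrable _ _ _ _ _ (2 / e)).
- by apply: continuous_measurable_fun; exact: continuous_damp.
- by move=> x; exact: damp_ge0.
by rewrite integral_damp.
Qed.

Lemma integrable_damp_mul (e : R) (f : measurableTypeR R -> R) : 0 < e -> measurable_fun setT f -> (forall x, `|f x| <= 1) ->
  mu.-integrable setT (EFin \o (fun x => damp e x * f x)).
Proof.
move=> e0 mf f1; have := rintegrable_bmul mf f1 (integrable_damp e0).
by apply: eq_integrable => // x _; rewrite /= mulrC.
Qed.

Lemma measurable_trig_lin (z : R) :
  measurable_fun setT (fun x : measurableTypeR R => cos (z * x)) /\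
  measurable_fun setT (fun x : measurableTypeR R => sin (z * x)).
Proof.
split; apply: continuous_measurable_fun => x.
  by apply: (@is_derive1_continuous _ (fun x => cos (z * x))); derive_auto.
by apply: (@is_derive1_continuous _ (fun x => sin (z * x))); derive_auto.
Qed.

Lemma norm_cos_le1 (x : R) : `|cos x| <= 1.
Proof. by rewrite ler_norml cos_geN1 cos_le1. Qed.

Lemma norm_sin_le1 (x : R) : `|sin x| <= 1.
Proof. by rewrite ler_norml sin_geN1 sin_le1. Qed.

Lemma Rintegral_damp (e : R) : 0 < e -> \int[mu]_x damp e x = 2 / e.
Proof.
move=> e0; apply: EFin_inj; rewrite EFin_Rintegral ?integrable_damp//.
by rewrite integral_damp.
Qed.

Lemma Rintegral_damp_cos (e z : R) : 0 < e ->
  \int[mu]_x (damp e x * cos (z * x)) = 2 * e / (e ^+ 2 + z ^+ 2).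
Proof.
move=> e0; have [mc ms] := measurable_trig_lin z.
have ic := integrable_damp_mul e0 mc (fun x => norm_cos_le1 _).
have h0 x : 0 <= 1 + 1 * cos (z * x) + 0 * sin (z * x).
  by rewrite mul1r mul0r addr0 -lerBlDl sub0r cos_geN1.
have := integral_damp_trig e0 h0.
rewrite (_ : (\int[mu]_x _)%E = (2 / e + \int[mu]_x (damp e x * cos (z * x)))%:E).
  move=> h; have h' := EFin_inj h; by rewrite (addrI _ h') mulr1.
rewrite -Rintegral_damp// -RintegralD//; last exact: integrable_damp.
rewrite EFin_Rintegral; last by apply: rintegrableD => //; exact: integrable_damp.
by apply: eq_integral => x _; rewrite mul1r mul0r addr0 mulrDr mulr1.
Qed.

Lemma Rintegral_damp_sin (e z : R) : 0 < e -> \int[mu]_x (damp e x * sin (z * x)) = 0.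
Proof.
move=> e0; have [mc ms] := measurable_trig_lin z.
have ic := integrable_damp_mul e0 ms (fun x => norm_sin_le1 _).
have h0 x : 0 <= 1 + 0 * cos (z * x) + 1 * sin (z * x).
  by rewrite mul1r mul0r addr0 -lerBlDl sub0r sin_geN1.
have := integral_damp_trig e0 h0.
rewrite (_ : (\int[mu]_x _)%E = (2 / e + \int[mu]_x (damp e x * sin (z * x)))%:E).
  move=> h; have h' := EFin_inj h; by rewrite (addrI _ h') mulr0 !mul0r.
rewrite -Rintegral_damp// -RintegralD//; last exact: integrable_damp.
rewrite EFin_Rintegral; last by apply: rintegrableD => //; exact: integrable_damp.
by apply: eq_integral => x _; rewrite mul1r mul0r addr0 mulrDr mulr1.
Qed.
End poisson.

(** * Poisson and Lorentz kernels on the line *)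

Section line_kernels.
Context (R : realType).
Notation mu := (@lebesgue_measure R).

Lemma Rintegral_indic (A : set (measurableTypeR R)) (f : R -> R) :
  \int[mu]_y (\1_A y * f y) = \int[mu]_(y in A) f y.
Proof.
rewrite [RHS]Rintegral_mkcond; apply: eq_Rintegral => y _; rewrite patchE indicE.
by case: (y \in A); rewrite ?mul1r ?mul0r.
Qed.

(** The Fourier transform of [damp e], that is 2 pi times the usual Poisson kernel; as [e] tends to
    0 it is an approximate identity of mass 2 pi. *)
Definition poisson (e z : R) : R := 2 * e / (e ^+ 2 + z ^+ 2).

Lemma poisson_bound e z : 0 < e -> 0 <= poisson e z <= 2 / e.
Proof.
move=> e0; have p : 0 < e ^+ 2 + z ^+ 2 by rewrite ltr_wpDr ?sqr_ge0// exprn_gt0.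
rewrite /poisson divr_ge0 ?mulr_ge0 ?(ltW e0) ?(ltW p)//=.
rewrite ler_pdivrMr// mulrDr -subr_ge0.
suff -> : 2 / e * e ^+ 2 + 2 / e * z ^+ 2 - 2 * e = 2 / e * z ^+ 2.
  by rewrite mulr_ge0 ?sqr_ge0// divr_ge0// ltW.
by field; rewrite gt_eqF.
Qed.

Lemma Rintegral_FTC (f F : R -> R) (a b : R) : a < b ->
  (forall x : R, is_derive x 1 F (f x)) -> continuous f ->
  \int[mu]_(x in `[a, b]) f x = F b - F a.
Proof.
move=> ab dF cf; have cF x : {for x, continuous F} by exact: is_derive1_continuous.
rewrite /Rintegral (@continuous_FTC2 _ f F a b)//.
- exact: continuous_subspaceT.
- split.
  + by move=> x _.
  + by apply: cvg_at_right_filter; exact: cF.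
  + by apply: cvg_at_left_filter; exact: cF.
- by move=> x _; rewrite derive1E derive_val.
Qed.

Lemma Rintegral_poisson_itv (e a b x : R) : 0 < e -> a < b ->
  \int[mu]_(y in `[a, b]) poisson e (y - x) =
  2 * (atan ((b - x) / e) - atan ((a - x) / e)).
Proof.
move=> e0 ab; have en0 : e != 0 by rewrite gt_eqF.
have dn y : e ^+ 2 + (y - x) ^+ 2 != 0.
  by rewrite gt_eqF// ltr_wpDr ?sqr_ge0// exprn_gt0.
have dF (y : R) : is_derive y 1 (fun y => 2 * atan ((y - x) / e)) (poisson e (y - x)).
  apply: is_derive_eq; rewrite /GRing.scale/= /poisson; field; by rewrite en0 dn.
rewrite (Rintegral_FTC ab dF) ?mulrBr//.
by move=> y; apply: (@is_derive1_continuous _ (fun y => 2 * e / (e ^+ 2 + (y - x) ^+ 2))).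
Qed.

Lemma lorentz_gt0 (s x : R) : 0 < 1 + (s * x) ^+ 2.
Proof. by rewrite ltr_pwDl ?sqr_ge0. Qed.

Lemma continuous_lorentz (s : R) : continuous (fun x : R => (1 + (s * x) ^+ 2)^-1).
Proof.
by move=> x; apply: is_derive1_continuous; apply: is_derive1_inv; rewrite gt_eqF ?lorentz_gt0.
Qed.

Lemma integral_lorentz (s : R) : 0 < s ->
  (\int[mu]_x ((1 + (s * x) ^+ 2)^-1)%:E = (pi / s)%:E)%E.
Proof.
move=> s0; have cf := continuous_lorentz (s := s).
have dF (x : R) : is_derive x 1 (fun x => s^-1 * atan (s * x)) ((1 + (s * x) ^+ 2)^-1).
  apply: is_derive_eq; rewrite /GRing.scale/=; field.
  by rewrite (gt_eqF s0) gt_eqF// lorentz_gt0.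
have cl : s^-1 * atan (s * x) @[x --> +oo] --> s^-1 * (pi / 2).
  apply: cvgMr; apply: (@cvg_comp _ _ _ (fun x => s * x) atan _ +oo%R); last exact: cvgy_atan.
  apply/cvgryPge => A; near=> x.
  by rewrite -ler_pdivrMl//; near: x; exact: nbhs_pinfty_ge.
rewrite ge0_integralT_half//; last by move=> x; rewrite invr_ge0 ltW// lorentz_gt0.
under [X in (_ + X)%E]eq_integral do rewrite mulrN sqrrN.
rewrite (ge0_integral_half_line _ cf dF cl); last by move=> x _; rewrite invr_ge0 ltW// lorentz_gt0.
rewrite -EFinD; congr EFin; rewrite mulr0 atan0 mulr0 subr0; field.
by rewrite gt_eqF.
Unshelve. all: by end_near. Qed.

Lemma integrable_lorentz (s : R) : 0 < s ->
  mu.-integrable setT (EFin \o (fun x : R => (1 + (s * x) ^+ 2)^-1)).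
Proof.
move=> s0; apply: (@ge0_rintegrable _ _ _ _ _ (pi / s)).
- by apply: continuous_measurable_fun; exact: continuous_lorentz.
- by move=> x; rewrite invr_ge0 ltW// lorentz_gt0.
- by rewrite integral_lorentz.
Qed.
End line_kernels.

(** * Fourier transform on the plane *)

Section plane_integrals.
Context (R : realType).
Notation mu := (@lebesgue_measure R).

(* A copy of [leb2] carrying a sigma-finite structure, for Fubini's theorem. *)
Definition lebp : set (plane R) -> \bar R := (mu \x mu)%E.

HB.instance Definition _ := Measure.on lebp.

Let box (n : nat) : set (measurableTypeR R) := `]- n%:R, n%:R]%classic.

Lemma lebp_sigma_finite : sigma_finite setT lebp.
Proof.
exists (fun n => box n `*` box n).
  apply/seteqP; split => // -[x y] _; pose n := (Num.trunc (Num.max `|x| `|y|)).+1.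
  have nP : Num.max `|x| `|y| < n%:R by rewrite /n truncnS_gt.
  move: nP; rewrite gt_max => /andP[xn yn]; exists n => //; split => /=.
    by move: xn; rewrite /box/= in_itv/= ltr_norml => /andP[-> /ltW].
  by move: yn; rewrite /box/= in_itv/= ltr_norml => /andP[-> /ltW].
move=> n; have mb : measurable (box n) by exact: measurable_itv.
split; first exact: measurableX.
have fb : (mu (box n) < +oo)%E.
  by rewrite /box lebesgue_measure_itv/=; case: ifP => _; rewrite -?EFinB ltry.
by rewrite [X in (X < _)%E]product_measure1E// lte_mul_pinfty// ge0_fin_numE.
Qed.

HB.instance Definition _ := Measure_isSigmaFinite.Build _ _ _ lebp lebp_sigma_finite.

Lemma plane_fubini (f : plane R * plane R -> R) (g h : plane R -> R) :
  measurable_fun setT f ->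
  (leb2 R).-integrable setT (EFin \o g) -> (leb2 R).-integrable setT (EFin \o h) ->
  (forall z, `|f z| <= g z.1 * h z.2) ->
  \int[leb2 R]_x \int[leb2 R]_y f (x, y) = \int[leb2 R]_y \int[leb2 R]_x f (x, y).
Proof. exact: (@Rintegral_fubini _ _ _ _ R lebp lebp). Qed.

Lemma plane_section_integrable (f : plane R * plane R -> R) (g h : plane R -> R) :
  measurable_fun setT f ->
  (leb2 R).-integrable setT (EFin \o g) -> (leb2 R).-integrable setT (EFin \o h) ->
  (forall z, `|f z| <= g z.1 * h z.2) ->
  (leb2 R).-integrable setT (EFin \o (fun x => \int[leb2 R]_y f (x, y))).
Proof. by move=> m ig ih b; have [] := @Rintegral_prod _ _ _ _ R lebp lebp f g h m ig ih b. Qed.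

Lemma plane_tensor (g h : R -> R) :
  mu.-integrable setT (EFin \o g) -> mu.-integrable setT (EFin \o h) ->
  (leb2 R).-integrable setT (EFin \o (fun z => g z.1 * h z.2)) /\
  \int[leb2 R]_z (g z.1 * h z.2) = (\int[mu]_x g x) * (\int[mu]_y h y).
Proof. exact: (@Rintegral_tensor _ _ _ _ R mu mu). Qed.

Lemma dot2C (x y : plane R) : dot2 x y = dot2 y x.
Proof. by rewrite /dot2 mulrC [x.2 * _]mulrC. Qed.

Lemma measurable_dot2 : measurable_fun setT (fun z : plane R * plane R => dot2 z.1 z.2).
Proof.
have m1 : measurable_fun setT (fun z : plane R * plane R => z.1.1).
  by apply: (measurableT_comp measurable_fst); exact: measurable_fst.
have m2 : measurable_fun setT (fun z : plane R * plane R => z.1.2).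
  by apply: (measurableT_comp measurable_snd); exact: measurable_fst.
have m3 : measurable_fun setT (fun z : plane R * plane R => z.2.1).
  by apply: (measurableT_comp measurable_fst); exact: measurable_snd.
have m4 : measurable_fun setT (fun z : plane R * plane R => z.2.2).
  by apply: (measurableT_comp measurable_snd); exact: measurable_snd.
by apply: measurable_funD; apply: measurable_funM.
Qed.

Lemma measurable_cosf d (T : measurableType d) (f : T -> R) : measurable_fun setT f ->
  measurable_fun setT (fun x => cos (f x)).
Proof.
by move=> mf; apply: measurableT_comp mf; apply: continuous_measurable_fun; exact: continuous_cos.
Qed.

Lemma measurable_sinf d (T : measurableType d) (f : T -> R) : measurable_fun setT f ->
  measurable_fun setT (fun x => sin (f x)).
Proof.
by move=> mf; apply: measurableT_comp mf; apply: continuous_measurable_fun; exact: continuous_sin.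
Qed.

Definition damp2 (e : R) (xi : plane R) : R := damp e xi.1 * damp e xi.2.

Lemma integrable_damp2 e : 0 < e -> (leb2 R).-integrable setT (EFin \o damp2 e).
Proof. by move=> e0; have [] := plane_tensor (integrable_damp e0) (integrable_damp e0). Qed.

Lemma damp2_gt0 e xi : 0 < damp2 e xi.
Proof. by rewrite mulr_gt0 ?expR_gt0. Qed.

Lemma damp2_le1 e xi : 0 < e -> damp2 e xi <= 1.
Proof. by move=> e0; rewrite mulr_ile1 ?damp_ge0 ?damp_le1. Qed.

Lemma Rintegral_damp2_cos e z : 0 < e ->
  \int[leb2 R]_xi (damp2 e xi * cos (dot2 z xi)) = poisson e z.1 * poisson e z.2.
Proof.
move=> e0.
have mt (w : R) := measurable_trig_lin w.
have ic (w : R) := integrable_damp_mul e0 (mt w).1 (fun x => norm_cos_le1 _).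
have is_ (w : R) := integrable_damp_mul e0 (mt w).2 (fun x => norm_sin_le1 _).
have [i1 e1] := plane_tensor (ic z.1) (ic z.2).
have [i2 e2] := plane_tensor (is_ z.1) (is_ z.2).
transitivity (\int[leb2 R]_xi ((damp e xi.1 * cos (z.1 * xi.1)) * (damp e xi.2 * cos (z.2 * xi.2))
   - (damp e xi.1 * sin (z.1 * xi.1)) * (damp e xi.2 * sin (z.2 * xi.2)))).
  by apply: eq_Rintegral => xi _; rewrite /damp2 /dot2 cosD; ring.
rewrite RintegralB// e1 e2 !Rintegral_damp_cos// Rintegral_damp_sin// mul0r subr0//.
Qed.

Lemma Rintegral_damp2_sin e z : 0 < e ->
  \int[leb2 R]_xi (damp2 e xi * sin (dot2 z xi)) = 0.
Proof.
move=> e0.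
have mt (w : R) := measurable_trig_lin w.
have ic (w : R) := integrable_damp_mul e0 (mt w).1 (fun x => norm_cos_le1 _).
have is_ (w : R) := integrable_damp_mul e0 (mt w).2 (fun x => norm_sin_le1 _).
have [i1 e1] := plane_tensor (is_ z.1) (ic z.2).
have [i2 e2] := plane_tensor (ic z.1) (is_ z.2).
transitivity (\int[leb2 R]_xi ((damp e xi.1 * sin (z.1 * xi.1)) * (damp e xi.2 * cos (z.2 * xi.2))
   + (damp e xi.1 * cos (z.1 * xi.1)) * (damp e xi.2 * sin (z.2 * xi.2)))).
  by apply: eq_Rintegral => xi _; rewrite /damp2 /dot2 sinD; ring.
by rewrite RintegralD// e1 e2 !Rintegral_damp_sin// mul0r mulr0 addr0.
Qed.

(* The real part of the (unnormalised) Fourier transform of u + i v; its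
   imaginary part is [ftr v (- u)]. *)
Definition ftr (u v : plane R -> R) (xi : plane R) : R :=
  \int[leb2 R]_x (cos (dot2 x xi) * u x + sin (dot2 x xi) * v x).

Lemma ftr_pair_measurable (u v : plane R -> R) :
  measurable_fun setT u -> measurable_fun setT v ->
  measurable_fun setT (fun z : plane R * plane R =>
    cos (dot2 z.2 z.1) * u z.2 + sin (dot2 z.2 z.1) * v z.2).
Proof.
move=> mu_ mv.
have md : measurable_fun setT (fun z : plane R * plane R => dot2 z.2 z.1).
  by under eq_fun do rewrite dot2C; exact: measurable_dot2.
apply: measurable_funD; apply: measurable_funM.
- exact: measurable_cosf.
- exact: measurableT_comp mu_ measurable_snd.
- exact: measurable_sinf.
- exact: measurableT_comp mv measurable_snd.
Qed.

Lemma norm_trig_le (s u v : R) : `|cos s * u + sin s * v| <= `|u| + `|v|.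
Proof.
apply: le_trans (ler_normD _ _) _; rewrite !normrM; apply: lerD.
  by rewrite ler_piMl ?norm_cos_le1.
by rewrite ler_piMl ?norm_sin_le1.
Qed.

Lemma ftr_integrand_integrable (u v : plane R -> R) xi :
  (leb2 R).-integrable setT (EFin \o u) -> (leb2 R).-integrable setT (EFin \o v) ->
  (leb2 R).-integrable setT
    (EFin \o (fun x => cos (dot2 x xi) * u x + sin (dot2 x xi) * v x)).
Proof.
move=> iu iv; apply: (@rintegrable_le _ _ _ _ _ (fun x => `|u x| + `|v x|)).
- exact: (measurable_fun_pair2 xi (ftr_pair_measurable (rintegrable_measurable iu) (rintegrable_measurable iv))).
- by move=> x; exact: norm_trig_le.
- by apply: rintegrableD; exact: rintegrable_norm.
Qed.

Definition l1 (u v : plane R -> R) : R := \int[leb2 R]_x (`|u x| + `|v x|).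

Lemma ftr_bound (u v : plane R -> R) xi :
  (leb2 R).-integrable setT (EFin \o u) -> (leb2 R).-integrable setT (EFin \o v) ->
  `|ftr u v xi| <= l1 u v.
Proof.
move=> iu iv; apply: norm_Rintegral_le.
- exact: ftr_integrand_integrable.
- by apply: rintegrableD; exact: rintegrable_norm.
- by move=> x; exact: norm_trig_le.
Qed.

(** Measurability comes from Fubini, which needs an integrand that is integrable in xi and x
    jointly: the factor [damp2 1 xi] supplies integrability in xi and is divided out afterwards. *)
Lemma measurable_ftr (u v : plane R -> R) :
  (leb2 R).-integrable setT (EFin \o u) -> (leb2 R).-integrable setT (EFin \o v) ->
  measurable_fun setT (ftr u v).
Proof.
move=> iu iv; have mu_ := rintegrable_measurable iu; have mv := rintegrable_measurable iv.
have md : measurable_fun setT (damp2 1) by apply: rintegrable_measurable (integrable_damp2 _).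
have i := @plane_section_integrable
  (fun z => damp2 1 z.1 * (cos (dot2 z.2 z.1) * u z.2 + sin (dot2 z.2 z.1) * v z.2))
  (damp2 1) (fun x => `|u x| + `|v x|) _ (integrable_damp2 ltr01) _ _.
have -> : ftr u v = (fun xi => (damp2 1 xi)^-1 *
    \int[leb2 R]_x (damp2 1 xi * (cos (dot2 x xi) * u x + sin (dot2 x xi) * v x))).
  apply/funext => xi; rewrite RintegralZl//; last exact: ftr_integrand_integrable.
  by rewrite mulKf// gt_eqF ?damp2_gt0.
apply: measurable_funM.
  have -> : (fun xi : plane R => (damp2 1 xi)^-1) = (fun xi => expR `|xi.1| * expR `|xi.2|).
    by apply/funext => xi; rewrite /damp2 /damp !mul1r -!expRD -expRN opprD !opprK.
  by apply: measurable_funM; apply: measurableT_comp => //; apply: measurableT_comp.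
apply: rintegrable_measurable; apply: i.
- apply: measurable_funM; last exact: ftr_pair_measurable.
  exact: measurableT_comp md measurable_fst.
- by apply: rintegrableD; exact: rintegrable_norm.
- move=> z; rewrite normrM ger0_norm ?(ltW (damp2_gt0 _ _))// ler_wpM2l ?(ltW (damp2_gt0 _ _))//.
  exact: norm_trig_le.
Qed.
End plane_integrals.

(** * Boxes and exchange of integrals *)

Section box_indicators.
Context (R : realType).
Notation mu := (@lebesgue_measure R).

Definition itv_ind (a b : R) : R -> R := \1_(`[a, b]%classic : set (measurableTypeR R)).

Definition box_ind (a1 b1 a2 b2 : R) (y : plane R) : R := itv_ind a1 b1 y.1 * itv_ind a2 b2 y.2.

Lemma itv_ind_ge0 a b x : 0 <= itv_ind a b x.
Proof. by rewrite /itv_ind indicE. Qed.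

Lemma itv_ind_le1 a b x : itv_ind a b x <= 1.
Proof. by rewrite /itv_ind indicE; case: (_ \in _). Qed.

Lemma integrable_itv_ind a b : mu.-integrable setT (EFin \o itv_ind a b).
Proof.
apply: rintegrable_indic; first exact: measurable_itv.
have fab : (mu `[a, b]%classic < +oo)%E.
  by rewrite lebesgue_measure_itv/=; case: ifP => _; rewrite -?EFinB ltry.
exact: fab.
Qed.

Lemma box_ind_ge0 a1 b1 a2 b2 y : 0 <= box_ind a1 b1 a2 b2 y.
Proof. by rewrite mulr_ge0 ?itv_ind_ge0. Qed.

Lemma box_ind_le1 a1 b1 a2 b2 y : box_ind a1 b1 a2 b2 y <= 1.
Proof. by rewrite mulr_ile1 ?itv_ind_ge0 ?itv_ind_le1. Qed.

Lemma integrable_box_ind a1 b1 a2 b2 :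
  (leb2 R).-integrable setT (EFin \o box_ind a1 b1 a2 b2).
Proof. by have [] := plane_tensor (integrable_itv_ind a1 b1) (integrable_itv_ind a2 b2). Qed.

Lemma measurable_dot2r (y : plane R) : measurable_fun setT (fun x : plane R => dot2 x y).
Proof. exact: (measurable_fun_pair1 y (@measurable_dot2 R)). Qed.

Lemma measurable_dot2l (y : plane R) : measurable_fun setT (fun x : plane R => dot2 y x).
Proof. by under eq_fun do rewrite dot2C; exact: measurable_dot2r. Qed.

(** The tensor bound is M |g| |h|. Trigonometric and Poisson kernels are both bounded, so this one
    form serves for the frequency integrals and for the convolutions. *)
Lemma plane_swap (K : plane R * plane R -> R) (M : R) (g h : plane R -> R) :
  measurable_fun setT K -> (forall z, `|K z| <= M) ->
  (leb2 R).-integrable setT (EFin \o g) -> (leb2 R).-integrable setT (EFin \o h) ->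
  \int[leb2 R]_x (g x * \int[leb2 R]_y (h y * K (x, y))) =
  \int[leb2 R]_y (h y * \int[leb2 R]_x (g x * K (x, y))).
Proof.
move=> mK bK ig ih.
have mg := rintegrable_measurable ig; have mh := rintegrable_measurable ih.
have m : measurable_fun setT (fun z : plane R * plane R => g z.1 * h z.2 * K z).
  apply: measurable_funM => //; apply: measurable_funM.
    exact: measurableT_comp mg measurable_fst.
  exact: measurableT_comp mh measurable_snd.
have := @plane_fubini R (fun z => g z.1 * h z.2 * K z)
  (fun x => M * `|g x|) (fun x => `|h x|) m _ _ _.
have -> : \int[leb2 R]_x (g x * \int[leb2 R]_y (h y * K (x, y))) =
    \int[leb2 R]_x \int[leb2 R]_y (g x * h y * K (x, y)).
  apply: eq_Rintegral => x _; rewrite -RintegralZl//.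
    by apply: eq_Rintegral => y _; rewrite mulrA.
  have := rintegrable_bmul (measurable_fun_pair2 x mK) (fun y => bK (x, y)) ih.
  by apply: eq_integrable => // y _ /=; rewrite mulrC.
have -> : \int[leb2 R]_y (h y * \int[leb2 R]_x (g x * K (x, y))) =
    \int[leb2 R]_y \int[leb2 R]_x (g x * h y * K (x, y)).
  apply: eq_Rintegral => y _; rewrite -RintegralZl//.
    by apply: eq_Rintegral => x _; rewrite mulrCA mulrA.
  have := rintegrable_bmul (measurable_fun_pair1 y mK) (fun x => bK (x, y)) ig.
  by apply: eq_integrable => // x _ /=; rewrite mulrC.
apply.
- exact/rintegrableZ/rintegrable_norm.
- exact: rintegrable_norm.
- by move=> z; rewrite !normrM mulrC mulrA ler_wpM2r// ler_wpM2r.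
Qed.

Lemma bounded_mul_integrable (M : R) (f g : plane R -> R) : measurable_fun setT f ->
  (forall x, `|f x| <= M) -> (leb2 R).-integrable setT (EFin \o g) ->
  (leb2 R).-integrable setT (EFin \o (fun x => g x * f x)).
Proof.
move=> mf bf ig; have := rintegrable_bmul mf bf ig.
by apply: eq_integrable => // x _ /=; rewrite mulrC.
Qed.

Lemma plane_swap_integrable (K : plane R * plane R -> R) (M : R) (g h : plane R -> R) :
  measurable_fun setT K -> (forall z, `|K z| <= M) ->
  (leb2 R).-integrable setT (EFin \o g) -> (leb2 R).-integrable setT (EFin \o h) ->
  (leb2 R).-integrable setT (EFin \o (fun x => g x * \int[leb2 R]_y (h y * K (x, y)))).
Proof.
move=> mK bK ig ih.
have mg := rintegrable_measurable ig; have mh := rintegrable_measurable ih.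
have m : measurable_fun setT (fun z : plane R * plane R => g z.1 * (h z.2 * K z)).
  apply: measurable_funM; first exact: measurableT_comp mg measurable_fst.
  by apply: measurable_funM => //; exact: measurableT_comp mh measurable_snd.
have := @plane_section_integrable R (fun z => g z.1 * (h z.2 * K z))
  (fun x => M * `|g x|) (fun x => `|h x|) m _ _ _.
rewrite (_ : (fun x => \int[leb2 R]_y _) = (fun x => g x * \int[leb2 R]_y (h y * K (x, y)))).
  apply.
  - exact/rintegrableZ/rintegrable_norm.
  - exact: rintegrable_norm.
  - by move=> z; rewrite !normrM mulrA mulrC mulrA ler_wpM2r// ler_wpM2r.
apply/funext => x; rewrite -RintegralZl//.
exact: (bounded_mul_integrable (measurable_fun_pair2 x mK) (fun y => bK (x, y)) ih).
Qed.

Definition shift2 (z : plane R * plane R) : plane R := (z.1.1 - z.2.1, z.1.2 - z.2.2).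

Lemma measurable_shift2 : measurable_fun setT shift2.
Proof.
apply: measurable_fun_pair; apply: measurable_funB.
- exact: measurableT_comp measurable_fst measurable_fst.
- exact: measurableT_comp measurable_fst measurable_snd.
- exact: measurableT_comp measurable_snd measurable_fst.
- exact: measurableT_comp measurable_snd measurable_snd.
Qed.

Lemma measurable_phase (y : plane R) :
  measurable_fun setT (fun z : plane R * plane R => dot2 (shift2 (y, z.2)) z.1).
Proof.
apply: (measurableT_comp (@measurable_dot2 R)
  (g := fun z : plane R * plane R => (shift2 (y, z.2), z.1))).
apply: measurable_fun_pair; last exact: measurable_fst.
apply: (measurableT_comp measurable_shift2 (g := fun z : plane R * plane R => (y, z.2))).
by apply: measurable_fun_pair => //; exact: measurable_snd.
Qed.

Lemma dot2_shift2 (y x xi : plane R) : dot2 (shift2 (y, x)) xi = dot2 y xi - dot2 x xi.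
Proof. by rewrite /dot2/=; ring. Qed.

End box_indicators.

Section leb2_linearity.
Context (R : realType).
Implicit Types f g : plane R -> R.

Lemma leb2_RintegralB f g : (leb2 R).-integrable setT (EFin \o f) ->
  (leb2 R).-integrable setT (EFin \o g) ->
  \int[leb2 R]_x (f x - g x) = \int[leb2 R]_x f x - \int[leb2 R]_x g x.
Proof. exact: RintegralB. Qed.

Lemma leb2_RintegralD f g : (leb2 R).-integrable setT (EFin \o f) ->
  (leb2 R).-integrable setT (EFin \o g) ->
  \int[leb2 R]_x (f x + g x) = \int[leb2 R]_x f x + \int[leb2 R]_x g x.
Proof. exact: RintegralD. Qed.

Lemma leb2_RintegralZ (k : R) f : (leb2 R).-integrable setT (EFin \o f) ->
  \int[leb2 R]_x (k * f x) = k * \int[leb2 R]_x f x.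
Proof. by move=> i; rewrite RintegralZl. Qed.

Lemma leb2_Rintegral0 : \int[leb2 R]_(x in [set: plane R]) (0 : R) = 0.
Proof. by rewrite Rintegral_cst// mul0r. Qed.

End leb2_linearity.

(** * Parseval's identity on a box, in damped form *)

Section box_parseval.
Context (R : realType).
Notation mu := (@lebesgue_measure R).

(** The integral of [poisson e (y - x)] over y in [a, b]. For a < b, as [e] tends to 0, it tends to
    2 pi inside the interval, to 0 outside and to pi at the ends. *)
Definition poisson_itv (e a b x : R) : R := 2 * (atan ((b - x) / e) - atan ((a - x) / e)).

Variables (a1 b1 a2 b2 : R) (ab1 : a1 < b1) (ab2 : a2 < b2).
Let chi := box_ind a1 b1 a2 b2.
Variables (u v : plane R -> R).
Hypotheses (iu : (leb2 R).-integrable setT (EFin \o u))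
           (iv : (leb2 R).-integrable setT (EFin \o v)).

Let P := ftr u v.
Let S := ftr v (fun x => - u x).
Let iNu : (leb2 R).-integrable setT (EFin \o (fun x => - u x)).
Proof. exact: rintegrableN. Qed.

Let mP : measurable_fun setT P. Proof. exact: measurable_ftr. Qed.
Let mS : measurable_fun setT S. Proof. exact: measurable_ftr. Qed.

(** The left side is the real part of exp(i y.xi) (P + i S)(xi). The modulation translates the
    phase, so that x and y enter only through y - x, which is what produces a convolution kernel. *)
Lemma modulated_ftr (y xi : plane R) :
  cos (dot2 y xi) * P xi - sin (dot2 y xi) * S xi =
  \int[leb2 R]_x (cos (dot2 (shift2 (y, x)) xi) * u x -
                  sin (dot2 (shift2 (y, x)) xi) * v x).
Proof.
have i1 := ftr_integrand_integrable xi iu iv.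
have i2 := ftr_integrand_integrable xi iv iNu.
rewrite /P /S /ftr -(leb2_RintegralZ _ i1) -(leb2_RintegralZ _ i2).
rewrite -(leb2_RintegralB (rintegrableZ _ i1) (rintegrableZ _ i2)).
apply: eq_Rintegral => x _.
by rewrite dot2_shift2 cosB sinB; ring.
Qed.

Let swap1 e : 0 < e ->
  \int[leb2 R]_xi (damp2 e xi * \int[leb2 R]_y (chi y * (cos (dot2 y xi) * P xi - sin (dot2 y xi) * S xi)))
  = \int[leb2 R]_y (chi y * \int[leb2 R]_xi (damp2 e xi * (cos (dot2 y xi) * P xi - sin (dot2 y xi) * S xi))).
Proof.
move=> e0.
pose M := l1 u v + l1 v (fun x => - u x).
have bPS (y xi : plane R) : `|cos (dot2 y xi) * P xi - sin (dot2 y xi) * S xi| <= M.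
  rewrite -mulrN; apply: le_trans (norm_trig_le _ _ _) _; rewrite normrN.
  by apply: lerD; exact: ftr_bound.
have mPS : measurable_fun setT (fun z : plane R * plane R =>
    cos (dot2 z.2 z.1) * P z.1 - sin (dot2 z.2 z.1) * S z.1).
  have md : measurable_fun setT (fun z : plane R * plane R => dot2 z.2 z.1).
    by under eq_fun do rewrite dot2C; exact: measurable_dot2.
  apply: measurable_funB; apply: measurable_funM.
  - exact: measurable_cosf.
  - exact: measurableT_comp mP measurable_fst.
  - exact: measurable_sinf.
  - exact: measurableT_comp mS measurable_fst.
have mPS' : measurable_fun setT (fun z : plane R * plane R =>
    cos (dot2 z.2 z.1) * P z.1 - sin (dot2 z.2 z.1) * S z.1) by [].
exact: (plane_swap mPS' (fun z => bPS z.2 z.1) (integrable_damp2 e0) (integrable_box_ind _ _ _ _)).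
Qed.

(** The integral in xi, done before the one in x, is the transform of [damp2 e]: its cosine part
    gives the Poisson kernels, and its sine part vanishes, which removes [v]. *)
Let swap2 e y : 0 < e ->
  \int[leb2 R]_xi (damp2 e xi * (cos (dot2 y xi) * P xi - sin (dot2 y xi) * S xi)) =
  \int[leb2 R]_x (u x * (poisson e (y.1 - x.1) * poisson e (y.2 - x.2))).
Proof.
move=> e0.
have mc := measurable_cosf (measurable_phase y).
have ms := measurable_sinf (measurable_phase y).
have bc (z : plane R * plane R) := norm_cos_le1 (dot2 (shift2 (y, z.2)) z.1).
have bs (z : plane R * plane R) := norm_sin_le1 (dot2 (shift2 (y, z.2)) z.1).
have id := integrable_damp2 e0.
have E1 := plane_swap mc bc id iu.
have E2 := plane_swap ms bs id iv.
have E xi : cos (dot2 y xi) * P xi - sin (dot2 y xi) * S xi =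
   \int[leb2 R]_x (u x * cos (dot2 (shift2 (y, x)) xi)) - \int[leb2 R]_x (v x * sin (dot2 (shift2 (y, x)) xi)).
  have i1 := bounded_mul_integrable (measurable_fun_pair2 xi mc) (fun x => bc (xi, x)) iu.
  have i2 := bounded_mul_integrable (measurable_fun_pair2 xi ms) (fun x => bs (xi, x)) iv.
  rewrite modulated_ftr -(leb2_RintegralB i1 i2).
  by apply: eq_Rintegral => x _; rewrite mulrC [sin _ * _]mulrC.
transitivity (\int[leb2 R]_xi (damp2 e xi * \int[leb2 R]_x (u x * cos (dot2 (shift2 (y, x)) xi))
    - damp2 e xi * \int[leb2 R]_x (v x * sin (dot2 (shift2 (y, x)) xi)))).
  by apply: eq_Rintegral => xi _; rewrite E mulrBr.
rewrite (leb2_RintegralB (plane_swap_integrable mc bc id iu) (plane_swap_integrable ms bs id iv)).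
rewrite E1 E2 [X in _ - X](_ : _ = 0) ?subr0.
  by apply: eq_Rintegral => x _; congr (u x * _); exact: (Rintegral_damp2_cos (shift2 (y, x)) e0).
rewrite -[RHS](@leb2_Rintegral0 R); apply: eq_Rintegral => x _.
by rewrite -[RHS](mulr0 (v x)); congr (v x * _); exact: (Rintegral_damp2_sin (shift2 (y, x)) e0).
Qed.

(** Two exchanges of integrals move the frequency integral innermost, where it is explicit; a third
    one applies the integral over the box to the Poisson kernels, which gives arctangents. *)
Lemma damped_box_parseval e : 0 < e ->
  \int[leb2 R]_xi (damp2 e xi * \int[leb2 R]_y (chi y * (cos (dot2 y xi) * P xi - sin (dot2 y xi) * S xi)))
  = \int[leb2 R]_x (u x * (poisson_itv e a1 b1 x.1 * poisson_itv e a2 b2 x.2)).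
Proof.
move=> e0; rewrite swap1//.
under eq_Rintegral do rewrite swap2//.
have cp : continuous (poisson e).
  have dn (y : R) : e ^+ 2 + y ^+ 2 != 0.
    by rewrite gt_eqF// ltr_wpDr ?sqr_ge0// exprn_gt0.
  by move=> y; apply: (@is_derive1_continuous _ (fun y => 2 * e / (e ^+ 2 + y ^+ 2))).
have mp : measurable_fun setT (fun y : measurableTypeR R => poisson e y).
  exact: continuous_measurable_fun.
have mK : measurable_fun setT (fun z : plane R * plane R =>
    poisson e (shift2 z).1 * poisson e (shift2 z).2).
  apply: measurable_funM.
    exact: measurableT_comp mp (measurableT_comp measurable_fst (@measurable_shift2 R)).
  exact: measurableT_comp mp (measurableT_comp measurable_snd (@measurable_shift2 R)).
have bK z : `|poisson e (shift2 z).1 * poisson e (shift2 z).2| <= 2 / e * (2 / e).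
  have [p1 p2] := andP (poisson_bound (shift2 z).1 e0).
  have [q1 q2] := andP (poisson_bound (shift2 z).2 e0).
  by rewrite ger0_norm; [exact: ler_pM|exact: mulr_ge0].
rewrite (plane_swap mK bK (integrable_box_ind _ _ _ _) iu).
apply: eq_Rintegral => x _; congr (_ * _).
have ip (a b c : R) : mu.-integrable setT (EFin \o (fun y => itv_ind a b y * poisson e (y - c))).
  have mpc : measurable_fun setT (fun y : measurableTypeR R => poisson e (y - c)).
    by apply: measurableT_comp mp _; exact: measurable_funB.
  have bp y : `|poisson e (y - c)| <= 2 / e.
    by have [p1 p2] := andP (poisson_bound (y - c) e0); rewrite ger0_norm.
  have := rintegrable_bmul mpc bp (integrable_itv_ind a b).
  by apply: eq_integrable => // y _ /=; rewrite mulrC.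
have [_] := plane_tensor (ip a1 b1 x.1) (ip a2 b2 x.2).
rewrite !Rintegral_indic !Rintegral_poisson_itv// => <-.
by apply: eq_Rintegral => y _; rewrite /chi /box_ind/=; ring.
Qed.

End box_parseval.

Section ae_combinations.
Context d (T : measurableType d) (R : realType) (mu : {measure set T -> \bar R}).

Lemma ae_imp (P Q : T -> Prop) : (forall x, P x -> Q x) ->
  {ae mu, forall x, P x} -> {ae mu, forall x, Q x}.
Proof. by move=> PQ; apply: filterS. Qed.

Lemma ae_imp2 (P Q S : T -> Prop) : (forall x, P x -> Q x -> S x) ->
  {ae mu, forall x, P x} -> {ae mu, forall x, Q x} -> {ae mu, forall x, S x}.
Proof. by move=> PQ; apply: filterS2. Qed.

Lemma ae_and (P Q : T -> Prop) :
  {ae mu, forall x, P x} -> {ae mu, forall x, Q x} -> {ae mu, forall x, P x /\ Q x}.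
Proof. exact: ae_imp2. Qed.

End ae_combinations.

(** * Removal of the damping *)

Section box_parseval_limit.
Context (R : realType).
Notation mu := (@lebesgue_measure R).
Let eps (n : nat) : R := n.+1%:R^-1.

Lemma cvg_eps : eps n @[n --> \oo] --> (0 : R).
Proof. exact: cvg_harmonic. Qed.

Lemma cvg_atan_scaled (c : R) : 0 < c -> atan (c / eps n) @[n --> \oo] --> pi / 2.
Proof.
move=> c0; apply: (@cvg_comp _ _ _ (fun n => c / eps n) atan _ +oo%R); last exact: cvgy_atan.
apply/cvgryPge => A; near=> n.
rewrite /eps invrK -ler_pdivrMl// (@le_trans _ _ n%:R) ?ler_nat//.
by near: n; exact: nbhs_infty_ger.
Unshelve. all: by end_near. Qed.

(** Away from the end points the arguments of both arctangents tend to plus or minus infinity. At an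
    end point the limit would be pi, hence the exclusions; in the plane they amount to null
    lines. *)
Lemma cvg_poisson_itv (a b x : R) : a < b -> x != a -> x != b ->
  poisson_itv (eps n) a b x @[n --> \oo] --> 2 * pi * itv_ind a b x.
Proof.
move=> ab xa xb.
have neg (c : R) : c < 0 -> atan (c / eps n) @[n --> \oo] --> - (pi / 2).
  move=> c0; have := cvg_atan_scaled (c := - c); rewrite oppr_gt0 => /(_ c0) h.
  have -> : (fun n => atan (c / eps n)) = (fun n => - atan (- c / eps n)).
    by apply/funext => n; rewrite mulNr atanN opprK.
  exact: cvgN.
rewrite /poisson_itv /itv_ind indicE.
have [xlta|altx|E] := ltgtP x a; last by rewrite E eqxx in xa.
  rewrite memNset/=; last by rewrite in_itv/= leNgt xlta.
  have -> : 2 * pi * 0%:R = 2 * (pi / 2 - pi / 2) :> R by rewrite subrr !mulr0.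
  by apply: cvgMr; apply: cvgB; apply: cvg_atan_scaled; rewrite subr_gt0// (lt_trans xlta).
have [xltb|bltx|E] := ltgtP x b; last by rewrite E eqxx in xb.
  rewrite mem_set/=; last by rewrite in_itv/= (ltW altx) (ltW xltb).
  have -> : 2 * pi * 1%:R = 2 * (pi / 2 - - (pi / 2)) :> R by field.
  apply: cvgMr; apply: cvgB; first by apply: cvg_atan_scaled; rewrite subr_gt0.
  by apply: neg; rewrite subr_lt0.
rewrite memNset/=; last by rewrite in_itv/= [x <= b]leNgt bltx andbF.
have -> : 2 * pi * 0%:R = 2 * (- (pi / 2) - - (pi / 2)) :> R by rewrite subrr !mulr0.
by apply: cvgMr; apply: cvgB; apply: neg; rewrite subr_lt0// (lt_trans ab).
Qed.

Lemma norm_poisson_itv e a b x : `|poisson_itv e a b x| <= 2 * pi :> R.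
Proof.
rewrite /poisson_itv normrM ger0_norm// ler_wpM2l//.
have h y : `|atan y| <= pi / 2 :> R.
  by rewrite ler_norml (ltW (atan_gtNpi2 _)) (ltW (atan_ltpi2 _)).
by apply: le_trans (ler_normB _ _) _; rewrite [leRHS]splitr; exact: lerD.
Qed.

Lemma measurable_poisson_itv e a b :
  measurable_fun setT (fun x : measurableTypeR R => poisson_itv e a b x).
Proof.
apply: continuous_measurable_fun => x.
by apply: (@is_derive1_continuous _ (fun x => 2 * (atan ((b - x) / e) - atan ((a - x) / e)))).
Qed.

Lemma ae_fst_neq (c : R) : {ae leb2 R, forall x, x.1 != c}.
Proof.
exists ([set c] `*` setT); split.
- by apply: measurableX.
- rewrite [LHS](product_measure1E mu mu (measurable_set1 c) measurableT).
  by rewrite [X in (X * _)%E]lebesgue_measure_set1 mul0e.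
- by move=> x /= /negP; rewrite negbK => /eqP.
Qed.

Lemma ae_snd_neq (c : R) : {ae leb2 R, forall x, x.2 != c}.
Proof.
exists (setT `*` [set c]); split.
- by apply: measurableX.
- rewrite [LHS](product_measure1E mu mu measurableT (measurable_set1 c)).
  by rewrite [X in (_ * X)%E]lebesgue_measure_set1 mule0.
- by move=> x /= /negP; rewrite negbK => /eqP.
Qed.

Variables (a1 b1 a2 b2 : R) (ab1 : a1 < b1) (ab2 : a2 < b2).
Let chi := box_ind a1 b1 a2 b2.
Variables (u v : plane R -> R).
Hypotheses (iu : (leb2 R).-integrable setT (EFin \o u))
           (iv : (leb2 R).-integrable setT (EFin \o v)).
Let P := ftr u v.
Let S := ftr v (fun x => - u x).
Let Phi xi := \int[leb2 R]_y (chi y * (cos (dot2 y xi) * P xi - sin (dot2 y xi) * S xi)).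

(** Dominated convergence on both sides of [damped_box_parseval], along e = 1 / (n + 1). On the
    frequency side [Phi] itself dominates, which is why its integrability is assumed; on the other
    side each difference of arctangents is bounded by 2 pi, whence the majorant (2 pi)^2 |u|. *)
Lemma box_parseval_L1 : (leb2 R).-integrable setT (EFin \o Phi) ->
  \int[leb2 R]_xi Phi xi = (2 * pi) ^+ 2 * \int[leb2 R]_x (u x * chi x).
Proof.
move=> iPhi; have e0 n : 0 < eps n by rewrite invr_gt0.
have mu_ := rintegrable_measurable iu.
have mPhi := rintegrable_measurable iPhi.
have [_ L] : (leb2 R).-integrable setT (EFin \o Phi) /\
    \int[leb2 R]_xi (damp2 (eps n) xi * Phi xi) @[n --> \oo] --> \int[leb2 R]_xi Phi xi.
  apply: (@Rintegral_dominated _ _ _ _ _ _ (fun xi => `|Phi xi|)) => //.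
  - move=> n; apply: measurable_funM => //.
    exact: rintegrable_measurable (integrable_damp2 (e0 n)).
  - apply: aeW => xi; rewrite -[X in _ --> X]mul1r; apply: cvgMl.
    have d1 (x : R) : damp (eps n) x @[n --> \oo] --> (1 : R).
      rewrite /damp -expR0; apply: continuous_cvg; first exact: continuous_expR.
      by rewrite -oppr0 -(mul0r `|x|); apply: cvgN; apply: cvgMl; exact: cvg_eps.
    by rewrite -[1]mulr1; apply: cvgM; exact: d1.
  - move=> n xi; rewrite normrM ler_piMl// ger0_norm ?(ltW (damp2_gt0 _ _))//.
    exact: damp2_le1.
  - exact: rintegrable_norm.
have iuchi : (leb2 R).-integrable setT (EFin \o (fun x => u x * chi x)).
  apply: (@bounded_mul_integrable _ 1) => //.
    exact: rintegrable_measurable (integrable_box_ind _ _ _ _).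
  by move=> x; rewrite ger0_norm ?box_ind_ge0 ?box_ind_le1.
have [_ L'] : (leb2 R).-integrable setT (EFin \o (fun x => (2 * pi) ^+ 2 * (u x * chi x))) /\
    \int[leb2 R]_x (u x * (poisson_itv (eps n) a1 b1 x.1 * poisson_itv (eps n) a2 b2 x.2))
    @[n --> \oo] --> \int[leb2 R]_x ((2 * pi) ^+ 2 * (u x * chi x)).
  apply: (@Rintegral_dominated _ _ _ _ _ _ (fun x => (2 * pi) ^+ 2 * `|u x|)) => //.
  - move=> n; apply: measurable_funM => //; apply: measurable_funM.
      exact: measurableT_comp (measurable_poisson_itv _ _ _) measurable_fst.
    exact: measurableT_comp (measurable_poisson_itv _ _ _) measurable_snd.
  - by apply: measurable_funM => //; exact: rintegrable_measurable iuchi.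
  - apply: ae_imp2 (ae_and (ae_fst_neq a1) (ae_fst_neq b1)) (ae_and (ae_snd_neq a2) (ae_snd_neq b2)).
    move=> x [xa1 xb1] [xa2 xb2].
    have -> : (2 * pi) ^+ 2 * (u x * chi x) =
        u x * ((2 * pi * itv_ind a1 b1 x.1) * (2 * pi * itv_ind a2 b2 x.2)).
      by rewrite /chi /box_ind; ring.
    by apply: cvgMr; apply: cvgM; exact: cvg_poisson_itv.
  - move=> n x; rewrite normrM mulrC ler_wpM2r// normrM expr2.
    by apply: ler_pM => //; exact: norm_poisson_itv.
  - exact/rintegrableZ/rintegrable_norm.
rewrite -leb2_RintegralZ//.
have E : (fun n => \int[leb2 R]_xi (damp2 (eps n) xi * Phi xi)) =
    (fun n => \int[leb2 R]_x (u x * (poisson_itv (eps n) a1 b1 x.1 * poisson_itv (eps n) a2 b2 x.2))).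
  by apply/funext => n; exact: damped_box_parseval.
by rewrite E in L; exact: (cvg_unique (@norm_hausdorff _ _) L L').
Qed.
End box_parseval_limit.

(** * Square integrability of the transform of a box *)

Section plancherel_boxes.
Context (R : realType).
Notation mu := (@lebesgue_measure R).
Implicit Types (u v P S : plane R -> R).

Lemma sqr_add_le (x y Q : R) : x ^+ 2 <= Q -> y ^+ 2 <= Q -> (x + y) ^+ 2 <= 4 * Q.
Proof. by move=> hx hy; have := sqr_ge0 (x - y); nra. Qed.

Lemma sqr_sub_le (x y Q : R) : x ^+ 2 <= Q -> y ^+ 2 <= Q -> (x - y) ^+ 2 <= 4 * Q.
Proof. by move=> hx hy; have := sqr_ge0 (x + y); nra. Qed.

(** Two bounds for the integral I are combined: |I| <= b - a, and |xi I| <= 2 because xi times the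
    trigonometric factor has a bounded antiderivative. Adding the squares gives (1 + xi^2) I^2 <= (b
    - a)^2 + 4. *)
Lemma itv_fourier_bound (a b xi : R) : a < b ->
  (\int[mu]_y (itv_ind a b y * cos (y * xi))) ^+ 2 <= ((b - a) ^+ 2 + 4) * (1 + xi ^+ 2)^-1 /\
  (\int[mu]_y (itv_ind a b y * sin (y * xi))) ^+ 2 <= ((b - a) ^+ 2 + 4) * (1 + xi ^+ 2)^-1.
Proof.
move=> ab.
have bound (I : R) : `|I| <= b - a -> `|xi * I| <= 2 ->
    I ^+ 2 <= ((b - a) ^+ 2 + 4) * (1 + xi ^+ 2)^-1.
  move=> h1 h2; rewrite ler_pdivlMr ?ltr_pwDl ?sqr_ge0//.
  rewrite mulrDr mulr1 -exprMn; apply: lerD.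
    by rewrite -(real_normK (num_real I)) lerXn2r ?nnegrE// subr_ge0 ltW.
  rewrite mulrC -(real_normK (num_real (xi * I))) (_ : 4 = 2 ^+ 2); last by ring.
  by rewrite lerXn2r ?nnegrE.
have size (f : R -> R) : continuous f -> (forall y, `|f y| <= 1) ->
    `|\int[mu]_y (itv_ind a b y * f y)| <= b - a.
  move=> cf f1.
  have mf : measurable_fun setT (f : measurableTypeR R -> R) by exact: continuous_measurable_fun.
  apply: (@le_trans _ _ (\int[mu]_y (itv_ind a b y * 1))).
    apply: norm_Rintegral_le.
    - have := rintegrable_bmul mf f1 (integrable_itv_ind a b).
      by apply: eq_integrable => // y _ /=; rewrite mulrC.
    - by under [X in _ \o X]eq_fun do rewrite mulr1; exact: integrable_itv_ind.
    - by move=> y; rewrite normrM ger0_norm ?itv_ind_ge0// ler_wpM2l ?itv_ind_ge0.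
  have d1 (y : R) : is_derive y 1 (fun y : R => y) 1 by exact: is_derive_id.
  rewrite Rintegral_indic (Rintegral_FTC ab d1)//.
  exact: cst_continuous.
have cc : continuous (fun y : R => cos (y * xi)).
  by move=> y; apply: (@is_derive1_continuous _ (fun y => cos (y * xi))).
have cs : continuous (fun y : R => sin (y * xi)).
  by move=> y; apply: (@is_derive1_continuous _ (fun y => sin (y * xi))).
have pull (f : R -> R) : continuous f -> (forall y, `|f y| <= 1) ->
    xi * \int[mu]_y (itv_ind a b y * f y) = \int[mu]_(y in `[a, b]) (xi * f y).
  move=> cf f1.
  have mf : measurable_fun setT (f : measurableTypeR R -> R) by exact: continuous_measurable_fun.
  rewrite -[RHS]Rintegral_indic -RintegralZl//.
    by apply: eq_Rintegral => y _; rewrite mulrCA.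
  have := rintegrable_bmul mf f1 (integrable_itv_ind a b).
  by apply: eq_integrable => // y _ /=; rewrite mulrC.
split; apply: bound.
- by apply: size => // y; exact: norm_cos_le1.
- rewrite pull//; last by move=> y; exact: norm_cos_le1.
  have dF (y : R) : is_derive y 1 (fun y => sin (y * xi)) (xi * cos (y * xi)).
    by apply: is_derive_eq; rewrite /GRing.scale/=; ring.
  rewrite (Rintegral_FTC ab dF); last first.
    by move=> y; apply: cvgMr; exact: cc.
  by apply: le_trans (ler_normB _ _) _; rewrite -[leRHS]/(1 + 1); apply: lerD; exact: norm_sin_le1.
- by apply: size => // y; exact: norm_sin_le1.
- rewrite pull//; last by move=> y; exact: norm_sin_le1.
  have dF (y : R) : is_derive y 1 (fun y => - cos (y * xi)) (xi * sin (y * xi)).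
    by apply: is_derive_eq; rewrite /GRing.scale/=; ring.
  rewrite (Rintegral_FTC ab dF); last first.
    by move=> y; apply: cvgMr; exact: cs.
  by apply: le_trans (ler_normB _ _) _; rewrite !normrN -[leRHS]/(1 + 1); apply: lerD; exact: norm_cos_le1.
Qed.

Definition box_cos (a1 b1 a2 b2 : R) (xi : plane R) : R :=
  \int[leb2 R]_y (box_ind a1 b1 a2 b2 y * cos (dot2 y xi)).
Definition box_sin (a1 b1 a2 b2 : R) (xi : plane R) : R :=
  \int[leb2 R]_y (box_ind a1 b1 a2 b2 y * sin (dot2 y xi)).

(** The addition formulas express both transforms through products of one-variable ones, so that
    their squares are dominated by a product of two Lorentz functions. *)
Lemma box_fourier_L2 (a1 b1 a2 b2 : R) : a1 < b1 -> a2 < b2 ->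
  exists2 G : plane R -> R, (leb2 R).-integrable setT (EFin \o G) &
    forall xi, box_cos a1 b1 a2 b2 xi ^+ 2 <= G xi /\ box_sin a1 b1 a2 b2 xi ^+ 2 <= G xi.
Proof.
move=> ab1 ab2; pose q (x : R) := (1 + x ^+ 2)^-1.
pose M1 := (b1 - a1) ^+ 2 + 4; pose M2 := (b2 - a2) ^+ 2 + 4.
have iq : mu.-integrable setT (EFin \o q).
  have := @integrable_lorentz R 1 ltr01.
  by apply: eq_integrable => // x _ /=; rewrite mul1r.
have [iqq _] := plane_tensor iq iq.
exists (fun xi => 4 * M1 * M2 * (q xi.1 * q xi.2)); first exact: rintegrableZ.
move=> xi.
have [c1 s1] := itv_fourier_bound xi.1 ab1; have [c2 s2] := itv_fourier_bound xi.2 ab2.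
have iT (f : R -> R) (a b : R) : continuous f -> (forall y, `|f y| <= 1) ->
    mu.-integrable setT (EFin \o (fun y => itv_ind a b y * f y)).
  move=> cf f1.
  have mf : measurable_fun setT (f : measurableTypeR R -> R) by exact: continuous_measurable_fun.
  have := rintegrable_bmul mf f1 (integrable_itv_ind a b).
  by apply: eq_integrable => // y _ /=; rewrite mulrC.
have ic a b z : mu.-integrable setT (EFin \o (fun y => itv_ind a b y * cos (y * z))).
  apply: (iT (fun y => cos (y * z))) => y; last exact: norm_cos_le1.
  by apply: (@is_derive1_continuous _ (fun y => cos (y * z))).
have is_ a b z : mu.-integrable setT (EFin \o (fun y => itv_ind a b y * sin (y * z))).
  apply: (iT (fun y => sin (y * z))) => y; last exact: norm_sin_le1.
  by apply: (@is_derive1_continuous _ (fun y => sin (y * z))).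
have [icc Ecc] := plane_tensor (ic a1 b1 xi.1) (ic a2 b2 xi.2).
have [iss Ess] := plane_tensor (is_ a1 b1 xi.1) (is_ a2 b2 xi.2).
have [isc Esc] := plane_tensor (is_ a1 b1 xi.1) (ic a2 b2 xi.2).
have [ics Ecs] := plane_tensor (ic a1 b1 xi.1) (is_ a2 b2 xi.2).
have -> : box_cos a1 b1 a2 b2 xi =
   (\int[mu]_y (itv_ind a1 b1 y * cos (y * xi.1))) * (\int[mu]_y (itv_ind a2 b2 y * cos (y * xi.2)))
 - (\int[mu]_y (itv_ind a1 b1 y * sin (y * xi.1))) * (\int[mu]_y (itv_ind a2 b2 y * sin (y * xi.2))).
  rewrite -Ecc -Ess -(leb2_RintegralB icc iss); apply: eq_Rintegral => y _.
  by rewrite /box_ind /dot2 cosD; ring.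
have -> : box_sin a1 b1 a2 b2 xi =
   (\int[mu]_y (itv_ind a1 b1 y * sin (y * xi.1))) * (\int[mu]_y (itv_ind a2 b2 y * cos (y * xi.2)))
 + (\int[mu]_y (itv_ind a1 b1 y * cos (y * xi.1))) * (\int[mu]_y (itv_ind a2 b2 y * sin (y * xi.2))).
  rewrite -Esc -Ecs -(leb2_RintegralD isc ics); apply: eq_Rintegral => y _.
  by rewrite /box_ind /dot2 sinD; ring.
have pr (x y : R) : x ^+ 2 <= M1 * q xi.1 -> y ^+ 2 <= M2 * q xi.2 ->
    (x * y) ^+ 2 <= M1 * M2 * (q xi.1 * q xi.2).
  move=> h1 h2; rewrite exprMn (_ : _ * _ = M1 * q xi.1 * (M2 * q xi.2)); last by ring.
  by apply: ler_pM => //; exact: sqr_ge0.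
rewrite (_ : 4 * M1 * M2 * _ = 4 * (M1 * M2 * (q xi.1 * q xi.2))); last by ring.
by split; [apply: sqr_sub_le|apply: sqr_add_le]; exact: pr.
Qed.

End plancherel_boxes.

(** * The L^2 Fourier transform in real components *)

Section plancherel_pairs.
Context (R : realType).
Notation mu := (@lebesgue_measure R).
Implicit Types (u v P S : plane R -> R).

Definition disk_cut (k : nat) (u : plane R -> R) (x : plane R) : R :=
  if norm2 x <= k%:R then u x else 0.

Definition sq_integrable (u : plane R -> R) : Prop :=
  measurable_fun setT u /\ (leb2 R).-integrable setT (EFin \o (fun x => u x ^+ 2)).

Definition fourier_tail u v P S (k : nat) (xi : plane R) : R :=
  (P xi - (2 * pi)^-1 * ftr (disk_cut k u) (disk_cut k v) xi) ^+ 2 +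
  (S xi - (2 * pi)^-1 * ftr (disk_cut k v) (fun x => - disk_cut k u x) xi) ^+ 2.

(* [P + i S] is the L^2 Fourier transform of [u + i v]. *)
Definition fourier_pair u v P S : Prop :=
  [/\ sq_integrable u, sq_integrable v, sq_integrable P, sq_integrable S &
      (\int[leb2 R]_xi (fourier_tail u v P S k xi)%:E)%E @[k --> \oo] --> 0%E].

Lemma measurable_norm2 : measurable_fun setT (@norm2 R).
Proof.
apply: (measurableT_comp (f := Num.sqrt : measurableTypeR R -> R)).
  by apply: continuous_measurable_fun; exact: sqrt_continuous.
by apply: measurable_funD; apply: measurable_funM.
Qed.

Lemma measurable_disk_cut k u : measurable_fun setT u -> measurable_fun setT (disk_cut k u).
Proof.
move=> m_u; apply: measurable_fun_ifT => //.
by apply: measurable_fun_ler => //; exact: measurable_norm2.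
Qed.

Lemma norm2_ge_coord (x : plane R) : `|x.1| <= norm2 x /\ `|x.2| <= norm2 x.
Proof.
have h (a b : R) : `|a| <= Num.sqrt (a ^+ 2 + b ^+ 2).
  by rewrite -sqrtr_sqr ler_sqrt ?lerDl ?sqr_ge0 ?addr_ge0 ?sqr_ge0.
split; rewrite /norm2 /dot2 -!expr2; first exact: h.
by rewrite addrC; exact: h.
Qed.

Lemma disk_cut_integrable k u : sq_integrable u ->
  (leb2 R).-integrable setT (EFin \o disk_cut k u).
Proof.
move=> [m_u iu]; pose K : R := k%:R.
(* On the disk |u| <= 1 + u^2, and the disk lies in the square of half-side [K]. *)
apply: (@rintegrable_le _ _ _ _ _ (fun x => box_ind (- K) K (- K) K x + u x ^+ 2)).
- exact: measurable_disk_cut.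
- move=> x; rewrite /disk_cut; case: ifPn => h.
    have [h1 h2] := norm2_ge_coord x.
    have -> : box_ind (- K) K (- K) K x = 1.
      rewrite /box_ind /itv_ind !indicE !mem_set ?mulr1//=.
        by rewrite in_itv/= -ler_norml (le_trans h2).
      by rewrite in_itv/= -ler_norml (le_trans h1).
    by have := sqr_ge0 (`|u x| - 1); rewrite -(real_normK (num_real (u x))); have := sqr_ge0 `|u x|; nra.
  by rewrite normr0 addr_ge0 ?box_ind_ge0 ?sqr_ge0.
- by apply: rintegrableD => //; exact: integrable_box_ind.
Qed.

Lemma ftrN u v : (leb2 R).-integrable setT (EFin \o u) ->
  (leb2 R).-integrable setT (EFin \o v) ->
  forall xi, ftr (fun x => - u x) (fun x => - v x) xi = - ftr u v xi.
Proof.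
move=> iu iv xi; rewrite /ftr -mulN1r -(leb2_RintegralZ _ (ftr_integrand_integrable xi iu iv)).
by apply: eq_Rintegral => x _; ring.
Qed.

Lemma sq_integrableN u : sq_integrable u -> sq_integrable (fun x => - u x).
Proof.
move=> [mw iw]; split; first exact: measurableT_comp mw.
by apply: eq_integrable iw => // x _; rewrite /= sqrrN.
Qed.

(** This is multiplication by -i. It lets a result about the real part of a function be applied to
    its imaginary part. *)
Lemma fourier_pair_rot u v P S : fourier_pair u v P S ->
  fourier_pair v (fun x => - u x) S (fun x => - P x).
Proof.
move=> [su sv sP sS c].
split; [exact: sv|exact: sq_integrableN|exact: sS|exact: sq_integrableN|].
have E : (fun k => (\int[leb2 R]_xi (fourier_tail v (fun x => - u x) S (fun x => - P x) k xi)%:E)%E) =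
    (fun k => (\int[leb2 R]_xi (fourier_tail u v P S k xi)%:E)%E).
  apply/funext => k; apply: eq_integral => xi _; congr EFin.
  have cN : disk_cut k (fun x => - u x) = (fun x => - disk_cut k u x).
    by apply/funext => x; rewrite /disk_cut; case: ifP; rewrite ?oppr0.
  rewrite /fourier_tail cN addrC; congr (_ + _).
  rewrite (ftrN (disk_cut_integrable k su) (disk_cut_integrable k sv)).
  by rewrite mulrN -opprD sqrrN.
by rewrite E; exact: c.
Qed.

Lemma measurable_fourier_tail u v P S k : sq_integrable u -> sq_integrable v ->
  measurable_fun setT P -> measurable_fun setT S ->
  measurable_fun setT (fourier_tail u v P S k).
Proof.
move=> su sv mP mS.
have iu := disk_cut_integrable k su; have iv := disk_cut_integrable k sv.
have m1 := measurable_ftr iu iv; have m2 := measurable_ftr iv (rintegrableN iu).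
by apply: measurable_funD; apply: measurable_funX; apply: measurable_funB => //;
  apply: measurable_funM.
Qed.

Lemma fourier_tail_ge0 u v P S k xi : 0 <= fourier_tail u v P S k xi.
Proof. by rewrite addr_ge0 ?sqr_ge0. Qed.

Lemma fourier_pair_small u v P S (e : R) : fourier_pair u v P S -> 0 < e ->
  exists k0, forall k, (k0 <= k)%N ->
    (leb2 R).-integrable setT (EFin \o fourier_tail u v P S k) /\
    \int[leb2 R]_xi fourier_tail u v P S k xi <= e.
Proof.
move=> [su sv [mP _] [mS _] c] e0.
have [k0 _ h] : \forall k \near \oo, (\int[leb2 R]_xi (fourier_tail u v P S k xi)%:E <= e%:E)%E.
  have /fine_cvgP[fin c'] := c.
  have h' : \forall k \near \oo, `|(fine \o (fun k : nat => (\int[leb2 R]_xi (fourier_tail u v P S k xi)%:E)%E)) k| <= e.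
    exact: (cvgr0_norm_le _ c' _ e0).
  move: h'.
  apply: filterS2 fin => k fk /= h; rewrite -(fineK fk) lee_fin.
  exact: le_trans (ler_norm _) h.
exists k0 => k kk; have hk := h k kk.
have i : (leb2 R).-integrable setT (EFin \o fourier_tail u v P S k).
  apply: ge0_rintegrable hk; first exact: measurable_fourier_tail.
  by move=> xi; exact: fourier_tail_ge0.
by split => //; rewrite -lee_fin EFin_Rintegral.
Qed.

(** Both pairs are compared with the same truncated transform: their squared distance is at most
    twice the sum of the two tails, whose integrals are arbitrarily small. *)
Lemma fourier_pair_unique u v P S P' S' : fourier_pair u v P S -> fourier_pair u v P' S' ->
  {ae leb2 R, forall xi, P xi = P' xi /\ S xi = S' xi}.
Proof.
move=> f1 f2; pose h xi := (P xi - P' xi) ^+ 2 + (S xi - S' xi) ^+ 2.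
have [_ _ [mP _] [mS _] _] := f1; have [_ _ [mP' _] [mS' _] _] := f2.
have mh : measurable_fun setT h.
  by apply: measurable_funD; apply: measurable_funX; exact: measurable_funB.
have h0 xi : 0 <= h xi by rewrite addr_ge0 ?sqr_ge0.
have hle k xi : h xi <= 2 * fourier_tail u v P S k xi + 2 * fourier_tail u v P' S' k xi.
  rewrite /h /fourier_tail; set A := _^-1 * _; set B := _^-1 * _.
  have := sqr_ge0 (P xi - A + (P' xi - A)); have := sqr_ge0 (S xi - B + (S' xi - B)).
  by nra.
have I e : 0 < e -> (\int[leb2 R]_xi (h xi)%:E <= e%:E)%E.
  move=> e0; have e4 : 0 < e / 4 by rewrite divr_gt0.
  have [k1 h1] := fourier_pair_small f1 e4; have [k2 h2] := fourier_pair_small f2 e4.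
  have [i1 l1] := h1 (maxn k1 k2) (leq_maxl _ _).
  have [i2 l2] := h2 (maxn k1 k2) (leq_maxr _ _).
  have i12 := rintegrableD (rintegrableZ 2 i1) (rintegrableZ 2 i2).
  apply: (@le_trans _ _ (\int[leb2 R]_xi (2 * fourier_tail u v P S (maxn k1 k2) xi +
     2 * fourier_tail u v P' S' (maxn k1 k2) xi)%:E)%E).
    apply: ge0_le_integral => //.
    - by move=> xi _; rewrite lee_fin.
    - exact/measurable_EFinP.
    - by apply/measurable_EFinP; exact: (rintegrable_measurable i12).
    - by move=> xi _; rewrite lee_fin.
  rewrite -EFin_Rintegral// lee_fin leb2_RintegralD; [|exact: rintegrableZ..].
  rewrite !leb2_RintegralZ//.
  by rewrite (_ : e = 2 * (e / 4) + 2 * (e / 4)); [apply: lerD; rewrite ler_wpM2l|field].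
have z : (\int[leb2 R]_xi `|(h xi)%:E| = 0)%E.
  under eq_integral do rewrite gee0_abs ?lee_fin//.
  apply/eqP; rewrite eq_le integral_ge0 ?andbT; last by move=> *; rewrite lee_fin.
  by apply/lee_addgt0Pr => e e0; rewrite add0e; exact: I.
have mh' : measurable_fun setT (EFin \o h) by exact/measurable_EFinP.
have := (ae_eq_integral_abs (leb2 R) measurableT mh').1 z.
apply: ae_imp => xi hx; have : h xi == 0 by rewrite -eqe; apply/eqP; exact: hx.
rewrite /h paddr_eq0 ?sqr_ge0//.
by rewrite !sqrf_eq0 !subr_eq0 => /andP[/eqP -> /eqP ->].
Qed.
End plancherel_pairs.

(** * Functions whose integrals over rectangles vanish *)

Section pi_lambda_integrals.
Context d (T : measurableType d) d' (T' : measurableType d') (R : realType)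
  (m : {measure set T -> \bar R}).

(** A Dynkin system argument, stated through a map [h] so that it serves for either coordinate and
    for the identity. The vanishing of the total integral is a separate hypothesis because [G] need
    not contain the whole space. *)
Lemma Rintegral_pi_lambda (h : T -> T') (w : T -> R) (G : set (set T')) :
  measurable_fun setT h -> m.-integrable setT (EFin \o w) ->
  @measurable _ T' = <<s G >> -> setI_closed G ->
  (forall A, G A -> \int[m]_x (\1_A (h x) * w x) = 0) ->
  \int[m]_x w x = 0 ->
  forall A, measurable A -> \int[m]_x (\1_A (h x) * w x) = 0.
Proof.
move=> mh iw mG IG G0 w0 A mA.
have mw := rintegrable_measurable iw.
have mind B : measurable B -> measurable_fun setT (fun x => \1_B (h x) : R).
  by move=> mB; apply: measurableT_comp mh; exact: measurable_indic.
have iB B : measurable B -> m.-integrable setT (EFin \o (fun x => \1_B (h x) * w x)).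
  move=> mB; apply: (@rintegrable_bmul _ _ _ _ 1) => //; first exact: mind.
  by move=> x; rewrite indicE ger0_norm; case: (_ \in _).
pose H : set (set T') := [set B | measurable B /\ \int[m]_x (\1_B (h x) * w x) = 0].
suff : H A by case.
have mGm B : G B -> measurable B by move=> GB; rewrite mG; exact: sub_sigma_algebra.
have : <<s setT, G >> `<=` H.
  apply: lambda_system_subset => //; last first.
    by move=> B GB; split; [exact: mGm|exact: G0].
  split => //.
  - split => //; rewrite -[RHS]w0; apply: eq_Rintegral => x _.
    by rewrite indicE in_setT mul1r.
  - move=> B C CB [mB B0] [mC C0]; split; first exact: measurableD.
    rewrite -[RHS]subr0 -{1}B0 -[X in _ - X]C0 -RintegralB//; [|exact: iB..].
    apply: eq_Rintegral => x _; rewrite -mulrBl; congr (_ * _).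
    rewrite !indicE in_setD.
    have [xC|xC] := boolP (h x \in C); last by rewrite andbT subr0.
    by rewrite (_ : h x \in B) ?subrr// inE; apply: CB; rewrite inE in xC.
  - move=> F ndF HF.
    have mF n : measurable (F n) by case: (HF n).
    have mUF : measurable (\bigcup_n F n) by exact: bigcupT_measurable.
    split => //.
    have [_ L] : m.-integrable setT (EFin \o (fun x => \1_(\bigcup_n F n) (h x) * w x)) /\
      \int[m]_x (\1_(F n) (h x) * w x) @[n --> \oo] --> \int[m]_x (\1_(\bigcup_n F n) (h x) * w x).
      apply: (@Rintegral_dominated _ _ _ _ _ _ (fun x => `|w x|)).
      + by move=> n; exact: rintegrable_measurable (iB _ (mF n)).
      + exact: rintegrable_measurable (iB _ mUF).
      + apply: aeW => x; apply: cvgMl; apply: cvg_near_cst.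
        have [[k _ Fk]|nF] := pselect ((\bigcup_n F n) (h x)).
          exists k => // n /= kn; rewrite !indicE !mem_set//.
            by exists k.
          by move/subsetPset: (ndF _ _ kn); apply.
        by apply: nearW => n; rewrite !indicE !memNset// => Fn; apply: nF; exists n.
      + move=> n x; rewrite normrM ler_piMl// indicE ger0_norm; by case: (_ \in _).
      + exact: rintegrable_norm.
    have E : (fun n => \int[m]_x (\1_(F n) (h x) * w x)) = (fun=> 0).
      by apply/funext => n; case: (HF n).
    rewrite E in L; apply: (cvg_unique (@norm_hausdorff _ _) L); exact: cvg_cst.
by apply; rewrite -mG.
Qed.

End pi_lambda_integrals.

Section zero_on_boxes.
Context (R : realType).
Notation mu := (@lebesgue_measure R).

Let oc (a b : R) : set (measurableTypeR R) := `]a, b]%classic.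

(** The pi-lambda argument is used three times: in the first coordinate, in the second, then from
    rectangles to all measurable sets of the plane. In the first two passages the support condition
    supplies the total integral, through the interval (-N, N]. *)
Lemma zero_on_boxes (f : plane R -> R) (N : R) :
  (leb2 R).-integrable setT (EFin \o f) ->
  (forall x, f x = \1_(oc (- N) N) x.1 * \1_(oc (- N) N) x.2 * f x) ->
  (forall a b c d, \int[leb2 R]_x (\1_(oc a b) x.1 * (\1_(oc c d) x.2 * f x)) = 0) ->
  {ae leb2 R, forall x, f x = 0}.
Proof.
move=> i_f fN box0.
have mo a b : measurable (oc a b) by exact: measurable_itv.
have mG : @measurable _ (measurableTypeR R) = <<s @ocitv R >> by [].
have w_int (A : set (measurableTypeR R)) (p : plane R -> measurableTypeR R) (w : plane R -> R) :
    measurable A -> measurable_fun setT p ->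
    (leb2 R).-integrable setT (EFin \o w) ->
    (leb2 R).-integrable setT (EFin \o (fun x => \1_A (p x) * w x)).
  move=> mA mp iw; apply: (@rintegrable_bmul _ _ _ _ 1) => //.
    by apply: measurableT_comp mp; exact: measurable_indic.
  by move=> x; rewrite indicE ger0_norm; case: (_ \in _).
have step1 A c d : measurable A -> \int[leb2 R]_x (\1_A x.1 * (\1_(oc c d) x.2 * f x)) = 0.
  move=> mA.
  apply: (@Rintegral_pi_lambda _ _ _ (measurableTypeR R) R (leb2 R) fst _ (@ocitv R)) => //.
  - exact: w_int.
  - exact: ocitvI.
  - by move=> _ [[a b] _ <-]; exact: box0.
  - rewrite -[RHS](box0 (- N) N c d); apply: eq_Rintegral => x _.
    rewrite [in RHS]fN [in LHS]fN !indicE.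
    by case: (x.1 \in _); case: (x.2 \in oc (- N) N); case: (x.2 \in oc c d); rewrite /=; ring.
have step2 A B : measurable A -> measurable B -> \int[leb2 R]_x (\1_B x.2 * (\1_A x.1 * f x)) = 0.
  move=> mA mB.
  apply: (@Rintegral_pi_lambda _ _ _ (measurableTypeR R) R (leb2 R) snd _ (@ocitv R)) => //.
  - exact: w_int.
  - exact: ocitvI.
  - move=> _ [[a b] _ <-]; rewrite -[RHS](step1 A a b mA); apply: eq_Rintegral => x _.
    by rewrite mulrCA.
  - rewrite -[RHS](step1 A (- N) N mA); apply: eq_Rintegral => x _.
    rewrite [in LHS]fN [in RHS]fN !indicE.
    by case: (x.1 \in A); case: (x.2 \in oc (- N) N); case: (x.1 \in oc (- N) N); rewrite /=; ring.
have step3 A : measurable A -> \int[leb2 R]_x (\1_A x * f x) = 0.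
  move=> mA.
  apply: (@Rintegral_pi_lambda _ _ _ (plane R) R (leb2 R) id _
    [set A `*` B | A in measurable & B in measurable]) => //.
  - exact: measurable_prod_measurableType.
  - move=> _ _ [A1 m1 [B1 n1 <-]] [A2 m2 [B2 n2 <-]]; rewrite -setXI.
    by exists (A1 `&` A2); [exact: measurableI|exists (B1 `&` B2) => //; exact: measurableI].
  - move=> _ [A1 m1 [B1 n1 <-]]; rewrite -[RHS](step2 A1 B1 m1 n1); apply: eq_Rintegral => x _.
    rewrite mulrA; congr (_ * _); rewrite !indicE in_setX.
    by case: (x.1 \in A1); case: (x.2 \in B1); rewrite /= ?mulr0 ?mulr1.
  - rewrite -[RHS](step2 setT setT)//; apply: eq_Rintegral => x _.
    by rewrite !indicE !in_setT !mul1r.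
have : ae_eq (leb2 R) setT (EFin \o f) (cst 0%E).
  apply: integral_ae_eq => //.
  move=> A _ mA; rewrite integral0.
  rewrite integral_mkcond.
  have -> : ((EFin \o f) \_ A) = EFin \o (fun x => \1_A x * f x).
    by apply/funext => x; rewrite patchE /= indicE; case: (x \in A); rewrite ?mul1r ?mul0r.
  rewrite -[RHS](congr1 EFin (step3 A mA)) EFin_Rintegral//.
  apply: (@rintegrable_bmul _ _ _ _ 1) => //.
  by move=> x; rewrite indicE ger0_norm; case: (_ \in _).
by apply: ae_imp => x /(_ Logic.I)/= [].
Qed.

End zero_on_boxes.

(** * Fourier inversion *)

Section inversion.
Context (R : realType).
Notation mu := (@lebesgue_measure R).
Implicit Types (u v P S : plane R -> R).

Lemma box_cosE a1 b1 a2 b2 : @box_cos R a1 b1 a2 b2 = ftr (box_ind a1 b1 a2 b2) (fun=> 0).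
Proof. by apply/funext => xi; apply: eq_Rintegral => y _; rewrite mulr0 addr0 mulrC. Qed.

Lemma box_sinE a1 b1 a2 b2 : @box_sin R a1 b1 a2 b2 = ftr (fun=> 0) (box_ind a1 b1 a2 b2).
Proof. by apply/funext => xi; apply: eq_Rintegral => y _; rewrite mulr0 add0r mulrC. Qed.

Lemma leb2_integrable0 : (leb2 R).-integrable setT (EFin \o (fun=> 0 : R)).
Proof. exact: integrable0. Qed.

Lemma measurable_box_trig a1 b1 a2 b2 :
  measurable_fun setT (@box_cos R a1 b1 a2 b2) /\ measurable_fun setT (@box_sin R a1 b1 a2 b2).
Proof.
rewrite box_cosE box_sinE; split; apply: measurable_ftr;
  solve [exact: integrable_box_ind | exact: leb2_integrable0].
Qed.

Lemma box_integrand_split a1 b1 a2 b2 (p s : R) xi :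
  \int[leb2 R]_y (box_ind a1 b1 a2 b2 y * (cos (dot2 y xi) * p - sin (dot2 y xi) * s)) =
  box_cos a1 b1 a2 b2 xi * p - box_sin a1 b1 a2 b2 xi * s.
Proof.
have mc : measurable_fun setT (fun y : plane R => cos (dot2 y xi)).
  apply: measurable_cosf; exact: measurable_dot2r.
have ms : measurable_fun setT (fun y : plane R => sin (dot2 y xi)).
  apply: measurable_sinf; exact: measurable_dot2r.
have ib := @integrable_box_ind R a1 b1 a2 b2.
have ic := bounded_mul_integrable mc (fun y => norm_cos_le1 (dot2 y xi)) ib.
have is_ := bounded_mul_integrable ms (fun y => norm_sin_le1 (dot2 y xi)) ib.
rewrite /box_cos /box_sin [_ * p]mulrC [_ * s]mulrC.
rewrite -(leb2_RintegralZ p ic) -(leb2_RintegralZ s is_).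
rewrite -(leb2_RintegralB (rintegrableZ p ic) (rintegrableZ s is_)).
by apply: eq_Rintegral => y _; ring.
Qed.

Lemma mul_le_sq (x y e : R) : 0 < e -> `|x * y| <= e * x ^+ 2 + e^-1 * y ^+ 2.
Proof.
move=> e0; have i0 : 0 < e^-1 by rewrite invr_gt0.
have E : e^-1 * e = 1 by rewrite mulVf ?gt_eqF.
have h : 0 <= e^-1 * (e * x - y) ^+ 2 by rewrite mulr_ge0 ?sqr_ge0 ?ltW.
have h' : 0 <= e^-1 * (e * x + y) ^+ 2 by rewrite mulr_ge0 ?sqr_ge0 ?ltW.
have x0 : 0 <= e * x ^+ 2 by rewrite mulr_ge0 ?sqr_ge0 ?ltW.
have y0 : 0 <= e^-1 * y ^+ 2 by rewrite mulr_ge0 ?sqr_ge0 ?ltW.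
have e1 : e^-1 * (e * x - y) ^+ 2 = e * x ^+ 2 - 2 * (x * y) + e^-1 * y ^+ 2.
  rewrite (_ : _ * _ = (e^-1 * e) * (e * x ^+ 2) - (e^-1 * e) * (2 * (x * y)) + e^-1 * y ^+ 2); last by ring.
  by rewrite E !mul1r.
have e2 : e^-1 * (e * x + y) ^+ 2 = e * x ^+ 2 + 2 * (x * y) + e^-1 * y ^+ 2.
  rewrite (_ : _ * _ = (e^-1 * e) * (e * x ^+ 2) + (e^-1 * e) * (2 * (x * y)) + e^-1 * y ^+ 2); last by ring.
  by rewrite E !mul1r.
by rewrite ler_norml; apply/andP; split; lra.
Qed.

Lemma sq_product_integrable u v : sq_integrable u -> sq_integrable v ->
  (leb2 R).-integrable setT (EFin \o (fun x => u x * v x)).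
Proof.
move=> [m_u iu] [m_v iv].
apply: (@rintegrable_le _ _ _ _ _ (fun x => 1 * u x ^+ 2 + 1^-1 * v x ^+ 2)).
- exact: measurable_funM.
- by move=> x; exact: mul_le_sq.
- by apply: rintegrableD; exact: rintegrableZ.
Qed.

Lemma box_trig_sq a1 b1 a2 b2 : a1 < b1 -> a2 < b2 ->
  sq_integrable (@box_cos R a1 b1 a2 b2) /\ sq_integrable (@box_sin R a1 b1 a2 b2).
Proof.
move=> ab1 ab2; have [G iG GP] := box_fourier_L2 ab1 ab2.
have [mc ms] := measurable_box_trig a1 b1 a2 b2.
split; split=> //; apply: (@rintegrable_le _ _ _ _ _ G) => //.
- exact: measurable_funX.
- by move=> x; rewrite ger0_norm ?sqr_ge0//; have [] := GP x.
- exact: measurable_funX.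
- by move=> x; rewrite ger0_norm ?sqr_ge0//; have [] := GP x.
Qed.

Lemma small_eq0 (x C : R) : 0 <= C -> (forall e, 0 < e -> `|x| <= e * C) -> x = 0.
Proof.
move=> C0 h; apply/eqP; rewrite -normr_le0; apply/ler_addgt0Pr => e e0; rewrite add0r.
have C1 : 0 < C + 1 by rewrite ltr_wpDl.
apply: le_trans (h (e / (C + 1)) _) _; first by rewrite divr_gt0.
by rewrite mulrAC ler_pdivrMr// ler_wpM2l ?(ltW e0)// lerDl.
Qed.

(** The identity holds for the truncation of u + i v to a large disk, by [box_parseval_L1]. Since
    the transforms of the box lie in L^2, the error is controlled by the L^2 tail of the pair. *)
Lemma box_parseval_L2 a1 b1 a2 b2 u v P S : a1 < b1 -> a2 < b2 ->
  fourier_pair u v P S ->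
  \int[leb2 R]_xi (box_cos a1 b1 a2 b2 xi * P xi - box_sin a1 b1 a2 b2 xi * S xi) =
  2 * pi * \int[leb2 R]_x (u x * box_ind a1 b1 a2 b2 x).
Proof.
move=> ab1 ab2 fp; have [su sv sP sS _] := fp.
have [sc ss] := box_trig_sq ab1 ab2.
set Kc := box_cos a1 b1 a2 b2; set Ks := box_sin a1 b1 a2 b2.
have iP := sq_product_integrable sc sP; have iS := sq_product_integrable ss sS.
pose I2 := \int[leb2 R]_xi (Kc xi ^+ 2 + Ks xi ^+ 2).
have iK : (leb2 R).-integrable setT (EFin \o (fun xi => Kc xi ^+ 2 + Ks xi ^+ 2)).
  by apply: rintegrableD; [case: sc|case: ss].
have I20 : 0 <= I2 by apply: Rintegral_ge0 => xi _; rewrite addr_ge0 ?sqr_ge0.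
apply/eqP; rewrite -subr_eq0; apply/eqP; apply: (@small_eq0 _ (I2 + 1)).
  by rewrite addr_ge0.
(* The tail is made at most e^2 because the bound for [D] weights it by 1 / e; the total error is
   then at most e (I2 + 1). *)
move=> e e0; have [k0 hk0] := fourier_pair_small fp (exprn_gt0 2 e0).
(* A disk of radius at least [rad] contains the box, so that the truncation does not affect [u]
   there. *)
pose rad := `|a1| + `|b1| + (`|a2| + `|b2|).
pose k := maxn k0 (Num.trunc rad).+1.
have [iT lT] := hk0 k (leq_maxl _ _).
have radk : rad <= k%:R.
  rewrite (@le_trans _ _ (Num.trunc rad).+1%:R) ?ler_nat ?leq_maxr//.
  by rewrite ltW// truncnS_gt.
have cutE x : disk_cut k u x * box_ind a1 b1 a2 b2 x = u x * box_ind a1 b1 a2 b2 x.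
  rewrite /disk_cut; case: ifPn => //; rewrite -ltNge => far.
  suff -> : box_ind a1 b1 a2 b2 x = 0 by rewrite !mulr0.
  rewrite /box_ind /itv_ind !indicE.
  have [/set_mem h1|h1] := boolP (x.1 \in _); last by rewrite mul0r.
  have [/set_mem h2|h2] := boolP (x.2 \in _); last by rewrite mulr0.
  exfalso; move: far; apply/negP; rewrite -leNgt (le_trans _ radk)//.
  move: h1 h2; rewrite /= !in_itv/= => /andP[h1 h1'] /andP[h2 h2'].
  have n1 : `|x.1| <= `|a1| + `|b1|.
    have := ler_norm a1; have := ler_norm (- a1); have := ler_norm b1; have := ler_norm (- b1).
    by rewrite !normrN ler_norml; clear -h1 h1'; move=> *; apply/andP; split; lra.
  have n2 : `|x.2| <= `|a2| + `|b2|.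
    have := ler_norm a2; have := ler_norm (- a2); have := ler_norm b2; have := ler_norm (- b2).
    by rewrite !normrN ler_norml; clear -h2 h2'; move=> *; apply/andP; split; lra.
  have n0 : 0 <= `|x.1| + `|x.2| by rewrite addr_ge0.
  apply: (@le_trans _ _ (`|x.1| + `|x.2|)); last exact: lerD.
  rewrite -(ger0_norm n0) -sqrtr_sqr /norm2 /dot2 -!expr2 ler_sqrt ?sqr_ge0//.
  rewrite -(real_normK (num_real x.1)) -(real_normK (num_real x.2)).
  by have := mulr_ge0 (normr_ge0 x.1) (normr_ge0 x.2); nra.
pose uk := disk_cut k u; pose vk := disk_cut k v.
have iuk := disk_cut_integrable k su : (leb2 R).-integrable setT (EFin \o uk).
have ivk := disk_cut_integrable k sv : (leb2 R).-integrable setT (EFin \o vk).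
pose Pk xi := (2 * pi)^-1 * ftr uk vk xi.
pose Sk xi := (2 * pi)^-1 * ftr vk (fun x => - uk x) xi.
have mPk : measurable_fun setT Pk by apply: measurable_funM => //; exact: measurable_ftr.
have mSk : measurable_fun setT Sk.
  by apply: measurable_funM => //; apply: measurable_ftr => //; exact: rintegrableN.
have [mP _] := sP; have [mS _] := sS; have [mKc _] := sc; have [mKs _] := ss.
pose D xi := Kc xi * (P xi - Pk xi) - Ks xi * (S xi - Sk xi).
have bD xi : `|D xi| <= e * (Kc xi ^+ 2 + Ks xi ^+ 2) + e^-1 * fourier_tail u v P S k xi.
  apply: le_trans (ler_normB _ _) _.
  have h1 := mul_le_sq (Kc xi) (P xi - Pk xi) e0.
  have h2 := mul_le_sq (Ks xi) (S xi - Sk xi) e0.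
  apply: le_trans (lerD h1 h2) _; rewrite le_eqVlt; apply/orP; left; apply/eqP.
  by rewrite /fourier_tail /Pk /Sk /uk /vk; ring.
have iB := rintegrableD (rintegrableZ e iK) (rintegrableZ e^-1 iT).
have iD : (leb2 R).-integrable setT (EFin \o D).
  apply: rintegrable_le bD iB.
  by apply: measurable_funB; apply: measurable_funM => //; exact: measurable_funB.
have iPS := rintegrableB iP iS.
pose Phi xi := Kc xi * Pk xi - Ks xi * Sk xi.
have PhiE xi : Phi xi = (Kc xi * P xi - Ks xi * S xi) - D xi by rewrite /Phi /D; ring.
have iPhi : (leb2 R).-integrable setT (EFin \o Phi).
  by have := rintegrableB iPS iD; apply: eq_integrable => // xi _; rewrite /= PhiE.
have pi0 : (2 * pi : R) != 0 by rewrite mulf_neq0// gt_eqF ?pi_gt0.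
(* [box_parseval_L1] has the factor (2 pi)^2, one power of which is spent on the normalisation of
   [Pk] and [Sk]. *)
have E1 : \int[leb2 R]_xi Phi xi = 2 * pi * \int[leb2 R]_x (u x * box_ind a1 b1 a2 b2 x).
  have F : (fun xi => \int[leb2 R]_y (box_ind a1 b1 a2 b2 y *
      (cos (dot2 y xi) * ftr uk vk xi - sin (dot2 y xi) * ftr vk (fun x => - uk x) xi))) =
      (fun xi => 2 * pi * Phi xi).
    apply/funext => xi; rewrite box_integrand_split -/Kc -/Ks /Phi /Pk /Sk mulrBr.
    by congr (_ - _); rewrite [RHS]mulrCA mulVKf.
  have := @box_parseval_L1 R a1 b1 a2 b2 ab1 ab2 uk vk iuk ivk.
  rewrite F => /(_ (rintegrableZ _ iPhi)); rewrite leb2_RintegralZ// => H.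
  apply: (mulfI pi0); rewrite H expr2 -[LHS]mulrA; congr (_ * (_ * _)).
  by apply: eq_Rintegral => x _; exact: cutE.
have -> : \int[leb2 R]_xi (Kc xi * P xi - Ks xi * S xi) -
    2 * pi * \int[leb2 R]_x (u x * box_ind a1 b1 a2 b2 x) = \int[leb2 R]_xi D xi.
  rewrite -E1 -(leb2_RintegralB iPS iPhi); apply: eq_Rintegral => xi _; rewrite PhiE.
  exact: subKr.
apply: le_trans (norm_Rintegral_le iD iB bD) _.
rewrite leb2_RintegralD ?leb2_RintegralZ//; [|exact: rintegrableZ..].
rewrite mulrDr mulr1 lerD2l mulrC ler_pdivrMr// -expr2.
Qed.

End inversion.

Section fourier_inversion.
Context (R : realType).
Notation mu := (@lebesgue_measure R).
Implicit Types (u v P S : plane R -> R).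

(** [ftr P (fun xi => - S xi)] at x is the real part of the integral of exp(i x.xi) (P + i S), the
    inverse transform without its constant. Fubini moves the transform onto the box, where it meets
    the left side of [box_parseval_L2]. *)
Lemma box_integral_ftr a1 b1 a2 b2 P S :
  (leb2 R).-integrable setT (EFin \o P) -> (leb2 R).-integrable setT (EFin \o S) ->
  \int[leb2 R]_x (box_ind a1 b1 a2 b2 x * ftr P (fun xi => - S xi) x) =
  \int[leb2 R]_xi (box_cos a1 b1 a2 b2 xi * P xi - box_sin a1 b1 a2 b2 xi * S xi).
Proof.
move=> iP iS; have ib := @integrable_box_ind R a1 b1 a2 b2.
have md : measurable_fun setT (fun z : plane R * plane R => dot2 z.2 z.1).
  by under eq_fun do rewrite dot2C; exact: measurable_dot2.
have mc := measurable_cosf md; have ms := measurable_sinf md.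
have bc (z : plane R * plane R) := norm_cos_le1 (dot2 z.2 z.1).
have bs (z : plane R * plane R) := norm_sin_le1 (dot2 z.2 z.1).
have E1 := plane_swap mc bc ib iP; have E2 := plane_swap ms bs ib iS.
have I1 := plane_swap_integrable mc bc ib iP; have I2 := plane_swap_integrable ms bs ib iS.
have -> : \int[leb2 R]_x (box_ind a1 b1 a2 b2 x * ftr P (fun xi => - S xi) x) =
  \int[leb2 R]_x (box_ind a1 b1 a2 b2 x * (\int[leb2 R]_xi (P xi * cos (dot2 xi x)))
    - box_ind a1 b1 a2 b2 x * (\int[leb2 R]_xi (S xi * sin (dot2 xi x)))).
  apply: eq_Rintegral => x _; rewrite -mulrBr; congr (_ * _).
  have i1 := bounded_mul_integrable (measurable_fun_pair2 x mc) (fun xi => bc (x, xi)) iP.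
  have i2 := bounded_mul_integrable (measurable_fun_pair2 x ms) (fun xi => bs (x, xi)) iS.
  rewrite -(leb2_RintegralB i1 i2) /ftr; apply: eq_Rintegral => xi _ /=.
  by rewrite mulrN mulrC [sin _ * _]mulrC.
have mcr : measurable_fun setT (fun z : plane R * plane R => cos (dot2 z.1 z.2)).
  by apply: measurable_cosf; exact: measurable_dot2.
have msr : measurable_fun setT (fun z : plane R * plane R => sin (dot2 z.1 z.2)).
  by apply: measurable_sinf; exact: measurable_dot2.
have J1 := plane_swap_integrable mcr (fun z => norm_cos_le1 _) iP ib.
have J2 := plane_swap_integrable msr (fun z => norm_sin_le1 _) iS ib.
rewrite (leb2_RintegralB I1 I2) E1 E2.
have K1 : (leb2 R).-integrable setT (EFin \o (fun xi => box_cos a1 b1 a2 b2 xi * P xi)).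
  apply: eq_integrable J1; first by [].
  move=> xi _ /=; rewrite mulrC; congr (_ * _)%:E.
  by apply: eq_Rintegral => y _; rewrite dot2C.
have K2 : (leb2 R).-integrable setT (EFin \o (fun xi => box_sin a1 b1 a2 b2 xi * S xi)).
  apply: eq_integrable J2; first by [].
  move=> xi _ /=; rewrite mulrC; congr (_ * _)%:E.
  by apply: eq_Rintegral => y _; rewrite dot2C.
rewrite (leb2_RintegralB K1 K2); congr (_ - _); apply: eq_Rintegral => xi _; rewrite mulrC;
  congr (_ * _); apply: eq_Rintegral => y _ /=; by rewrite dot2C.
Qed.

Let oc (a b : R) : set (measurableTypeR R) := `]a, b]%classic.

Lemma in_oc (a b x : R) : (x \in oc a b) = (a < x <= b).
Proof.
by apply/idP/idP => [/set_mem|h]; [|apply/mem_set]; rewrite /oc /= in_itv.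
Qed.

Lemma oc_inter (a b N x : R) :
  \1_(oc a b) x * \1_(oc (- N) N) x = \1_(oc (Num.max a (- N)) (Num.min b N)) x :> R.
Proof.
rewrite !indicE -natrM mulnb !in_oc gt_max le_min; congr (nat_of_bool _)%:R.
by case: (a < x); case: (x <= b); case: (- N < x); case: (x <= N).
Qed.

Lemma oc_itv_ind (a b x : R) : x != a -> \1_(oc a b) x = itv_ind a b x.
Proof.
move=> xa; rewrite /itv_ind !indicE in_oc; congr (nat_of_bool _)%:R.
rewrite lt_neqAle eq_sym xa /=.
by apply/idP/idP => [h|/set_mem]; [apply/mem_set|]; rewrite /= in_itv.
Qed.

(** [u] and the inverse transform have the same integral over every box: [box_parseval_L2] computes
    it for the first and [box_integral_ftr] for the second. Their difference vanishes almost
    everywhere on each square (-N, N]^2 by [zero_on_boxes], and the squares exhaust the plane. *)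
Theorem fourier_inversion u v P S : fourier_pair u v P S ->
  (leb2 R).-integrable setT (EFin \o P) -> (leb2 R).-integrable setT (EFin \o S) ->
  {ae leb2 R, forall x, u x = (2 * pi)^-1 * ftr P (fun xi => - S xi) x}.
Proof.
move=> fp iP iS; have [[m_u iu] _ _ _ _] := fp.
have iNS := rintegrableN iS.
pose ut x := (2 * pi)^-1 * ftr P (fun xi => - S xi) x.
have mut : measurable_fun setT ut by apply: measurable_funM => //; exact: measurable_ftr.
pose M := (2 * pi)^-1 * l1 P (fun xi => - S xi).
have but x : `|ut x| <= M.
  by rewrite normrM ger0_norm ?invr_ge0 ?mulr_ge0 ?pi_ge0// ler_wpM2l ?invr_ge0 ?mulr_ge0 ?pi_ge0// ftr_bound.
pose g x := u x - ut x.
have ibox a b c d : (leb2 R).-integrable setT (EFin \o (fun x => box_ind a b c d x * g x)).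
  have i1 := bounded_mul_integrable mut but (@integrable_box_ind R a b c d).
  have i2 : (leb2 R).-integrable setT (EFin \o (fun x => box_ind a b c d x * u x)).
    apply: (@rintegrable_le _ _ _ _ _ (fun x => box_ind a b c d x + u x ^+ 2)).
    - apply: measurable_funM => //; exact: rintegrable_measurable (integrable_box_ind _ _ _ _).
    - move=> x; rewrite normrM ger0_norm ?box_ind_ge0//.
      have := box_ind_ge0 a b c d x; have := box_ind_le1 a b c d x.
      have := sqr_ge0 (`|u x| - 1); have := normr_ge0 (u x); rewrite -(real_normK (num_real (u x))).
      by set B := box_ind _ _ _ _ _; nra.
    - by apply: rintegrableD => //; exact: integrable_box_ind.
  apply: eq_integrable (rintegrableB i2 i1) => // x _ /=; by rewrite /g mulrBr.
have zbox a b c d : a < b -> c < d -> \int[leb2 R]_x (box_ind a b c d x * g x) = 0.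
  move=> ab cd; have E := box_parseval_L2 ab cd fp.
  have iu' : (leb2 R).-integrable setT (EFin \o (fun x => u x * box_ind a b c d x)).
    have := rintegrableD (ibox a b c d)
      (bounded_mul_integrable mut but (@integrable_box_ind R a b c d)).
    by apply: eq_integrable => // x _ /=; rewrite /g; congr EFin; ring.
  have it := bounded_mul_integrable mut but (@integrable_box_ind R a b c d).
  transitivity (\int[leb2 R]_x (u x * box_ind a b c d x) - \int[leb2 R]_x (box_ind a b c d x * ut x)).
    rewrite -(leb2_RintegralB iu' it); apply: eq_Rintegral => x _; rewrite /g; ring.
  have -> : \int[leb2 R]_x (box_ind a b c d x * ut x) =
     (2 * pi)^-1 * \int[leb2 R]_x (box_ind a b c d x * ftr P (fun xi => - S xi) x).
    have ift := bounded_mul_integrable (measurable_ftr iP iNS)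
      (fun x => ftr_bound x iP iNS) (@integrable_box_ind R a b c d).
    rewrite -(leb2_RintegralZ _ ift); apply: eq_Rintegral => x _; rewrite /ut; ring.
  rewrite (box_integral_ftr _ _ _ _ iP iS) E mulKf ?subrr//.
  by rewrite mulf_neq0// gt_eqF ?pi_gt0.
have ioc a b c d : (leb2 R).-integrable setT (EFin \o (fun x => \1_(oc a b) x.1 * \1_(oc c d) x.2 * g x)).
  have mo a' b' : measurable (oc a' b') by exact: measurable_itv.
  apply: (@rintegrable_le _ _ _ _ _ (fun x => `|box_ind a b c d x * g x|)).
  - apply: measurable_funM; last exact: measurable_funB.
    apply: measurable_funM.
      by apply: measurableT_comp measurable_fst; exact: measurable_indic.
    by apply: measurableT_comp measurable_snd; exact: measurable_indic.
  - have le1 a' b' (x : R) : 0 <= (\1_(oc a' b') x : R) <= itv_ind a' b' x.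
      rewrite /itv_ind !indicE ler0n ler_nat /= in_oc; case: ltP => //= h1; case: leP => //= h2.
      by rewrite mem_set//= in_itv/= (ltW h1).
    move=> x; rewrite !normrM ler_wpM2r//; apply: ler_pM => //.
      by have /andP[h1 h2] := le1 a b x.1; rewrite !ger0_norm ?itv_ind_ge0.
    by have /andP[h1 h2] := le1 c d x.2; rewrite !ger0_norm ?itv_ind_ge0.
  - exact: rintegrable_norm.
have zoc a b c d : \int[leb2 R]_x (\1_(oc a b) x.1 * \1_(oc c d) x.2 * g x) = 0.
  have [ab|ba] := ltP a b; last first.
    rewrite -[RHS](@leb2_Rintegral0 R); apply: eq_Rintegral => x _.
    rewrite indicE in_oc [a < x.1 <= b](_ : _ = false) ?mul0r//.
    by apply/negbTE/negP => /andP[h1 h2]; have := lt_le_trans h1 h2; rewrite ltNge ba.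
  have [cd|dc] := ltP c d; last first.
    rewrite -[RHS](@leb2_Rintegral0 R); apply: eq_Rintegral => x _.
    rewrite [\1_(oc c d) _]indicE in_oc [c < x.2 <= d](_ : _ = false) ?mulr0 ?mul0r//.
    by apply/negbTE/negP => /andP[h1 h2]; have := lt_le_trans h1 h2; rewrite ltNge dc.
  (* [zero_on_boxes] works with half-open intervals and the Parseval identities with closed ones;
     the indicators agree off two null lines. *)
  rewrite -[RHS](zbox a b c d ab cd) /Rintegral; congr fine.
  apply: ae_eq_integral => //.
  - exact: (measurable_int _ (ioc a b c d)).
  - exact: (measurable_int _ (ibox a b c d)).
  - apply: ae_imp2 (ae_fst_neq a) (ae_snd_neq c) => x h1 h2 _ /=.
    by rewrite /box_ind !oc_itv_ind.
have main (N : nat) : {ae leb2 R, forall x, \1_(oc (- N%:R) N%:R) x.1 * \1_(oc (- N%:R) N%:R) x.2 * g x = 0}.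
  apply: (@zero_on_boxes _ _ N%:R).
  - exact: ioc.
  - move=> x; rewrite !indicE.
    by case: (x.1 \in _); case: (x.2 \in _); rewrite /=; ring.
  - move=> a b c d.
    rewrite -[RHS](zoc (Num.max a (- N%:R)) (Num.min b N%:R) (Num.max c (- N%:R)) (Num.min d N%:R)).
    by apply: eq_Rintegral => x _; rewrite -!oc_inter; ring.
apply: ae_imp (ae_foralln main) => x h; apply/eqP; rewrite -subr_eq0 -/(g x); apply/eqP.
have [h1 h2] := norm2_ge_coord x; pose n := (Num.trunc (norm2 x)).+1.
have hn : norm2 x < n%:R by rewrite truncnS_gt.
move: (h n); rewrite !indicE !in_oc.
have b1 : - n%:R < x.1 <= n%:R.
  by have := le_lt_trans h1 hn; rewrite ltr_norml => /andP[-> /ltW].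
have b2 : - n%:R < x.2 <= n%:R.
  by have := le_lt_trans h2 hn; rewrite ltr_norml => /andP[-> /ltW].
by rewrite b1 b2 !mul1r.
Qed.

End fourier_inversion.

(** * Lyapunov functional *)

Section lyapunov.
Context (R : realType).

(** Gronwall's inequality, by the mean value theorem for exp(c t) L. The derivative is only given
    for t > 0, so continuity from the right at 0 is what links the bound to [L 0]. *)
Lemma differential_inequality_decay (L dL : R -> R) (c : R) :
  (forall t : R, 0 < t -> is_derive t 1 L (dL t)) ->
  L t @[t --> (0 : R)^'+] --> L 0 ->
  (forall t, 0 < t -> dL t <= - c * L t) ->
  forall t, 0 <= t -> L t <= expR (- (c * t)) * L 0.
Proof.
move=> dLt L0 dLle t; rewrite le_eqVlt => /predU1P[<-|t0].
  by rewrite mulr0 oppr0 expR0 mul1r.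
pose M s := expR (c * s) * L s.
pose dM s := expR (c * s) * (c * L s + dL s).
have dMt (s : R) : 0 < s -> is_derive s 1 M (dM s).
  move=> s0; have h := dLt s s0; apply: is_derive_eq.
  by rewrite /GRing.scale/= /dM; ring.
have M0 : M s @[s --> (0 : R)^'+] --> M 0.
  apply: cvgM => //; apply: cvg_at_right_filter.
  by apply: (@is_derive1_continuous _ (fun s => expR (c * s))).
have cM : {within `[0, t], continuous M}.
  apply/continuous_within_itvP => //; split.
  - by move=> s; rewrite in_itv/= => /andP[s0 _]; apply: is_derive1_continuous (dMt _ s0).
  - exact: M0.
  - by apply: cvg_at_left_filter; exact: is_derive1_continuous (dMt _ t0).
have dM' (x : R) : x \in `]0, t[ -> is_derive x 1 M (dM x).
  by rewrite in_itv/= => /andP[x0 _]; exact: dMt.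
have [s] := MVT t0 dM' cM.
rewrite in_itv/= => /andP[s0 st] E.
have : M t <= M 0.
  rewrite -subr_le0 E pmulr_lle0 ?subr0// /dM pmulr_rle0 ?expR_gt0//.
  by have := dLle s s0; lra.
rewrite /M mulr0 expR0 mul1r => h.
by rewrite expRN ler_pdivlMl ?expR_gt0.
Qed.

Lemma amgm (e a b : R) : 0 < e -> a * b <= e * a ^+ 2 + (4 * e)^-1 * b ^+ 2.
Proof.
move=> e0; have e4 : 0 < 4 * e by rewrite mulr_gt0.
rewrite -subr_ge0.
have -> : e * a ^+ 2 + (4 * e)^-1 * b ^+ 2 - a * b = (4 * e)^-1 * (2 * e * a - b) ^+ 2.
  by field; rewrite gt_eqF.
by rewrite mulr_ge0 ?sqr_ge0// invr_ge0 ltW.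
Qed.

Section functional.
Variables (k g T1 B D0 s1 : R).
Hypotheses (k0 : 0 < k) (g0 : 0 < g) (T10 : 0 <= T1) (D00 : 0 < D0).

(* The corrector: each product damps one more of the components that
   [f] reaches along the chain f -> y1 -> z2 -> y2 -> z1. *)
Definition corrector (m1 m2 f y1 y2 z1 z2 : R) : R :=
  m1 * (f * y1) + m2 * (y1 * z2) - z2 * y2 - z1 * y2.

(** The derivative of [corrector] along the equations listed in [thermal_decay], divided by rho.
    [T], [D] and [s] stand for tr A, det A and eta.A eta: by Cayley-Hamilton eta.A^2 p = T z2 - D
    z1, which closes the chain. *)
Definition corrector_rate (m1 m2 rho T D s f y1 y2 z1 z2 : R) : R :=
  m1 * (- k * rho * f * y1 - g * y1 ^+ 2 - f * z2 + g * f ^+ 2)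
  + m2 * (- z2 ^+ 2 + g * f * z2 + y1 * y2)
  - (y2 ^+ 2 + z2 * (- (T * z2 - D * z1) + g * s * f))
  - (y1 * y2 + z1 * (- (T * z2 - D * z1) + g * s * f)).

(** The four negative squares are - m1 g y1^2, - m2 z2^2, - y2^2 and - D z1^2. The cross terms are
    absorbed by Young's inequality: [m2] is fixed first, against the terms in z2, then [m1] against
    [m2]; every square of f goes into [K]. The factor 1 + rho^2 comes from the term in k rho f
    y1. *)
Lemma corrector_rate_le : exists m1 m2 c K : R, [/\ 0 < m1, 0 < m2, 0 < c, 0 < K &
  forall rho T D s f y1 y2 z1 z2, `|T| <= T1 -> D0 <= D -> `|T - D| <= B -> `|s| <= s1 ->
    corrector_rate m1 m2 rho T D s f y1 y2 z1 z2 <=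
    - c * (y1 ^+ 2 + y2 ^+ 2 + z1 ^+ 2 + z2 ^+ 2) + K * (1 + rho ^+ 2) * f ^+ 2].
Proof.
pose G := g ^+ 2 * s1 ^+ 2.
(* [A2] adds up coefficients of z2^2: [T1] from the trace, [B^2 / D0] from (T - D) z1 z2 and 1 from
   g s f z2. Of m2 = 4 A2, one quarter pays for these, one for [M2a], one for [M1b], and one
   remains. Likewise m1 g = 2 (1 + m2^2) pays in y1^2 for [M1a], [Y] and [M2b] and leaves (1 + m2^2)
   / 2. *)
pose A2 := T1 + B ^+ 2 / D0 + 1.
pose m2 := 4 * A2; pose m1 := 2 * (1 + m2 ^+ 2) / g.
have D0n : D0 != 0 by rewrite gt_eqF.
have A20 : 0 < A2 by rewrite ltr_wpDl// addr_ge0// divr_ge0 ?sqr_ge0// ltW.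
have m20 : 0 < m2 by rewrite mulr_gt0.
have m10 : 0 < m1 by rewrite divr_gt0// mulr_gt0// ltr_wpDr ?sqr_ge0.
have m1g : m1 * g = 2 * (1 + m2 ^+ 2) by rewrite /m1 divfK ?gt_eqF.
pose K0 := G + G / D0 + m2 * g ^+ 2 + m1 ^+ 2 / (4 * A2) + m1 * g.
pose K1 := m1 * (k ^+ 2 / g).
have G0 : 0 <= G by rewrite mulr_ge0 ?sqr_ge0.
have K00 : 0 < K0.
  have p1 : 0 <= G / D0 by rewrite divr_ge0// ltW.
  have p2 : 0 <= m2 * g ^+ 2 by rewrite mulr_ge0 ?sqr_ge0// ltW.
  have p3 : 0 <= m1 ^+ 2 / (4 * A2) by rewrite divr_ge0 ?sqr_ge0// mulr_ge0// ltW.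
  have p4 : 0 < m1 * g by rewrite mulr_gt0.
  by rewrite /K0; lra.
have K10 : 0 < K1 by rewrite mulr_gt0// divr_gt0// exprn_gt0.
pose c := Num.min (1 / 2) (Num.min (D0 / 2) A2).
exists m1, m2, c, (K0 + K1); split => //.
- by rewrite !lt_min divr_gt0//= divr_gt0.
- by rewrite addr_gt0.
move=> rho T D s f y1 y2 z1 z2 hT hD hTD hs.
have cle : c <= 1 / 2 /\ (c <= D0 / 2 /\ c <= A2).
  by rewrite /c !ge_min !lexx !orbT.
have sqle (x M : R) : `|x| <= M -> x ^+ 2 <= M ^+ 2.
  move=> h; rewrite -(real_normK (num_real x)) lerXn2r ?nnegrE//.
  exact: le_trans h.
have hs2 : (g * s) ^+ 2 <= G by rewrite exprMn ler_wpM2l ?sqr_ge0// sqle.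
have hB2 : (T - D) ^+ 2 <= B ^+ 2 by exact: sqle.
have TD : (T - D) * z1 * z2 <= D0 / 4 * z1 ^+ 2 + B ^+ 2 / D0 * z2 ^+ 2.
  have D4 : 0 < D0 / 4 by rewrite divr_gt0.
  have := amgm z1 ((T - D) * z2) D4.
  rewrite (_ : (4 * (D0 / 4))^-1 = D0^-1); last by field.
  rewrite mulrA [z1 * _]mulrC => h; apply: le_trans h _; rewrite lerD2l exprMn.
  rewrite (_ : D0^-1 * (_ * _) = (T - D) ^+ 2 * (D0^-1 * z2 ^+ 2)); last by ring.
  rewrite (_ : B ^+ 2 / D0 * _ = B ^+ 2 * (D0^-1 * z2 ^+ 2)); last by ring.
  by rewrite ler_wpM2r// mulr_ge0 ?sqr_ge0// invr_ge0 ltW.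
have F2 : - (g * s * f * z2) <= z2 ^+ 2 + G * f ^+ 2.
  have := sqr_ge0 (g * s * f + 2 * z2); have := ler_wpM2r (sqr_ge0 f) hs2.
  have := sqr_ge0 (g * s * f); nra.
have F1 : - (g * s * f * z1) <= D0 / 4 * z1 ^+ 2 + G / D0 * f ^+ 2.
  have D4 : 0 < D0 / 4 by rewrite divr_gt0.
  have := amgm z1 (- (g * s) * f) D4.
  rewrite (_ : (4 * (D0 / 4))^-1 = D0^-1); last by field.
  rewrite (_ : z1 * _ = - (g * s * f * z1)); last by ring.
  move=> h; apply: le_trans h _; rewrite lerD2l exprMn sqrrN.
  rewrite mulrA ler_wpM2r ?sqr_ge0// mulrC ler_wpM2r// invr_ge0 ltW//.
have Tz : T * z2 ^+ 2 <= T1 * z2 ^+ 2.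
  by rewrite ler_wpM2r ?sqr_ge0// (le_trans (ler_norm _)).
have Dz : D0 * z1 ^+ 2 <= D * z1 ^+ 2 by rewrite ler_wpM2r ?sqr_ge0.
have Y : - (y1 * y2) <= y2 ^+ 2 / 4 + y1 ^+ 2 by have := sqr_ge0 (y2 / 2 + y1); nra.
have M2a : m2 * (g * f * z2) <= m2 * (z2 ^+ 2 / 4 + g ^+ 2 * f ^+ 2).
  by rewrite ler_wpM2l ?(ltW m20)//; have := sqr_ge0 (z2 / 2 - g * f); nra.
have M2b : m2 * (y1 * y2) <= y2 ^+ 2 / 4 + m2 ^+ 2 * y1 ^+ 2.
  by have := sqr_ge0 (y2 / 2 - m2 * y1); nra.
have M1a : m1 * (- k * rho * f * y1) <= m1 * (g / 4 * y1 ^+ 2 + k ^+ 2 / g * (rho ^+ 2 * f ^+ 2)).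
  rewrite ler_wpM2l ?(ltW m10)//; have g4 : 0 < g / 4 by rewrite divr_gt0.
  have := amgm y1 (- k * rho * f) g4.
  rewrite (_ : (4 * (g / 4))^-1 = g^-1); last by field; rewrite gt_eqF.
  rewrite (_ : y1 * _ = - k * rho * f * y1); last by ring.
  by move=> h; apply: le_trans h _; rewrite lerD2l le_eqVlt; apply/orP; left; apply/eqP; ring.
have M1b : - (m1 * (f * z2)) <= A2 * z2 ^+ 2 + m1 ^+ 2 / (4 * A2) * f ^+ 2.
  have := amgm z2 (- m1 * f) A20; rewrite (_ : z2 * _ = - (m1 * (f * z2))); last by ring.
  by move=> h; apply: le_trans h _; rewrite lerD2l le_eqVlt; apply/orP; left; apply/eqP; ring.
have [c1 [c2 c3]] := cle.
have C1 : c * y1 ^+ 2 <= (1 + m2 ^+ 2) / 2 * y1 ^+ 2.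
  rewrite ler_wpM2r ?sqr_ge0// (le_trans c1)// ler_wpM2r// lerDl sqr_ge0//.
have C2 : c * y2 ^+ 2 <= 1 / 2 * y2 ^+ 2 by rewrite ler_wpM2r ?sqr_ge0.
have C3 : c * z1 ^+ 2 <= D0 / 2 * z1 ^+ 2 by rewrite ler_wpM2r ?sqr_ge0.
have C4 : c * z2 ^+ 2 <= A2 * z2 ^+ 2 by rewrite ler_wpM2r ?sqr_ge0.
have f2 := sqr_ge0 f; have r2 := sqr_ge0 rho.
have C5 : 0 <= K0 * (rho ^+ 2 * f ^+ 2) by apply: mulr_ge0; [exact: ltW|exact: mulr_ge0].
have C6 : 0 <= K1 * f ^+ 2 by apply: mulr_ge0 => //; exact: ltW.
have -> : corrector_rate m1 m2 rho T D s f y1 y2 z1 z2 =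
  m1 * (- k * rho * f * y1) - m1 * g * y1 ^+ 2 + - (m1 * (f * z2)) + m1 * g * f ^+ 2
  - m2 * z2 ^+ 2 + m2 * (g * f * z2) + m2 * (y1 * y2)
  - y2 ^+ 2 + T * z2 ^+ 2 + (T - D) * z1 * z2 + - (g * s * f * z2)
  + - (y1 * y2) - D * z1 ^+ 2 + - (g * s * f * z1).
  by rewrite /corrector_rate; ring.
apply: (@le_trans _ _ (- ((1 + m2 ^+ 2) / 2) * y1 ^+ 2 - 1 / 2 * y2 ^+ 2 - D0 / 2 * z1 ^+ 2 - A2 * z2 ^+ 2
   + K0 * f ^+ 2 + K1 * (rho ^+ 2 * f ^+ 2))); last by lra.
rewrite m1g.
have -> : K0 * f ^+ 2 = G * f ^+ 2 + G / D0 * f ^+ 2 + m2 * (g ^+ 2 * f ^+ 2) + m1 ^+ 2 / (4 * A2) * f ^+ 2 + 2 * (1 + m2 ^+ 2) * f ^+ 2.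
  by rewrite /K0 m1g; ring.
have -> : K1 * (rho ^+ 2 * f ^+ 2) = m1 * (k ^+ 2 / g * (rho ^+ 2 * f ^+ 2)) by rewrite /K1; ring.
have e1 : m1 * (g / 4 * y1 ^+ 2 + k ^+ 2 / g * (rho ^+ 2 * f ^+ 2)) =
   2 * (1 + m2 ^+ 2) / 4 * y1 ^+ 2 + m1 * (k ^+ 2 / g * (rho ^+ 2 * f ^+ 2)).
  by rewrite -m1g; ring.
have e2 : A2 * z2 ^+ 2 = T1 * z2 ^+ 2 + B ^+ 2 / D0 * z2 ^+ 2 + z2 ^+ 2 by rewrite /A2; ring.
have e3 : m2 * z2 ^+ 2 = 4 * (A2 * z2 ^+ 2) by rewrite /m2; ring.
have e4 : m2 * (z2 ^+ 2 / 4 + g ^+ 2 * f ^+ 2) = A2 * z2 ^+ 2 + m2 * (g ^+ 2 * f ^+ 2) by rewrite /m2; field.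
move: M1a M1b M2a M2b TD F1 F2 Tz Dz Y m1g e2 e3; rewrite e1 e4.
clearbody A2 m2 m1 c G.
clear=> M1a M1b M2a M2b TD F1 F2 Tz Dz Y m1g e2 e3.
by lra.
Qed.
End functional.
End lyapunov.

Section thermal_decay.
Context (R : realType).

(* y1, y2, z1, z2 stand for eta.v, eta.Av, eta.p, eta.Ap with p = rho u, and f
   for the temperature multiplied by -i.  The corrector is weighted by
   rho / (1 + rho^2), which makes the estimate uniform in rho. *)
Lemma thermal_decay (k g T1 B D0 s1 e0 : R) :
  0 < k -> 0 < g -> 0 <= T1 -> 0 < D0 -> 0 < e0 ->
  exists2 c : R, 0 < c & forall (rho T D s d : R) (y1 y2 z1 z2 f E : R -> R),
    0 < rho -> `|T| <= T1 -> D0 <= D -> `|T - D| <= B -> `|s| <= s1 -> 0 <= d ->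
    (forall t : R, 0 < t ->
      [/\ is_derive t 1 y1 (- rho * z2 t + g * rho * f t),
          is_derive t 1 y2 (- rho * (T * z2 t - D * z1 t) + g * rho * s * f t),
          is_derive t 1 z1 (rho * y1 t) & is_derive t 1 z2 (rho * y2 t)] /\
      is_derive t 1 f (- k * rho ^+ 2 * f t - g * rho * y1 t) /\
      is_derive t 1 E (- 2 * k * rho ^+ 2 * f t ^+ 2)) ->
    [/\ y1 t @[t --> (0 : R)^'+] --> y1 0, y2 t @[t --> (0 : R)^'+] --> y2 0,
        z1 t @[t --> (0 : R)^'+] --> z1 0 & z2 t @[t --> (0 : R)^'+] --> z2 0] ->
    f t @[t --> (0 : R)^'+] --> f 0 -> E t @[t --> (0 : R)^'+] --> E 0 ->
    (forall t, 0 <= t ->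
      e0 * (y1 t ^+ 2 + y2 t ^+ 2 + z1 t ^+ 2 + z2 t ^+ 2 + f t ^+ 2) <= E t /\
      d * E t <= y1 t ^+ 2 + y2 t ^+ 2 + z1 t ^+ 2 + z2 t ^+ 2 + f t ^+ 2) ->
    forall t, 0 <= t ->
      E t <= 3 * expR (- (c * d * (rho ^+ 2 / (1 + rho ^+ 2)) * t)) * E 0.
Proof.
move=> k0 g0 T10 D00 e00.
have [m1 [m2 [c0 [K [m10 m20 c00 K0 rate]]]]] := corrector_rate_le B s1 k0 g0 T10 D00.
pose m := m1 + m2 + 2.
have mpos : 0 < m by rewrite /m !addr_gt0.
(* The first bound lets the dissipation absorb the error of the corrector, the second keeps the
   weighted corrector below half of the energy. *)
pose de := Num.min (k / K) (e0 / (2 * m)).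
have de0 : 0 < de by rewrite lt_min !divr_gt0// mulr_gt0.
have deK : de * K <= k by rewrite -ler_pdivlMr// ge_min lexx.
have dem : de * m <= e0 / 2.
  rewrite -ler_pdivlMr// (le_trans (_ : de <= e0 / (2 * m)))//.
    by rewrite ge_min lexx orbT.
  by rewrite le_eqVlt; apply/orP; left; apply/eqP; field; rewrite gt_eqF.
pose c1 := Num.min k (de * c0).
have c10 : 0 < c1 by rewrite lt_min k0 mulr_gt0.
exists (c1 * (2 / 3)); first by rewrite mulr_gt0// divr_gt0.
move=> rho T D s d y1 y2 z1 z2 f E r0 hT hD hTD hs d0 ode [c_y1 c_y2 c_z1 c_z2] c_f c_E eqv.
have q0 : 0 < 1 + rho ^+ 2 by rewrite ltr_wpDr ?sqr_ge0.
(* [be] weights the corrector and [b] is the resulting rate: be rho = b, and b (1 + rho^2) = rho^2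
   turns the error K (1 + rho^2) f^2 into a multiple of rho^2 f^2, which is the form of the
   dissipation. *)
pose be := rho / (1 + rho ^+ 2); pose b := rho ^+ 2 / (1 + rho ^+ 2).
have be0 : 0 < be by rewrite divr_gt0.
have b0 : 0 < b by rewrite divr_gt0// exprn_gt0.
have beb : be * rho = b by rewrite /be /b expr2; ring.
have br : b * (1 + rho ^+ 2) = rho ^+ 2 by rewrite /b divfK// gt_eqF.
have b1 : b <= rho ^+ 2 by rewrite -br ler_peMr ?(ltW b0)// lerDl sqr_ge0.
have be1 : be <= 1 / 2.
  by rewrite ler_pdivrMr//; have := sqr_ge0 (1 - rho); nra.
pose N t := y1 t ^+ 2 + y2 t ^+ 2 + z1 t ^+ 2 + z2 t ^+ 2.
pose Q t := corrector m1 m2 (f t) (y1 t) (y2 t) (z1 t) (z2 t).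
pose L t := E t + de * be * Q t.
pose dL t := - 2 * k * rho ^+ 2 * f t ^+ 2 +
  de * b * corrector_rate k g m1 m2 rho T D s (f t) (y1 t) (y2 t) (z1 t) (z2 t).
have Qle t : `|Q t| <= m * (N t + f t ^+ 2).
  rewrite /Q /corrector /N /m ler_norml.
  move: (y1 t) (y2 t) (z1 t) (z2 t) (f t) => a1 a2 a3 a4 a5; clear -m10 m20.
  have h1 : `|m1 * (a5 * a1)| <= m1 * (a5 ^+ 2 + a1 ^+ 2).
    rewrite normrM gtr0_norm// ler_wpM2l ?(ltW m10)// ler_norml.
    by have := sqr_ge0 (a5 - a1); have := sqr_ge0 (a5 + a1); have := sqr_ge0 a5; have := sqr_ge0 a1; nra.
  have h2 : `|m2 * (a1 * a4)| <= m2 * (a1 ^+ 2 + a4 ^+ 2).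
    rewrite normrM gtr0_norm// ler_wpM2l ?(ltW m20)// ler_norml.
    by have := sqr_ge0 (a1 - a4); have := sqr_ge0 (a1 + a4); have := sqr_ge0 a1; have := sqr_ge0 a4; nra.
  move: h1 h2; rewrite !ler_norml => /andP[h1 h1'] /andP[h2 h2'].
  have h3 := sqr_ge0 (a4 - a2); have h3' := sqr_ge0 (a4 + a2).
  have h4 := sqr_ge0 (a3 - a2); have h4' := sqr_ge0 (a3 + a2).
  have p1 := sqr_ge0 a1; have p2 := sqr_ge0 a2; have p3 := sqr_ge0 a3.
  have p4 := sqr_ge0 a4; have p5 := sqr_ge0 a5.
  have q1 := mulr_ge0 (ltW m10) p2; have q2 := mulr_ge0 (ltW m10) p3; have q3 := mulr_ge0 (ltW m10) p4.
  have q4 := mulr_ge0 (ltW m20) p2; have q5 := mulr_ge0 (ltW m20) p3; have q6 := mulr_ge0 (ltW m20) p5.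
  by apply/andP; split; lra.
have N0 t : 0 <= N t by rewrite /N !addr_ge0 ?sqr_ge0.
(* The ratio of the constants 3/2 and 1/2 is the factor 3 of the conclusion; the inverse 2/3 of the
   upper one appears in the rate. *)
have LE t : 0 <= t -> E t / 2 <= L t /\ L t <= 3 / 2 * E t.
  move=> t0; have [h1 _] := eqv t t0; rewrite -/(N t) in h1.
  have : `|de * be * Q t| <= E t / 2.
    rewrite normrM (gtr0_norm (mulr_gt0 de0 be0)).
    have Nf0 : 0 <= N t + f t ^+ 2 by rewrite addr_ge0 ?sqr_ge0.
    apply: (@le_trans _ _ (de * 1 * (m * (N t + f t ^+ 2)))).
      apply: ler_pM; rewrite ?normr_ge0 ?Qle //; first by apply: mulr_ge0; exact: ltW.
      by rewrite ler_wpM2l ?(ltW de0)// (le_trans be1)//; clear; lra.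
    rewrite mulr1 mulrA; have := ler_wpM2r Nf0 dem; clear -h1; lra.
  by rewrite /L ler_norml => /andP[h2 h3]; clear -h2 h3; split; lra.
have dLt (t : R) : 0 < t -> is_derive t 1 L (dL t).
  move=> t0; have [[h1 h2 h3 h4] [h5 h6]] := ode t t0.
  have := is_derive1_add h6 (is_derive1_mul (is_derive1_cst t (de * be))
    (is_derive1_add (is_derive1_add (is_derive1_add
      (is_derive1_mul (is_derive1_cst t m1) (is_derive1_mul h5 h1))
      (is_derive1_mul (is_derive1_cst t m2) (is_derive1_mul h1 h4)))
      (is_derive1_opp (is_derive1_mul h4 h2)))
      (is_derive1_opp (is_derive1_mul h3 h2)))).
  move=> h; apply: (is_derive_eq h); rewrite /dL -beb /corrector_rate; ring.
have L0 : L t @[t --> (0 : R)^'+] --> L 0.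
  apply: cvgD => //; apply: cvgMr; rewrite /Q /corrector.
  apply: cvgB; last exact: cvgM.
  apply: cvgB; last exact: cvgM.
  by apply: cvgD; apply: cvgMr; exact: cvgM.
have dLle t : 0 < t -> dL t <= - (c1 * (2 / 3) * d * b) * L t.
  move=> t0; have [_ hd] := eqv t (ltW t0); have [_ hL] := LE t (ltW t0).
  have h := rate rho T D s (f t) (y1 t) (y2 t) (z1 t) (z2 t) hT hD hTD hs.
  rewrite -/(N t) in h hd.
  have f2 := sqr_ge0 (f t).
  have h1 : dL t <= - c1 * b * (N t + f t ^+ 2).
    have := ler_wpM2l (ltW (mulr_gt0 de0 b0)) h.
    rewrite /dL; set X := corrector_rate _ _ _ _ _ _ _ _ _ _ _ _ _ => hX.
    have e1 : de * b * (- c0 * N t + K * (1 + rho ^+ 2) * f t ^+ 2) =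
      - (de * c0 * b * N t) + de * K * (rho ^+ 2 * f t ^+ 2).
      by rewrite -[in RHS]br; ring.
    rewrite e1 in hX.
    have h2 : de * K * (rho ^+ 2 * f t ^+ 2) <= k * (rho ^+ 2 * f t ^+ 2).
      by rewrite ler_wpM2r// mulr_ge0 ?sqr_ge0.
    have bN : 0 <= b * N t := mulr_ge0 (ltW b0) (N0 t).
    have h3 : c1 * (b * N t) <= de * c0 * (b * N t).
      by rewrite ler_wpM2r// /c1 ge_min lexx orbT.
    have h4 : c1 * (b * f t ^+ 2) <= k * (rho ^+ 2 * f t ^+ 2).
      apply: ler_pM; [exact: ltW|exact: mulr_ge0 (ltW b0) f2| |exact: ler_wpM2r].
      by rewrite /c1 ge_min lexx.
    by clear -hX h2 bN h3 h4; lra.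
  apply: le_trans h1 _.
  have cb : 0 <= c1 * b := mulr_ge0 (ltW c10) (ltW b0).
  have h2 := ler_wpM2l cb hd.
  have h3 := ler_wpM2l (mulr_ge0 cb d0) hL.
  by clear -h2 h3; lra.
move=> t t0.
have := differential_inequality_decay dLt L0 dLle t0.
have [l1 _] := LE t t0; have [_ l2] := LE 0 (lexx 0).
rewrite -/b => h.
have ex := expR_gt0 (- (c1 * (2 / 3) * d * b * t)).
have := ler_wpM2l (ltW ex) l2.
by clear -h l1; lra.
Qed.

End thermal_decay.

(** * Weighted frequency integrals *)

Section japanese_bracket_integrals.
Context (R : realType).
Notation mu := (@lebesgue_measure R).

Definition line_weight (p y : R) : R := (1 + y ^+ 2) `^ (- p).

Lemma one_sqr_gt0 (y : R) : 0 < 1 + y ^+ 2.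
Proof. by rewrite ltr_pwDl ?sqr_ge0. Qed.

Lemma line_weight_gt0 p y : 0 < line_weight p y.
Proof. by rewrite powR_gt0// one_sqr_gt0. Qed.

Lemma powRE_pos (a p : R) : 0 < a -> a `^ p = expR (p * ln a).
Proof. by move=> a0; rewrite /powR gt_eqF. Qed.

Lemma continuous_pow_line (p : R) (f : R -> R) : continuous f -> (forall x, 0 < f x) ->
  continuous (fun x => f x `^ p).
Proof.
move=> cf f0 x; rewrite (_ : (fun x => f x `^ p) = (fun x => expR (p * ln (f x)))).
  apply: continuous_comp; last exact: continuous_expR.
  apply: cvgMr; apply: continuous_comp; first exact: cf.
  exact: continuous_ln.
by apply/funext => y; rewrite powRE_pos.
Qed.

Lemma is_derive1_powR (g : R -> R) (x b a : R) : 0 < g x -> is_derive x 1 g b ->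
  is_derive x 1 (fun y => g y `^ a) (a * g x `^ (a - 1) * b).
Proof.
move=> g0 gb; have h : is_derive (g x) 1 (fun z : R => z `^ a) (a * g x `^ (a - 1)).
  have gin : g x \in `]0, +oo[ by rewrite in_itv/= g0.
  rewrite -(powR_derive1 a gin) derive1E; apply: derivableP; exact: derivable_powR.
exact: (is_derive1_compo h gb).
Qed.

Lemma continuous_one_sqr : continuous (fun y : R => 1 + y ^+ 2).
Proof. by move=> y; apply: (@is_derive1_continuous _ (fun y => 1 + y ^+ 2)). Qed.

Lemma measurable_line_weight p :
  measurable_fun setT (fun y : measurableTypeR R => line_weight p y).
Proof.
apply: continuous_measurable_fun; apply: continuous_pow_line; first exact: continuous_one_sqr.
exact: one_sqr_gt0.
Qed.

Lemma powRN_le (a b p : R) : 0 < b -> b <= a -> 0 <= p -> a `^ (- p) <= b `^ (- p).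
Proof.
move=> b0 ba p0; rewrite !powRN lef_pV2 ?posrE ?powR_gt0//; last exact: lt_le_trans ba.
by rewrite ge0_ler_powR// nnegrE ltW// (lt_le_trans b0).
Qed.

(** Since (1 + |y|)^2 <= 2 (1 + y^2), the weight is dominated by a power of 1 + |y|, which has an
    explicit antiderivative on the half-line. *)
Lemma integrable_line_weight p : 2^-1 < p -> mu.-integrable setT (EFin \o line_weight p).
Proof.
move=> p1; have p2 : 0 < 2 * p - 1 by rewrite subr_gt0 -ltr_pdivrMl// mulr1.
pose f (y : R) := (1 + `|y|) `^ (- (2 * p)).
pose F (y : R) := - ((2 * p - 1)^-1 * (1 + y) `^ (1 - 2 * p)).
have ab0 (y : R) : 0 < 1 + `|y| by rewrite ltr_pwDl.
have cf : continuous f.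
  apply: continuous_pow_line => // y; apply: cvgD; first exact: cvg_cst.
  exact: norm_continuous.
have dF (y : R) : 0 <= y -> is_derive y 1 F (f y).
  move=> y0; have y1 : 0 < 1 + y by rewrite ltr_pwDl.
  have d1 : is_derive y 1 (fun y : R => 1 + y) (0 + 1).
    exact: (is_derive1_add (is_derive1_cst y 1) (is_derive1_id y)).
  have h := is_derive1_powR (1 - 2 * p) y1 d1.
  have h' := is_derive1_opp (is_derive1_mul (is_derive1_cst y (2 * p - 1)^-1) h).
  apply: (is_derive_eq h'); rewrite /f ger0_norm//.
  rewrite (_ : 1 - 2 * p - 1 = - (2 * p)); last by ring.
  by move: (_ `^ _) (_ `^ _) => W W'; field; rewrite gt_eqF.
have Fl : F x @[x --> +oo] --> (0 : R).
  rewrite -oppr0 -(mulr0 (2 * p - 1)^-1); apply: cvgN; apply: cvgMr.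
  apply/cvgr0Pnorm_le => e e0; near=> x.
  pose b := e `^ (- (2 * p - 1)^-1).
  have b0 : 0 < b by rewrite powR_gt0.
  have bx : b <= 1 + x.
    by rewrite ler_wpDl// /b; near: x; exact: nbhs_pinfty_ge.
  rewrite ger0_norm ?powR_ge0// (_ : 1 - 2 * p = - (2 * p - 1)); last by ring.
  apply: le_trans (powRN_le b0 bx (ltW p2)) _.
  have p2n : 2 * p - 1 != 0 by rewrite gt_eqF.
  by rewrite /b -powRrM mulrNN mulVf// powRr1// ltW.
have F0 : F x @[x --> 0^'+] --> F 0.
  by apply: cvg_at_right_filter; exact: is_derive1_continuous (dF 0 (lexx 0)).
have half : (\int[mu]_(x in `[0%R, +oo[) (f x)%:E = (0 - F 0)%:E)%E.
  have f0 x : 0 <= x -> 0 <= f x by move=> _; exact: powR_ge0.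
  have cf' : {within `[0, +oo[, continuous f} by exact: continuous_subspaceT.
  have dF' x : 0 < x -> derivable F x 1 by move=> x0; have h := dF x (ltW x0); exact: ex_derive.
  have dFE : {in `]0, +oo[%R, derive1 F =1 f}.
    by move=> x; rewrite in_itv/= andbT => x0; have h := dF x (ltW x0); rewrite derive1E derive_val.
  by rewrite (ge0_continuous_FTC2y f0 cf' Fl dF' F0 dFE) EFinB.
have if_ : mu.-integrable setT (EFin \o f).
  apply: (@ge0_rintegrable _ _ _ _ _ ((0 - F 0) + (0 - F 0))).
  - exact: continuous_measurable_fun.
  - by move=> x; exact: powR_ge0.
  rewrite ge0_integralT_half//; last by move=> x; exact: powR_ge0.
  under [X in (_ + X)%E]eq_integral do rewrite /f normrN -/(f _).
  by rewrite half EFinD.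
apply: (@rintegrable_le _ _ _ _ _ (fun y : measurableTypeR R => 2 `^ p * f y)); last exact: rintegrableZ.
  exact: measurable_line_weight.
move=> y; rewrite ger0_norm ?(ltW (line_weight_gt0 _ _))// /line_weight /f.
have -> : 2 `^ p * (1 + `|y|) `^ (- (2 * p)) = ((1 + `|y|) ^+ 2 / 2) `^ (- p).
  rewrite powRM ?sqr_ge0 ?invr_ge0// [RHS]mulrC; congr (_ * _).
    by rewrite -powR_inv1// -powRrM mulN1r opprK.
  by rewrite -powR_mulrn ?(ltW (ab0 y))// -powRrM mulrN.
apply: powRN_le; first by rewrite divr_gt0// exprn_gt0.
  rewrite ler_pdivrMr// -(real_normK (num_real y)); have := sqr_ge0 (1 - `|y|); nra.
by rewrite ltW// (lt_trans _ p1)// invr_gt0.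
Unshelve. all: by end_near.
Qed.
End japanese_bracket_integrals.

Section plane_weights.
Context (R : realType).
Notation mu := (@lebesgue_measure R).

Lemma half_lorentz (s b : R) : 0 < s ->
  (\int[mu]_(x in `[0%R, +oo[) ((1 + (s * (x - b)) ^+ 2)^-1)%:E =
   (s^-1 * (pi / 2) - s^-1 * atan (s * (0 - b)))%:E)%E.
Proof.
move=> s0.
have dF (x : R) : is_derive x 1 (fun x => s^-1 * atan (s * (x - b))) ((1 + (s * (x - b)) ^+ 2)^-1).
  have d : is_derive x 1 (fun x : R => s * (x - b)) (s * 1) by apply: is_derive_eq; rewrite /GRing.scale/=; ring.
  have h := is_derive1_mul (is_derive1_cst x s^-1) (is_derive1_atan d).
  apply: (is_derive_eq h); rewrite mul0r add0r mulr1 mulrC -mulrA divff ?mulr1//.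
  by rewrite gt_eqF.
have cl : s^-1 * atan (s * (x - b)) @[x --> +oo] --> s^-1 * (pi / 2).
  apply: cvgMr; apply: (@cvg_comp _ _ _ (fun x => s * (x - b)) atan _ +oo%R); last exact: cvgy_atan.
  apply/cvgryPge => A; near=> x.
  by rewrite -ler_pdivrMl// lerBrDr; near: x; apply: nbhs_pinfty_ge; exact: num_real.
have cf : continuous (fun x : R => (1 + (s * (x - b)) ^+ 2)^-1).
  move=> x; apply: (@continuous_comp _ _ _ (fun x => x - b) (fun x => (1 + (s * x) ^+ 2)^-1)).
    by apply: (@is_derive1_continuous _ (fun x => x - b)).
  exact: continuous_lorentz.
rewrite (ge0_integral_half_line _ cf dF cl)//.
by move=> x _; rewrite invr_ge0 ltW// lorentz_gt0.
Unshelve. all: by end_near. Qed.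

Lemma integral_lorentz_shift (s b : R) : 0 < s ->
  (\int[mu]_x ((1 + (s * (x - b)) ^+ 2)^-1)%:E = (pi / s)%:E)%E.
Proof.
move=> s0.
have cf : continuous (fun x : R => (1 + (s * (x - b)) ^+ 2)^-1).
  move=> x; apply: (@continuous_comp _ _ _ (fun x => x - b) (fun x => (1 + (s * x) ^+ 2)^-1)).
    by apply: (@is_derive1_continuous _ (fun x => x - b)).
  exact: continuous_lorentz.
rewrite ge0_integralT_half//; last by move=> x; rewrite invr_ge0 ltW// lorentz_gt0.
have -> : (\int[mu]_(x in `[0%R, +oo[) ((1 + (s * (- x - b)) ^+ 2)^-1)%:E =
   \int[mu]_(x in `[0%R, +oo[) ((1 + (s * (x - - b)) ^+ 2)^-1)%:E)%E.
  apply: eq_integral => x _; congr ((1 + _)^-1)%:E.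
  by rewrite -[in RHS]sqrrN; congr (_ ^+ 2); ring.
rewrite !half_lorentz// -EFinD; congr EFin.
rewrite !sub0r opprK mulrN atanN; field.
by rewrite gt_eqF.
Qed.

Lemma jap_sq (xi : plane R) : jap xi ^+ 2 = 1 + (xi.1 ^+ 2 + xi.2 ^+ 2).
Proof.
rewrite /jap /norm2 sqr_sqrtr ?sqr_sqrtr /dot2 -?expr2 ?addr_ge0 ?sqr_ge0//.
Qed.

Lemma jap_gt0 (xi : plane R) : 0 < jap xi.
Proof. by rewrite /jap sqrtr_gt0 ltr_pwDl ?sqr_ge0. Qed.

Lemma jap_powR (r : R) (xi : plane R) :
  jap xi `^ r = (1 + (xi.1 ^+ 2 + xi.2 ^+ 2)) `^ (r / 2).
Proof.
rewrite -jap_sq -powR_mulrn ?(ltW (jap_gt0 _))// -powRrM; congr (_ `^ _).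
by rewrite mulrCA mulfV// mulr1.
Qed.

Lemma bracket_gt0 (x y : R) : 0 < 1 + (x ^+ 2 + y ^+ 2).
Proof. by rewrite ltr_pwDl// addr_ge0 ?sqr_ge0. Qed.

(** This is (1 + x^2) (1 + y^2) <= (1 + x^2 + y^2)^2 raised to the power - q / 2; it makes plane
    weights tensor products. *)
Lemma line_weightM (q x y : R) : 0 <= q ->
  (1 + (x ^+ 2 + y ^+ 2)) `^ (- q) <= line_weight (q / 2) x * line_weight (q / 2) y.
Proof.
move=> q0; rewrite /line_weight -powRM ?(ltW (one_sqr_gt0 _))//.
have -> : (1 + (x ^+ 2 + y ^+ 2)) `^ (- q) = ((1 + (x ^+ 2 + y ^+ 2)) ^+ 2) `^ (- (q / 2)).
  rewrite -[(1 + (x ^+ 2 + y ^+ 2)) ^+ 2]powR_mulrn ?(ltW (bracket_gt0 _ _))// -powRrM; congr (_ `^ _).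
  by rewrite mulrN mulrCA mulfV// mulr1.
apply: powRN_le; last by rewrite divr_ge0.
  by rewrite mulr_gt0 ?one_sqr_gt0.
have := sqr_ge0 x; have := sqr_ge0 y; move: (x ^+ 2) (y ^+ 2) => X Y X0 Y0.
by have := mulr_ge0 X0 Y0; nra.
Qed.

Lemma expRN_le (z : R) : 0 <= z -> expR (- z) <= (1 + z)^-1.
Proof.
move=> z0; rewrite expRN lef_pV2 ?posrE ?expR_gt0 ?ltr_pwDl//.
exact: expR_ge1Dx.
Qed.

(* Replacing t by 1 + t costs a factor e^(2c), since l^2 <= 2 <xi>^2; then
   <xi> is comparable with <y> or with |l|. *)
Lemma hyperbolic_pointwise (c t q a x y s : R) : 0 < c -> 0 <= t -> 0 <= q -> `|a| <= 1 ->
  s ^+ 2 = c * (1 + t) / 5 ->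
  expR (- (c * t * ((x - a * y) ^+ 2 / (1 + (x ^+ 2 + y ^+ 2))))) * (1 + (x ^+ 2 + y ^+ 2)) `^ (- q) <=
  expR (2 * c) * ((1 + (s * line_weight 2^-1 y * (x - a * y)) ^+ 2)^-1 * line_weight q y
     + (1 + s ^+ 2)^-1 * (line_weight (q / 2) x * line_weight (q / 2) y)).
Proof.
move=> c0 t0 q0 a1 s2.
set J := 1 + (x ^+ 2 + y ^+ 2); have J0 : 0 < J := bracket_gt0 x y.
set l := x - a * y; set X := l ^+ 2 / J.
have X0 : 0 <= X by rewrite divr_ge0 ?sqr_ge0// ltW.
have a2 : a ^+ 2 <= 1.
  by rewrite -(real_normK (num_real a)) -[leRHS](expr1n _ 2) lerXn2r ?nnegrE.
have ay : (a * y) ^+ 2 <= y ^+ 2 by rewrite exprMn ler_piMl ?sqr_ge0.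
have X2 : X <= 2.
  rewrite ler_pdivrMr// /l /J; have := sqr_ge0 (x + a * y); have := sqr_ge0 x; have := sqr_ge0 y.
  by nra.
have e1 : expR (- (c * t * X)) <= expR (2 * c) * expR (- (c * (1 + t) * X)).
  rewrite -expRD ler_expR; have := ler_wpM2l (ltW c0) X2; lra.
have cX : 0 <= c * (1 + t) * X by rewrite mulr_ge0// mulr_ge0 ?addr_ge0// ltW.
have W0 : 0 < J `^ (- q) by rewrite powR_gt0.
apply: le_trans (ler_wpM2r (ltW W0) e1) _.
rewrite -[leLHS]mulrA ler_wpM2l ?expR_ge0//.
have G10 : 0 <= (1 + (s * line_weight 2^-1 y * l) ^+ 2)^-1 * line_weight q y.
  by rewrite mulr_ge0 ?invr_ge0 ?(ltW (lorentz_gt0 _ _)) ?(ltW (line_weight_gt0 _ _)).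
have s20 : 0 < 1 + s ^+ 2 by exact: one_sqr_gt0.
have G20 : 0 <= (1 + s ^+ 2)^-1 * (line_weight (q / 2) x * line_weight (q / 2) y).
  by rewrite mulr_ge0 ?invr_ge0 ?(ltW s20)// mulr_ge0 ?(ltW (line_weight_gt0 _ _)).
have lw2 : line_weight 2^-1 y ^+ 2 = (1 + y ^+ 2)^-1.
  rewrite /line_weight -[(_ `^ _) ^+ 2]powR_mulrn ?powR_ge0// -powRrM mulNr mulVf// powR_inv1//.
  by rewrite ltW// one_sqr_gt0.
have y1 := one_sqr_gt0 y.
(* If l^2 <= 1 + y^2, then J <= 5 (1 + y^2) and the exponential is small beyond the distance <y> / s
   from the line; otherwise J <= 5 l^2 and it is small outright. This constant is the 5 in the
   hypothesis on [s]. *)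
have [ly|ly] := leP (l ^+ 2) (1 + y ^+ 2).
  apply: (@le_trans _ _ ((1 + (s * line_weight 2^-1 y * l) ^+ 2)^-1 * line_weight q y)); last by rewrite lerDl.
  apply: ler_pM; rewrite ?expR_ge0 ?(ltW W0)//.
    apply: le_trans (expRN_le cX) _; rewrite lef_pV2 ?posrE ?ltr_pwDl ?sqr_ge0// lerD2l.
    rewrite !exprMn lw2 s2 /X.
    have J5 : J <= 5 * (1 + y ^+ 2).
      have -> : J = 1 + ((l + a * y) ^+ 2 + y ^+ 2) by rewrite /J /l subrK.
      by have := sqr_ge0 (l - a * y); lra.
    have -> : c * (1 + t) / 5 / (1 + y ^+ 2) * l ^+ 2 = c * (1 + t) * (l ^+ 2 * (5 * (1 + y ^+ 2))^-1).
      by field; rewrite gt_eqF.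
    have ct : 0 <= c * (1 + t) by rewrite mulr_ge0 ?addr_ge0 ?(ltW c0).
    by rewrite (ler_wpM2l ct)// ler_wpM2l ?sqr_ge0// lef_pV2 ?posrE// mulr_gt0.
  apply: powRN_le => //; rewrite /J; have := sqr_ge0 x; lra.
apply: (@le_trans _ _ ((1 + s ^+ 2)^-1 * (line_weight (q / 2) x * line_weight (q / 2) y))); last by rewrite lerDr.
apply: ler_pM; rewrite ?expR_ge0 ?(ltW W0)//; last exact: line_weightM.
apply: le_trans (expRN_le cX) _; rewrite lef_pV2 ?posrE ?ltr_pwDl ?sqr_ge0// lerD2l s2.
rewrite ler_wpM2l ?mulr_ge0 ?addr_ge0 ?(ltW c0)//.
rewrite /X ler_pdivlMr// mulrC ler_pdivrMr//.
have -> : J = 1 + ((l + a * y) ^+ 2 + y ^+ 2) by rewrite /J /l subrK.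
by have := sqr_ge0 (l - a * y); lra.
Qed.

End plane_weights.

(** * Weights concentrated near a line *)

Section plane_weight_integrals.
Context (R : realType).
Notation mu := (@lebesgue_measure R).

(** A Lorentz profile of width <y> / s across the line x = a y, with the weight <y>^(-2 q) along it;
    the profile serves because its integral in x is explicit. *)
Definition slab (s a q x y : R) : R :=
  (1 + (s * line_weight 2^-1 y * (x - a * y)) ^+ 2)^-1 * line_weight q y.

Lemma slab_ge0 s a q x y : 0 <= slab s a q x y.
Proof. by rewrite mulr_ge0 ?invr_ge0 ?(ltW (lorentz_gt0 _ _)) ?(ltW (line_weight_gt0 _ _)). Qed.

Lemma measurable_slab (s a q : R) d (T : measurableType d) (f g : T -> measurableTypeR R) :
  measurable_fun setT f -> measurable_fun setT g ->
  measurable_fun setT (fun z => slab s a q (f z) (g z)).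
Proof.
move=> mf mg.
have ml : measurable_fun setT (fun u : measurableTypeR R => (1 + u ^+ 2)^-1).
  rewrite (_ : (fun u => _) = (fun u => (1 + (1 * u) ^+ 2)^-1)); last by apply/funext => u; rewrite mul1r.
  by apply: continuous_measurable_fun; exact: continuous_lorentz.
apply: measurable_funM; last exact: measurableT_comp (measurable_line_weight q) mg.
apply: (measurableT_comp ml (g := fun z => s * line_weight 2^-1 (g z) * (f z - a * g z))).
apply: measurable_funM; last by apply: measurable_funB => //; exact: measurable_funM.
by apply: measurable_funM => //; exact: measurableT_comp (measurable_line_weight _) mg.
Qed.

Lemma slab_inner (s a q y : R) : 0 < s ->
  (\int[mu]_x (slab s a q x y)%:E = (pi / s * line_weight (q - 2^-1) y)%:E)%E.
Proof.
move=> s0; have lw := line_weight_gt0 2^-1 y.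
have sl : 0 < s * line_weight 2^-1 y by rewrite mulr_gt0.
rewrite /slab; under eq_integral do rewrite EFinM.
rewrite ge0_integralZr//; last 3 first.
- apply/measurable_EFinP; apply: continuous_measurable_fun => x.
  apply: (@continuous_comp _ _ _ (fun x => x - a * y) (fun x => (1 + (s * line_weight 2^-1 y * x) ^+ 2)^-1)).
    by apply: (@is_derive1_continuous _ (fun x => x - a * y)).
  exact: continuous_lorentz.
- by move=> x _; rewrite lee_fin invr_ge0 ltW// lorentz_gt0.
- by rewrite lee_fin ltW// line_weight_gt0.
rewrite integral_lorentz_shift// -EFinM; congr EFin.
have -> : line_weight (q - 2^-1) y = line_weight q y / line_weight 2^-1 y.
  by rewrite /line_weight -powRN -powRD ?(gt_eqF (one_sqr_gt0 y)) ?implybT//; congr (_ `^ _); ring.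
by field; rewrite (gt_eqF s0) gt_eqF.
Qed.

(** Integration across the line gains 1 / s and loses one factor <y>, which leaves the exponent q -
    1/2. It exceeds 1/2 exactly when q > 1, that is r > 2 for q = r / 2. *)
Lemma slab_integral (s a q : R) : 0 < s -> 1 < q ->
  (\int[leb2 R]_z (slab s a q z.1 z.2)%:E = (pi / s * \int[mu]_y line_weight (q - 2^-1) y)%:E)%E /\
  (\int[leb2 R]_z (slab s a q z.2 z.1)%:E = (pi / s * \int[mu]_y line_weight (q - 2^-1) y)%:E)%E.
Proof.
move=> s0 q1.
have iw : mu.-integrable setT (EFin \o line_weight (q - 2^-1)).
  by apply: integrable_line_weight; lra.
have E : (\int[mu]_y (pi / s * line_weight (q - 2^-1) y)%:E =
    (pi / s * \int[mu]_y line_weight (q - 2^-1) y)%:E)%E.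
  by rewrite EFinM EFin_Rintegral// -integralZl//.
split.
  have := @fubini_tonelli2 _ _ _ _ R mu mu (fun z => (slab s a q z.1 z.2)%:E).
  rewrite /leb2 => ->.
  - by rewrite -E; apply: eq_integral => y _; rewrite /fubini_G/= slab_inner.
  - by apply/measurable_EFinP; apply: measurable_slab; [exact: measurable_fst|exact: measurable_snd].
  - by move=> z; rewrite lee_fin slab_ge0.
have := @fubini_tonelli1 _ _ _ _ R mu mu (fun z => (slab s a q z.2 z.1)%:E).
rewrite /leb2 => ->.
- by rewrite -E; apply: eq_integral => y _; rewrite /fubini_F/= slab_inner.
- by apply/measurable_EFinP; apply: measurable_slab; [exact: measurable_snd|exact: measurable_fst].
- by move=> z; rewrite lee_fin slab_ge0.
Qed.

(** With a slope of modulus at most 1 in one of the two charts, every line through the origin is the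
    zero set of such a form, and l^2 <= 2 <xi>^2 holds uniformly. *)
Definition hyperbolic_form (l : plane R -> R) : Prop :=
  exists2 a : R, `|a| <= 1 & l = (fun xi => xi.1 - a * xi.2) \/ l = (fun xi => xi.2 - a * xi.1).

Definition hyperbolic_weight (c t r : R) (l : plane R -> R) (xi : plane R) : R :=
  expR (- (c * t * (l xi ^+ 2 / jap xi ^+ 2))) * jap xi `^ (- r).

Lemma measurable_jap : measurable_fun setT (@jap R).
Proof.
apply: (measurableT_comp (f := Num.sqrt : measurableTypeR R -> R)).
  by apply: continuous_measurable_fun; exact: sqrt_continuous.
by apply: measurable_funD => //; apply: measurable_funX; exact: measurable_norm2.
Qed.

Lemma measurable_jap_powR (r : R) : measurable_fun setT (fun xi : plane R => jap xi `^ r).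
Proof. exact: measurableT_comp (@measurable_powR R r) measurable_jap. Qed.

Lemma measurable_hyperbolic_weight c t r l : hyperbolic_form l ->
  measurable_fun setT (hyperbolic_weight c t r l).
Proof.
move=> [a _ hl].
have ml : measurable_fun setT l.
  by case: hl => ->; apply: measurable_funB => //; exact: measurable_funM.
apply: measurable_funM; last exact: measurable_jap_powR.
apply: measurableT_comp => //; apply: measurableT_comp => //.
apply: measurable_funM => //; apply: measurable_funM; first exact: measurable_funX.
have -> : (fun xi : plane R => (jap xi ^+ 2)^-1) = (fun xi => jap xi `^ (- 2)).
  by apply/funext => xi; rewrite powRN powR_mulrn// ltW// jap_gt0.
exact: measurable_jap_powR.
Qed.

(** The slab part has mass pi J1 / s and the other part is at most J2^2 / (1 + s^2) <= J2^2 / s,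
    with s a multiple of (1 + t)^(1/2). The constant does not depend on the slope. *)
Lemma hyperbolic_weight_integral (c r : R) : 0 < c -> 2 < r ->
  exists2 C : R, 0 < C & forall (t : R) (l : plane R -> R), 0 <= t -> hyperbolic_form l ->
    (leb2 R).-integrable setT (EFin \o hyperbolic_weight c t r l) /\
    \int[leb2 R]_xi hyperbolic_weight c t r l xi <= C * (1 + t) `^ (- 2^-1).
Proof.
move=> c0 r2; pose q := r / 2.
have q1 : 1 < q by rewrite /q; lra.
pose J1 := \int[mu]_y line_weight (q - 2^-1) y; pose J2 := \int[mu]_y line_weight (q / 2) y.
have J10 : 0 <= J1 by apply: Rintegral_ge0 => y _; exact: ltW (line_weight_gt0 _ _).
have iw2 : mu.-integrable setT (EFin \o line_weight (q / 2)) by apply: integrable_line_weight; lra.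
pose K := expR (2 * c) * (pi * J1 + J2 ^+ 2) / Num.sqrt (c / 5).
have c5 : 0 < c / 5 by rewrite divr_gt0.
have sc0 : 0 < Num.sqrt (c / 5) by rewrite sqrtr_gt0.
have K0 : 0 <= K.
  by rewrite divr_ge0 ?(ltW sc0)// mulr_ge0 ?expR_ge0// addr_ge0 ?sqr_ge0// mulr_ge0 ?pi_ge0.
exists (K + 1); first by rewrite ltr_wpDl.
move=> t l t0 hl.
have t1 : 0 < 1 + t by rewrite ltr_pwDl.
pose s := Num.sqrt (c / 5) * Num.sqrt (1 + t).
have st0 : 0 < Num.sqrt (1 + t) by rewrite sqrtr_gt0.
have s0 : 0 < s by rewrite mulr_gt0.
have s2 : s ^+ 2 = c * (1 + t) / 5.
  by rewrite exprMn !sqr_sqrtr ?(ltW t1) ?(ltW c5)//; ring.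
have [itens Etens] := plane_tensor iw2 iw2.
have mhw := measurable_hyperbolic_weight c t r hl.
have [S [mS S0 ES hS]] : exists S : plane R -> R, [/\ measurable_fun setT S, forall z, 0 <= S z,
    (\int[leb2 R]_z (S z)%:E = (pi / s * J1)%:E)%E &
    forall z, hyperbolic_weight c t r l z <=
      expR (2 * c) * (S z + (1 + s ^+ 2)^-1 * (line_weight (q / 2) z.1 * line_weight (q / 2) z.2))].
  case: hl => a a1 [->|->]; have [E1 E2] := @slab_integral s a q s0 q1.
    exists (fun z => slab s a q z.1 z.2); split; [| |exact: E1|].
    - by apply: measurable_slab; [exact: measurable_fst|exact: measurable_snd].
    - by move=> z; exact: slab_ge0.
    - move=> z; rewrite /hyperbolic_weight jap_sq jap_powR mulNr -/q.
      by apply: hyperbolic_pointwise => //; lra.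
  exists (fun z => slab s a q z.2 z.1); split; [| |exact: E2|].
  - by apply: measurable_slab; [exact: measurable_snd|exact: measurable_fst].
  - by move=> z; exact: slab_ge0.
  - move=> z; rewrite /hyperbolic_weight jap_sq jap_powR mulNr -/q [z.1 ^+ 2 + _]addrC.
    rewrite [line_weight (q / 2) z.1 * _]mulrC.
    by apply: hyperbolic_pointwise => //; lra.
have iS : (leb2 R).-integrable setT (EFin \o S).
  by apply: (@ge0_rintegrable _ _ _ _ _ (pi / s * J1)); rewrite ?ES.
have IS : \int[leb2 R]_z S z = pi / s * J1 by apply: EFin_inj; rewrite EFin_Rintegral.
have iB := rintegrableZ (expR (2 * c)) (rintegrableD iS (rintegrableZ (1 + s ^+ 2)^-1 itens)).
have hw0 z : 0 <= hyperbolic_weight c t r l z by rewrite mulr_ge0 ?expR_ge0 ?powR_ge0.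
have ihw : (leb2 R).-integrable setT (EFin \o hyperbolic_weight c t r l).
  by apply: rintegrable_le iB => // z; rewrite ger0_norm.
split => //.
have := norm_Rintegral_le ihw iB; rewrite ger0_norm ?Rintegral_ge0//.
move=> /(_ _)h; apply: le_trans (h _) _; first by move=> z; rewrite ger0_norm.
rewrite leb2_RintegralZ; last by apply: rintegrableD => //; exact: rintegrableZ.
rewrite leb2_RintegralD//; last exact: rintegrableZ.
rewrite leb2_RintegralZ// IS Etens -expr2 -/J2.
rewrite powRN powR12_sqrt ?(ltW t1)//.
have h1 : (1 + s ^+ 2)^-1 <= s^-1.
  by rewrite lef_pV2 ?posrE ?one_sqr_gt0//; clear; have := sqr_ge0 (1 - s); have := sqr_ge0 s; lra.
have h2 : (1 + s ^+ 2)^-1 * J2 ^+ 2 <= s^-1 * J2 ^+ 2 by rewrite ler_wpM2r ?sqr_ge0.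
apply: (@le_trans _ _ (expR (2 * c) * (pi / s * J1 + s^-1 * J2 ^+ 2))).
  by rewrite ler_wpM2l ?expR_ge0// lerD2l.
have -> : expR (2 * c) * (pi / s * J1 + s^-1 * J2 ^+ 2) = K * (Num.sqrt (1 + t))^-1.
  by rewrite /K /s; field; rewrite (gt_eqF sc0) (gt_eqF st0).
by rewrite ler_wpM2r ?invr_ge0 ?(ltW st0)// lerDl.
Qed.

End plane_weight_integrals.

(** * Oscillatory integrals *)

Section van_der_corput.
Context (R : realType).
Notation mu := (@lebesgue_measure R).

Lemma continuous_rintegrable_itv (f : R -> R) (a b : R) : continuous f ->
  mu.-integrable `[a, b] (EFin \o f).
Proof.
move=> cf; apply: continuous_compact_integrable; first exact: segment_compact.
exact: continuous_subspaceT.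
Qed.

Lemma Rintegral_sandwich (f g G : R -> R) (a b : R) : a < b -> continuous f ->
  continuous g -> (forall x : R, is_derive x 1 G (g x)) ->
  (forall x : R, a <= x <= b -> f x <= g x) ->
  \int[mu]_(x in `[a, b]) f x <= G b - G a.
Proof.
move=> ab cf cg dG fg; rewrite -(Rintegral_FTC ab dG cg); apply: le_Rintegral => //.
- exact: continuous_rintegrable_itv.
- exact: continuous_rintegrable_itv.
Qed.

(* The quotient [h = f1 / (f1 ^+ 2 + l)] is a smooth substitute for [1 / f1]
   near the stationary point: [cos f = h * (sin f)' + l * cos f / (f1 ^+ 2 + l)],
   and both [`|h'|] and the last factor are bounded by
   [f2 / (f1 ^+ 2 + l)], an exact derivative. *)
Lemma van_der_corput (f f1 f2 b b1 : R -> R) (u v l M N : R) : u < v -> 0 < l ->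
  (forall x : R, is_derive x 1 f (f1 x)) -> (forall x : R, is_derive x 1 f1 (f2 x)) ->
  (forall x : R, is_derive x 1 b (b1 x)) -> continuous f2 -> continuous b1 ->
  (forall x, u <= x <= v -> l ^+ 2 <= f2 x) ->
  (forall x, u <= x <= v -> `|b x| <= M) -> (forall x, u <= x <= v -> `|b1 x| <= N) ->
  `|\int[mu]_(x in `[u, v]) (cos (f x) * b x)| <= l^-1 * (M * (1 + 2 * pi) + N * (v - u) / 2).
Proof.
move=> uv l0 df df1 db cf2 cb1 hl hM hN.
have M0 : 0 <= M by apply: le_trans (hM u _); rewrite ?normr_ge0 ?lexx ?ltW.
have N0 : 0 <= N by apply: le_trans (hN u _); rewrite ?normr_ge0 ?lexx ?ltW.
have cf : continuous f by move=> x; exact: is_derive1_continuous (df x).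
have cf1 : continuous f1 by move=> x; exact: is_derive1_continuous (df1 x).
have cb : continuous b by move=> x; exact: is_derive1_continuous (db x).
have Q0 x : 0 < f1 x ^+ 2 + l ^+ 2 by rewrite ltr_wpDl ?sqr_ge0// exprn_gt0.
pose Q x := (f1 x ^+ 2 + l ^+ 2)^-1.
have dQ (x : R) : is_derive x 1 Q (- (2 * f1 x * f2 x) * Q x ^+ 2).
  have d := is_derive1_add (is_derive1_exp 1 (df1 x)) (is_derive1_cst x (l ^+ 2)).
  have h := @is_derive1_inv _ (fun x => f1 x ^+ 2 + l ^+ 2) x _ (lt0r_neq0 (Q0 x)) d; apply: (is_derive_eq h).
  by rewrite /Q exprVn; ring.
have cQ : continuous Q by move=> x; exact: is_derive1_continuous (dQ x).
pose F x := sin (f x) * (f1 x * Q x * b x).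
pose g x := cos (f x) * f1 x * (f1 x * Q x * b x) +
  sin (f x) * ((f2 x * Q x + f1 x * (- (2 * f1 x * f2 x) * Q x ^+ 2)) * b x + f1 x * Q x * b1 x).
have dF (x : R) : is_derive x 1 F (g x).
  exact: (is_derive1_mul (is_derive1_sin (df x)) (is_derive1_mul (is_derive1_mul (df1 x) (dQ x)) (db x))).
pose k x := 2 * M * f2 x * Q x + N / (2 * l).
(* [G] is an antiderivative of the error bound [k]. The arctangent increases by at most pi, whatever
   the length of the interval and the range of [f1]. *)
pose G x := 2 * M * (l^-1 * atan (l^-1 * f1 x)) + N / (2 * l) * x.
have dG (x : R) : is_derive x 1 G (k x).
  have h1 := is_derive1_atan (is_derive1_mul (is_derive1_cst x l^-1) (df1 x)).
  have h := is_derive1_add (is_derive1_mul (is_derive1_cst x (2 * M)) (is_derive1_mul (is_derive1_cst x l^-1) h1))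
    (is_derive1_mul (is_derive1_cst x (N / (2 * l))) (is_derive1_id x)).
  apply: (is_derive_eq h); rewrite /k /Q; field.
  by rewrite (gt_eqF l0)/= !gt_eqF// addrC [X in _ + X]addrC ?Q0.
have csin : continuous (fun x => sin (f x)).
  by move=> x; apply: continuous_comp; [exact: cf|exact: continuous_sin].
have ccos : continuous (fun x => cos (f x)).
  by move=> x; apply: continuous_comp; [exact: cf|exact: continuous_cos].
have cg : continuous g.
  move=> x; apply: cvgD.
    apply: cvgM; first by apply: cvgM; [exact: ccos|exact: cf1].
    by apply: cvgM; [apply: cvgM; [exact: cf1|exact: cQ]|exact: cb].
  apply: cvgM; first exact: csin.
  apply: cvgD; last by apply: cvgM; [apply: cvgM; [exact: cf1|exact: cQ]|exact: cb1].
  apply: cvgM; last exact: cb.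
  apply: cvgD; first by apply: cvgM; [exact: cf2|exact: cQ].
  apply: cvgM; first exact: cf1.
  apply: cvgM; last by apply: cvgM; exact: cQ.
  apply: cvgN; apply: cvgM; last exact: cf2.
  by apply: cvgMr; exact: cf1.
have ck : continuous k.
  move=> x; apply: cvgD; last exact: cvg_cst.
  apply: cvgM; last exact: cQ.
  by apply: cvgMr; exact: cf2.
have ce : continuous (fun x => cos (f x) * b x) by move=> x; apply: cvgM; [exact: ccos|exact: cb].
have Qp x : 0 < Q x by rewrite invr_gt0.
have QE x : (f1 x ^+ 2 + l ^+ 2) * Q x = 1 by rewrite mulfV// gt_eqF.
have f1Q x : `|f1 x * Q x| <= (2 * l)^-1.
  have -> : (2 * l)^-1 = (2 * l)^-1 * ((f1 x ^+ 2 + l ^+ 2) * Q x) by rewrite QE mulr1.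
  rewrite normrM (gtr0_norm (Qp x)) mulrA ler_wpM2r ?(ltW (Qp x))//.
  rewrite ler_pdivlMl ?mulr_gt0// -[f1 x ^+ 2]real_normK ?num_real//.
  by have := sqr_ge0 (`|f1 x| - l); nra.
have key x : u <= x <= v -> `|cos (f x) * b x - g x| <= k x.
  move=> xuv.
  have f2l := hl x xuv; have f20 : 0 <= f2 x by rewrite (le_trans _ f2l)// sqr_ge0.
  have -> : cos (f x) * b x - g x = cos (f x) * (b x * (l ^+ 2 * Q x)) -
     sin (f x) * (b x * (f2 x * Q x * (1 - 2 * (f1 x ^+ 2 * Q x))) + f1 x * Q x * b1 x).
    have := QE x; rewrite /g; move: (Q x) => q qE.
    apply: subr0_eq; rewrite (_ : _ - _ = cos (f x) * b x * (1 - (f1 x ^+ 2 + l ^+ 2) * q)); last by ring.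
    by rewrite qE subrr mulr0.
  have hb := hM x xuv; have hb1 := hN x xuv.
  have s1 : `|f2 x * Q x * (1 - 2 * (f1 x ^+ 2 * Q x))| <= f2 x * Q x.
    rewrite normrM ger0_norm ?mulr_ge0 ?(ltW (Qp x))// ler_piMr ?mulr_ge0 ?(ltW (Qp x))//.
    have h1 : 0 <= f1 x ^+ 2 * Q x by rewrite mulr_ge0 ?sqr_ge0 ?(ltW (Qp x)).
    have h2 : 0 <= l ^+ 2 * Q x by rewrite mulr_ge0 ?sqr_ge0 ?(ltW (Qp x)).
    by rewrite ler_norml; have := QE x; rewrite mulrDl; lra.
  have s2 : l ^+ 2 * Q x <= f2 x * Q x by rewrite ler_wpM2r ?(ltW (Qp x)).
  have t1 : `|cos (f x) * (b x * (l ^+ 2 * Q x))| <= M * (f2 x * Q x).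
    have lQ : 0 <= l ^+ 2 * Q x by rewrite mulr_ge0 ?sqr_ge0 ?(ltW (Qp x)).
    rewrite normrM [`|b x * _|]normrM (ger0_norm lQ) -[leRHS]mul1r.
    apply: ler_pM; [exact: normr_ge0|by rewrite mulr_ge0|exact: norm_cos_le1|].
    exact: ler_pM.
  have t2 : `|b x * (f2 x * Q x * (1 - 2 * (f1 x ^+ 2 * Q x))) + f1 x * Q x * b1 x| <=
     M * (f2 x * Q x) + (2 * l)^-1 * N.
    apply: le_trans (ler_normD _ _) _; apply: lerD; rewrite normrM.
      by apply: ler_pM.
    by apply: ler_pM.
  apply: le_trans (ler_normB _ _) _; rewrite /k.
  have t3 : `|sin (f x) * (b x * (f2 x * Q x * (1 - 2 * (f1 x ^+ 2 * Q x))) + f1 x * Q x * b1 x)| <=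
     M * (f2 x * Q x) + (2 * l)^-1 * N.
    rewrite normrM; apply: le_trans t2; rewrite ler_piMl ?normr_ge0 ?norm_sin_le1//.
  rewrite [N / _]mulrC; lra.
have hF x : u <= x <= v -> `|F x| <= l^-1 * M / 2.
  move=> xuv; rewrite /F !normrM.
  have -> : l^-1 * M / 2 = 1 * ((2 * l)^-1 * M) by rewrite invfM; ring.
  rewrite ler_pM ?mulr_ge0 ?normr_ge0 ?norm_sin_le1// ler_pM ?mulr_ge0 ?normr_ge0 ?hM//.
  by rewrite -normrM.
have uu : u <= u <= v by rewrite lexx ltW.
have vv : u <= v <= v by rewrite lexx ltW.
have hG : G v - G u <= l^-1 * (2 * M * pi + N * (v - u) / 2).
  have a1 := @atan_gtNpi2 R (l^-1 * f1 u); have a2 := @atan_ltpi2 R (l^-1 * f1 v).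
  have -> : G v - G u = l^-1 * (2 * M * (atan (l^-1 * f1 v) - atan (l^-1 * f1 u)) + N * (v - u) / 2).
    by rewrite /G invfM; ring.
  rewrite ler_wpM2l ?invr_ge0 ?(ltW l0)// lerD2r ler_wpM2l ?mulr_ge0//; lra.
(* Both signs are treated: comparison with g + k gives the upper bound and with g - k the lower one.
   The end values of [F] cost M / l, the increment of [G] gives the rest. *)
have Fu := hF u uu; have Fv := hF v vv; rewrite ler_norml; apply/andP; split.
  have dH (x : R) : is_derive x 1 (fun x => - F x + G x) (- g x + k x).
    exact: is_derive1_add (is_derive1_opp (dF x)) (dG x).
  have ch : continuous (fun x => - g x + k x) by move=> x; apply: cvgD; [apply: cvgN; exact: cg|exact: ck].
  have cn : continuous (fun x => - (cos (f x) * b x)) by move=> x; apply: cvgN; exact: ce.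
  have := Rintegral_sandwich uv cn ch dH.
  have -> : \int[mu]_(x in `[u, v]) (- (cos (f x) * b x)) = - \int[mu]_(x in `[u, v]) (cos (f x) * b x).
    rewrite (_ : (fun x => - _) = fun x => (-1) * (cos (f x) * b x)); last by apply/funext => x; rewrite mulN1r.
    by rewrite RintegralZl ?mulN1r//; exact: continuous_rintegrable_itv.
  move=> h; have {}h : - (\int[mu]_(x in `[u, v]) (cos (f x) * b x)) <= - F v + G v - (- F u + G u).
    by apply: h => x xuv; have := key x xuv; rewrite ler_norml; lra.
  move: Fu Fv; rewrite !ler_norml => /andP[? ?] /andP[? ?].
  have -> : l^-1 * (M * (1 + 2 * pi) + N * (v - u) / 2) = l^-1 * M + l^-1 * (2 * M * pi + N * (v - u) / 2) by ring.
  lra.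
have dH (x : R) : is_derive x 1 (fun x => F x + G x) (g x + k x).
  exact: is_derive1_add (dF x) (dG x).
have ch : continuous (fun x => g x + k x) by move=> x; apply: cvgD; [exact: cg|exact: ck].
have h : (\int[mu]_(x in `[u, v]) (cos (f x) * b x)) <= F v + G v - (F u + G u).
  apply: (Rintegral_sandwich uv ce ch dH) => x xuv.
  by have := key x xuv; rewrite ler_norml; lra.
move: Fu Fv; rewrite !ler_norml => /andP[? ?] /andP[? ?].
apply: le_trans h _; have -> : l^-1 * (M * (1 + 2 * pi) + N * (v - u) / 2) = l^-1 * M + l^-1 * (2 * M * pi + N * (v - u) / 2) by ring.
lra.
Qed.
End van_der_corput.

(** * Oscillatory integrals over sections of a cone *)

Section cone_sections.
Context (R : realType).
Notation mu := (@lebesgue_measure R).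

(* A quadratic form of the direction xi / |xi|, times <xi>^(-r). *)
Definition cone_amplitude (r al be ga a y : R) : R :=
  (al * a ^+ 2 + be * (a * y) + ga * y ^+ 2) / (a ^+ 2 + y ^+ 2) * (1 + (a ^+ 2 + y ^+ 2)) `^ (- (r / 2)).

Lemma quadratic_form_le (al be ga a y : R) : `|al| <= 1 -> `|be| <= 1 -> `|ga| <= 1 ->
  `|al * a ^+ 2 + be * (a * y) + ga * y ^+ 2| <= 2 * (a ^+ 2 + y ^+ 2).
Proof.
move=> al1 be1 ga1.
have h1 : `|al * a ^+ 2| <= a ^+ 2.
  by rewrite normrM [`|a ^+ 2|]ger0_norm ?sqr_ge0// ler_piMl ?sqr_ge0.
have h3 : `|ga * y ^+ 2| <= y ^+ 2.
  by rewrite normrM [`|y ^+ 2|]ger0_norm ?sqr_ge0// ler_piMl ?sqr_ge0.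
have h2 : `|be * (a * y)| <= `|a * y| by rewrite normrM ler_piMl.
have h4 : `|a * y| <= a ^+ 2 + y ^+ 2.
  by rewrite ler_norml; have := sqr_ge0 (a - y); have := sqr_ge0 (a + y);
     have := sqr_ge0 a; have := sqr_ge0 y; nra.
apply: le_trans (ler_normD _ _) _; have := ler_normD (al * a ^+ 2) (be * (a * y)); lra.
Qed.

Lemma cone_amplitude_le (r al be ga a y : R) : 0 <= r ->
  `|al| <= 1 -> `|be| <= 1 -> `|ga| <= 1 ->
  `|cone_amplitude r al be ga a y| <= 2 * (1 + (a ^+ 2 + y ^+ 2)) `^ (- (r / 2)).
Proof.
move=> r0 al1 be1 ga1; rewrite /cone_amplitude normrM [X in _ * X <= _]ger0_norm ?powR_ge0//.
rewrite ler_wpM2r ?powR_ge0//.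
have := quadratic_form_le a y al1 be1 ga1.
have [->|n0] := eqVneq (a ^+ 2 + y ^+ 2) 0; first by rewrite invr0 !mulr0 normr0.
have g0 : 0 < a ^+ 2 + y ^+ 2 by rewrite lt0r n0 addr_ge0 ?sqr_ge0.
by rewrite normrM normfV (gtr0_norm g0) ler_pdivrMr.
Qed.

(** For |y| <= |a| the second derivative of the phase is k a^2 / (a^2 + y^2)^(3/2) >= k / (4 |a|),
    whatever the linear term. The amplitude is O(<a>^(-r)) and its derivative is smaller by a factor
    1 / |a|, which the length 2 |a| of the interval compensates. Van der Corput's lemma gives a
    multiple of k^(-1/2) |a|^(1/2) <a>^(-r), and |a|^(1/2) <= <a>. *)
Lemma cone_section_bound (r al be ga k p x2 a : R) : 0 < k -> 0 <= r -> a != 0 ->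
  `|al| <= 1 -> `|be| <= 1 -> `|ga| <= 1 ->
  `|\int[mu]_(y in `[- `|a|, `|a|]) (cos (p + x2 * y + k * Num.sqrt (a ^+ 2 + y ^+ 2)) *
      cone_amplitude r al be ga a y)| <=
  (10 + 4 * r + 8 * pi) / Num.sqrt k * line_weight ((r - 1) / 2) a.
Proof.
move=> k0 r0 a0 al1 be1 ga1; have na : 0 < `|a| by rewrite normr_gt0.
have a2 : 0 < a ^+ 2 by rewrite exprn_even_gt0.
have g0 (y : R) : 0 < a ^+ 2 + y ^+ 2 by rewrite ltr_pwDl ?sqr_ge0.
pose rho (y : R) := Num.sqrt (a ^+ 2 + y ^+ 2).
have rho0 (y : R) : 0 < rho y by rewrite sqrtr_gt0.
have rho2 (y : R) : rho y ^+ 2 = a ^+ 2 + y ^+ 2 by rewrite sqr_sqrtr// ltW.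
have dg (y : R) : is_derive y 1 (fun y : R => a ^+ 2 + y ^+ 2) (2 * y).
  by apply: is_derive_eq; rewrite /GRing.scale/=; ring.
have drho (y : R) : is_derive y 1 rho (y * (rho y)^-1).
  have h := @is_derive1_compo _ Num.sqrt (fun y => a ^+ 2 + y ^+ 2) y _ _ (is_derive1_sqrt (g0 y)) (dg y); apply: (is_derive_eq h).
  by rewrite -/(rho y); field; rewrite gt_eqF.
have drhoV (y : R) : is_derive y 1 (fun y => (rho y)^-1) (- (rho y) ^- 2 * (y * (rho y)^-1)).
  exact: is_derive1_inv (lt0r_neq0 (rho0 y)) (drho y).
pose f (y : R) := p + x2 * y + k * rho y.
pose f1 (y : R) := x2 + k * (y * (rho y)^-1).
pose f2 (y : R) := k * (a ^+ 2 * (rho y)^-1 ^+ 3).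
have df (y : R) : is_derive y 1 f (f1 y).
  have h := is_derive1_add (is_derive1_add (is_derive1_cst y p) (is_derive1_mul (is_derive1_cst y x2) (is_derive1_id y)))
    (is_derive1_mul (is_derive1_cst y k) (drho y)).
  by apply: (is_derive_eq h); rewrite /f1; ring.
have df1 (y : R) : is_derive y 1 f1 (f2 y).
  have h := is_derive1_add (is_derive1_cst y x2) (is_derive1_mul (is_derive1_cst y k)
    (is_derive1_mul (is_derive1_id y) (drhoV y))).
  apply: (is_derive_eq h); rewrite /f2 (_ : a ^+ 2 = rho y ^+ 2 - y ^+ 2); last by rewrite rho2 addrK.
  by field; rewrite gt_eqF.
pose J (y : R) := 1 + (a ^+ 2 + y ^+ 2).
have J0 (y : R) : 0 < J y by rewrite ltr_pwDl// ltW.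
have dJ (y : R) : is_derive y 1 J (2 * y).
  by apply: (is_derive_eq (is_derive1_add (is_derive1_cst y 1) (dg y))); rewrite add0r.
pose P (y : R) := J y `^ (- (r / 2)).
pose P1 (y : R) := - (r / 2) * J y `^ (- (r / 2) - 1) * (2 * y).
have dP (y : R) : is_derive y 1 P (P1 y) by exact: is_derive1_powR (J0 y) (dJ y).
pose w (y : R) := (a ^+ 2 + y ^+ 2)^-1.
have dw (y : R) : is_derive y 1 w (- (a ^+ 2 + y ^+ 2) ^- 2 * (2 * y)).
  exact: (@is_derive1_inv _ (fun y => a ^+ 2 + y ^+ 2) y _ (lt0r_neq0 (g0 y)) (dg y)).
pose n (y : R) := al * a ^+ 2 + be * (a * y) + ga * y ^+ 2.
have dn (y : R) : is_derive y 1 n (be * a + 2 * ga * y).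
  by apply: is_derive_eq; rewrite /GRing.scale/=; ring.
pose q1 (y : R) := (be * a * (a ^+ 2 - y ^+ 2) + 2 * (ga - al) * a ^+ 2 * y) * (w y ^+ 2).
have dq (y : R) : is_derive y 1 (fun y => n y * w y) (q1 y).
  apply: (is_derive_eq (is_derive1_mul (dn y) (dw y))); rewrite /q1 /w /n; field.
  by rewrite gt_eqF.
pose b1 (y : R) := q1 y * P y + n y * w y * P1 y.
have db (y : R) : is_derive y 1 (cone_amplitude r al be ga a) (b1 y) by exact: is_derive1_mul (dq y) (dP y).
have cP : continuous P by move=> y; exact: is_derive1_continuous (dP y).
have cw : continuous w by move=> y; exact: is_derive1_continuous (dw y).
have cn : continuous n by move=> y; exact: is_derive1_continuous (dn y).
have cf2 : continuous f2.
  move=> y; apply: cvgMr; apply: cvgMr.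
  by apply: (@is_derive1_continuous _ (fun y => (rho y)^-1 ^+ 3)); exact: is_derive1_exp (drhoV y).
have cb1 : continuous b1.
  have cp1 : continuous (fun y : R => be * a * (a ^+ 2 - y ^+ 2) + 2 * (ga - al) * a ^+ 2 * y).
    by move=> y; apply: (@is_derive1_continuous _ (fun y : R => be * a * (a ^+ 2 - y ^+ 2) + 2 * (ga - al) * a ^+ 2 * y)).
  have cJ : continuous J by move=> y; exact: is_derive1_continuous (dJ y).
  have cJp : continuous (fun y : R => J y `^ (- (r / 2) - 1)) by apply: continuous_pow_line.
  have cy : continuous (fun y : R => 2 * y) by move=> y; apply: cvgMr; exact: cvg_id.
  have cw2 : continuous (fun y : R => w y ^+ 2).
    by move=> y; apply: (@is_derive1_continuous _ (fun y => w y ^+ 2)); exact: is_derive1_exp (dw y).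
  have cP1 : continuous P1 by move=> y; apply: cvgM; [apply: cvgMr; exact: cJp|exact: cy].
  move=> y; apply: cvgD.
    by apply: cvgM; [apply: cvgM; [exact: cp1|exact: cw2]|exact: cP].
  by apply: cvgM; [apply: cvgM; [exact: cn|exact: cw]|exact: cP1].
pose l := Num.sqrt k / (2 * Num.sqrt `|a|).
have sk0 : 0 < Num.sqrt k by rewrite sqrtr_gt0.
have sa0 : 0 < Num.sqrt `|a| by rewrite sqrtr_gt0.
have l0 : 0 < l by rewrite divr_gt0// mulr_gt0.
have l2 : l ^+ 2 = k / (4 * `|a|).
  by rewrite expr_div_n exprMn !sqr_sqrtr ?(ltW k0)//; congr (_ / _); ring.
have aN : - `|a| < `|a| by lra.
pose W := line_weight (r / 2) a.
have W0 : 0 < W := line_weight_gt0 _ _.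
have PW (y : R) : P y <= W.
  apply: powRN_le; rewrite ?one_sqr_gt0 ?divr_ge0// /J; have := sqr_ge0 y; lra.
have Pp (y : R) : 0 < P y by rewrite powR_gt0.
have ay (y : R) : 2 * (`|a| * `|y|) <= a ^+ 2 + y ^+ 2.
  rewrite -(real_normK (num_real a)) -(real_normK (num_real y)).
  by have := sqr_ge0 (`|a| - `|y|); nra.
have hl (y : R) : - `|a| <= y <= `|a| -> l ^+ 2 <= f2 y.
  rewrite -ler_norml => ya; rewrite l2 /f2 ler_wpM2l ?(ltW k0)// exprVn.
  have y2 : y ^+ 2 <= a ^+ 2.
    rewrite -[y ^+ 2]real_normK ?num_real// -[a ^+ 2]real_normK ?num_real//.
    by rewrite lerXn2r ?nnegrE.
  have r2 : rho y <= 2 * `|a|.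
    rewrite -(@ler_pXn2r _ 2) ?nnegrE ?(ltW (rho0 y)) ?mulr_ge0// rho2 exprMn real_normK ?num_real//.
    lra.
  rewrite ler_pdivlMr ?exprn_gt0// ler_pdivrMl ?mulr_gt0// exprSr rho2.
  have -> : 4 * `|a| * a ^+ 2 = 2 * a ^+ 2 * (2 * `|a|) by ring.
  by rewrite ler_pM ?(ltW (g0 y)) ?(ltW (rho0 y))//; lra.
have hM (y : R) : - `|a| <= y <= `|a| -> `|cone_amplitude r al be ga a y| <= 2 * W.
  by move=> _; apply: le_trans (cone_amplitude_le _ _ _ _ _ _) _ => //; rewrite ler_wpM2l ?PW.
have hN (y : R) : - `|a| <= y <= `|a| -> `|b1 y| <= (3 + 2 * r) / `|a| * W.
  move=> _; have w0 : 0 < w y by rewrite invr_gt0.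
  have aE : `|a| * `|a| = a ^+ 2 by rewrite -[RHS]real_normK ?num_real.
  have wa : w y * `|a| <= `|a|^-1.
    rewrite /w ler_pdivrMl// ler_pdivlMr// aE; have := sqr_ge0 y; lra.
  have hq : `|q1 y| <= 3 / `|a|.
    have hn : `|be * a * (a ^+ 2 - y ^+ 2) + 2 * (ga - al) * a ^+ 2 * y| <= 3 * `|a| * (a ^+ 2 + y ^+ 2).
      have h1 : `|be * a * (a ^+ 2 - y ^+ 2)| <= `|a| * (a ^+ 2 + y ^+ 2).
        rewrite -mulrA normrM -[leRHS]mul1r ler_pM// normrM ler_wpM2l//.
        by rewrite ler_norml; have := sqr_ge0 y; have := sqr_ge0 a; lra.
      have h2 : `|2 * (ga - al) * a ^+ 2 * y| <= 2 * `|a| * (a ^+ 2 + y ^+ 2).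
        have -> : 2 * (ga - al) * a ^+ 2 * y = (ga - al) * (2 * (a ^+ 2 * y)) by ring.
        have -> : 2 * `|a| * (a ^+ 2 + y ^+ 2) = 2 * (`|a| * (a ^+ 2 + y ^+ 2)) by ring.
        rewrite normrM ler_pM//.
          by apply: le_trans (ler_normB _ _) _; lra.
        have -> : `|2 * (a ^+ 2 * y)| = `|a| * (2 * (`|a| * `|y|)).
          by rewrite !normrM normr_nat; ring.
        by rewrite ler_wpM2l.
      apply: le_trans (ler_normD _ _) _; lra.
    rewrite /q1 normrM [`|w y ^+ 2|]ger0_norm ?sqr_ge0//.
    have wE : (a ^+ 2 + y ^+ 2) * w y = 1 by rewrite mulfV// gt_eqF.
    apply: (@le_trans _ _ (3 * `|a| * (a ^+ 2 + y ^+ 2) * w y ^+ 2)).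
      by rewrite ler_wpM2r ?sqr_ge0.
    have -> : 3 * `|a| * (a ^+ 2 + y ^+ 2) * w y ^+ 2 = 3 * (w y * `|a|) * ((a ^+ 2 + y ^+ 2) * w y) by ring.
    by rewrite wE mulr1 ler_wpM2l.
  have hnw : `|n y * w y| <= 2.
    by rewrite normrM (gtr0_norm w0) ler_pdivrMr//; exact: quadratic_form_le.
  have hP1 : `|P1 y| <= r / `|a| * P y.
    have -> : P1 y = r * (P y * (- y / J y)).
      rewrite /P1 powRD ?(gt_eqF (J0 y)) ?implybT// powR_inv1 ?(ltW (J0 y))// /P.
      by move: (_ `^ _) => Z; field; rewrite gt_eqF.
    rewrite -mulrA normrM (ger0_norm r0) ler_wpM2l// normrM (gtr0_norm (Pp y)) mulrC ler_wpM2r ?(ltW (Pp y))//.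
    rewrite normrM normrN normfV (gtr0_norm (J0 y)) ler_pdivrMr// ler_pdivlMl// /J.
    by have := ay y; have := g0 y; have := mulr_ge0 (normr_ge0 a) (normr_ge0 y); lra.
  rewrite /b1; apply: le_trans (ler_normD _ _) _.
  have e1 : `|q1 y * P y| <= 3 / `|a| * W.
    by rewrite normrM (gtr0_norm (Pp y)) ler_pM ?(ltW (Pp y)).
  have e2 : `|n y * w y * P1 y| <= 2 * (r / `|a| * W).
    rewrite normrM ler_pM//; apply: le_trans hP1 _.
    by rewrite ler_wpM2l ?divr_ge0.
  have -> : (3 + 2 * r) / `|a| * W = 3 / `|a| * W + 2 * (r / `|a| * W) by ring.
  exact: lerD.
have := van_der_corput aN l0 df df1 db cf2 cb1 hl hM hN.
move=> h; apply: le_trans h _.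
have -> : l^-1 * (2 * W * (1 + 2 * pi) + (3 + 2 * r) / `|a| * W * (`|a| - - `|a|) / 2) =
   (10 + 4 * r + 8 * pi) / Num.sqrt k * (Num.sqrt `|a| * W).
  by rewrite /l; field; rewrite !gt_eqF.
rewrite ler_wpM2l ?divr_ge0 ?(ltW sk0)//.
  by have := pi_ge0 R; lra.
have -> : line_weight ((r - 1) / 2) a = (1 + a ^+ 2) `^ 2^-1 * W.
  rewrite /W /line_weight -powRD ?(gt_eqF (one_sqr_gt0 a)) ?implybT//; congr (_ `^ _); ring.
rewrite ler_wpM2r ?(ltW W0)// powR12_sqrt ?(ltW (one_sqr_gt0 a))// ler_wsqrtr//.
by rewrite -[a ^+ 2]real_normK ?num_real//; have := sqr_ge0 (`|a| - 1); nra.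
Qed.
End cone_sections.

(** * Decay of the dispersive kernel *)

Section dispersive_kernel.
Context (R : realType).
Notation mu := (@lebesgue_measure R).

Lemma plane_section_bound2 (f : plane R -> R) (g h B : R -> R) : measurable_fun setT f ->
  mu.-integrable setT (EFin \o g) -> mu.-integrable setT (EFin \o h) ->
  (forall z, `|f z| <= g z.1 * h z.2) -> mu.-integrable setT (EFin \o B) ->
  (forall x, `|\int[mu]_y f (x, y)| <= B x) ->
  `|\int[leb2 R]_z f z| <= \int[mu]_x B x.
Proof.
move=> mf ig ih fgh iB fB; have [i1 E] := @Rintegral_prod _ _ _ _ R mu mu f g h mf ig ih fgh.
by rewrite E; exact: norm_Rintegral_le.
Qed.

Lemma plane_section_bound1 (f : plane R -> R) (g h B : R -> R) : measurable_fun setT f ->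
  mu.-integrable setT (EFin \o g) -> mu.-integrable setT (EFin \o h) ->
  (forall z, `|f z| <= g z.1 * h z.2) -> mu.-integrable setT (EFin \o B) ->
  (forall y, `|\int[mu]_x f (x, y)| <= B y) ->
  `|\int[leb2 R]_z f z| <= \int[mu]_y B y.
Proof.
move=> mf ig ih fgh iB fB; have [_ E] := @Rintegral_prod _ _ _ _ R mu mu f g h mf ig ih fgh.
have mf' : measurable_fun setT (fun z : plane R => f (z.2, z.1)).
  exact: measurableT_comp mf (measurable_fun_pair measurable_snd measurable_fst).
have fgh' (z : plane R) : `|f (z.2, z.1)| <= h z.1 * g z.2 by rewrite mulrC; exact: fgh.
have [i2 _] := @Rintegral_prod _ _ _ _ R mu mu _ h g mf' ih ig fgh'.
rewrite E (@Rintegral_fubini _ _ _ _ R mu mu f g h mf ig ih fgh).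
exact: norm_Rintegral_le.
Qed.

(** On the cone the second coordinate is the smaller one, on the complement the first. Integrating
    along the smaller coordinate keeps the phase curved, since its values stay in [-|a|, |a|] for
    the other coordinate a. *)
Definition cone : set (plane R) := [set z | `|z.2| <= `|z.1|].

Lemma measurable_cone : measurable cone.
Proof.
rewrite /cone -[X in measurable X]setTI.
have -> : [set: plane R] `&` [set z | `|z.2| <= `|z.1| ] =
  [set: plane R] `&` (fun z : plane R => `|z.2| <= `|z.1|) @^-1` [set true].
  by [].
by apply: measurable_fun_ler => //; apply: measurableT_comp.
Qed.

Lemma cone_section (a : R) (f : R -> R) :
  \int[mu]_y (\1_cone (a, y) * f y) = \int[mu]_(y in `[- `|a|, `|a|]) f y.
Proof.
rewrite -[RHS]Rintegral_indic; apply: eq_Rintegral => y _; congr (_ * _).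
rewrite !indicE; congr (_%:R); congr nat_of_bool.
by apply/idP/idP; rewrite !inE /cone /= in_itv/= -ler_norml.
Qed.

Lemma coneC_section (a : R) (f : R -> R) : continuous f ->
  \int[mu]_x (\1_(~` cone) (x, a) * f x) = \int[mu]_(x in `[- `|a|, `|a|]) f x.
Proof.
move=> cf; have i1 := continuous_rintegrable_itv (- `|a|) (`|a|) cf.
have i2 : mu.-integrable `]- `|a|, `|a|] (EFin \o f).
  by apply: integrableS i1 => // z; rewrite /= !in_itv/= => /andP[/ltW -> ->].
have i3 : mu.-integrable `]- `|a|, `|a|[ (EFin \o f).
  by apply: integrableS i1 => // z; rewrite /= !in_itv/= => /andP[/ltW -> /ltW ->].
rewrite -(Rintegral_itv_obnd_cbnd i2) -(Rintegral_itv_bndo_bndc i3).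
rewrite -[RHS]Rintegral_indic; apply: eq_Rintegral => y _; congr (_ * _).
rewrite !indicE; congr (_%:R); congr nat_of_bool.
apply/idP/idP; rewrite !inE /cone /= in_itv/= -ltr_norml => h.
  by rewrite ltNge; apply/negP.
by apply/negP; rewrite -ltNge.
Qed.

(** The free shift [s] lets one kernel cover cosines and sines, hence the real and imaginary parts
    of the data. *)
Definition dispersive_phase (r al be ga k s : R) (x xi : plane R) : R :=
  cos (s + dot2 x xi + k * norm2 xi) * cone_amplitude r al be ga xi.1 xi.2.

Lemma cone_amplitudeC (r al be ga a y : R) : cone_amplitude r al be ga a y = cone_amplitude r ga be al y a.
Proof. by rewrite /cone_amplitude [y ^+ 2 + a ^+ 2]addrC [y * a]mulrC; congr (_ / _ * _); ring. Qed.

Lemma norm2E (xi : plane R) : norm2 xi = Num.sqrt (xi.1 ^+ 2 + xi.2 ^+ 2).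
Proof. by rewrite /norm2 /dot2 -!expr2. Qed.

Lemma measurable_cone_amplitude (r al be ga : R) :
  measurable_fun setT (fun xi : plane R => cone_amplitude r al be ga xi.1 xi.2).
Proof.
have m1 : measurable_fun setT (fun xi : plane R => xi.1 : R) by exact: measurable_fst.
have m2 : measurable_fun setT (fun xi : plane R => xi.2 : R) by exact: measurable_snd.
have mq : measurable_fun setT (fun xi : plane R => xi.1 ^+ 2 + xi.2 ^+ 2).
  by apply: measurable_funD; exact: measurable_funX.
apply: measurable_funM; last first.
  apply: (measurableT_comp (@measurable_powR R (- (r / 2)))); exact: measurable_funD.
apply: measurable_funM.
  apply: measurable_funD; last by apply: measurable_funM => //; exact: measurable_funX.
  apply: measurable_funD; first by apply: measurable_funM => //; exact: measurable_funX.
  by apply: measurable_funM => //; exact: measurable_funM.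
have -> : (fun xi : plane R => (xi.1 ^+ 2 + xi.2 ^+ 2)^-1) = (fun xi => (xi.1 ^+ 2 + xi.2 ^+ 2) `^ (- 1)).
  by apply/funext => xi; rewrite powR_inv1// addr_ge0 ?sqr_ge0.
exact: (measurableT_comp (@measurable_powR R (- 1))).
Qed.

Lemma measurable_dispersive_phase r al be ga k s x :
  measurable_fun setT (dispersive_phase r al be ga k s x).
Proof.
apply: measurable_funM; last exact: measurable_cone_amplitude.
apply: measurable_cosf; apply: measurable_funD.
  by apply: measurable_funD => //; exact: measurable_dot2l.
by apply: measurable_funM => //; exact: measurable_norm2.
Qed.

Lemma dispersive_phase_le r al be ga k s x xi : 0 <= r ->
  `|al| <= 1 -> `|be| <= 1 -> `|ga| <= 1 ->
  `|dispersive_phase r al be ga k s x xi| <= 2 * line_weight (r / 2 / 2) xi.1 * line_weight (r / 2 / 2) xi.2.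
Proof.
move=> r0 al1 be1 ga1; rewrite /dispersive_phase normrM.
apply: (@le_trans _ _ (1 * (2 * (1 + (xi.1 ^+ 2 + xi.2 ^+ 2)) `^ (- (r / 2))))).
  by rewrite ler_pM ?norm_cos_le1//; exact: cone_amplitude_le.
by rewrite mul1r -mulrA ler_wpM2l// line_weightM// divr_ge0.
Qed.

Lemma coneC_section0 (f : R -> R) : \int[mu]_x (\1_(~` cone) (x, 0) * f x) = 0.
Proof.
rewrite [RHS](_ : _ = \int[mu]_(x in [set: measurableTypeR R]) (0 : R)); last by rewrite Rintegral_cst// mul0r.
apply: eq_Rintegral => x _; rewrite indicE memNset ?mul0r//.
by rewrite /cone /= normr0; apply.
Qed.

Lemma dispersive_phase_section r al be ga k s x (a y : R) :
  dispersive_phase r al be ga k s x (a, y) =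
  cos ((s + x.1 * a) + x.2 * y + k * Num.sqrt (a ^+ 2 + y ^+ 2)) * cone_amplitude r al be ga a y.
Proof. by rewrite /dispersive_phase norm2E /dot2/= [X in cos (X + _)]addrA. Qed.

Lemma dispersive_phase_sectionC r al be ga k s x (a y : R) :
  dispersive_phase r al be ga k s x (y, a) =
  cos ((s + x.2 * a) + x.1 * y + k * Num.sqrt (a ^+ 2 + y ^+ 2)) * cone_amplitude r ga be al a y.
Proof.
rewrite /dispersive_phase norm2E /dot2/= cone_amplitudeC [y ^+ 2 + _]addrC; congr (cos _ * _).
by congr (_ + _); ring.
Qed.

Lemma continuous_cone_amplitude (r al be ga a : R) : a != 0 -> continuous (cone_amplitude r al be ga a).
Proof.
move=> a0; have g0 (y : R) : 0 < a ^+ 2 + y ^+ 2 by rewrite ltr_pwDl ?sqr_ge0// exprn_even_gt0.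
have dg (y : R) : is_derive y 1 (fun y : R => a ^+ 2 + y ^+ 2) (2 * y).
  by apply: is_derive_eq; rewrite /GRing.scale/=; ring.
move=> y; apply: cvgM.
  apply: cvgM.
    by apply: (@is_derive1_continuous _ (fun y : R => al * a ^+ 2 + be * (a * y) + ga * y ^+ 2)).
  have := @is_derive1_inv _ (fun y : R => a ^+ 2 + y ^+ 2) y _ (lt0r_neq0 (g0 y)) (dg y).
  exact: is_derive1_continuous.
apply: (@continuous_pow_line _ _ (fun y => 1 + (a ^+ 2 + y ^+ 2))); last by move=> z; rewrite ltr_pwDl// ltW.
by move=> z; apply: cvgD; [exact: cvg_cst|exact: is_derive1_continuous (dg z)].
Qed.

Lemma continuous_dispersive_section (r al be ga k p x2 a : R) : a != 0 ->
  continuous (fun y : R => cos (p + x2 * y + k * Num.sqrt (a ^+ 2 + y ^+ 2)) * cone_amplitude r al be ga a y).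
Proof.
move=> a0 y; apply: cvgM; last exact: continuous_cone_amplitude.
apply: (@continuous_comp _ _ _ (fun y : R => p + x2 * y + k * Num.sqrt (a ^+ 2 + y ^+ 2)) cos); last exact: continuous_cos.
apply: cvgD; first by apply: (@is_derive1_continuous _ (fun y : R => p + x2 * y)).
apply: cvgMr; apply: (@continuous_comp _ _ _ (fun y : R => a ^+ 2 + y ^+ 2) Num.sqrt); last exact: sqrt_continuous.
by apply: (@is_derive1_continuous _ (fun y : R => a ^+ 2 + y ^+ 2)).
Qed.

(** For t <= 1 the integral of the modulus suffices. For t > 1 the cone and its complement are
    treated alike by exchanging the coordinates; the section bound, a multiple of (c t)^(-1/2)
    <a>^(-(r - 1)), is integrable in a since r > 2. The bound is uniform in x because x enters the
    phase linearly. *)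
Lemma dispersive_kernel (r c : R) : 2 < r -> 0 < c ->
  exists2 C : R, 0 < C & forall al be ga s t x, `|al| <= 1 -> `|be| <= 1 -> `|ga| <= 1 -> 0 <= t ->
    `|\int[leb2 R]_xi dispersive_phase r al be ga (c * t) s x xi| <= C * (1 + t) `^ (- 2^-1).
Proof.
move=> r2 c0; have r0 : 0 <= r by lra.
pose q := r / 2 / 2; have q1 : 2^-1 < q by rewrite /q; lra.
have iq := @integrable_line_weight R q q1; pose J1 := \int[mu]_y line_weight q y.
pose q' := (r - 1) / 2; have q1' : 2^-1 < q' by rewrite /q'; lra.
have iq' := @integrable_line_weight R q' q1'; pose J2 := \int[mu]_y line_weight q' y.
have J10 : 0 <= J1 by apply: Rintegral_ge0 => y _; exact: ltW (line_weight_gt0 _ _).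
have J20 : 0 <= J2 by apply: Rintegral_ge0 => y _; exact: ltW (line_weight_gt0 _ _).
pose D := 10 + 4 * r + 8 * pi : R.
have D0 : 0 <= D by rewrite /D; have := pi_ge0 R; lra.
have sc0 : 0 < Num.sqrt c by rewrite sqrtr_gt0.
have iZ := rintegrableZ 2 iq.
pose C := 2 * (2 * J1 * J1) + 4 * (D / Num.sqrt c * J2) + 1.
have DJ : 0 <= D / Num.sqrt c * J2 by rewrite mulr_ge0 ?divr_ge0 ?(ltW sc0).
have JJ : 0 <= 2 * J1 * J1 by rewrite !mulr_ge0.
exists C; first by rewrite /C; lra.
move=> al be ga s t x al1 be1 ga1 t0.
have mf := measurable_dispersive_phase r al be ga (c * t) s x.
set f := dispersive_phase r al be ga (c * t) s x in mf *.
have t1 : 0 < 1 + t by rewrite ltr_pwDl.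
have st : 0 < Num.sqrt (1 + t) by rewrite sqrtr_gt0.
have fle xi : `|f xi| <= 2 * line_weight q xi.1 * line_weight q xi.2 by exact: dispersive_phase_le.
rewrite powRN powR12_sqrt ?(ltW t1)//.
have [tle|tgt] := leP t 1.
  apply: (@le_trans _ _ (2 * J1 * J1)).
    have [itens Etens] := plane_tensor iZ iq.
    have if_ : (leb2 R).-integrable setT (EFin \o f) by apply: rintegrable_le itens.
    apply: le_trans (norm_Rintegral_le if_ itens fle) _.
    by rewrite Etens RintegralZl.
  have h : 2^-1 <= (Num.sqrt (1 + t))^-1.
    rewrite lef_pV2 ?posrE// -(@ler_pXn2r _ 2) ?nnegrE ?(ltW st)// sqr_sqrtr ?(ltW t1)//; lra.
  have := ler_wpM2r JJ h; rewrite /C; nra.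
have tp : 0 < t by lra.
have k0 : 0 < c * t by rewrite mulr_gt0.
have sE : Num.sqrt (c * t) = Num.sqrt c * Num.sqrt t by rewrite sqrtrM// ltW.
have st0 : 0 < Num.sqrt t by rewrite sqrtr_gt0.
have B0 (B : R) : 0 <= B -> D / Num.sqrt (c * t) * B <= 2 * (D / Num.sqrt c * B) * (Num.sqrt (1 + t))^-1.
  move=> B0; rewrite sE invfM mulrA.
  have h : (Num.sqrt t)^-1 <= 2 * (Num.sqrt (1 + t))^-1.
    rewrite ler_pdivlMr// ler_pdivrMl// -(@ler_pXn2r _ 2) ?nnegrE ?mulr_ge0 ?(ltW st) ?(ltW st0)//.
    rewrite exprMn !sqr_sqrtr ?(ltW t1) ?(ltW tp)//; lra.
  have hD : 0 <= D / Num.sqrt c * B by rewrite mulr_ge0 ?divr_ge0 ?(ltW sc0).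
  have := ler_wpM2l hD h; set Z := (Num.sqrt c)^-1; nra.
have iB := rintegrableZ (D / Num.sqrt (c * t)) iq'.
have EB : \int[mu]_y (D / Num.sqrt (c * t) * line_weight q' y) = D / Num.sqrt (c * t) * J2 by rewrite RintegralZl.
have mI (A : set (plane R)) : measurable A -> measurable_fun setT (fun z => \1_A z * f z).
  by move=> mA; apply: measurable_funM => //; exact: measurable_indic.
have Ile (A : set (plane R)) z : `|\1_A z * f z| <= 2 * line_weight q z.1 * line_weight q z.2.
  apply: le_trans (fle z); rewrite normrM ler_piMl// indicE; case: (_ \in _); by rewrite ?normr1 ?normr0.
have mC := measurableC measurable_cone.
have [itens _] := plane_tensor iZ iq.
have iI (A : set (plane R)) : measurable A -> (leb2 R).-integrable setT (EFin \o (fun z => \1_A z * f z)).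
  by move=> mA; apply: rintegrable_le itens => //; exact: mI.
have -> : \int[leb2 R]_xi f xi = \int[leb2 R]_xi (\1_cone xi * f xi) + \int[leb2 R]_xi (\1_(~` cone) xi * f xi).
  rewrite -(leb2_RintegralD (iI _ measurable_cone) (iI _ mC)); apply: eq_Rintegral => z _.
  rewrite -mulrDl !indicE in_setC; case: (_ \in _); by rewrite ?addr0 ?add0r mul1r.
apply: (@le_trans _ _ (D / Num.sqrt (c * t) * J2 + D / Num.sqrt (c * t) * J2)).
  apply: le_trans (ler_normD _ _) _; rewrite -EB; apply: lerD.
    apply: (plane_section_bound2 (mI _ measurable_cone) iZ iq (Ile _) iB) => a.
    rewrite cone_section /f; under eq_Rintegral do rewrite dispersive_phase_section.
    have [->|a0] := eqVneq a 0; last exact: cone_section_bound.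
    rewrite normr0 oppr0 set_itv1 Rintegral_set1 normr0 mulr_ge0 ?divr_ge0 ?sqrtr_ge0//.
    exact: ltW (line_weight_gt0 _ _).
  apply: (plane_section_bound1 (mI _ mC) iZ iq (Ile _) iB) => a.
  have [->|a0] := eqVneq a 0.
    rewrite coneC_section0 normr0 mulr_ge0 ?divr_ge0 ?sqrtr_ge0//.
    exact: ltW (line_weight_gt0 _ _).
  rewrite /f; under eq_Rintegral do rewrite dispersive_phase_sectionC.
  rewrite coneC_section; last exact: continuous_dispersive_section.
  exact: cone_section_bound.
have h1 := B0 _ J20; have si : 0 <= (Num.sqrt (1 + t))^-1 by rewrite invr_ge0 ltW.
have := mulr_ge0 JJ si; rewrite /C; nra.
Qed.

End dispersive_kernel.

(** * The system at one frequency *)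

Section planar_system.
Context (R : realType).

Definition planar_system (k g x y a11 a12 a22 : R) (u1 u2 v1 v2 f : R -> R) : Prop :=
  (forall t : R, 0 < t ->
    [/\ is_derive t 1 u1 (v1 t), is_derive t 1 u2 (v2 t),
        is_derive t 1 v1 (- (a11 * u1 t + a12 * u2 t) + g * x * f t),
        is_derive t 1 v2 (- (a12 * u1 t + a22 * u2 t) + g * y * f t) &
        is_derive t 1 f (- k * (x ^+ 2 + y ^+ 2) * f t - g * (x * v1 t + y * v2 t))]) /\
  [/\ u1 t @[t --> (0 : R)^'+] --> u1 0, u2 t @[t --> (0 : R)^'+] --> u2 0,
      v1 t @[t --> (0 : R)^'+] --> v1 0, v2 t @[t --> (0 : R)^'+] --> v2 0 &
      f t @[t --> (0 : R)^'+] --> f 0].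

Definition planar_energy (a11 a12 a22 u1 u2 v1 v2 f : R) : R :=
  v1 ^+ 2 + v2 ^+ 2 + (a11 * u1 ^+ 2 + 2 * a12 * (u1 * u2) + a22 * u2 ^+ 2) + f ^+ 2.

Lemma cvg_lin2 (a b : R) (f g : R -> R) :
  f t @[t --> (0 : R)^'+] --> f 0 -> g t @[t --> (0 : R)^'+] --> g 0 ->
  (a * f t + b * g t) @[t --> (0 : R)^'+] --> a * f 0 + b * g 0.
Proof. by move=> cf cg; apply: cvgD; exact: cvgMr. Qed.

Lemma is_derive1_lin2 (a b t df dg : R) (f g : R -> R) : is_derive t 1 f df -> is_derive t 1 g dg ->
  is_derive t 1 (fun s => a * f s + b * g s) (a * df + b * dg).
Proof.
move=> hf hg; have h := is_derive1_add (is_derive1_mul (is_derive1_cst t a) hf) (is_derive1_mul (is_derive1_cst t b) hg).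
by apply: (is_derive_eq h); rewrite !mul0r !add0r.
Qed.

Lemma cvgX2 (f : R -> R) : f t @[t --> (0 : R)^'+] --> f 0 -> f t ^+ 2 @[t --> (0 : R)^'+] --> f 0 ^+ 2.
Proof. by move=> cf; rewrite expr2; under eq_fun do rewrite expr2; exact: cvgM. Qed.

Lemma sqr_lin2_le (a b c d : R) : (a * c + b * d) ^+ 2 <= (a ^+ 2 + b ^+ 2) * (c ^+ 2 + d ^+ 2).
Proof. have := sqr_ge0 (a * d - b * c); nra. Qed.

(* The determinant of (n, A(n) n) is the obstruction to recovering v from n.v
   and A(n)n.v by Cramer's rule. *)
Lemma planar_decay (k g al be D0 : R) : 0 < k -> 0 < g -> 0 < al -> 0 < be -> 0 < D0 ->
  exists2 c : R, 0 < c & forall (rho n1 n2 a11 a12 a22 : R) (u1 u2 v1 v2 f : R -> R),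
    0 < rho -> n1 ^+ 2 + n2 ^+ 2 = 1 ->
    (forall p q : R, al * (p ^+ 2 + q ^+ 2) <= a11 * p ^+ 2 + 2 * a12 * (p * q) + a22 * q ^+ 2 <=
       be * (p ^+ 2 + q ^+ 2)) ->
    `|a11| <= be -> `|a12| <= be -> `|a22| <= be -> D0 <= a11 * a22 - a12 ^+ 2 ->
    planar_system k g (rho * n1) (rho * n2) (rho ^+ 2 * a11) (rho ^+ 2 * a12) (rho ^+ 2 * a22) u1 u2 v1 v2 f ->
    forall t, 0 <= t ->
    planar_energy (rho ^+ 2 * a11) (rho ^+ 2 * a12) (rho ^+ 2 * a22) (u1 t) (u2 t) (v1 t) (v2 t) (f t) <=
    3 * expR (- (c * (n1 * (a12 * n1 + a22 * n2) - n2 * (a11 * n1 + a12 * n2)) ^+ 2 *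
                   (rho ^+ 2 / (1 + rho ^+ 2)) * t)) *
    planar_energy (rho ^+ 2 * a11) (rho ^+ 2 * a12) (rho ^+ 2 * a22) (u1 0) (u2 0) (v1 0) (v2 0) (f 0).
Proof.
move=> k0 g0 al0 be0 D00.
(* [m] bounds 1 + |A(n) n|^2, the squared norm of the matrix with rows n and A(n) n. *)
pose m := 1 + 8 * be ^+ 2.
have m0 : 0 < m by rewrite /m; have := sqr_ge0 be; lra.
have mi0 : 0 < Num.min 1 al by rewrite lt_min ltr01.
pose e0 := Num.min 1 al / m.
have e00 : 0 < e0 by rewrite divr_gt0.
have T0 : 0 <= 2 * be by lra.
have [c c0 H] := thermal_decay (2 * be + 2 * be ^+ 2) be k0 g0 T0 D00 e00.
(* The energy is recovered from the four scalar products with d = d0^2 / N: Cramer's rule costs [m],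
   and the passage from |v|^2 + rho^2 |u|^2 to the energy costs 1 + be. *)
pose N := m * (1 + be).
have N0 : 0 < N := mulr_gt0 m0 (addr_gt0 ltr01 be0).
exists (c / N); first by rewrite divr_gt0.
move=> rho n1 n2 a11 a12 a22 u1 u2 v1 v2 f rho0 n12 form b11 b12 b22 hD [ode [cu1 cu2 cv1 cv2 cf]] t t0.
pose w1 := a11 * n1 + a12 * n2; pose w2 := a12 * n1 + a22 * n2; pose d0 := n1 * w2 - n2 * w1.
have n1le : n1 ^+ 2 <= 1 by rewrite -n12 lerDl sqr_ge0.
have n2le : n2 ^+ 2 <= 1 by rewrite -n12 lerDr sqr_ge0.
have sq (z : R) : `|z| <= be -> z ^+ 2 <= be ^+ 2.
  by move=> hz; rewrite -[z ^+ 2]real_normK ?num_real// lerXn2r ?nnegrE// (le_trans _ hz).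
have w12 : w1 ^+ 2 + w2 ^+ 2 <= 8 * be ^+ 2.
  have h1 := sqr_lin2_le a11 a12 n1 n2; have h2 := sqr_lin2_le a12 a22 n1 n2.
  rewrite n12 !mulr1 in h1 h2; have := sq _ b11; have := sq _ b12; have := sq _ b22.
  by have := sqr_ge0 be; rewrite /w1 /w2; clear -h1 h2; lra.
have mw : 1 + (w1 ^+ 2 + w2 ^+ 2) <= m by rewrite /m; clear -w12; lra.
have formT s := form (u1 s) (u2 s).
pose E s := planar_energy (rho ^+ 2 * a11) (rho ^+ 2 * a12) (rho ^+ 2 * a22) (u1 s) (u2 s) (v1 s) (v2 s) (f s).
have d0le : d0 ^+ 2 <= m.
  have := sqr_lin2_le n1 n2 w2 (- w1); rewrite n12 mul1r sqrrN mulrN -/d0; clear -mw; lra.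
have dE : c / N * d0 ^+ 2 * (rho ^+ 2 / (1 + rho ^+ 2)) * t = c * (d0 ^+ 2 / N) * (rho ^+ 2 / (1 + rho ^+ 2)) * t.
  by rewrite -[c / N * _]mulrA [N^-1 * _]mulrC.
rewrite -/w1 -/w2 -/d0 dE.
apply: (H rho (a11 + a22) (a11 * a22 - a12 ^+ 2) (n1 * w1 + n2 * w2) (d0 ^+ 2 / N)
  (fun s => n1 * v1 s + n2 * v2 s) (fun s => w1 * v1 s + w2 * v2 s)
  (fun s => rho * (n1 * u1 s + n2 * u2 s)) (fun s => rho * (w1 * u1 s + w2 * u2 s)) f E).
- exact: rho0.
- by apply: le_trans (ler_normD _ _) _; clear -b11 b22; lra.
- exact: hD.
- apply: le_trans (ler_normB _ _) _; apply: lerD; first by apply: le_trans (ler_normD _ _) _; clear -b11 b22; lra.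
  apply: le_trans (ler_normB _ _) _; rewrite normrM [`|a12 ^+ 2|]ger0_norm ?sqr_ge0//.
  have h : `|a11| * `|a22| <= be * be by rewrite ler_pM.
  have := sq _ b12; clear -h; lra.
- have h := form n1 n2; rewrite n12 !mulr1 in h.
  have -> : n1 * w1 + n2 * w2 = a11 * n1 ^+ 2 + 2 * a12 * (n1 * n2) + a22 * n2 ^+ 2 by rewrite /w1 /w2; ring.
  by rewrite ler_norml; clear -h al0 be0; lra.
- by rewrite divr_ge0 ?sqr_ge0 ?(ltW N0).
- move=> s s0; have [du1 du2 dv1 dv2 df] := ode s s0; split; last split.
  + split.
    * apply: (is_derive_eq (is_derive1_lin2 n1 n2 dv1 dv2)); rewrite /w1 /w2.
      transitivity (- rho * (rho * ((a11 * n1 + a12 * n2) * u1 s + (a12 * n1 + a22 * n2) * u2 s)) + g * rho * (n1 ^+ 2 + n2 ^+ 2) * f s); first by ring.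
      by rewrite n12 mulr1.
    * apply: (is_derive_eq (is_derive1_lin2 w1 w2 dv1 dv2)); rewrite /w1 /w2; ring.
    * apply: (is_derive_eq (is_derive1_mul (is_derive1_cst s rho) (is_derive1_lin2 n1 n2 du1 du2))); ring.
    * apply: (is_derive_eq (is_derive1_mul (is_derive1_cst s rho) (is_derive1_lin2 w1 w2 du1 du2))); ring.
  + apply: (is_derive_eq df).
    transitivity (- k * (rho ^+ 2 * (n1 ^+ 2 + n2 ^+ 2)) * f s - g * rho * (n1 * v1 s + n2 * v2 s)); first by ring.
    by rewrite n12 mulr1.
  + have h := is_derive1_add (is_derive1_add (is_derive1_add (is_derive1_exp 1 dv1) (is_derive1_exp 1 dv2))
       (is_derive1_add (is_derive1_add (is_derive1_mul (is_derive1_cst s (rho ^+ 2 * a11)) (is_derive1_exp 1 du1))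
          (is_derive1_mul (is_derive1_cst s (2 * (rho ^+ 2 * a12))) (is_derive1_mul du1 du2)))
          (is_derive1_mul (is_derive1_cst s (rho ^+ 2 * a22)) (is_derive1_exp 1 du2)))) (is_derive1_exp 1 df).
    apply: (is_derive_eq h).
    transitivity (- 2 * k * (rho ^+ 2 * (n1 ^+ 2 + n2 ^+ 2)) * f s ^+ 2); first by ring.
    by rewrite n12 mulr1.
- by split; try apply: cvgMr; exact: cvg_lin2.
- exact: cf.
- apply: cvgD; last exact: cvgX2.
  apply: cvgD; first by apply: cvgD; exact: cvgX2.
  apply: cvgD; first by apply: cvgD; apply: cvgMr; [exact: cvgX2|exact: cvgM].
  by apply: cvgMr; exact: cvgX2.
- move=> s s0; have /andP[fl fu] := formT s.
  have hv := sqr_lin2_le n1 n2 (v1 s) (v2 s); have hv' := sqr_lin2_le w1 w2 (v1 s) (v2 s).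
  have hu := sqr_lin2_le n1 n2 (u1 s) (u2 s); have hu' := sqr_lin2_le w1 w2 (u1 s) (u2 s).
  rewrite n12 !mul1r in hv hu.
  set V := v1 s ^+ 2 + v2 s ^+ 2 in hv hv'; set U := u1 s ^+ 2 + u2 s ^+ 2 in fl fu hu hu'.
  have V0 : 0 <= V by rewrite addr_ge0 ?sqr_ge0.
  have U0 : 0 <= U by rewrite addr_ge0 ?sqr_ge0.
  have rU : 0 <= rho ^+ 2 * U by rewrite mulr_ge0 ?sqr_ge0.
  have EE : E s = V + rho ^+ 2 * (a11 * u1 s ^+ 2 + 2 * a12 * (u1 s * u2 s) + a22 * u2 s ^+ 2) + f s ^+ 2.
    by rewrite /E /planar_energy /V; ring.
  have El := ler_wpM2l (sqr_ge0 rho) fl; have Eu := ler_wpM2l (sqr_ge0 rho) fu.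
  have cramer a b : d0 ^+ 2 * (a ^+ 2 + b ^+ 2) <= m * ((n1 * a + n2 * b) ^+ 2 + (w1 * a + w2 * b) ^+ 2).
    have h1 := sqr_lin2_le w2 (- n2) (n1 * a + n2 * b) (w1 * a + w2 * b).
    have h2 := sqr_lin2_le (- w1) n1 (n1 * a + n2 * b) (w1 * a + w2 * b).
    have h3 := ler_wpM2r (addr_ge0 (sqr_ge0 (n1 * a + n2 * b)) (sqr_ge0 (w1 * a + w2 * b))) mw.
    have -> : d0 ^+ 2 * (a ^+ 2 + b ^+ 2) = (w2 * (n1 * a + n2 * b) + - n2 * (w1 * a + w2 * b)) ^+ 2 +
       (- w1 * (n1 * a + n2 * b) + n1 * (w1 * a + w2 * b)) ^+ 2 by rewrite /d0; ring.
    apply: le_trans (lerD h1 h2) (le_trans _ h3); rewrite -mulrDl le_eqVlt; apply/orP; left; apply/eqP.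
    by congr (_ * _); rewrite !sqrrN -n12; ring.
  have cV := cramer (v1 s) (v2 s); have cU := cramer (u1 s) (u2 s).
  have Vm := ler_wpM2r V0 mw; have Um := ler_wpM2r rU mw.
  have F0 := sqr_ge0 (f s).
  rewrite !exprMn -/V -/U in cV cU *; move: cV cU hv hv' hu hu'.
  set Y1 := (n1 * v1 s + n2 * v2 s) ^+ 2; set Y2 := (w1 * v1 s + w2 * v2 s) ^+ 2.
  set Z1 := (n1 * u1 s + n2 * u2 s) ^+ 2; set Z2 := (w1 * u1 s + w2 * u2 s) ^+ 2.
  move=> cV cU hv hv' hu hu'; move: F0; set F := f s ^+ 2 => F0.
  have hu1 := ler_wpM2l (sqr_ge0 rho) hu; have hu2 := ler_wpM2l (sqr_ge0 rho) hu'.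
  have cU' := ler_wpM2l (sqr_ge0 rho) cU.
  clear H ode formT form b11 b12 b22 hD cu1 cu2 cv1 cv2 cf cramer cU w12.
  split.
    have mF : F <= m * F by rewrite ler_peMl// /m; have := sqr_ge0 be; clear; lra.
    apply: (@le_trans _ _ (e0 * (m * (V + rho ^+ 2 * U + F)))).
      rewrite ler_wpM2l ?(ltW e00)//; move: hu2 Um; rewrite mulrCA; clear -Vm hv hv' hu1 mF; lra.
    have -> : e0 * (m * (V + rho ^+ 2 * U + F)) = Num.min 1 al * (V + rho ^+ 2 * U + F).
      by rewrite /e0; field; rewrite gt_eqF.
    have m1 : Num.min 1 al <= 1 by rewrite ge_min lexx.
    have m2 : Num.min 1 al <= al by rewrite ge_min lexx orbT.
    have e1 := ler_wpM2r V0 m1; have e2 := ler_wpM2r rU m2; have e3 := ler_wpM2r F0 m1.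
    by rewrite EE -/F; move: El; rewrite mulrCA; clear -e1 e2 e3; lra.
  rewrite mulrAC ler_pdivrMr//.
  have dd := sqr_ge0 d0.
  have b1 : E s <= (1 + be) * (V + rho ^+ 2 * U + F).
    have e1 := mulr_ge0 (ltW be0) V0; have e2 := mulr_ge0 (ltW be0) F0.
    by rewrite EE -/F; move: Eu; rewrite mulrCA; clear -e1 e2 rU; lra.
  apply: le_trans (ler_wpM2l dd b1) _.
  have -> : d0 ^+ 2 * ((1 + be) * (V + rho ^+ 2 * U + F)) = (1 + be) * (d0 ^+ 2 * V + rho ^+ 2 * (d0 ^+ 2 * U) + d0 ^+ 2 * F) by ring.
  have -> : (Y1 + Y2 + rho ^+ 2 * Z1 + rho ^+ 2 * Z2 + F) * N = (1 + be) * (m * (Y1 + Y2) + rho ^+ 2 * (m * (Z1 + Z2)) + m * F).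
    by rewrite /N; ring.
  rewrite ler_wpM2l ?addr_ge0 ?(ltW be0)//.
  by have := ler_wpM2r F0 d0le; clear -cV cU'; lra.
- exact: t0.
Qed.
End planar_system.

Section isotropic_system.
Context (R : realType).

Lemma derive0_const (f : R -> R) : (forall t : R, 0 < t -> is_derive t 1 f 0) ->
  f t @[t --> (0 : R)^'+] --> f 0 -> forall t, 0 <= t -> f t = f 0.
Proof.
move=> df cf t t0; apply/eqP; rewrite eq_le; apply/andP; split.
  have h := @differential_inequality_decay R f (fun=> 0) 0 df cf _ t t0.
  by move: h; rewrite mul0r oppr0 expR0 mul1r; apply=> s _; rewrite mul0r.
have df' (s : R) : 0 < s -> is_derive s 1 (fun s => - f s) 0.
  by move=> s0; apply: (is_derive_eq (is_derive1_opp (df s s0))); rewrite oppr0.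
have cf' : - f s @[s --> (0 : R)^'+] --> - f 0 by apply: cvgN.
have h := @differential_inequality_decay R (fun s => - f s) (fun=> 0) 0 df' cf' _ t t0.
by move: h; rewrite mul0r oppr0 expR0 mul1r lerN2; apply=> s _; rewrite mul0r.
Qed.

(** Rotating back by the angle w t gives two quantities with zero derivative. *)
Lemma rotation_solution (w : R) (q h : R -> R) :
  (forall t : R, 0 < t -> is_derive t 1 q (- w * h t) /\ is_derive t 1 h (w * q t)) ->
  q t @[t --> (0 : R)^'+] --> q 0 -> h t @[t --> (0 : R)^'+] --> h 0 ->
  forall t, 0 <= t -> q t = cos (w * t) * q 0 - sin (w * t) * h 0 /\
                      h t = sin (w * t) * q 0 + cos (w * t) * h 0.
Proof.
move=> ode cq ch t t0.
pose P s := cos (w * s) * q s + sin (w * s) * h s.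
pose Q s := cos (w * s) * h s + - sin (w * s) * q s.
have dw (s : R) : is_derive s 1 (fun s => w * s) w.
  by apply: (is_derive_eq (is_derive1_mul (is_derive1_cst s w) (is_derive1_id s))); rewrite mul0r add0r mulr1.
have cc : cos (w * s) @[s --> (0 : R)^'+] --> cos (w * 0).
  by apply: cvg_at_right_filter; exact: is_derive1_continuous (is_derive1_cos (dw 0)).
have cs : sin (w * s) @[s --> (0 : R)^'+] --> sin (w * 0).
  by apply: cvg_at_right_filter; exact: is_derive1_continuous (is_derive1_sin (dw 0)).
have P0 : P t = P 0.
  apply: derive0_const; [|by apply: cvgD; exact: cvgM|exact: t0].
  move=> s s0; have [dq dh] := ode s s0.
  have h1 := is_derive1_add (is_derive1_mul (is_derive1_cos (dw s)) dq) (is_derive1_mul (is_derive1_sin (dw s)) dh).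
  by apply: (is_derive_eq h1); ring.
have Q0 : Q t = Q 0.
  apply: derive0_const; [|by apply: cvgD; apply: cvgM => //; exact: cvgN|exact: t0].
  move=> s s0; have [dq dh] := ode s s0.
  have h1 := is_derive1_add (is_derive1_mul (is_derive1_cos (dw s)) dh)
    (is_derive1_mul (is_derive1_opp (is_derive1_sin (dw s))) dq).
  by apply: (is_derive_eq h1); ring.
have P0E : P 0 = q 0 by rewrite /P mulr0 cos0 sin0 mul1r mul0r addr0.
have Q0E : Q 0 = h 0 by rewrite /Q mulr0 cos0 sin0 mul1r oppr0 mul0r addr0.
rewrite -P0E -Q0E -P0 -Q0 /P /Q; have := cos2Dsin2 (w * t).
move: (cos _) (sin _) => c s cs1; split.
  by rewrite -[LHS]mul1r -cs1; ring.
by rewrite -[LHS]mul1r -cs1; ring.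
Qed.

(** The direction n is an eigenvector for [ta] and its normal one for [mu], so the system splits. In
    the longitudinal chain y2 = ta y1 and z2 = ta z1; [thermal_decay] still applies, because the
    energy involves only n.v, rho n.u and f, and for it [d] is a positive constant. *)
Lemma isotropic_solution (k g ta mu : R) : 0 < k -> 0 < g -> 0 < ta -> 0 < mu ->
  exists2 c : R, 0 < c & forall (rho n1 n2 : R) (u1 u2 v1 v2 f : R -> R),
    0 < rho -> n1 ^+ 2 + n2 ^+ 2 = 1 ->
    planar_system k g (rho * n1) (rho * n2) (rho ^+ 2 * (ta * n1 ^+ 2 + mu * n2 ^+ 2))
      (rho ^+ 2 * ((ta - mu) * (n1 * n2))) (rho ^+ 2 * (mu * n1 ^+ 2 + ta * n2 ^+ 2)) u1 u2 v1 v2 f ->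
    forall t, 0 <= t ->
    [/\ (n1 * v1 t + n2 * v2 t) ^+ 2 + ta * (rho * (n1 * u1 t + n2 * u2 t)) ^+ 2 + f t ^+ 2 <=
        3 * expR (- (c * (rho ^+ 2 / (1 + rho ^+ 2)) * t)) *
        ((n1 * v1 0 + n2 * v2 0) ^+ 2 + ta * (rho * (n1 * u1 0 + n2 * u2 0)) ^+ 2 + f 0 ^+ 2),
        n1 * v2 t - n2 * v1 t = cos (Num.sqrt mu * rho * t) * (n1 * v2 0 - n2 * v1 0) -
          sin (Num.sqrt mu * rho * t) * (Num.sqrt mu * rho * (n1 * u2 0 - n2 * u1 0)) &
        Num.sqrt mu * rho * (n1 * u2 t - n2 * u1 t) =
          sin (Num.sqrt mu * rho * t) * (n1 * v2 0 - n2 * v1 0) +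
          cos (Num.sqrt mu * rho * t) * (Num.sqrt mu * rho * (n1 * u2 0 - n2 * u1 0))].
Proof.
move=> k0 g0 ta0 mu0.
have m0 : 0 < 1 + ta ^+ 2 by rewrite ltr_pwDl ?sqr_ge0.
have mi0 : 0 < Num.min 1 ta by rewrite lt_min ltr01.
have m1 : Num.min 1 ta <= 1 by rewrite ge_min lexx.
have m2 : Num.min 1 ta <= ta by rewrite ge_min lexx orbT.
pose e0 := Num.min 1 ta / (1 + ta ^+ 2).
have e00 : 0 < e0 by rewrite divr_gt0.
have em : e0 * (1 + ta ^+ 2) = Num.min 1 ta by rewrite divfK ?gt_eqF.
have e01 : e0 <= 1.
  by apply: le_trans m1; rewrite ler_pdivrMr// ler_peMr ?(ltW mi0)// lerDl sqr_ge0.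
have T0 : 0 <= ta + mu by rewrite addr_ge0 ?ltW.
have D0 : 0 < ta * mu by rewrite mulr_gt0.
have [c c0 H] := thermal_decay (ta + mu + ta * mu) ta k0 g0 T0 D0 e00.
have d0 : 0 < (1 + ta)^-1 by rewrite invr_gt0 addr_gt0.
exists (c / (1 + ta)); first by rewrite mulr_gt0.
move=> rho n1 n2 u1 u2 v1 v2 f rho0 n12 [ode [cu1 cu2 cv1 cv2 cf]] t t0.
pose y s := n1 * v1 s + n2 * v2 s; pose z s := rho * (n1 * u1 s + n2 * u2 s).
pose E s := y s ^+ 2 + ta * z s ^+ 2 + f s ^+ 2.
have dy (s : R) : 0 < s -> is_derive s 1 y (- rho * (ta * z s) + g * rho * f s).
  move=> s0; have [du1 du2 dv1 dv2 df] := ode s s0.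
  apply: (is_derive_eq (is_derive1_lin2 n1 n2 dv1 dv2)); rewrite /z.
  transitivity (- rho * (ta * (rho * ((n1 * u1 s + n2 * u2 s) * (n1 ^+ 2 + n2 ^+ 2)))) + g * rho * (n1 ^+ 2 + n2 ^+ 2) * f s); first by ring.
  by rewrite n12 !mulr1.
have dz (s : R) : 0 < s -> is_derive s 1 z (rho * y s).
  move=> s0; have [du1 du2 dv1 dv2 df] := ode s s0.
  by apply: (is_derive_eq (is_derive1_mul (is_derive1_cst s rho) (is_derive1_lin2 n1 n2 du1 du2))); rewrite mul0r add0r.
have df (s : R) : 0 < s -> is_derive s 1 f (- k * rho ^+ 2 * f s - g * rho * y s).
  move=> s0; have [du1 du2 dv1 dv2 df] := ode s s0; apply: (is_derive_eq df).
  transitivity (- k * (rho ^+ 2 * (n1 ^+ 2 + n2 ^+ 2)) * f s - g * rho * (n1 * v1 s + n2 * v2 s)); first by ring.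
  by rewrite n12 mulr1.
have cy : y s @[s --> (0 : R)^'+] --> y 0 by exact: cvg_lin2.
have cz : z s @[s --> (0 : R)^'+] --> z 0 by apply: cvgMr; exact: cvg_lin2.
pose w := Num.sqrt mu * rho.
have w2 : w ^+ 2 = mu * rho ^+ 2 by rewrite exprMn sqr_sqrtr// ltW.
pose q s := n1 * v2 s + - n2 * v1 s; pose h s := w * (n1 * u2 s + - n2 * u1 s).
have rot (s : R) : 0 < s -> is_derive s 1 q (- w * h s) /\ is_derive s 1 h (w * q s).
  move=> s0; have [du1 du2 dv1 dv2 _] := ode s s0; split.
    apply: (is_derive_eq (is_derive1_lin2 n1 (- n2) dv2 dv1)); rewrite /h.
    transitivity (- (mu * rho ^+ 2) * (n1 * u2 s - n2 * u1 s) * (n1 ^+ 2 + n2 ^+ 2)); first by ring.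
    by rewrite n12 -w2; ring.
  by apply: (is_derive_eq (is_derive1_mul (is_derive1_cst s w) (is_derive1_lin2 n1 (- n2) du2 du1))); rewrite mul0r add0r.
have cq : q s @[s --> (0 : R)^'+] --> q 0 by exact: cvg_lin2.
have ch : h s @[s --> (0 : R)^'+] --> h 0 by apply: cvgMr; exact: cvg_lin2.
have [r1 r2] := rotation_solution rot cq ch t0.
rewrite /q /h !mulNr in r1 r2.
split.
- rewrite -/(y t) -/(z t) -/(y 0) -/(z 0) -/(E t) -/(E 0).
  (* With T = ta + mu and D = ta mu, the expression T z2 - D z1 reduces to ta^2 z, as the equation
     for ta y requires. *)
  apply: (H rho (ta + mu) (ta * mu) ta (1 + ta)^-1 y (fun s => ta * y s) z (fun s => ta * z s) f E).
  + exact: rho0.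
  + by rewrite ger0_norm.
  + exact: lexx.
  + apply: le_trans (ler_normB _ _) _; rewrite !ger0_norm ?(ltW D0)//.
  + by rewrite gtr0_norm.
  + exact: ltW.
  + move=> s s0; split; last split.
    * split; [exact: dy| |exact: dz|].
        by apply: (is_derive_eq (is_derive1_mul (is_derive1_cst s ta) (dy s s0))); ring.
      by apply: (is_derive_eq (is_derive1_mul (is_derive1_cst s ta) (dz s s0))); ring.
    * exact: df.
    * have hE := is_derive1_add (is_derive1_add (is_derive1_exp 1 (dy s s0))
        (is_derive1_mul (is_derive1_cst s ta) (is_derive1_exp 1 (dz s s0)))) (is_derive1_exp 1 (df s s0)).
      by apply: (is_derive_eq hE); ring.
  + by split => //; exact: cvgMr.
  + exact: cf.
  + by apply: cvgD; [apply: cvgD; [exact: cvgX2|apply: cvgMr; exact: cvgX2]|exact: cvgX2].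
  + move=> s s0; rewrite /E; have Y0 := sqr_ge0 (y s); have Z0 := sqr_ge0 (z s); have F0 := sqr_ge0 (f s).
    rewrite [(ta * y s) ^+ 2]exprMn [(ta * z s) ^+ 2]exprMn; set Y := y s ^+ 2 in Y0 *; set Z := z s ^+ 2 in Z0 *; set F := f s ^+ 2 in F0 *.
    split.
      have -> : e0 * (Y + ta ^+ 2 * Y + Z + ta ^+ 2 * Z + F) = e0 * (1 + ta ^+ 2) * (Y + Z) + e0 * F by ring.
      rewrite em; have h1 := ler_wpM2r Y0 m1; have h2 := ler_wpM2r Z0 m2; have h3 := ler_wpM2r F0 e01; clear -h1 h2 h3; lra.
    rewrite ler_pdivrMl ?addr_gt0//.
    have h1 := mulr_ge0 (ltW ta0) Y0; have h2 := mulr_ge0 (ltW ta0) Z0; have h3 := mulr_ge0 (ltW ta0) F0.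
    have h4 := mulr_ge0 (sqr_ge0 ta) Y0; have h5 := mulr_ge0 (sqr_ge0 ta) Z0.
    have h6 := mulr_ge0 (ltW ta0) h4; have h7 := mulr_ge0 (ltW ta0) h5; clear -h1 h2 h3 h4 h5 h6 h7 Y0 Z0 F0; lra.
  + exact: t0.
- exact: r1.
- exact: r2.
Qed.
End isotropic_system.

(** * Real form of the system and square root of the symbol *)

Section fourier_side.
Context (R : realType).
Local Notation C := R[i].
Local Notation Re := complex.Re.
Local Notation Im := complex.Im.
Local Open Scope complex_scope.

Lemma sum2E (V : nmodType) (F : 'I_2 -> V) : \sum_i F i = F 0 + F 1.
Proof. by rewrite !big_ord_recl big_ord0 addr0; congr (_ + F _); apply: val_inj. Qed.

Lemma ord2_ind (P : 'I_2 -> Prop) : P 0 -> P 1 -> forall i, P i.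
Proof.
move=> P0 P1 i; have [->//|-> //] : i = 0 \/ i = 1.
by case: i => [[|[|//]] hi]; [left|right]; apply: val_inj.
Qed.

Lemma ReD (x y : C) : Re (x + y) = Re x + Re y. Proof. by case: x; case: y. Qed.
Lemma ImD (x y : C) : Im (x + y) = Im x + Im y. Proof. by case: x; case: y. Qed.
Lemma ReN (x : C) : Re (- x) = - Re x. Proof. by case: x. Qed.
Lemma ImN (x : C) : Im (- x) = - Im x. Proof. by case: x. Qed.
Lemma ReM (x y : C) : Re (x * y) = Re x * Re y - Im x * Im y. Proof. by case: x; case: y. Qed.
Lemma ImM (x y : C) : Im (x * y) = Re x * Im y + Im x * Re y. Proof. by case: x; case: y. Qed.

Definition complexE := (ReD, ImD, ReN, ImN, ReM, ImM).

Lemma mulmx_col2E (A : 'M[R]_2) (u : 'cV[C]_2) i :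
  (complexify A *m u) i 0 = (A i 0)%:C * u 0 0 + (A i 1)%:C * u 1 0.
Proof. by rewrite mxE sum2E !mxE. Qed.

(** With theta = i f the equations v' = - A u + g f xi and f' = - k |xi|^2 f - g xi.v have real
    coefficients, so the real and imaginary parts decouple. The real part of f is Im theta, its
    imaginary part is - Re theta. *)
Lemma planar_systems (A : plane R -> 'M[R]_2) (k g : R) (xi : plane R) u v th :
  A xi 1 0 = A xi 0 1 -> fourier_system A k g xi u v th ->
  planar_system k g xi.1 xi.2 (A xi 0 0) (A xi 0 1) (A xi 1 1)
    (fun t => Re (u t 0 0)) (fun t => Re (u t 1 0)) (fun t => Re (v t 0 0)) (fun t => Re (v t 1 0))
    (fun t => Im (th t 0 0)) /\
  planar_system k g xi.1 xi.2 (A xi 0 0) (A xi 0 1) (A xi 1 1)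
    (fun t => Im (u t 0 0)) (fun t => Im (u t 1 0)) (fun t => Im (v t 0 0)) (fun t => Im (v t 1 0))
    (fun t => - Re (th t 0 0)).
Proof.
move=> As [[cu cv cth] du dv dth].
have n2 : norm2 xi ^+ 2 = xi.1 ^+ 2 + xi.2 ^+ 2.
  by rewrite norm2E sqr_sqrtr// addr_ge0 ?sqr_ge0.
have vE t i : (- (complexify (A xi) *m u t) - (g%:C * 'i) *: (complexify (col2 xi) *m th t)) i 0 =
   - ((A xi i 0)%:C * u t 0 0 + (A xi i 1)%:C * u t 1 0) - g%:C * 'i * ((col2 xi i 0)%:C * th t 0 0).
  by rewrite [LHS]mxE mxE mulmx_col2E mxE; congr (_ - _); rewrite mxE mxE big_ord_recl big_ord0 addr0 mxE.
have tE t : (- ((k * norm2 xi ^+ 2)%:C *: th t) - (g%:C * 'i) *: ((complexify (col2 xi))^T *m v t)) 0 0 =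
   - ((k * norm2 xi ^+ 2)%:C * th t 0 0) - g%:C * 'i * ((xi.1)%:C * v t 0 0 + (xi.2)%:C * v t 1 0).
  have e (P Q : 'cV[C]_1) a b : (- (a *: P) - b *: Q) 0 0 = - (a * P 0 0) - b * Q 0 0 by rewrite !mxE.
  by rewrite e mxE sum2E !mxE.
split; split.
- move=> t t0; have [u0 _] := du t t0 0; have [u1 _] := du t t0 1.
  have [v0 _] := dv t t0 0; have [v1 _] := dv t t0 1; have [_ th0] := dth t t0 0.
  split => //.
  + by apply: (is_derive_eq v0); rewrite vE !mxE !complexE /=; ring.
  + by apply: (is_derive_eq v1); rewrite vE As !mxE !complexE /=; ring.
  + by apply: (is_derive_eq th0); rewrite tE n2 !complexE /=; ring.
- by split; [case: (cu 0)|case: (cu 1)|case: (cv 0)|case: (cv 1)|case: (cth 0)].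
- move=> t t0; have [_ u0] := du t t0 0; have [_ u1] := du t t0 1.
  have [_ v0] := dv t t0 0; have [_ v1] := dv t t0 1; have [th0 _] := dth t t0 0.
  split => //.
  + by apply: (is_derive_eq v0); rewrite vE !mxE !complexE /=; ring.
  + by apply: (is_derive_eq v1); rewrite vE As !mxE !complexE /=; ring.
  + by apply: (is_derive_eq (is_derive1_opp th0)); rewrite tE n2 !complexE /=; ring.
- split; [by case: (cu 0)|by case: (cu 1)|by case: (cv 0)|by case: (cv 1)|].
  by have [h _] := cth 0; apply: cvgN.
Qed.

Lemma quadratic2E (B : 'M[R]_2) (v : 'cV[R]_2) :
  (v^T *m B *m v) 0 0 = B 0 0 * v 0 0 ^+ 2 + (B 0 1 + B 1 0) * (v 0 0 * v 1 0) + B 1 1 * v 1 0 ^+ 2.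
Proof. by rewrite mxE sum2E !mxE !sum2E !mxE; ring. Qed.

Lemma psd2 (p q s x y : R) : 0 < p -> 0 < p * s - q ^+ 2 -> 0 <= p * x ^+ 2 + 2 * q * (x * y) + s * y ^+ 2.
Proof.
move=> p0 d0; rewrite -(pmulr_rge0 _ p0).
have -> : p * (p * x ^+ 2 + 2 * q * (x * y) + s * y ^+ 2) = (p * x + q * y) ^+ 2 + (p * s - q ^+ 2) * y ^+ 2 by ring.
by rewrite addr_ge0 ?sqr_ge0// mulr_ge0 ?sqr_ge0 ?ltW.
Qed.

(* By Cayley-Hamilton, (A + d) ^ 2 = (tr A + 2 d) A for d ^ 2 = det A. *)
Lemma sqrtmx2 (A : 'M[R]_2) : A 1 0 = A 0 1 -> 0 < A 0 0 -> 0 < A 0 0 * A 1 1 - A 0 1 ^+ 2 ->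
  [/\ (sqrtmx A)^T = sqrtmx A, forall v : 'cV[R]_2, 0 <= (v^T *m sqrtmx A *m v) 0 0 &
      sqrtmx A *m sqrtmx A = A].
Proof.
move=> As p0 d0.
have s0 : 0 < A 1 1.
  by rewrite -(pmulr_rgt0 _ p0); apply: lt_le_trans d0 _; rewrite gerBl sqr_ge0.
pose d := Num.sqrt (A 0 0 * A 1 1 - A 0 1 ^+ 2).
have dE : d ^+ 2 = A 0 0 * A 1 1 - A 0 1 ^+ 2 by rewrite sqr_sqrtr// ltW.
have dp : 0 < d by rewrite sqrtr_gt0.
pose r := Num.sqrt (A 0 0 + A 1 1 + 2 * d).
have tr0 : 0 < A 0 0 + A 1 1 + 2 * d by rewrite !addr_gt0 ?mulr_gt0.
have r2 : r ^+ 2 = A 0 0 + A 1 1 + 2 * d by rewrite sqr_sqrtr// ltW.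
have r0 : 0 < r by rewrite sqrtr_gt0.
have A01 : (1 == 0 :> 'I_2) = false by [].
have A10 : (0 == 1 :> 'I_2) = false by [].
pose B := r^-1 *: (A + d%:M).
have B00 : B 0 0 = r^-1 * (A 0 0 + d) by rewrite !mxE eqxx.
have B01 : B 0 1 = r^-1 * A 0 1 by rewrite !mxE A10 addr0.
have B10 : B 1 0 = r^-1 * A 0 1 by rewrite !mxE A01 addr0 As.
have B11 : B 1 1 = r^-1 * (A 1 1 + d) by rewrite !mxE eqxx.
apply: (@xgetPex _ 0 [set B | [/\ B^T = B,
                      forall v : 'cV[R]_2, 0 <= (v^T *m B *m v) 0 0 &
                      B *m B = A]]); exists B; split.
- by apply/matrixP; apply: ord2_ind; apply: ord2_ind; rewrite !mxE ?As// A01 A10.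
- move=> v; rewrite quadratic2E B00 B01 B10 B11.
  have h := @psd2 (A 0 0) (A 0 1) (A 1 1) (v 0 0) (v 1 0) p0 d0.
  have -> : r^-1 * (A 0 0 + d) * v 0 0 ^+ 2 + (r^-1 * A 0 1 + r^-1 * A 0 1) * (v 0 0 * v 1 0) + r^-1 * (A 1 1 + d) * v 1 0 ^+ 2 =
    r^-1 * (A 0 0 * v 0 0 ^+ 2 + 2 * A 0 1 * (v 0 0 * v 1 0) + A 1 1 * v 1 0 ^+ 2 + d * (v 0 0 ^+ 2 + v 1 0 ^+ 2)) by ring.
  by rewrite mulr_ge0 ?invr_ge0 ?(ltW r0)// addr_ge0// mulr_ge0 ?(ltW dp)// addr_ge0 ?sqr_ge0.
- have rr : r^-1 * r^-1 * r ^+ 2 = 1 by rewrite -expr2 exprVn mulVf// expf_neq0// gt_eqF.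
  apply/matrixP; apply: ord2_ind; apply: ord2_ind; rewrite mxE sum2E ?B00 ?B01 ?B10 ?B11 ?As -[RHS]mul1r -rr r2.
  + apply: subr0_eq; rewrite (_ : _ - _ = r^-1 * r^-1 * (d ^+ 2 - (A 0 0 * A 1 1 - A 0 1 ^+ 2))); last by ring.
    by rewrite dE subrr mulr0.
  + by ring.
  + by ring.
  + apply: subr0_eq; rewrite (_ : _ - _ = r^-1 * r^-1 * (d ^+ 2 - (A 0 0 * A 1 1 - A 0 1 ^+ 2))); last by ring.
    by rewrite dE subrr mulr0.
Qed.
End fourier_side.

(** * Bounds for the cubic symbol *)

Section cubic_symbol.
Context (R : realType).
Local Notation C := R[i].
Local Notation Re := complex.Re.
Local Notation Im := complex.Im.
Local Open Scope complex_scope.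

(** The hypotheses on [la] say that |la + mu| < ta + mu. With F the diagonal part of the form, (ta +
    mu) 2 |n1 p n2 q| <= F, so the mixed term is at most (1 - e) F. The determinant is a mean of ta
    mu and ((ta + mu)^2 - (la + mu)^2) / 4 with weights (n1^2 - n2^2)^2 and 4 n1^2 n2^2, whose sum
    is 1. *)
Lemma cubic_form_bounds (la mu ta : R) : 0 < mu -> 0 < ta -> - ta - 2 * mu < la -> la < ta ->
  exists al be D0 : R, [/\ 0 < al, 0 < be, 0 < D0 & forall n1 n2 : R, n1 ^+ 2 + n2 ^+ 2 = 1 ->
    let a11 := ta * n1 ^+ 2 + mu * n2 ^+ 2 in let a12 := (la + mu) * (n1 * n2) in
    let a22 := mu * n1 ^+ 2 + ta * n2 ^+ 2 in
    [/\ forall p q : R, al * (p ^+ 2 + q ^+ 2) <= a11 * p ^+ 2 + 2 * a12 * (p * q) + a22 * q ^+ 2 <=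
          be * (p ^+ 2 + q ^+ 2),
        `|a11| <= be, `|a12| <= be, `|a22| <= be & D0 <= a11 * a22 - a12 ^+ 2]].
Proof.
move=> mu0 ta0 lal lau.
pose S := ta + mu; pose th := la + mu.
have thS : `|th| < S by rewrite ltr_norml /S /th; lra.
have S0 : 0 < S by rewrite addr_gt0.
pose m := Num.min ta mu; have m0 : 0 < m by rewrite lt_min ta0.
have mta : m <= ta by rewrite ge_min lexx.
have mmu : m <= mu by rewrite ge_min lexx orbT.
pose e := (S - `|th|) / S; have e0 : 0 < e by rewrite divr_gt0 ?subr_gt0.
have eS : e * S = S - `|th| by rewrite divfK ?gt_eqF.
have th2 : th ^+ 2 < S ^+ 2 by rewrite -[th ^+ 2]real_normK ?num_real// ltrXn2r// nnegrE.
pose D0 := Num.min (ta * mu) ((S ^+ 2 - th ^+ 2) / 4).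
exists (e * m), (2 * S), D0; split.
- exact: mulr_gt0 e0 m0.
- exact: mulr_gt0 (ltr0n _ 2) S0.
- rewrite lt_min (mulr_gt0 ta0 mu0)/=; apply: divr_gt0 => //; by rewrite subr_gt0.
move=> n1 n2 n12; have N1 := sqr_ge0 n1; have N2 := sqr_ge0 n2.
have tn1 := mulr_ge0 (ltW ta0) N1; have tn2 := mulr_ge0 (ltW ta0) N2.
have mn1 := mulr_ge0 (ltW mu0) N1; have mn2 := mulr_ge0 (ltW mu0) N2.
have a1 : ta * n1 ^+ 2 + mu * n2 ^+ 2 <= S.
  have -> : S = ta * (n1 ^+ 2 + n2 ^+ 2) + mu * (n1 ^+ 2 + n2 ^+ 2) by rewrite n12 /S !mulr1.
  lra.
have a2 : mu * n1 ^+ 2 + ta * n2 ^+ 2 <= S.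
  have -> : S = ta * (n1 ^+ 2 + n2 ^+ 2) + mu * (n1 ^+ 2 + n2 ^+ 2) by rewrite n12 /S !mulr1.
  lra.
split.
- move=> p q.
  pose F := ta * ((n1 * p) ^+ 2 + (n2 * q) ^+ 2) + mu * ((n2 * p) ^+ 2 + (n1 * q) ^+ 2).
  have FE : (ta * n1 ^+ 2 + mu * n2 ^+ 2) * p ^+ 2 + (mu * n1 ^+ 2 + ta * n2 ^+ 2) * q ^+ 2 = F by rewrite /F; ring.
  have P0 := sqr_ge0 p; have Q0 := sqr_ge0 q.
  have Fu : F <= S * (p ^+ 2 + q ^+ 2).
    rewrite -FE mulrDr; apply: lerD; exact: ler_wpM2r.
  have Fl : m * (p ^+ 2 + q ^+ 2) <= F.
    have -> : m * (p ^+ 2 + q ^+ 2) = m * ((n1 * p) ^+ 2 + (n2 * q) ^+ 2) + m * ((n2 * p) ^+ 2 + (n1 * q) ^+ 2).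
      transitivity (m * (p ^+ 2 + q ^+ 2) * (n1 ^+ 2 + n2 ^+ 2)); [by rewrite n12 mulr1|ring].
    by apply: lerD; rewrite ler_wpM2r// addr_ge0 ?sqr_ge0.
  have F0 : 0 <= F by apply: le_trans Fl; rewrite mulr_ge0 ?(ltW m0)// addr_ge0.
  pose X := 2 * `|n1 * p * (n2 * q)|.
  have X1 : X <= (n1 * p) ^+ 2 + (n2 * q) ^+ 2.
    rewrite /X -(ger0_norm (ler0n R 2)) -normrM ler_norml.
    by have := sqr_ge0 (n1 * p - n2 * q); have := sqr_ge0 (n1 * p + n2 * q); lra.
  have X2 : X <= (n2 * p) ^+ 2 + (n1 * q) ^+ 2.
    rewrite /X (_ : n1 * p * (n2 * q) = n2 * p * (n1 * q)); last by ring.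
    rewrite -(ger0_norm (ler0n R 2)) -normrM ler_norml.
    by have := sqr_ge0 (n2 * p - n1 * q); have := sqr_ge0 (n2 * p + n1 * q); lra.
  have SX : S * X <= F by rewrite /S mulrDl; apply: lerD; rewrite ler_wpM2l// ltW.
  have X0 : 0 <= X by rewrite mulr_ge0.
  have cross : `|2 * ((la + mu) * (n1 * n2)) * (p * q)| <= (1 - e) * F.
    have -> : 2 * ((la + mu) * (n1 * n2)) * (p * q) = th * (2 * (n1 * p * (n2 * q))) by rewrite /th; ring.
    rewrite normrM normrM (ger0_norm (ler0n R 2)) -/X.
    have -> : `|th| = (1 - e) * S by rewrite mulrBl eS; ring.
    rewrite -mulrA ler_wpM2l// subr_ge0 /e ler_pdivrMr// mul1r gerBl//.
  have -> : (ta * n1 ^+ 2 + mu * n2 ^+ 2) * p ^+ 2 + 2 * ((la + mu) * (n1 * n2)) * (p * q) +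
      (mu * n1 ^+ 2 + ta * n2 ^+ 2) * q ^+ 2 = F + 2 * ((la + mu) * (n1 * n2)) * (p * q) by rewrite -FE; ring.
  move: cross; rewrite ler_norml => /andP[x1 x2].
  have eF : 0 <= e * F by rewrite mulr_ge0 ?(ltW e0).
  have := ler_wpM2l (ltW e0) Fl; rewrite !mulrA -/S => eFl; apply/andP; split; lra.
- by rewrite ger0_norm ?addr_ge0//; lra.
- have h : `|n1 * n2| <= 1 by rewrite ler_norml; have := sqr_ge0 (n1 - n2); have := sqr_ge0 (n1 + n2); lra.
  by rewrite normrM; have := ler_pM (normr_ge0 th) (normr_ge0 (n1 * n2)) (ltW thS) h; rewrite mulr1 -/th; lra.
- by rewrite ger0_norm ?addr_ge0//; lra.
- have -> : (ta * n1 ^+ 2 + mu * n2 ^+ 2) * (mu * n1 ^+ 2 + ta * n2 ^+ 2) - ((la + mu) * (n1 * n2)) ^+ 2 =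
    ta * mu * (n1 ^+ 2 - n2 ^+ 2) ^+ 2 + (S ^+ 2 - th ^+ 2) / 4 * (4 * (n1 ^+ 2 * n2 ^+ 2)) by rewrite /S /th; field.
  have d1 : D0 <= ta * mu by rewrite ge_min lexx.
  have d2 : D0 <= (S ^+ 2 - th ^+ 2) / 4 by rewrite ge_min lexx orbT.
  have h2 : 0 <= 4 * (n1 ^+ 2 * n2 ^+ 2) by rewrite mulr_ge0// mulr_ge0.
  have := ler_wpM2r (sqr_ge0 (n1 ^+ 2 - n2 ^+ 2)) d1; have := ler_wpM2r h2 d2.
  have : D0 = D0 * (n1 ^+ 2 - n2 ^+ 2) ^+ 2 + D0 * (4 * (n1 ^+ 2 * n2 ^+ 2)).
    by transitivity (D0 * (n1 ^+ 2 + n2 ^+ 2) ^+ 2); [rewrite n12 expr1n mulr1|ring].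
  lra.
Qed.

(** The linear factors of n1 n2 (n1^2 - n2^2), with the slopes 0, 1 and -1 written out so that they
    are literally hyperbolic forms. *)
Definition degenerate_forms : seq (plane R -> R) :=
  [:: (fun xi => xi.1 - 0 * xi.2); (fun xi => xi.2 - 0 * xi.1);
      (fun xi => xi.1 - 1 * xi.2); (fun xi => xi.1 - (-1) * xi.2)].

(** The sum dominates whichever of the four exponentials matters in a given direction, and it can be
    integrated term by term. *)
Definition degenerate_decay (c t : R) (xi : plane R) : R :=
  \sum_(l <- degenerate_forms) expR (- (c * t * (l xi ^+ 2 / jap xi ^+ 2))).

Lemma degenerate_decay_ge (c t : R) (xi : plane R) (l : plane R -> R) (z : R) : l \in degenerate_forms ->
  c * t * (l xi ^+ 2 / jap xi ^+ 2) <= z -> expR (- z) <= degenerate_decay c t xi.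
Proof.
move=> hl hz; rewrite /degenerate_decay (big_rem l hl)/=.
apply: (@le_trans _ _ (expR (- (c * t * (l xi ^+ 2 / jap xi ^+ 2))))); first by rewrite ler_expR lerN2.
by rewrite lerDl sumr_ge0// => l' _; exact: expR_ge0.
Qed.

(* 4 (n1 n2)^2 + (n1^2 - n2^2)^2 = 1, so that at most one of the four linear
   factors of n1 n2 (n1^2 - n2^2) is small. *)
Lemma quartic_lower_bound (n1 n2 : R) : n1 ^+ 2 + n2 ^+ 2 = 1 ->
  [\/ n1 ^+ 2 / 8 <= (n1 * n2 * (n1 ^+ 2 - n2 ^+ 2)) ^+ 2,
      n2 ^+ 2 / 8 <= (n1 * n2 * (n1 ^+ 2 - n2 ^+ 2)) ^+ 2,
      (n1 - n2) ^+ 2 / 8 <= (n1 * n2 * (n1 ^+ 2 - n2 ^+ 2)) ^+ 2 |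
      (n1 + n2) ^+ 2 / 8 <= (n1 * n2 * (n1 ^+ 2 - n2 ^+ 2)) ^+ 2].
Proof.
move=> n12; have N1 := sqr_ge0 n1; have N2 := sqr_ge0 n2.
have id : 4 * (n1 * n2) ^+ 2 + (n1 ^+ 2 - n2 ^+ 2) ^+ 2 = 1.
  by transitivity ((n1 ^+ 2 + n2 ^+ 2) ^+ 2); [ring|rewrite n12 expr1n].
have hp : (n1 * n2 * (n1 ^+ 2 - n2 ^+ 2)) ^+ 2 = (n1 * n2) ^+ 2 * (n1 ^+ 2 - n2 ^+ 2) ^+ 2 by rewrite exprMn.
have [h|h] := leP (1 / 2) ((n1 ^+ 2 - n2 ^+ 2) ^+ 2).
  have g : (n1 * n2) ^+ 2 / 2 <= (n1 * n2 * (n1 ^+ 2 - n2 ^+ 2)) ^+ 2.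
    by rewrite hp ler_wpM2l ?sqr_ge0//; lra.
  have [h1|h1] := leP (1 / 2) (n1 ^+ 2).
    by apply: Or42; apply: le_trans g; rewrite exprMn; have := ler_wpM2r N2 h1; lra.
  apply: Or41; apply: le_trans g; rewrite exprMn.
  have h2 : 1 / 2 <= n2 ^+ 2 by lra.
  by have := ler_wpM2l N1 h2; lra.
have g : (n1 ^+ 2 - n2 ^+ 2) ^+ 2 / 8 <= (n1 * n2 * (n1 ^+ 2 - n2 ^+ 2)) ^+ 2.
  by rewrite hp mulrC ler_wpM2r ?sqr_ge0//; lra.
have e : (n1 ^+ 2 - n2 ^+ 2) ^+ 2 = (n1 - n2) ^+ 2 * (n1 + n2) ^+ 2 by rewrite -exprMn; congr (_ ^+ 2); ring.
rewrite e in g; have M1 := sqr_ge0 (n1 - n2); have M2 := sqr_ge0 (n1 + n2).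
have [h1|h1] := leP 1 ((n1 - n2) ^+ 2).
  by apply: Or44; apply: le_trans g; have := ler_wpM2r M2 h1; lra.
apply: Or43; apply: le_trans g.
have h2 : 1 <= (n1 + n2) ^+ 2.
  have : (n1 - n2) ^+ 2 + (n1 + n2) ^+ 2 = 2 * (n1 ^+ 2 + n2 ^+ 2) by ring.
  by rewrite n12; lra.
by have := ler_wpM2l M1 h2; lra.
Qed.

(** The factor 8 offsets the 1/8 of [quartic_lower_bound]. *)
Lemma quartic_decay (c t rho n1 n2 : R) (xi : plane R) : 0 <= c * t -> n1 ^+ 2 + n2 ^+ 2 = 1 ->
  xi = (rho * n1, rho * n2) ->
  expR (- (8 * c * (n1 * n2 * (n1 ^+ 2 - n2 ^+ 2)) ^+ 2 * (rho ^+ 2 / jap xi ^+ 2) * t)) <= degenerate_decay c t xi.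
Proof.
move=> ct n12 xiE.
have J0 : 0 < jap xi ^+ 2 by rewrite exprn_gt0// jap_gt0.
have key (m : R) : m ^+ 2 / 8 <= (n1 * n2 * (n1 ^+ 2 - n2 ^+ 2)) ^+ 2 ->
   c * t * ((rho * m) ^+ 2 / jap xi ^+ 2) <= 8 * c * (n1 * n2 * (n1 ^+ 2 - n2 ^+ 2)) ^+ 2 * (rho ^+ 2 / jap xi ^+ 2) * t.
  move=> h.
  have -> : c * t * ((rho * m) ^+ 2 / jap xi ^+ 2) = 8 * (c * t * (rho ^+ 2 / jap xi ^+ 2)) * (m ^+ 2 / 8).
    by field; rewrite gt_eqF// jap_gt0.
  have -> : 8 * c * (n1 * n2 * (n1 ^+ 2 - n2 ^+ 2)) ^+ 2 * (rho ^+ 2 / jap xi ^+ 2) * t =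
     8 * (c * t * (rho ^+ 2 / jap xi ^+ 2)) * (n1 * n2 * (n1 ^+ 2 - n2 ^+ 2)) ^+ 2 by ring.
  by rewrite ler_wpM2l// mulr_ge0// mulr_ge0// divr_ge0 ?sqr_ge0// ltW.
have [h|h|h|h] := quartic_lower_bound n12; have := key _ h => {h}h.
- apply: (@degenerate_decay_ge _ _ _ (fun xi => xi.1 - 0 * xi.2)); first by rewrite mem_head.
  by rewrite xiE /= mul0r subr0 -xiE.
- apply: (@degenerate_decay_ge _ _ _ (fun xi => xi.2 - 0 * xi.1)); first by rewrite in_cons mem_head orbT.
  by rewrite xiE /= mul0r subr0 -xiE.
- apply: (@degenerate_decay_ge _ _ _ (fun xi => xi.1 - 1 * xi.2)); first by rewrite !in_cons eqxx !orbT.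
  by rewrite xiE /= mul1r -mulrBr -xiE.
- apply: (@degenerate_decay_ge _ _ _ (fun xi => xi.1 - (-1) * xi.2)); first by rewrite !in_cons eqxx !orbT.
  by rewrite xiE /= mulN1r opprK -mulrDr -xiE.
Qed.

End cubic_symbol.

(** * The state at one frequency and its energy *)

Section state_representation.
Context (R : realType).
Local Notation C := R[i].
Local Notation Re := complex.Re.
Local Notation Im := complex.Im.
Local Open Scope complex_scope.

Definition sqabs (z : C) : R := Re z ^+ 2 + Im z ^+ 2.

Lemma sqabs_ge0 z : 0 <= sqabs z. Proof. by rewrite addr_ge0 ?sqr_ge0. Qed.

Lemma vnorm_ge0 n (v : 'cV[C]_n) : 0 <= vnorm v. Proof. exact: sqrtr_ge0. Qed.

Lemma vnorm_sqr n (v : 'cV[C]_n) : vnorm v ^+ 2 = \sum_i sqabs (v i 0).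
Proof. by rewrite sqr_sqrtr// sumr_ge0// => i _; exact: sqabs_ge0. Qed.

Lemma vnorm_col_mx_sqr (v w : 'cV[C]_2) (th : 'cV[C]_1) :
  vnorm (col_mx (col_mx v w) th) ^+ 2 =
  sqabs (v 0 0) + sqabs (v 1 0) + sqabs (w 0 0) + sqabs (w 1 0) + sqabs (th 0 0).
Proof.
rewrite vnorm_sqr big_split_ord/=; under eq_bigr do rewrite col_mxEu.
under [X in _ + X]eq_bigr do rewrite col_mxEd.
rewrite big_split_ord/=; under eq_bigr do rewrite col_mxEu.
under [X in _ + X + _]eq_bigr do rewrite col_mxEd.
by rewrite !sum2E big_ord_recl big_ord0 addr0 addrA.
Qed.

Definition thermo_state (B : 'M[R]_2) (u v : 'cV[C]_2) (th : 'cV[C]_1) : 'cV[C]_(2 + 2 + 1) :=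
  col_mx (col_mx v (complexify B *m u)) th.

(** For B symmetric with B^2 = A, |B u|^2 is the quadratic form of A at u; the squared norm of the
    state is thus the sum of the energies of the two real systems. *)
Lemma thermo_state_energy (A : 'M[R]_2) u v th :
  A 1 0 = A 0 1 -> 0 < A 0 0 -> 0 < A 0 0 * A 1 1 - A 0 1 ^+ 2 ->
  vnorm (thermo_state (sqrtmx A) u v th) ^+ 2 =
  planar_energy (A 0 0) (A 0 1) (A 1 1) (Re (u 0 0)) (Re (u 1 0)) (Re (v 0 0)) (Re (v 1 0)) (Im (th 0 0)) +
  planar_energy (A 0 0) (A 0 1) (A 1 1) (Im (u 0 0)) (Im (u 1 0)) (Im (v 0 0)) (Im (v 1 0)) (- Re (th 0 0)).
Proof.
move=> As A0 dA; have [Bs _ BB] := sqrtmx2 As A0 dA.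
have B10 : sqrtmx A 1 0 = sqrtmx A 0 1 by rewrite -{1}Bs mxE.
have E00 : A 0 0 = sqrtmx A 0 0 ^+ 2 + sqrtmx A 0 1 ^+ 2 by rewrite -{1}BB mxE sum2E B10.
have E01 : A 0 1 = sqrtmx A 0 0 * sqrtmx A 0 1 + sqrtmx A 0 1 * sqrtmx A 1 1 by rewrite -{1}BB mxE sum2E.
have E11 : A 1 1 = sqrtmx A 0 1 ^+ 2 + sqrtmx A 1 1 ^+ 2 by rewrite -{1}BB mxE sum2E B10.
rewrite /thermo_state vnorm_col_mx_sqr !mulmx_col2E B10 /sqabs /planar_energy E00 E01 E11 !complexE /=; ring.
Qed.

Lemma unit2_norm (xi : plane R) : 0 < norm2 xi ->
  (unit2 xi).1 ^+ 2 + (unit2 xi).2 ^+ 2 = 1 /\ xi = (norm2 xi * (unit2 xi).1, norm2 xi * (unit2 xi).2).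
Proof.
move=> r0; have rn : norm2 xi != 0 by rewrite gt_eqF.
split; last by rewrite /unit2 /= !mulrA ![norm2 xi * _]mulrC !mulfK//; case: xi {r0 rn}.
rewrite /unit2 /= !exprMn -mulrDl exprVn norm2E sqr_sqrtr ?addr_ge0 ?sqr_ge0// mulfV//.
by apply: contra rn => /eqP h; rewrite norm2E h sqrtr0.
Qed.

Lemma jap_norm2 (xi : plane R) : jap xi ^+ 2 = 1 + norm2 xi ^+ 2.
Proof. by rewrite jap_sq norm2E sqr_sqrtr// addr_ge0 ?sqr_ge0. Qed.

Lemma cubic_entries (ta la mu : R) (xi : plane R) :
  let A := elastic_symbol (cubic_stiffness ta la mu) xi in let n := unit2 xi in
  0 < norm2 xi ->
  [/\ A 0 0 = norm2 xi ^+ 2 * (ta * n.1 ^+ 2 + mu * n.2 ^+ 2),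
      A 0 1 = norm2 xi ^+ 2 * ((la + mu) * (n.1 * n.2)), A 1 0 = A 0 1 &
      A 1 1 = norm2 xi ^+ 2 * (mu * n.1 ^+ 2 + ta * n.2 ^+ 2)].
Proof.
move=> A n r0; have [_ xiE] := unit2_norm r0.
have x1 : xi.1 = norm2 xi * n.1 by rewrite {1}xiE.
have x2 : xi.2 = norm2 xi * n.2 by rewrite {1}xiE.
rewrite /A !cubic_symbolE !mxE /= x1 x2 /n /unit2 /=.
by split=> //; field; rewrite gt_eqF.
Qed.

(** Taking square roots halves the rate, and 2 exceeds the square root of 3. *)
Lemma sqr_decay (a b z : R) : 0 <= a -> 0 <= b -> a ^+ 2 <= 3 * expR (- z) * b ^+ 2 ->
  a <= 2 * expR (- (z / 2)) * b.
Proof.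
move=> a0 b0 h; rewrite -(@ler_pXn2r _ 2) ?nnegrE ?mulr_ge0 ?expR_ge0//.
apply: le_trans h _; rewrite 2!exprMn ler_wpM2r ?sqr_ge0// -expRM_natl.
have -> : 2 * - (z / 2) = - z by field.
by have := expR_ge0 (- z); lra.
Qed.

Lemma nondegenerate_decay (k g la mu ta : R) : 0 < k -> 0 < g ->
  0 < mu -> 0 < ta -> - ta - 2 * mu < la -> la < ta -> la + 2 * mu - ta != 0 ->
  let A := elastic_symbol (cubic_stiffness ta la mu) in
  exists2 c : R, 0 < c & forall xi u v th, 0 < norm2 xi -> fourier_system A k g xi u v th ->
    forall t, 0 <= t ->
      vnorm (thermo_state (sqrtmx (A xi)) (u t) (v t) (th t)) <=
      2 * degenerate_decay c t xi * vnorm (thermo_state (sqrtmx (A xi)) (u 0) (v 0) (th 0)).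
Proof.
move=> k0 g0 mu0 ta0 lal lau nd A.
have [al [be [D0 [al0 be0 D00 bounds]]]] := cubic_form_bounds mu0 ta0 lal lau.
have [c c0 decay] := planar_decay k0 g0 al0 be0 D00.
pose de := la + 2 * mu - ta; have de2 : 0 < de ^+ 2 by rewrite exprn_even_gt0.
(* The rate is halved by [sqr_decay] and divided by 8 for [quartic_decay]; [de^2] comes from the
   squared determinant, equal to (de n1 n2 (n1^2 - n2^2))^2. *)
exists (c * de ^+ 2 / 16); first by rewrite divr_gt0// mulr_gt0.
move=> xi u v th r0 sys t t0.
have [n12 xiE] := unit2_norm r0.
have [e00 e01 es e11] := cubic_entries ta la mu r0; rewrite -/A in e00 e01 es e11.
have := bounds _ _ n12; move: e00 e01 e11 xiE n12; set n1 := (unit2 xi).1; set n2 := (unit2 xi).2.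
move=> e00 e01 e11 xiE n12 /= [form b11 b12 b22 hD].
have r20 : 0 < norm2 xi ^+ 2 by rewrite exprn_gt0.
have A0 : 0 < A xi 0 0.
  rewrite e00 mulr_gt0//; have := form 1 0; rewrite expr1n expr0n /= mulr0n; lra.
have dA : 0 < A xi 0 0 * A xi 1 1 - A xi 0 1 ^+ 2.
  rewrite e00 e01 e11; have := mulr_gt0 r20 (mulr_gt0 r20 (lt_le_trans D00 hD)).
  by congr (is_true (0 < _)); ring.
have [s1 s2] := planar_systems es sys.
have x1 : xi.1 = norm2 xi * n1 by rewrite {1}xiE.
have x2 : xi.2 = norm2 xi * n2 by rewrite {1}xiE.
rewrite x1 x2 e00 e01 e11 in s1 s2.
have := decay _ _ _ _ _ _ _ _ _ _ _ r0 n12 form b11 b12 b22 hD s1 t t0.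
have := decay _ _ _ _ _ _ _ _ _ _ _ r0 n12 form b11 b12 b22 hD s2 t t0.
rewrite -e00 -e01 -e11 => d2 d1; have d12 := lerD d1 d2.
rewrite -mulrDr -!thermo_state_energy// in d12.
have := sqr_decay (vnorm_ge0 _) (vnorm_ge0 _) d12 => h; apply: le_trans h _.
rewrite ler_wpM2r ?vnorm_ge0// ler_wpM2l//.
have ct : 0 <= c * de ^+ 2 / 16 * t by rewrite mulr_ge0// divr_ge0// mulr_ge0 ?sqr_ge0// ltW.
have := quartic_decay ct n12 xiE; apply: le_trans; rewrite ler_expR lerN2 le_eqVlt; apply/orP; left; apply/eqP.
by rewrite jap_norm2 /de; field; rewrite gt_eqF// ltr_pwDl ?sqr_ge0.
Qed.

End state_representation.

(** * The transversal propagator *)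

Section isotropic_representation.
Context (R : realType).
Local Notation C := R[i].
Local Notation Re := complex.Re.
Local Notation Im := complex.Im.
Local Open Scope complex_scope.

(** With B the square root, y = (B - w) x satisfies B y = - w y because B^2 x = w^2 x; positivity of
    B then forces y = 0. *)
Lemma sqrtmx_eigen (A : 'M[R]_2) (x : 'cV[R]_2) (w : R) :
  A 1 0 = A 0 1 -> 0 < A 0 0 -> 0 < A 0 0 * A 1 1 - A 0 1 ^+ 2 -> 0 < w ->
  A *m x = w ^+ 2 *: x -> sqrtmx A *m x = w *: x.
Proof.
move=> As A0 dA w0 Ax; have [_ psd BB] := sqrtmx2 As A0 dA.
pose y := sqrtmx A *m x - w *: x.
have By : sqrtmx A *m y = - w *: y.
  rewrite mulmxBr mulmxA BB Ax -scalemxAr /y scalerBr scalerA mulNr -expr2 !scaleNr opprK addrC.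
  by [].
have yy : (y^T *m y) 0 0 = y 0 0 ^+ 2 + y 1 0 ^+ 2 by rewrite mxE sum2E !mxE -!expr2.
have := psd y; rewrite -mulmxA By -scalemxAr mxE yy mulNr oppr_ge0 pmulr_rle0// => h.
have y0 : y 0 0 ^+ 2 = 0 by apply/eqP; rewrite eq_le sqr_ge0 andbT; have := sqr_ge0 (y 1 0); lra.
have y1 : y 1 0 ^+ 2 = 0 by apply/eqP; rewrite eq_le sqr_ge0 andbT; have := sqr_ge0 (y 0 0); lra.
apply/subr0_eq/matrixP => i j; rewrite [j]ord1 [RHS]mxE; move: i; apply: ord2_ind.
  by move/eqP: y0; rewrite expf_eq0 => /eqP.
by move/eqP: y1; rewrite expf_eq0 => /eqP.
Qed.

(** Each entry is a quadratic form of the direction times a shifted cosine, so that the weight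
    <xi>^(-r) turns it into a [dispersive_phase]; the shifts account for sines. *)
Definition propagator (w : R) (al be ga s0 : 'M[R]_(2 + 2 + 1)) (t : R) (xi : plane R) :
    'M[R]_(2 + 2 + 1) :=
  \matrix_(i, j) ((al i j * xi.1 ^+ 2 + be i j * (xi.1 * xi.2) + ga i j * xi.2 ^+ 2) /
     (xi.1 ^+ 2 + xi.2 ^+ 2) * cos (s0 i j + w * t * norm2 xi)).

Definition elastic_block (a b c d : 'M[R]_2) : 'M[R]_(2 + 2 + 1) := block_mx (block_mx a b c d) 0 0 0.

(** The orthogonal projection onto the normal of xi, written with the coefficients of xi1^2, xi1 xi2
    and xi2^2 that [propagator] expects. *)
Definition transversal (xi : plane R) : 'M[R]_2 :=
  \matrix_(i, j) (((delta_mx 1 1 : 'M[R]_2) i j * xi.1 ^+ 2 - (delta_mx 0 1 + delta_mx 1 0 : 'M[R]_2) i j * (xi.1 * xi.2)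
     + (delta_mx 0 0 : 'M[R]_2) i j * xi.2 ^+ 2) / (xi.1 ^+ 2 + xi.2 ^+ 2)).

Definition transversal_al := let a : 'M[R]_2 := delta_mx 1 1 in elastic_block a a a a.
Definition transversal_be := let a : 'M[R]_2 := - (delta_mx 0 1 + delta_mx 1 0) in elastic_block a a a a.
Definition transversal_ga := let a : 'M[R]_2 := delta_mx 0 0 in elastic_block a a a a.
(** cos(pi/2 + z) = - sin z and cos(- pi/2 + z) = sin z give the off-diagonal blocks of the
    rotation. *)
Definition transversal_shift := elastic_block 0 (const_mx (pi / 2)) (const_mx (- (pi / 2))) 0.

Lemma transversal_propagator w t xi :
  propagator w transversal_al transversal_be transversal_ga transversal_shift t xi =
  elastic_block (cos (w * t * norm2 xi) *: transversal xi) (- sin (w * t * norm2 xi) *: transversal xi)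
    (sin (w * t * norm2 xi) *: transversal xi) (cos (w * t * norm2 xi) *: transversal xi).
Proof.
set z := w * t * norm2 xi.
have cp : cos (pi / 2 + z) = - sin z by rewrite cosD cos_pihalf sin_pihalf mul0r mul1r sub0r.
have cn : cos (- (pi / 2) + z) = sin z by rewrite cosD cosN sinN cos_pihalf sin_pihalf mul0r mulN1r sub0r opprK.
have c0 : cos (0 + z) = cos z by rewrite add0r.
apply/matrixP => i j; rewrite mxE /transversal_al /transversal_be /transversal_ga /transversal_shift /elastic_block.
case: (split_ordP i) => i' ->; case: (split_ordP j) => j' ->;
  rewrite ?block_mxEul ?block_mxEur ?block_mxEdl ?block_mxEdr.
- case: (split_ordP i') => i1 ->; case: (split_ordP j') => j1 ->;
    rewrite ?block_mxEul ?block_mxEur ?block_mxEdl ?block_mxEdr [RHS]mxE [transversal _ _ _]mxE.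
  + rewrite [(0 : 'M[R]_2) _ _]mxE c0 mulrC [(- _ : 'M[R]_2) _ _]mxE mulNr//.
  + rewrite [const_mx _ _ _]mxE cp mulrC [(- _ : 'M[R]_2) _ _]mxE !mulNr//.
  + rewrite [const_mx _ _ _]mxE cn mulrC [(- _ : 'M[R]_2) _ _]mxE mulNr//.
  + rewrite [(0 : 'M[R]_2) _ _]mxE c0 mulrC [(- _ : 'M[R]_2) _ _]mxE mulNr//.
- by rewrite !mxE !mul0r !addr0 !mul0r.
- by rewrite !mxE !mul0r !addr0 !mul0r.
- by rewrite !mxE !mul0r !addr0 !mul0r.
Qed.

Lemma transversal_entries (xi : plane R) : 0 < norm2 xi -> let n := unit2 xi in
  [/\ transversal xi 0 0 = n.2 ^+ 2, transversal xi 0 1 = - (n.1 * n.2),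
      transversal xi 1 0 = - (n.1 * n.2) & transversal xi 1 1 = n.1 ^+ 2].
Proof.
move=> r0 n; have rr : xi.1 ^+ 2 + xi.2 ^+ 2 = norm2 xi ^+ 2.
  by rewrite norm2E sqr_sqrtr// addr_ge0 ?sqr_ge0.
have A01 : (1 == 0 :> 'I_2) = false by [].
have A10 : (0 == 1 :> 'I_2) = false by [].
by rewrite !mxE rr !eqxx A01 A10 /= /n /unit2 /=; split; field; rewrite gt_eqF.
Qed.

(** The last two hypotheses say that the transversal components are rotated. Since n and its normal
    form an orthonormal basis, what is left after subtracting the propagated projection is the
    longitudinal part. *)
Lemma transversal_remainder (n1 n2 p00 p01 p10 p11 c s v0 v1 y0 y1 v0' v1' y0' y1' : R) :
  n1 ^+ 2 + n2 ^+ 2 = 1 ->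
  p00 = n2 ^+ 2 -> p01 = - (n1 * n2) -> p10 = - (n1 * n2) -> p11 = n1 ^+ 2 ->
  n1 * v1 - n2 * v0 = c * (n1 * v1' - n2 * v0') - s * (n1 * y1' - n2 * y0') ->
  n1 * y1 - n2 * y0 = s * (n1 * v1' - n2 * v0') + c * (n1 * y1' - n2 * y0') ->
  (v0 - (c * p00 * v0' + c * p01 * v1' + (- s * p00 * y0' + - s * p01 * y1'))) ^+ 2 +
  (v1 - (c * p10 * v0' + c * p11 * v1' + (- s * p10 * y0' + - s * p11 * y1'))) ^+ 2 +
  (y0 - (s * p00 * v0' + s * p01 * v1' + (c * p00 * y0' + c * p01 * y1'))) ^+ 2 +
  (y1 - (s * p10 * v0' + s * p11 * v1' + (c * p10 * y0' + c * p11 * y1'))) ^+ 2 =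
  (n1 * v0 + n2 * v1) ^+ 2 + (n1 * y0 + n2 * y1) ^+ 2.
Proof.
move=> n12 -> -> -> -> hq hh.
have d a b : n1 * (n1 * a + n2 * b) - n2 * (n1 * b - n2 * a) = a.
  by transitivity ((n1 ^+ 2 + n2 ^+ 2) * a); [ring|rewrite n12 mul1r].
have d' a b : n2 * (n1 * a + n2 * b) + n1 * (n1 * b - n2 * a) = b.
  by transitivity ((n1 ^+ 2 + n2 ^+ 2) * b); [ring|rewrite n12 mul1r].
have t0 : v0 - (c * n2 ^+ 2 * v0' + c * - (n1 * n2) * v1' + (- s * n2 ^+ 2 * y0' + - s * - (n1 * n2) * y1')) = n1 * (n1 * v0 + n2 * v1).
  by rewrite -[X in X - _](d v0 v1) hq; ring.
have t1 : v1 - (c * - (n1 * n2) * v0' + c * n1 ^+ 2 * v1' + (- s * - (n1 * n2) * y0' + - s * n1 ^+ 2 * y1')) = n2 * (n1 * v0 + n2 * v1).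
  by rewrite -[X in X - _](d' v0 v1) hq; ring.
have t2 : y0 - (s * n2 ^+ 2 * v0' + s * - (n1 * n2) * v1' + (c * n2 ^+ 2 * y0' + c * - (n1 * n2) * y1')) = n1 * (n1 * y0 + n2 * y1).
  by rewrite -[X in X - _](d y0 y1) hh; ring.
have t3 : y1 - (s * - (n1 * n2) * v0' + s * n1 ^+ 2 * v1' + (c * - (n1 * n2) * y0' + c * n1 ^+ 2 * y1')) = n2 * (n1 * y0 + n2 * y1).
  by rewrite -[X in X - _](d' y0 y1) hh; ring.
rewrite t0 t1 t2 t3; transitivity ((n1 ^+ 2 + n2 ^+ 2) * ((n1 * v0 + n2 * v1) ^+ 2 + (n1 * y0 + n2 * y1) ^+ 2)); first by ring.
by rewrite n12 mul1r.
Qed.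

End isotropic_representation.

(** * The isotropic state up to its propagator *)

Section propagator_representation.
Context (R : realType).
Local Notation C := R[i].
Local Notation Re := complex.Re.
Local Notation Im := complex.Im.
Local Open Scope complex_scope.

Lemma elastic_block_remainder (a b c d : 'M[R]_2) (v w v' w' : 'cV[C]_2) (th th' : 'cV[C]_1) :
  col_mx (col_mx v w) th - complexify (elastic_block a b c d) *m col_mx (col_mx v' w') th' =
  col_mx (col_mx (v - (complexify a *m v' + complexify b *m w'))
                 (w - (complexify c *m v' + complexify d *m w'))) th.
Proof.
rewrite /elastic_block /complexify !map_block_mx !map_mx0 mul_block_col !mul0mx add0r addr0.
by rewrite mul_block_col opp_col_mx add_col_mx opp_col_mx add_col_mx oppr0 addr0.
Qed.

Lemma ReZ (a : R) (z : C) : Re (a%:C * z) = a * Re z.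
Proof. by rewrite complexE /= mul0r subr0. Qed.

Lemma ImZ (a : R) (z : C) : Im (a%:C * z) = a * Im z.
Proof. by rewrite complexE /= mul0r addr0. Qed.

(** Regroups eight squares, given in pairs by component, into the four real and the four imaginary
    ones. *)
Let regroup_le (p q k l a b c d e f g h s x y m : R) :
  p = a + b -> q = c + d -> k = e + f -> l = g + h ->
  a + c + e + g = x -> b + d + f + h = y -> x + y + s <= m -> p + q + k + l + s <= m.
Proof. by move=> -> -> -> -> <- <-; lra. Qed.

Lemma remainder_sqabs (P : 'M[R]_2) (x y : R) (v v' w : 'cV[C]_2) i :
  sqabs ((v - (complexify (x *: P) *m v' + complexify (y *: P) *m w)) i 0) =
  (Re (v i 0) - (x * P i 0 * Re (v' 0 0) + x * P i 1 * Re (v' 1 0) +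
     (y * P i 0 * Re (w 0 0) + y * P i 1 * Re (w 1 0)))) ^+ 2 +
  (Im (v i 0) - (x * P i 0 * Im (v' 0 0) + x * P i 1 * Im (v' 1 0) +
     (y * P i 0 * Im (w 0 0) + y * P i 1 * Im (w 1 0)))) ^+ 2.
Proof.
have e (p q : 'cV[C]_2) : (v - (p + q)) i 0 = v i 0 - (p i 0 + q i 0) by rewrite !mxE.
by rewrite /sqabs e !mulmx_col2E ![(_ *: P) _ _]mxE !(ReD, ImD, ReN, ImN, ReZ, ImZ).
Qed.

(** Subtracting the propagator leaves the longitudinal components and the temperature, which
    [isotropic_solution] controls. The square root of the symbol has n and its normal as
    eigenvectors, so the components of sqrt(A) u along them are multiples of those of u. *)
Lemma isotropic_decay (k g la mu ta : R) : 0 < k -> 0 < g ->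
  0 < mu -> 0 < ta -> - ta - 2 * mu < la -> la < ta -> la + 2 * mu = ta ->
  let A := elastic_symbol (cubic_stiffness ta la mu) in
  exists2 c : R, 0 < c & forall xi u v th, 0 < norm2 xi -> fourier_system A k g xi u v th ->
    forall t, 0 <= t ->
      vnorm (thermo_state (sqrtmx (A xi)) (u t) (v t) (th t) -
        complexify (propagator (Num.sqrt mu) (transversal_al R) (transversal_be R) (transversal_ga R)
          (transversal_shift R) t xi) *m thermo_state (sqrtmx (A xi)) (u 0) (v 0) (th 0)) <=
      2 * degenerate_decay c t xi * vnorm (thermo_state (sqrtmx (A xi)) (u 0) (v 0) (th 0)).
Proof.
move=> k0 g0 mu0 ta0 lal lau iso A.
have [al [be [D0 [al0 be0 D00 bounds]]]] := cubic_form_bounds mu0 ta0 lal lau.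
have [c c0 sol] := isotropic_solution k0 g0 ta0 mu0.
exists (c / 2); first by rewrite divr_gt0.
move=> xi u v th r0 sys t t0.
have [n12 xiE] := unit2_norm r0.
have [p00 p01 p10 p11] := transversal_entries r0.
have [e00 e01 es e11] := cubic_entries ta la mu r0; rewrite -/A in e00 e01 es e11.
have := bounds _ _ n12; move: e00 e01 e11 xiE n12 p00 p01 p10 p11; set n1 := (unit2 xi).1; set n2 := (unit2 xi).2.
clearbody n1 n2; move=> e00 e01 e11 xiE n12 p00 p01 p10 p11 /= [form _ _ _ hD].
have r20 : 0 < norm2 xi ^+ 2 by rewrite exprn_gt0.
have A0 : 0 < A xi 0 0.
  rewrite e00 mulr_gt0//; have := form 1 0; rewrite expr1n expr0n /= mulr0n; lra.
have dA : 0 < A xi 0 0 * A xi 1 1 - A xi 0 1 ^+ 2.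
  rewrite e00 e01 e11; have := mulr_gt0 r20 (mulr_gt0 r20 (lt_le_trans D00 hD)).
  by congr (is_true (0 < _)); ring.
have lamu : la + mu = ta - mu by rewrite -iso; ring.
have x1 : xi.1 = norm2 xi * n1 by rewrite {1}xiE.
have x2 : xi.2 = norm2 xi * n2 by rewrite {1}xiE.
rewrite lamu in e01.
have smu : Num.sqrt mu ^+ 2 = mu by rewrite sqr_sqrtr// ltW.
have sta : Num.sqrt ta ^+ 2 = ta by rewrite sqr_sqrtr// ltW.
set B := sqrtmx (A xi).
have [Bs _ _] := sqrtmx2 es A0 dA; rewrite -/B in Bs.
have B10 : B 1 0 = B 0 1 by rewrite -{1}Bs mxE.
have ent (M : 'M[R]_2) (x : plane R) i : (M *m col2 x) i 0 = M i 0 * x.1 + M i 1 * x.2.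
  by rewrite mxE sum2E !mxE.
have [t0' t1'] : B 0 0 * - n2 + B 0 1 * n1 = Num.sqrt mu * norm2 xi * - n2 /\
     B 1 0 * - n2 + B 1 1 * n1 = Num.sqrt mu * norm2 xi * n1.
  have w0 : 0 < Num.sqrt mu * norm2 xi by rewrite mulr_gt0// sqrtr_gt0.
  have E : A xi *m col2 (- n2, n1) = (Num.sqrt mu * norm2 xi) ^+ 2 *: col2 (- n2, n1).
    apply/matrixP => i j; rewrite [j]ord1 ent [RHS]mxE exprMn smu; move: i; apply: ord2_ind.
      rewrite e00 e01 !mxE /=.
      transitivity (mu * norm2 xi ^+ 2 * - n2 * (n1 ^+ 2 + n2 ^+ 2)); [ring|by rewrite n12 mulr1].
    rewrite es e11 e01 !mxE /=.
    transitivity (mu * norm2 xi ^+ 2 * n1 * (n1 ^+ 2 + n2 ^+ 2)); [ring|by rewrite n12 mulr1].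
  have Bx := sqrtmx_eigen es A0 dA w0 E; rewrite -/B in Bx.
  by split; [have := congr1 (fun M : 'cV[R]_2 => M 0 0) Bx|have := congr1 (fun M : 'cV[R]_2 => M 1 0) Bx];
     rewrite ent [X in _ = X -> _]mxE [col2 _ _ _]mxE.
have [l0' l1'] : B 0 0 * n1 + B 0 1 * n2 = Num.sqrt ta * norm2 xi * n1 /\
     B 1 0 * n1 + B 1 1 * n2 = Num.sqrt ta * norm2 xi * n2.
  have w0 : 0 < Num.sqrt ta * norm2 xi by rewrite mulr_gt0// sqrtr_gt0.
  have E : A xi *m col2 (n1, n2) = (Num.sqrt ta * norm2 xi) ^+ 2 *: col2 (n1, n2).
    apply/matrixP => i j; rewrite [j]ord1 ent [RHS]mxE exprMn sta; move: i; apply: ord2_ind.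
      rewrite e00 e01 !mxE /=.
      transitivity (ta * norm2 xi ^+ 2 * n1 * (n1 ^+ 2 + n2 ^+ 2)); [ring|by rewrite n12 mulr1].
    rewrite es e11 e01 !mxE /=.
    transitivity (ta * norm2 xi ^+ 2 * n2 * (n1 ^+ 2 + n2 ^+ 2)); [ring|by rewrite n12 mulr1].
  have Bx := sqrtmx_eigen es A0 dA w0 E; rewrite -/B in Bx.
  by split; [have := congr1 (fun M : 'cV[R]_2 => M 0 0) Bx|have := congr1 (fun M : 'cV[R]_2 => M 1 0) Bx];
     rewrite ent [X in _ = X -> _]mxE [col2 _ _ _]mxE.
have trans (p q : R) : n1 * (B 1 0 * p + B 1 1 * q) - n2 * (B 0 0 * p + B 0 1 * q) = Num.sqrt mu * norm2 xi * (n1 * q - n2 * p).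
  transitivity (p * (B 0 0 * - n2 + B 0 1 * n1) + q * (B 1 0 * - n2 + B 1 1 * n1)); first by rewrite B10; ring.
  by rewrite t0' t1'; ring.
have long (p q : R) : n1 * (B 0 0 * p + B 0 1 * q) + n2 * (B 1 0 * p + B 1 1 * q) = Num.sqrt ta * (norm2 xi * (n1 * p + n2 * q)).
  transitivity (p * (B 0 0 * n1 + B 0 1 * n2) + q * (B 1 0 * n1 + B 1 1 * n2)); first by rewrite B10; ring.
  by rewrite l0' l1'; ring.
have [s1 s2] := planar_systems es sys.
rewrite x1 x2 e00 e01 e11 in s1 s2.
have [d1 q1 h1] := sol _ _ _ _ _ _ _ _ r0 n12 s1 t t0.
have [d2 q2 h2] := sol _ _ _ _ _ _ _ _ r0 n12 s2 t t0.
have wE : Num.sqrt mu * norm2 xi * t = Num.sqrt mu * t * norm2 xi by rewrite mulrAC.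
have YR (w : 'cV[C]_2) i : Re ((complexify B *m w) i 0) = B i 0 * Re (w 0 0) + B i 1 * Re (w 1 0).
  by rewrite mulmx_col2E !(ReD, ReZ).
have YI (w : 'cV[C]_2) i : Im ((complexify B *m w) i 0) = B i 0 * Im (w 0 0) + B i 1 * Im (w 1 0).
  by rewrite mulmx_col2E !(ImD, ImZ).
rewrite wE -!trans -!YR in q1 h1; rewrite wE -!trans -!YI in q2 h2.
rewrite transversal_propagator /thermo_state elastic_block_remainder.
set cz := cos (Num.sqrt mu * t * norm2 xi) in q1 h1 q2 h2 *; set sz := sin (Num.sqrt mu * t * norm2 xi) in q1 h1 q2 h2 *.
clearbody cz sz; set z := c * (norm2 xi ^+ 2 / (1 + norm2 xi ^+ 2)) * t in d1 d2.
have J0 : 0 < 1 + norm2 xi ^+ 2 by rewrite ltr_pwDl ?sqr_ge0.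
apply: (@le_trans _ _ (2 * expR (- (z / 2)) * vnorm (thermo_state B (u 0) (v 0) (th 0)))); last first.
  rewrite ler_wpM2r ?vnorm_ge0// ler_wpM2l//.
  have ct : 0 <= c / 2 * t by rewrite mulr_ge0// divr_ge0 ?(ltW c0).
  (* Here the decay depends on rho only. As xi1^2 <= rho^2, it is dominated by the term of
     [degenerate_decay] that belongs to xi1, which lets both cases share one weight. *)
  apply: (@degenerate_decay_ge _ _ _ _ (fun xi => xi.1 - 0 * xi.2)); first by rewrite mem_head.
  rewrite jap_norm2 mul0r subr0 /z.
  have -> : c * (norm2 xi ^+ 2 / (1 + norm2 xi ^+ 2)) * t / 2 = c / 2 * t * (norm2 xi ^+ 2 / (1 + norm2 xi ^+ 2)) by ring.
  rewrite ler_wpM2l// ler_wpM2r ?invr_ge0 ?(ltW J0)// norm2E sqr_sqrtr ?addr_ge0 ?sqr_ge0// lerDl sqr_ge0//.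
have r1 := transversal_remainder n12 p00 p01 p10 p11 q1 h1.
have r2 := transversal_remainder n12 p00 p01 p10 p11 q2 h2.
have longR (w : 'cV[C]_2) : (n1 * Re ((complexify B *m w) 0 0) + n2 * Re ((complexify B *m w) 1 0)) ^+ 2 =
    ta * (norm2 xi * (n1 * Re (w 0 0) + n2 * Re (w 1 0))) ^+ 2 by rewrite !YR long exprMn sta.
have longI (w : 'cV[C]_2) : (n1 * Im ((complexify B *m w) 0 0) + n2 * Im ((complexify B *m w) 1 0)) ^+ 2 =
    ta * (norm2 xi * (n1 * Im (w 0 0) + n2 * Im (w 1 0))) ^+ 2 by rewrite !YI long exprMn sta.
rewrite -!longR in d1; rewrite -!longI sqrrN in d2; apply: (sqr_decay (vnorm_ge0 _) (vnorm_ge0 _)); rewrite /thermo_state !vnorm_col_mx_sqr.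
move: r1 r2 d1 d2 {q1 q2 h1 h2 YR YI longR longI long trans s1 s2}.
move: (transversal xi) {p00 p01 p10 p11} => P.
move: (complexify B *m u t) (complexify B *m u 0) => y y0 r1 r2 d1 d2.
apply: (regroup_le (remainder_sqabs P cz (- sz) (v t) (v 0) y0 0)
  (remainder_sqabs P cz (- sz) (v t) (v 0) y0 1)
  (remainder_sqabs P sz cz y (v 0) y0 0) (remainder_sqabs P sz cz y (v 0) y0 1) r1 r2).
have d12 := lerD d1 d2; rewrite -mulrDr in d12.
apply: le_trans (le_trans d12 _).
  by clear; rewrite /sqabs le_eqVlt; apply/orP; left; apply/eqP; ring.
rewrite ler_wpM2l ?mulr_ge0 ?expR_ge0// sqrrN.
have sqr_le (a b : R) : (n1 * a + n2 * b) ^+ 2 <= a ^+ 2 + b ^+ 2.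
  by have := sqr_lin2_le n1 n2 a b; rewrite n12 mul1r.
have := sqr_le (Re (v 0 0 0)) (Re (v 0 1 0)); have := sqr_le (Im (v 0 0 0)) (Im (v 0 1 0)).
have := sqr_le (Re (y0 0 0)) (Re (y0 1 0)); have := sqr_le (Im (y0 0 0)) (Im (y0 1 0)).
by clear; rewrite /sqabs; lra.
Qed.
End propagator_representation.

Section thermo_representation.
Context (R : realType).
Local Open Scope complex_scope.

Lemma elastic_block_le (a b c d : 'M[R]_2) (m : R) : 0 <= m ->
  (forall i j, `|a i j| <= m) -> (forall i j, `|b i j| <= m) ->
  (forall i j, `|c i j| <= m) -> (forall i j, `|d i j| <= m) ->
  forall i j, `|elastic_block a b c d i j| <= m.
Proof.
move=> m0 ha hb hc hd i j; rewrite /elastic_block.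
case: (split_ordP i) => i' ->; case: (split_ordP j) => j' ->;
  rewrite ?block_mxEul ?block_mxEur ?block_mxEdl ?block_mxEdr; last 3 first.
- by rewrite mxE normr0.
- by rewrite mxE normr0.
- by rewrite mxE normr0.
by case: (split_ordP i') => i1 ->; case: (split_ordP j') => j1 ->;
  rewrite ?block_mxEul ?block_mxEur ?block_mxEdl ?block_mxEdr.
Qed.

(** The common form of both cases. Outside the isotropic case all coefficients are 0, hence so is
    the propagator, and the speed w = 1 is an arbitrary positive value. *)
Lemma thermo_representation (k g la mu ta : R) : 0 < k -> 0 < g ->
  0 < mu -> 0 < ta -> - ta - 2 * mu < la -> la < ta ->
  let A := elastic_symbol (cubic_stiffness ta la mu) in
  exists (w c : R) (al be ga s0 : 'M[R]_(2 + 2 + 1)),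
    [/\ 0 < w, 0 < c, forall i j, [/\ `|al i j| <= 1, `|be i j| <= 1 & `|ga i j| <= 1] &
    forall xi u v th, 0 < norm2 xi -> fourier_system A k g xi u v th ->
    forall t, 0 <= t ->
      vnorm (thermo_state (sqrtmx (A xi)) (u t) (v t) (th t) -
        complexify (propagator w al be ga s0 t xi) *m thermo_state (sqrtmx (A xi)) (u 0) (v 0) (th 0)) <=
      2 * degenerate_decay c t xi * vnorm (thermo_state (sqrtmx (A xi)) (u 0) (v 0) (th 0))].
Proof.
move=> k0 g0 mu0 ta0 lal lau A.
have [iso|niso] := eqVneq (la + 2 * mu) ta.
  have [c c0 H] := isotropic_decay k0 g0 mu0 ta0 lal lau iso.
  exists (Num.sqrt mu), c, (transversal_al R), (transversal_be R), (transversal_ga R), (transversal_shift R).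
  split => //; first by rewrite sqrtr_gt0.
  have d1 (p q i j : 'I_2) : `|(delta_mx p q : 'M[R]_2) i j| <= 1.
    by rewrite mxE; case: (_ && _); rewrite ?normr1 ?normr0.
  have d2 (i j : 'I_2) : `|(- (delta_mx 0 1 + delta_mx 1 0) : 'M[R]_2) i j| <= 1.
    rewrite !mxE normrN; move: i j; apply: ord2_ind; apply: ord2_ind; rewrite ?eqxx /=.
    - by rewrite addr0 normr0.
    - by rewrite addr0 normr1.
    - by rewrite add0r normr1.
    - by rewrite addr0 normr0.
  by move=> i j; split; apply: elastic_block_le.
have nd : la + 2 * mu - ta != 0 by rewrite subr_eq0.
have [c c0 H] := nondegenerate_decay k0 g0 mu0 ta0 lal lau nd.
exists 1, c, 0, 0, 0, 0; split => //; first by move=> i j; rewrite !mxE normr0.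
move=> xi u v th r0 sys t t0.
have -> : propagator 1 0 0 0 0 t xi = 0.
  by apply/matrixP => i j; rewrite !mxE !mul0r !addr0 !mul0r.
rewrite /complexify map_mx0 mul0mx subr0; exact: H.
Qed.

End thermo_representation.

(** * Passage to physical space *)

Section ae_domination.
Context d (T : measurableType d) (R : realType) (mu : {measure set T -> \bar R}).

Lemma ae_rintegrable_le (f g : T -> R) : measurable_fun setT f -> (forall x, 0 <= g x) ->
  mu.-integrable setT (EFin \o g) -> {ae mu, forall x, `|f x| <= g x} ->
  mu.-integrable setT (EFin \o f) /\ \int[mu]_x `|f x| <= \int[mu]_x g x.
Proof.
move=> mf g0 ig fg.
have h : (\int[mu]_x (`|f x|)%:E <= (\int[mu]_x g x)%:E)%E.
  rewrite EFin_Rintegral//; apply: ae_ge0_le_integral => //.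
  - by apply/measurable_EFinP; exact: measurableT_comp.
  - by move=> x _; rewrite lee_fin.
  - by apply/measurable_EFinP; exact: rintegrable_measurable ig.
  - by apply: filterS fg => x h _; rewrite lee_fin.
have if_ : mu.-integrable setT (EFin \o (fun x => `|f x|)).
  apply: (@ge0_rintegrable _ _ _ _ _ (\int[mu]_x g x)) => //; exact: measurableT_comp.
split.
  apply: (@rintegrable_le _ _ _ _ _ (fun x => `|f x|)) => //.
by rewrite -lee_fin EFin_Rintegral.
Qed.

End ae_domination.

(** * Pointwise bounds for inverse transforms *)

Section dispersive_components.
Context (R : realType).

Lemma ftrD (u v u' v' : plane R -> R) x :
  (leb2 R).-integrable setT (EFin \o u) -> (leb2 R).-integrable setT (EFin \o v) ->
  (leb2 R).-integrable setT (EFin \o u') -> (leb2 R).-integrable setT (EFin \o v') ->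
  ftr (fun y => u y + u' y) (fun y => v y + v' y) x = ftr u v x + ftr u' v' x.
Proof.
move=> iu iv iu' iv'; rewrite /ftr.
rewrite -(leb2_RintegralD (ftr_integrand_integrable x iu iv) (ftr_integrand_integrable x iu' iv')).
by apply: eq_Rintegral => y _; ring.
Qed.

Lemma ftr_sum (I : Type) (s : seq I) (u v : I -> plane R -> R) x :
  (forall i, (leb2 R).-integrable setT (EFin \o u i)) ->
  (forall i, (leb2 R).-integrable setT (EFin \o v i)) ->
  ftr (fun y => \sum_(i <- s) u i y) (fun y => \sum_(i <- s) v i y) x = \sum_(i <- s) ftr (u i) (v i) x.
Proof.
move=> iu iv; elim: s => [|i s ih].
  rewrite big_nil /ftr -[RHS](@leb2_Rintegral0 R); apply: eq_Rintegral => y _.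
  by rewrite !big_nil !mulr0 addr0.
rewrite big_cons -ih -ftrD//; first by congr ftr; apply/funext => y; rewrite big_cons.
- exact: rintegrable_sum.
- exact: rintegrable_sum.
Qed.

(** Exchanging the integrals exhibits a convolution with a kernel bounded by [B], which maps L^1 to
    L^oo. *)
Lemma oscillatory_term (g a : plane R -> R) (B s : R) (x : plane R) :
  (leb2 R).-integrable setT (EFin \o g) -> (leb2 R).-integrable setT (EFin \o a) ->
  (forall z, `|\int[leb2 R]_xi (g xi * cos (s + dot2 z xi))| <= B) ->
  `|\int[leb2 R]_xi (g xi * \int[leb2 R]_y (a y * cos (s + dot2 (shift2 (x, y)) xi)))| <=
  B * \int[leb2 R]_y `|a y|.
Proof.
move=> ig ia hB.
have mph := measurable_phase x.
have mK : measurable_fun setT (fun z : plane R * plane R => cos (s + dot2 (shift2 (x, z.2)) z.1)).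
  by apply: measurable_cosf; apply: measurable_funD.
have bK (z : plane R * plane R) : `|cos (s + dot2 (shift2 (x, z.2)) z.1)| <= 1 by exact: norm_cos_le1.
rewrite (plane_swap mK bK ig ia).
have mK' : measurable_fun setT (fun z : plane R * plane R => cos (s + dot2 (shift2 (x, z.1)) z.2)).
  exact: measurableT_comp mK (measurable_fun_pair measurable_snd measurable_fst).
have bK' (z : plane R * plane R) : `|cos (s + dot2 (shift2 (x, z.1)) z.2)| <= 1 by exact: norm_cos_le1.
have i1 := plane_swap_integrable mK' bK' ia ig.
have i2 := rintegrableZ B (rintegrable_norm ia).
rewrite -(leb2_RintegralZ B (rintegrable_norm ia)).
apply: (norm_Rintegral_le i1 i2) => y.
rewrite normrM [leLHS]mulrC; apply: ler_wpM2r; [exact: normr_ge0|exact: hB (shift2 (x, y))].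
Qed.

(* cos(x.xi) Re + sin(x.xi) Im of the transform of a + i b, as one oscillatory
   integral in y with phase (x - y).xi *)
Lemma ftr_translate (a b : plane R -> R) (x xi : plane R) :
  (leb2 R).-integrable setT (EFin \o a) -> (leb2 R).-integrable setT (EFin \o b) ->
  cos (dot2 xi x) * ftr a b xi - sin (dot2 xi x) * ftr b (fun y => - a y) xi =
  \int[leb2 R]_y (a y * cos (0 + dot2 (shift2 (x, y)) xi)) +
  \int[leb2 R]_y (b y * cos (pi / 2 + dot2 (shift2 (x, y)) xi)).
Proof.
move=> ia ib; have iNa := rintegrableN ia.
have ic (s : R) (c : plane R -> R) : (leb2 R).-integrable setT (EFin \o c) ->
    (leb2 R).-integrable setT (EFin \o (fun y => c y * cos (s + dot2 (shift2 (x, y)) xi))).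
  move=> icc; apply: (@bounded_mul_integrable _ 1) => //; last by move=> y; exact: norm_cos_le1.
  apply: measurable_cosf; apply: measurable_funD => //.
  by under eq_fun do rewrite dot2_shift2; apply: measurable_funB => //; exact: measurable_dot2r.
have i1 := ftr_integrand_integrable xi ia ib; have i2 := ftr_integrand_integrable xi ib iNa.
rewrite /ftr -(leb2_RintegralZ _ i1) -(leb2_RintegralZ _ i2).
rewrite -(leb2_RintegralB (rintegrableZ _ i1) (rintegrableZ _ i2)).
rewrite -(leb2_RintegralD (ic 0 a ia) (ic (pi / 2) b ib)); apply: eq_Rintegral => y _.
rewrite add0r cosD cos_pihalf sin_pihalf mul0r mul1r sub0r dot2_shift2 cosB sinB [dot2 xi x]dot2C.
ring.
Qed.

(** By [ftr_translate] the two parts of the data enter with the phases 0 and pi/2, which is why the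
    kernel is bounded for all shifts s. *)
Lemma dispersive_term (g a b : plane R -> R) (B : R) (x : plane R) :
  (leb2 R).-integrable setT (EFin \o g) ->
  (leb2 R).-integrable setT (EFin \o a) -> (leb2 R).-integrable setT (EFin \o b) ->
  (forall z s, `|\int[leb2 R]_xi (g xi * cos (s + dot2 z xi))| <= B) ->
  `|ftr (fun xi => g xi * ftr a b xi) (fun xi => - (g xi * ftr b (fun y => - a y) xi)) x| <= B * l1 a b.
Proof.
move=> ig ia ib hB; have iNa := rintegrableN ia.
have mph := measurable_phase x.
have iosc (s : R) (c : plane R -> R) : (leb2 R).-integrable setT (EFin \o c) ->
   (leb2 R).-integrable setT (EFin \o (fun xi => g xi * \int[leb2 R]_y (c y * cos (s + dot2 (shift2 (x, y)) xi)))).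
  move=> icc.
  have mK : measurable_fun setT (fun z : plane R * plane R => cos (s + dot2 (shift2 (x, z.2)) z.1)).
    by apply: measurable_cosf; apply: measurable_funD.
  have bK (z : plane R * plane R) : `|cos (s + dot2 (shift2 (x, z.2)) z.1)| <= 1 by exact: norm_cos_le1.
  exact: (plane_swap_integrable mK bK ig icc).
have -> : ftr (fun xi => g xi * ftr a b xi) (fun xi => - (g xi * ftr b (fun y => - a y) xi)) x =
  \int[leb2 R]_xi (g xi * \int[leb2 R]_y (a y * cos (0 + dot2 (shift2 (x, y)) xi))) +
  \int[leb2 R]_xi (g xi * \int[leb2 R]_y (b y * cos (pi / 2 + dot2 (shift2 (x, y)) xi))).
  rewrite -(leb2_RintegralD (iosc 0 a ia) (iosc (pi / 2) b ib)); apply: eq_Rintegral => xi _.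
  by rewrite -mulrDr -(ftr_translate x xi ia ib); ring.
have -> : l1 a b = (\int[leb2 R]_y `|a y|) + (\int[leb2 R]_y `|b y|).
  by rewrite /l1 (leb2_RintegralD (rintegrable_norm ia) (rintegrable_norm ib)).
apply: le_trans (ler_normD _ _) _; rewrite mulrDr; apply: lerD; exact: oscillatory_term.
Qed.

(** The transform is split into the multiplier part and a remainder. The remainder is dominated by
    [M * k xi], hence contributes at most a multiple of M B1; with the integrable multiplier part
    this makes the whole transform integrable, as inversion requires. The inversion constant (2
    pi)^-1 is estimated by 1. *)
Lemma dispersive_component (n : nat) (u v P S k : plane R -> R) (a b g : 'I_n -> plane R -> R) (M B1 B2 : R) :
  fourier_pair u v P S ->
  (forall j, (leb2 R).-integrable setT (EFin \o a j)) ->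
  (forall j, (leb2 R).-integrable setT (EFin \o b j)) ->
  (forall j, (leb2 R).-integrable setT (EFin \o g j)) ->
  (forall j z s, `|\int[leb2 R]_xi (g j xi * cos (s + dot2 z xi))| <= B2) ->
  (forall xi, 0 <= k xi) -> (leb2 R).-integrable setT (EFin \o k) -> \int[leb2 R]_xi k xi <= B1 ->
  0 <= M ->
  {ae leb2 R, forall xi,
    `|P xi - \sum_j g j xi * ftr (a j) (b j) xi| <= M * k xi /\
    `|S xi - \sum_j g j xi * ftr (b j) (fun y => - a j y) xi| <= M * k xi} ->
  {ae leb2 R, forall x, `|u x| <= 2 * (M * B1) + \sum_j B2 * l1 (a j) (b j)}.
Proof.
move=> fp ia ib ig hB2 k0 ik kB1 M0 hae.
have iNa j := rintegrableN (ia j).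
have [[_ _] _ [mP _] [mS _] _] := fp.
have iG (c e : 'I_n -> plane R -> R) j : (forall j, (leb2 R).-integrable setT (EFin \o c j)) ->
   (forall j, (leb2 R).-integrable setT (EFin \o e j)) ->
   (leb2 R).-integrable setT (EFin \o (fun xi => g j xi * ftr (c j) (e j) xi)).
  move=> ic ie; apply: (@bounded_mul_integrable _ (l1 (c j) (e j))) => //.
    exact: measurable_ftr.
  by move=> xi; exact: ftr_bound.
pose GP xi := \sum_j g j xi * ftr (a j) (b j) xi.
pose GS xi := \sum_j g j xi * ftr (b j) (fun y => - a j y) xi.
have iGP : (leb2 R).-integrable setT (EFin \o GP) by apply: rintegrable_sum => j; exact: iG.
have iGS : (leb2 R).-integrable setT (EFin \o GS).
  by apply: rintegrable_sum => j; exact: (iG b (fun j y => - a j y)).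
pose RP xi := P xi - GP xi; pose RS xi := S xi - GS xi.
have mRP : measurable_fun setT RP := measurable_funB mP (rintegrable_measurable iGP).
have mRS : measurable_fun setT RS := measurable_funB mS (rintegrable_measurable iGS).
have ikM := rintegrableZ M ik.
have kM0 xi : 0 <= M * k xi by rewrite mulr_ge0.
have [iRP bRP] := ae_rintegrable_le mRP kM0 ikM (ae_imp (fun _ h => proj1 h) hae).
have [iRS bRS] := ae_rintegrable_le mRS kM0 ikM (ae_imp (fun _ h => proj2 h) hae).
have PE : P = fun xi => RP xi + GP xi by apply/funext => xi; rewrite /RP subrK.
have SE : S = fun xi => RS xi + GS xi by apply/funext => xi; rewrite /RS subrK.
have iP : (leb2 R).-integrable setT (EFin \o P) by rewrite PE; exact: rintegrableD.
have iS : (leb2 R).-integrable setT (EFin \o S) by rewrite SE; exact: rintegrableD.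
apply: ae_imp (fourier_inversion fp iP iS) => x ->.
have -> : ftr P (fun xi => - S xi) x = ftr RP (fun xi => - RS xi) x +
   \sum_j ftr (fun xi => g j xi * ftr (a j) (b j) xi) (fun xi => - (g j xi * ftr (b j) (fun y => - a j y) xi)) x.
  rewrite -ftr_sum; last 2 first.
  - by move=> j; exact: iG.
  - by move=> j; apply: rintegrableN; exact: (iG b (fun j y => - a j y)).
  rewrite -ftrD//; last 2 first.
  - exact: rintegrableN.
  - by apply: rintegrable_sum => j; apply: rintegrableN; exact: (iG b (fun j y => - a j y)).
  congr ftr; first exact: PE.
  by apply/funext => xi; rewrite SE sumrN opprD.
have pi1 : `|(2 * pi)^-1 : R| <= 1.
  rewrite ger0_norm ?invr_ge0 ?mulr_ge0 ?pi_ge0// invf_le1 ?mulr_gt0 ?pi_gt0//.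
  have h := pi_ge2 R; clear -h; lra.
rewrite normrM; apply: le_trans (ler_wpM2r (normr_ge0 _) pi1) _; rewrite mul1r.
apply: le_trans (ler_normD _ _) _; apply: lerD.
  apply: le_trans (ftr_bound _ iRP (rintegrableN iRS)) _.
  rewrite /l1; under eq_Rintegral do rewrite normrN.
  rewrite (leb2_RintegralD (rintegrable_norm iRP) (rintegrable_norm iRS)).
  have h := ler_wpM2l M0 kB1; rewrite -(leb2_RintegralZ M ik) in h.
  by rewrite mulr_natl mulr2n; apply: lerD; [exact: le_trans bRP h|exact: le_trans bRS h].
apply: le_trans (ler_norm_sum _ _ _) _; apply: ler_sum => j _.
by apply: dispersive_term => //; exact: hB2.
Qed.

End dispersive_components.

(** * From vector-valued transforms to real components *)

Section fourier_bridges.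
Context (R : realType).
Local Notation C := R[i].
Local Notation Re := complex.Re.
Local Notation Im := complex.Im.
Local Open Scope complex_scope.

Lemma sqabs_le_vnorm n (v : 'cV[C]_n) i : sqabs (v i 0) <= vnorm v ^+ 2.
Proof. by rewrite vnorm_sqr (bigD1 i)//= lerDl sumr_ge0// => j _; exact: sqabs_ge0. Qed.

Lemma Re_le_vnorm n (v : 'cV[C]_n) i : `|Re (v i 0)| <= vnorm v.
Proof.
rewrite -(@ler_pXn2r _ 2) ?nnegrE ?vnorm_ge0// real_normK ?num_real//.
by apply: le_trans (sqabs_le_vnorm v i); rewrite lerDl sqr_ge0.
Qed.

Lemma Im_le_vnorm n (v : 'cV[C]_n) i : `|Im (v i 0)| <= vnorm v.
Proof.
rewrite -(@ler_pXn2r _ 2) ?nnegrE ?vnorm_ge0// real_normK ?num_real//.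
by apply: le_trans (sqabs_le_vnorm v i); rewrite lerDr sqr_ge0.
Qed.

Lemma vnorm_le_sum n (v : 'cV[C]_n) : vnorm v <= \sum_i (`|Re (v i 0)| + `|Im (v i 0)|).
Proof.
have s0 (s : seq 'I_n) : 0 <= \sum_(i <- s) (`|Re (v i 0)| + `|Im (v i 0)|).
  by rewrite sumr_ge0// => i _; rewrite addr_ge0.
rewrite -(@ler_pXn2r _ 2) ?nnegrE ?vnorm_ge0// vnorm_sqr.
elim: (index_enum _) => [|i s ih]; first by rewrite !big_nil expr0n.
rewrite !big_cons; have := s0 s; move: (\sum_(j <- s) (_ + _)) ih => z ih z0.
apply: le_trans (lerD (lexx _) ih) _; rewrite /sqabs -(real_normK (num_real (Re _))) -(real_normK (num_real (Im _))).
move: `|Re _| `|Im _| (normr_ge0 (Re (v i 0))) (normr_ge0 (Im (v i 0))) => a b a0 b0.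
by have := mulr_ge0 a0 b0; have := mulr_ge0 a0 z0; have := mulr_ge0 b0 z0; nra.
Qed.

Lemma measurable_sqabs n (f : plane R -> 'cV[C]_n) i :
  (forall i, measurable_fun setT (fun x => Re (f x i 0)) /\ measurable_fun setT (fun x => Im (f x i 0))) ->
  measurable_fun setT (fun x => sqabs (f x i 0)).
Proof. by move=> mf; have [m1 m2] := mf i; apply: measurable_funD; exact: measurable_funX. Qed.

Lemma measurable_vnorm n (f : plane R -> 'cV[C]_n) :
  (forall i, measurable_fun setT (fun x => Re (f x i 0)) /\ measurable_fun setT (fun x => Im (f x i 0))) ->
  measurable_fun setT (fun x => vnorm (f x)).
Proof.
move=> mf; apply: (measurableT_comp (f := Num.sqrt : measurableTypeR R -> R)).
  by apply: continuous_measurable_fun; exact: sqrt_continuous.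
by apply: measurable_sum => i; exact: measurable_sqabs.
Qed.

Lemma Lpnorm2_sqr n (f : plane R -> 'cV[C]_n) :
  (Lpnorm 2%:E f `^ 2 = \int[leb2 R]_x (vnorm (f x) ^+ 2)%:E)%E.
Proof.
rewrite /Lpnorm poweR_Lnorm//; apply: eq_integral => x _.
by rewrite /= ger0_norm ?vnorm_ge0// powR_mulrn ?vnorm_ge0.
Qed.

Lemma Lpnorm1E n (f : plane R -> 'cV[C]_n) :
  (Lpnorm 1%:E f = \int[leb2 R]_x (vnorm (f x))%:E)%E.
Proof.
rewrite /Lpnorm Lnorm1; apply: eq_integral => x _.
by rewrite /= ger0_norm ?vnorm_ge0.
Qed.

Lemma in_L2_components n (f : plane R -> 'cV[C]_n) i : in_Lp 2%:E f ->
  sq_integrable (fun x => Re (f x i 0)) /\ sq_integrable (fun x => Im (f x i 0)).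
Proof.
move=> [mf nf]; have [m1 m2] := mf i.
have iv : (leb2 R).-integrable setT (EFin \o (fun x => vnorm (f x) ^+ 2)).
  have h : (\int[leb2 R]_x (vnorm (f x) ^+ 2)%:E < +oo)%E by rewrite -Lpnorm2_sqr poweR_lty.
  apply/integrableP; split.
    by apply/measurable_EFinP; apply: measurable_funX; exact: measurable_vnorm.
  by under eq_integral do rewrite /= ger0_norm ?sqr_ge0//.
split; split => //; apply: rintegrable_le iv.
- exact: measurable_funX.
- move=> x; rewrite ger0_norm ?sqr_ge0//; apply: le_trans (sqabs_le_vnorm (f x) i).
  by rewrite lerDl sqr_ge0.
- exact: measurable_funX.
- move=> x; rewrite ger0_norm ?sqr_ge0//; apply: le_trans (sqabs_le_vnorm (f x) i).
  by rewrite lerDr sqr_ge0.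
Qed.

Lemma fourierL1_component n (f : plane R -> 'cV[C]_n) xi i :
  Re (fourierL1 f xi i 0) = (2 * pi)^-1 * ftr (fun x => Re (f x i 0)) (fun x => Im (f x i 0)) xi /\
  Im (fourierL1 f xi i 0) = (2 * pi)^-1 * ftr (fun x => Im (f x i 0)) (fun x => - Re (f x i 0)) xi.
Proof.
rewrite /fourierL1 mxE ReZ ImZ /cintegral /=; split; congr (_ * _); apply: eq_Rintegral => x _.
  by rewrite ReM /= mulNr opprK.
by rewrite ImM /= mulNr mulrN.
Qed.

(** The tail of one component is the squared modulus of that entry of the error, so its integral is
    at most the square of an L^2 norm that tends to 0. *)
Lemma fourierL2_component n (f F : plane R -> 'cV[C]_n) i : is_fourierL2 f F ->
  fourier_pair (fun x => Re (f x i 0)) (fun x => Im (f x i 0))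
    (fun xi => Re (F xi i 0)) (fun xi => Im (F xi i 0)).
Proof.
move=> [f2 F2 cF]; have [r1 i1] := in_L2_components i f2; have [r2 i2] := in_L2_components i F2.
split => //.
pose T k xi := F xi - fourierL1 (truncate k f) xi.
have trE k j : (fun x => Re (truncate k f x j 0)) = disk_cut k (fun x => Re (f x j 0)) /\
    (fun x => Im (truncate k f x j 0)) = disk_cut k (fun x => Im (f x j 0)).
  by split; apply/funext => x; rewrite /truncate /disk_cut; case: ifP => //; rewrite mxE.
have TE k j xi : Re (T k xi j 0) = Re (F xi j 0) -
      (2 * pi)^-1 * ftr (disk_cut k (fun x => Re (f x j 0))) (disk_cut k (fun x => Im (f x j 0))) xi /\
    Im (T k xi j 0) = Im (F xi j 0) -
      (2 * pi)^-1 * ftr (disk_cut k (fun x => Im (f x j 0))) (fun x => - disk_cut k (fun x => Re (f x j 0)) x) xi.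
  have [e1 e2] := fourierL1_component (truncate k f) xi j; have [c1 c2] := trE k j.
  have c3 : (fun x => - Re (truncate k f x j 0)) = (fun x => - disk_cut k (fun x => Re (f x j 0)) x).
    by apply/funext => x; rewrite -c1.
  have tE : T k xi j 0 = F xi j 0 - fourierL1 (truncate k f) xi j 0 by rewrite /T 2!mxE.
  by rewrite tE !(ReD, ImD, ReN, ImN) e1 e2 c1 c2 c3.
have mT k j : measurable_fun setT (fun xi => Re (T k xi j 0)) /\ measurable_fun setT (fun xi => Im (T k xi j 0)).
  have [rj ij] := in_L2_components j f2; have [mFr mFi] := (proj1 F2) j.
  have d1 := disk_cut_integrable k rj; have d2 := disk_cut_integrable k ij.
  have d3 := rintegrableN d1.
  have -> : (fun xi => Re (T k xi j 0)) = fun xi => Re (F xi j 0) -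
      (2 * pi)^-1 * ftr (disk_cut k (fun x => Re (f x j 0))) (disk_cut k (fun x => Im (f x j 0))) xi.
    by apply/funext => xi; case: (TE k j xi).
  have -> : (fun xi => Im (T k xi j 0)) = fun xi => Im (F xi j 0) -
      (2 * pi)^-1 * ftr (disk_cut k (fun x => Im (f x j 0))) (fun x => - disk_cut k (fun x => Re (f x j 0)) x) xi.
    by apply/funext => xi; case: (TE k j xi).
  have m1 := measurable_ftr d1 d2; have m2 := measurable_ftr d2 d3.
  by split; apply: measurable_funB => //; exact: measurable_funM.
have tailE k xi : fourier_tail (fun x => Re (f x i 0)) (fun x => Im (f x i 0))
    (fun xi => Re (F xi i 0)) (fun xi => Im (F xi i 0)) k xi = sqabs (T k xi i 0).
  by have [t1 t2] := TE k i xi; rewrite /sqabs t1 t2.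
have le k : (\int[leb2 R]_xi (fourier_tail (fun x => Re (f x i 0)) (fun x => Im (f x i 0))
    (fun xi => Re (F xi i 0)) (fun xi => Im (F xi i 0)) k xi)%:E <= Lpnorm 2%:E (T k) `^ 2)%E.
  rewrite Lpnorm2_sqr; under eq_integral do rewrite tailE.
  apply: ge0_le_integral.
  - exact: measurableT.
  - by move=> xi _; rewrite lee_fin sqabs_ge0.
  - by apply/measurable_EFinP; exact: (measurable_sqabs i (mT k)).
  - by apply/measurable_EFinP; apply: measurable_funX; exact: (measurable_vnorm (mT k)).
  - by move=> xi _; rewrite lee_fin; exact: sqabs_le_vnorm.
(* Once the norm is at most 1, its square is at most the norm itself, and the convergence follows by
   squeezing. *)
have small : \forall k \near \oo, (Lpnorm 2%:E (T k) <= 1)%E.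
  have /fine_cvgP[fin c] := cF.
  have h : \forall k \near \oo, `|fine (Lpnorm 2%:E (T k))| <= 1.
    exact: (cvgr0_norm_le _ c _ ltr01).
  near=> k; have fk : Lpnorm 2%:E (T k) \is a fin_num by near: k.
  rewrite -(fineK fk) lee_fin; apply: le_trans (ler_norm _) _; near: k; exact: h.
have c0 : (fun=> 0%E : \bar R) @ \oo --> (0%E : \bar R) by exact: cvg_cst.
apply: (squeeze_cvge _ c0 cF).
near=> k; apply/andP; split.
  by apply: integral_ge0 => xi _; rewrite lee_fin tailE sqabs_ge0.
apply: le_trans (le k) _.
have l1' : (Lpnorm 2%:E (T k) <= 1)%E by near: k.
have l0 : (0 <= Lpnorm 2%:E (T k))%E by exact: Lnorm_ge0.
case: (Lpnorm 2%:E (T k)) l0 l1' => [z| |]//; rewrite !lee_fin => z0 z1.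
by rewrite powR_mulrn// expr2 ler_piMl.
Unshelve. all: by end_near. Qed.

(** What the H^{1,r} norm provides: the transform of [w] is <xi>^(-r) times that of an integrable
    function, which is an absolutely convergent integral and can be written with [ftr]. *)
Lemma bessel_data n (r : R) (w g : plane R -> 'cV[C]_n) : is_bessel r w g ->
  exists2 F, is_fourierL2 w F &
  [/\ (leb2 R).-integrable setT (EFin \o (fun x => vnorm (g x))),
      Lpnorm 1%:E g = (\int[leb2 R]_x vnorm (g x))%:E,
      forall i, (leb2 R).-integrable setT (EFin \o (fun x => Re (g x i 0))) /\
                (leb2 R).-integrable setT (EFin \o (fun x => Im (g x i 0))) &
      {ae leb2 R, forall xi, forall i,
         Re (F xi i 0) = jap xi `^ (- r) * (2 * pi)^-1 * ftr (fun x => Re (g x i 0)) (fun x => Im (g x i 0)) xi /\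
         Im (F xi i 0) = jap xi `^ (- r) * (2 * pi)^-1 * ftr (fun x => Im (g x i 0)) (fun x => - Re (g x i 0)) xi}].
Proof.
move=> [[mg ng] [F [wF hF]]]; exists F => //.
have iv : (leb2 R).-integrable setT (EFin \o (fun x => vnorm (g x))).
  apply/integrableP; split; first by apply/measurable_EFinP; exact: measurable_vnorm.
  by under eq_integral do rewrite /= ger0_norm ?vnorm_ge0//; rewrite -Lpnorm1E.
split => //.
- by rewrite Lpnorm1E EFin_Rintegral.
- move=> i; have [m1 m2] := mg i; split.
    by apply: (rintegrable_le m1 _ iv) => x; exact: Re_le_vnorm.
  by apply: (rintegrable_le m2 _ iv) => x; exact: Im_le_vnorm.
- apply: ae_imp hF => xi hxi i.
  have [e1 e2] := fourierL1_component g xi i.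
  have J0 : 0 < jap xi `^ r by rewrite powR_gt0// jap_gt0.
  have h : fourierL1 g xi i 0 = (jap xi `^ r)%:C * F xi i 0 by rewrite hxi mxE.
  rewrite h ReZ in e1; rewrite h ImZ in e2; rewrite powRN -!mulrA -e1 -e2.
  by rewrite !mulKf// gt_eqF.
Qed.

End fourier_bridges.

(** * Integrated bounds for both parts of the representation *)

Section decay_assembly.
Context (R : realType).
Local Notation C := R[i].
Local Notation Re := complex.Re.
Local Notation Im := complex.Im.
Local Open Scope complex_scope.

(** The weight <xi>^(-r) of the data completes the entry to the amplitude for which the kernel was
    estimated. *)
Lemma propagator_entry (r w : R) (al be ga s0 : 'M[R]_(2 + 2 + 1)) (t : R) (xi : plane R) i j :
  propagator w al be ga s0 t xi i j * jap xi `^ (- r) =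
  dispersive_phase r (al i j) (be i j) (ga i j) (w * t) (s0 i j) (0, 0) xi.
Proof.
rewrite mxE /dispersive_phase /cone_amplitude jap_powR mulNr /dot2 /= !mul0r !addr0.
by rewrite mulrAC [RHS]mulrC.
Qed.

Lemma dispersive_phase_integrable (r al be ga k s : R) (x : plane R) : 2 < r ->
  `|al| <= 1 -> `|be| <= 1 -> `|ga| <= 1 ->
  (leb2 R).-integrable setT (EFin \o dispersive_phase r al be ga k s x).
Proof.
move=> r2 al1 be1 ga1; have r0 : 0 <= r by lra.
have q1 : 2^-1 < r / 2 / 2 by lra.
have iq := @integrable_line_weight R _ q1; have [it _] := plane_tensor (rintegrableZ 2 iq) iq.
apply: rintegrable_le it; first exact: measurable_dispersive_phase.
by move=> xi; exact: dispersive_phase_le.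
Qed.

(** A product of cosines becomes a sum. The second term is taken at - z, to which the kernel bound
    applies equally, being uniform in the point. *)
Lemma dispersive_phase_product (r al be ga k s0 s : R) (z xi : plane R) :
  dispersive_phase r al be ga k s0 (0, 0) xi * cos (s + dot2 z xi) =
  2^-1 * (dispersive_phase r al be ga k (s0 + s) z xi +
          dispersive_phase r al be ga k (s0 - s) (- z.1, - z.2) xi).
Proof.
rewrite /dispersive_phase -mulrDl.
have -> : s0 + dot2 (0, 0) xi + k * norm2 xi = s0 + k * norm2 xi by rewrite /dot2 /= !mul0r !addr0.
have -> : s0 + s + dot2 z xi + k * norm2 xi = (s0 + k * norm2 xi) + (s + dot2 z xi) by ring.
have -> : s0 - s + dot2 (- z.1, - z.2) xi + k * norm2 xi = (s0 + k * norm2 xi) - (s + dot2 z xi).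
  by rewrite /dot2 /=; ring.
by rewrite [X in (X + _) * _]cosD cosB; field.
Qed.

Lemma propagator_kernel (r w : R) : 2 < r -> 0 < w ->
  exists2 D : R, 0 < D & forall al be ga s0 t s z, `|al| <= 1 -> `|be| <= 1 -> `|ga| <= 1 -> 0 <= t ->
    `|\int[leb2 R]_xi (dispersive_phase r al be ga (w * t) s0 (0, 0) xi * cos (s + dot2 z xi))| <=
    D * (1 + t) `^ (- 2^-1).
Proof.
move=> r2 w0; have [D D0 H] := dispersive_kernel r2 w0; exists D => //.
move=> al be ga s0 t s z al1 be1 ga1 t0.
have i1 := dispersive_phase_integrable (w * t) (s0 + s) z r2 al1 be1 ga1.
have i2 := dispersive_phase_integrable (w * t) (s0 - s) (- z.1, - z.2) r2 al1 be1 ga1.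
under eq_Rintegral do rewrite dispersive_phase_product.
rewrite (leb2_RintegralZ _ (rintegrableD i1 i2)) (leb2_RintegralD i1 i2) normrM ger0_norm ?invr_ge0//.
have h1 := H al be ga (s0 + s) t z al1 be1 ga1 t0.
have h2 := H al be ga (s0 - s) t (- z.1, - z.2) al1 be1 ga1 t0.
rewrite ler_pdivrMl//; apply: le_trans (ler_normD _ _) _.
by rewrite mulr_natl mulr2n; exact: lerD.
Qed.

Lemma degenerate_forms_hyperbolic l : l \in degenerate_forms R -> hyperbolic_form l.
Proof.
rewrite !inE => /or4P[] /eqP ->.
- by exists 0; [rewrite normr0|left].
- by exists 0; [rewrite normr0|right].
- by exists 1; [rewrite normr1|left].
- by exists (-1); [rewrite normrN1|left].
Qed.

Lemma degenerate_decay_integral (c r : R) : 0 < c -> 2 < r ->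
  exists2 D : R, 0 < D & forall t, 0 <= t ->
    (leb2 R).-integrable setT (EFin \o (fun xi => degenerate_decay c t xi * jap xi `^ (- r))) /\
    \int[leb2 R]_xi (degenerate_decay c t xi * jap xi `^ (- r)) <= D * (1 + t) `^ (- 2^-1).
Proof.
move=> c0 r2; have [D D0 H] := @hyperbolic_weight_integral R c r c0 r2.
exists (4 * D); first by rewrite mulr_gt0.
move=> t t0.
have Hs (s : seq (plane R -> R)) : (forall l, l \in s -> hyperbolic_form l) ->
    (leb2 R).-integrable setT (EFin \o (fun xi => \sum_(l <- s) hyperbolic_weight c t r l xi)) /\
    \int[leb2 R]_xi (\sum_(l <- s) hyperbolic_weight c t r l xi) <= (size s)%:R * (D * (1 + t) `^ (- 2^-1)).
  elim: s => [|l s ih] hs.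
    have E : (fun xi : plane R => \sum_(l <- [::]) hyperbolic_weight c t r l xi) = fun=> 0.
      by apply/funext => xi; rewrite big_nil.
    by rewrite E mul0r leb2_Rintegral0; split => //; exact: integrable0.
  have [i1 b1] := ih (fun l' h => hs l' (mem_behead (s := l :: s) h)).
  have [i2 b2] := H t l t0 (hs l (mem_head _ _)).
  have E : (fun xi : plane R => \sum_(l <- l :: s) hyperbolic_weight c t r l xi) =
     fun xi => hyperbolic_weight c t r l xi + \sum_(l <- s) hyperbolic_weight c t r l xi.
    by apply/funext => xi; rewrite big_cons.
  rewrite E; split; first exact: rintegrableD.
  by rewrite (leb2_RintegralD i2 i1) /= -nat1r mulrDl mul1r; exact: lerD.
have -> : (fun xi : plane R => degenerate_decay c t xi * jap xi `^ (- r)) =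
   fun xi => \sum_(l <- degenerate_forms R) hyperbolic_weight c t r l xi.
  by apply/funext => xi; rewrite /degenerate_decay mulr_suml.
by rewrite -mulrA; exact: (Hs (degenerate_forms R) degenerate_forms_hyperbolic).
Qed.

Lemma vnormZ n (a : C) (v : 'cV[C]_n) : vnorm (a *: v) = Num.sqrt (sqabs a) * vnorm v.
Proof.
have e i : sqabs ((a *: v) i 0) = sqabs a * sqabs (v i 0).
  by rewrite mxE /sqabs ReM ImM; ring.
rewrite /vnorm -sqrtrM ?sqabs_ge0//; congr Num.sqrt; rewrite mulr_sumr.
by apply: eq_bigr => i _; exact: e.
Qed.

Lemma mulmx_complexify_entry m n (M : 'M[R]_(m, n)) (v : 'cV[C]_n) i :
  Re ((complexify M *m v) i 0) = \sum_j M i j * Re (v j 0) /\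
  Im ((complexify M *m v) i 0) = \sum_j M i j * Im (v j 0).
Proof.
rewrite mxE; split.
  rewrite (big_morph (@complex.Re R) (@ReD R) (erefl : complex.Re (0 : C) = 0)).
  by apply: eq_bigr => j _; rewrite mxE ReZ.
rewrite (big_morph (@complex.Im R) (@ImD R) (erefl : complex.Im (0 : C) = 0)).
by apply: eq_bigr => j _; rewrite mxE ImZ.
Qed.

(* One frequency: [W] and [W0] are the localized states at times [t] and [0],
   whose difference [W - M W0] inherits the bound from the state [Z]. *)
Lemma localized_remainder (k N r : R) (M : 'M[R]_(2 + 2 + 1)) (ch : C) (xi : plane R)
    (Z Z0 : 'cV[C]_(2 + 2 + 1)) : 0 <= k ->
  vnorm (Z - complexify M *m Z0) <= k * vnorm Z0 ->
  (forall j, `|Re ((ch%:M *m Z0) j 0)| <= jap xi `^ (- r) * (2 * N) /\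
             `|Im ((ch%:M *m Z0) j 0)| <= jap xi `^ (- r) * (2 * N)) ->
  forall i, `|Re ((ch%:M *m Z) i 0) - \sum_j M i j * Re ((ch%:M *m Z0) j 0)| <= 20 * N * (k * jap xi `^ (- r)) /\
            `|Im ((ch%:M *m Z) i 0) - \sum_j M i j * Im ((ch%:M *m Z0) j 0)| <= 20 * N * (k * jap xi `^ (- r)).
Proof.
rewrite !mul_scalar_mx => k0 ZM hW i.
have [eR eI] := mulmx_complexify_entry M (ch *: Z0) i.
rewrite -eR -eI -!(ReN, ImN) -!(ReD, ImD).
have sub (p q : 'cV[C]_(2 + 2 + 1)) : p i 0 - q i 0 = (p - q) i 0 by rewrite !mxE.
rewrite sub -scalemxAr -scalerBr.
(* Five components, each with a real and an imaginary part of size at most 2 N <xi>^(-r), give the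
   factor 20 N. *)
have W0 : vnorm (ch *: Z0) <= 20 * N * jap xi `^ (- r).
  apply: le_trans (vnorm_le_sum _) _.
  apply: (@le_trans _ _ (\sum_(j < 2 + 2 + 1) (jap xi `^ (- r) * (2 * N) + jap xi `^ (- r) * (2 * N)))).
    by apply: ler_sum => j _; have [h1 h2] := hW j; exact: lerD.
  rewrite sumr_const card_ord -mulr_natl le_eqVlt; apply/orP; left; apply/eqP; ring.
have h : vnorm (ch *: (Z - complexify M *m Z0)) <= 20 * N * (k * jap xi `^ (- r)).
  rewrite vnormZ; apply: le_trans (ler_wpM2l (sqrtr_ge0 _) ZM) _.
  rewrite mulrCA -vnormZ [leRHS]mulrCA; exact: ler_wpM2l.
by split; [apply: le_trans (Re_le_vnorm _ _) h|apply: le_trans (Im_le_vnorm _ _) h].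
Qed.


End decay_assembly.

(** * The decay estimate *)

Section dispersive_decay.
Context (R : realType).
Local Notation C := R[i].
Local Notation Re := complex.Re.
Local Notation Im := complex.Im.
Local Open Scope complex_scope.

Lemma ae_ord n (P : 'I_n -> plane R -> Prop) :
  (forall i, {ae leb2 R, forall x, P i x}) -> {ae leb2 R, forall x, forall i, P i x}.
Proof.
move=> hP; have h (m : nat) : {ae leb2 R, forall x, forall i : 'I_n, i = m :> nat -> P i x}.
  have [mn|nm] := ltnP m n.
    apply: ae_imp (hP (Ordinal mn)) => x Px i im.
    by rewrite (_ : i = Ordinal mn)//; exact: val_inj.
  by apply: aeW => x i im; have := ltn_ord i; rewrite im ltnNge nm.
by apply: ae_imp (ae_foralln h) => x hx i; exact: hx.
Qed.

Lemma complex_ext (z w : C) : Re z = Re w -> Im z = Im w -> z = w.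
Proof. by case: z => a b; case: w => c d /= -> ->. Qed.

(** The two indices may differ because the entries of a stacked vector have to be identified with
    those of its blocks. *)
Lemma fourierL2_component_unique n m (f F : plane R -> 'cV[C]_n) (g G : plane R -> 'cV[C]_m) i j :
  is_fourierL2 f F -> is_fourierL2 g G -> (forall x, f x i 0 = g x j 0) ->
  {ae leb2 R, forall xi, F xi i 0 = G xi j 0}.
Proof.
move=> hf hg fg; have p1 := fourierL2_component i hf; have p2 := fourierL2_component j hg.
have e1 : (fun x => Re (g x j 0)) = (fun x => Re (f x i 0)) by apply/funext => x; rewrite fg.
have e2 : (fun x => Im (g x j 0)) = (fun x => Im (f x i 0)) by apply/funext => x; rewrite fg.
rewrite e1 e2 in p2; apply: ae_imp (fourier_pair_unique p1 p2) => xi [h1 h2].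
exact: complex_ext.
Qed.

Lemma fourierL2_unique n (f F G : plane R -> 'cV[C]_n) :
  is_fourierL2 f F -> is_fourierL2 f G -> {ae leb2 R, forall xi, F xi = G xi}.
Proof.
move=> hF hG; have h := ae_ord (fun i => @fourierL2_component_unique _ _ f F f G i i hF hG (fun=> erefl)).
by apply: ae_imp h => xi h; apply/matrixP => i j; rewrite [j]ord1.
Qed.

(** The transforms inside [is_localized_state] are existentially quantified; uniqueness of the L^2
    transform identifies each of them, almost everywhere, with the one that solves the system. *)
Lemma localized_state_fourier (A : plane R -> 'M[R]_2) (chi : R * R -> C)
    (U Ut : R -> plane R -> 'cV[R]_2) (theta : R -> plane R -> R) (t : R) (w : plane R -> 'cV[C]_(2 + 2 + 1))
    (u v : plane R -> 'cV[C]_2) (th : plane R -> 'cV[C]_1) :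
  is_fourierL2 (fun x => complexify (U t x)) u ->
  is_fourierL2 (fun x => complexify (Ut t x)) v ->
  is_fourierL2 (fun x => complexify (theta t x)%:M) th ->
  is_localized_state A chi U Ut theta t w ->
  exists2 W, is_fourierL2 w W &
    {ae leb2 R, forall xi, W xi = (chi (unit2 xi))%:M *m thermo_state (sqrtmx (A xi)) (u xi) (v xi) (th xi)}.
Proof.
move=> hU hV hth [Y [[F1 [fU fY]] [F2 [fS fW]]]].
exists (fun xi => (chi (unit2 xi))%:M *m F2 xi) => //.
have eU := fourierL2_unique fU hU.
have e1 (i : 'I_2) : {ae leb2 R, forall xi, F2 xi (lshift 1 (lshift 2 i)) 0 = v xi i 0}.
  by apply: (fourierL2_component_unique fS hV) => x; rewrite !col_mxEu.
have e2 (i : 'I_2) : {ae leb2 R, forall xi, F2 xi (lshift 1 (rshift 2 i)) 0 = (complexify (sqrtmx (A xi)) *m F1 xi) i 0}.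
  by apply: (fourierL2_component_unique fS fY) => x; rewrite col_mxEu col_mxEd.
have e3 (i : 'I_1) : {ae leb2 R, forall xi, F2 xi (rshift (2 + 2) i) 0 = th xi i 0}.
  by apply: (fourierL2_component_unique fS hth) => x; rewrite col_mxEd.
have h := ae_and (ae_and (ae_ord e1) (ae_ord e2)) (ae_and (ae_ord e3) eU).
apply: ae_imp h => xi [[h1 h2] [h3 h4]]; congr (_ *m _).
rewrite -h4 /thermo_state; apply/matrixP => i j; rewrite [j]ord1.
case: (split_ordP i) => i' ->; last by rewrite col_mxEd h3.
by rewrite col_mxEu; case: (split_ordP i') => k ->; [rewrite col_mxEu h1|rewrite col_mxEd h2].
Qed.

Lemma ae_norm2_gt0 : {ae leb2 R, forall xi : plane R, 0 < norm2 xi}.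
Proof.
apply: ae_imp (@ae_fst_neq R 0) => xi h.
by rewrite norm2E sqrtr_gt0 ltr_pwDl ?sqr_ge0// exprn_even_gt0.
Qed.

(** [D] does not depend on the cut-off: multiplication by chi commutes with the propagator, and the
    right side is the norm of the state already localized. *)
Lemma localized_state_decay (k g la mu ta r : R) : 0 < k -> 0 < g ->
  0 < mu -> 0 < ta -> - ta - 2 * mu < la -> la < ta -> 2 < r ->
  exists2 D : R, 0 < D & forall chi U Ut theta t w0 w h,
    thermo_solution (elastic_symbol (cubic_stiffness ta la mu)) k g U Ut theta -> 0 <= t ->
    is_localized_state (elastic_symbol (cubic_stiffness ta la mu)) chi U Ut theta 0 w0 ->
    is_localized_state (elastic_symbol (cubic_stiffness ta la mu)) chi U Ut theta t w ->
    is_bessel r w0 h ->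
    {ae leb2 R, forall x, vnorm (w x) <= D * (1 + t) `^ (- 2^-1) * \int[leb2 R]_x vnorm (h x)}.
Proof.
move=> k0 g0 mu0 ta0 lal lau r2; set A := elastic_symbol _.
have [wv [c [al [be [ga [s0 [w0 c0 abg rep]]]]]]] := thermo_representation k0 g0 mu0 ta0 lal lau.
rewrite -/A in rep.
have [D1 D10 HD1] := degenerate_decay_integral c0 r2.
have [D2 D20 HD2] := propagator_kernel r2 w0.
(* Each real or imaginary part of a component is at most (80 D1 + 10 D2) (1 + t)^(-1/2) N, and there
   are ten of them. *)
exists (10 * (80 * D1 + 10 * D2)); first by rewrite mulr_gt0// addr_gt0// mulr_gt0.
move=> chi U Ut theta t wi w h [_ [Uh [Vh [thh [four sys]]]]] t0 st0 stt bes.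
have [f0U f0V f0t] := four 0 (lexx 0); have [ftU ftV ftt] := four t t0.
have [W0 fW0 eW0] := localized_state_fourier f0U f0V f0t st0.
have [W fW eW] := localized_state_fourier ftU ftV ftt stt.
have [F' fF' [ih _ ihc hae]] := bessel_data bes.
have eF := fourierL2_unique fF' fW0.
set N := \int[leb2 R]_x vnorm (h x).
have N0 : 0 <= N by apply: Rintegral_ge0 => x _; exact: vnorm_ge0.
set e := (1 + t) `^ (- 2^-1); have e0 : 0 <= e by exact: powR_ge0.
pose a (j : 'I_(2 + 2 + 1)) x := Re (h x j 0); pose b (j : 'I_(2 + 2 + 1)) x := Im (h x j 0).
have ia j : (leb2 R).-integrable setT (EFin \o a j) by case: (ihc j).
have ib j : (leb2 R).-integrable setT (EFin \o b j) by case: (ihc j).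
have aN j : \int[leb2 R]_x `|a j x| <= N.
  by apply: le_Rintegral => //; [exact: rintegrable_norm|move=> x _; exact: Re_le_vnorm].
have bN j : \int[leb2 R]_x `|b j x| <= N.
  by apply: le_Rintegral => //; [exact: rintegrable_norm|move=> x _; exact: Im_le_vnorm].
have l1N (p q : plane R -> R) : (leb2 R).-integrable setT (EFin \o p) -> (leb2 R).-integrable setT (EFin \o q) ->
    \int[leb2 R]_x `|p x| <= N -> \int[leb2 R]_x `|q x| <= N -> l1 p q <= 2 * N.
  move=> ip iq hp hq; rewrite /l1 (leb2_RintegralD (rintegrable_norm ip) (rintegrable_norm iq)).
  by rewrite mulr_natl mulr2n; exact: lerD.
have iNa j := rintegrableN (ia j); have iNb j := rintegrableN (ib j).
have aNN j : \int[leb2 R]_x `|- a j x| <= N by under eq_Rintegral do rewrite normrN; exact: aN.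
have kap0 : 0 <= (2 * pi)^-1 :> R by rewrite invr_ge0 mulr_ge0 ?pi_ge0.
have kap1 : (2 * pi)^-1 <= 1 :> R.
  rewrite invf_le1 ?mulr_gt0 ?pi_gt0//; have p2 := pi_ge2 R; clear -p2; lra.
pose gk i j xi := propagator wv al be ga s0 t xi i j * (jap xi `^ (- r) * (2 * pi)^-1).
have gkE i j : gk i j = fun xi => (2 * pi)^-1 * dispersive_phase r (al i j) (be i j) (ga i j) (wv * t) (s0 i j) (0, 0) xi.
  by apply/funext => xi; rewrite /gk mulrA propagator_entry mulrC.
have igk i j : (leb2 R).-integrable setT (EFin \o gk i j).
  have [h1 h2 h3] := abg i j; rewrite gkE; apply: rintegrableZ; exact: dispersive_phase_integrable.
have bgk i j z s : `|\int[leb2 R]_xi (gk i j xi * cos (s + dot2 z xi))| <= D2 * e.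
  have [h1 h2 h3] := abg i j.
  have iP : (leb2 R).-integrable setT (EFin \o (fun xi =>
     dispersive_phase r (al i j) (be i j) (ga i j) (wv * t) (s0 i j) (0, 0) xi * cos (s + dot2 z xi))).
    apply: (@bounded_mul_integrable _ 1); last exact: dispersive_phase_integrable.
      by apply: measurable_cosf; apply: measurable_funD => //; exact: measurable_dot2l.
    by move=> xi; exact: norm_cos_le1.
  rewrite gkE; under eq_Rintegral do rewrite -mulrA.
  rewrite (leb2_RintegralZ _ iP) normrM (ger0_norm kap0).
  apply: le_trans (ler_wpM2r (normr_ge0 _) kap1) _; rewrite mul1r.
  exact: (HD2 _ _ _ (s0 i j) t s z h1 h2 h3 t0).
have [ik kD1] := HD1 t t0.
have k0' xi : 0 <= degenerate_decay c t xi * jap xi `^ (- r).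
  by rewrite mulr_ge0 ?powR_ge0// sumr_ge0// => l _; exact: expR_ge0.
have hall := ae_and (ae_and eW0 eW) (ae_and (ae_and hae eF) (ae_and sys ae_norm2_gt0)).
(* 40 is twice the 20 of [localized_remainder], whose factor k is here
   [2 * degenerate_decay c t xi]. *)
have key i : {ae leb2 R, forall xi,
    `|Re (W xi i 0) - \sum_j gk i j xi * ftr (a j) (b j) xi| <= 40 * N * (degenerate_decay c t xi * jap xi `^ (- r)) /\
    `|Im (W xi i 0) - \sum_j gk i j xi * ftr (b j) (fun y => - a j y) xi| <=
       40 * N * (degenerate_decay c t xi * jap xi `^ (- r))}.
  apply: ae_imp hall => xi [[h1 h2] [[h3 h4] [h5 h6]]].
  have rp := rep xi _ _ _ h6 h5 t t0; rewrite /= in rp.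
  have dd0 : 0 <= 2 * degenerate_decay c t xi.
    by rewrite mulr_ge0// sumr_ge0// => l _; exact: expR_ge0.
  rewrite h4 h1 in h3.
  have J0 : 0 <= jap xi `^ (- r) by exact: powR_ge0.
  have data (p q : plane R -> R) : (leb2 R).-integrable setT (EFin \o p) -> (leb2 R).-integrable setT (EFin \o q) ->
      \int[leb2 R]_x `|p x| <= N -> \int[leb2 R]_x `|q x| <= N ->
      `|jap xi `^ (- r) * (2 * pi)^-1 * ftr p q xi| <= jap xi `^ (- r) * (2 * N).
    move=> ip iq hp hq; rewrite -mulrA normrM (ger0_norm J0) ler_wpM2l// normrM (ger0_norm kap0).
    apply: le_trans (ler_wpM2r (normr_ge0 _) kap1) _; rewrite mul1r.
    exact: le_trans (ftr_bound xi ip iq) (l1N _ _ ip iq hp hq).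
  have hW j : `|Re (((chi (unit2 xi))%:M *m thermo_state (sqrtmx (A xi)) (Uh 0 xi) (Vh 0 xi) (thh 0 xi)) j 0)| <= jap xi `^ (- r) * (2 * N) /\
              `|Im (((chi (unit2 xi))%:M *m thermo_state (sqrtmx (A xi)) (Uh 0 xi) (Vh 0 xi) (thh 0 xi)) j 0)| <= jap xi `^ (- r) * (2 * N).
    have [-> ->] := h3 j; split.
      exact: (data _ _ (ia j) (ib j) (aN j) (bN j)).
    exact: (data _ _ (ib j) (iNa j) (bN j) (aNN j)).
  have [r1 r3] := localized_remainder dd0 rp hW i.
  rewrite h2; split.
    have -> : \sum_j gk i j xi * ftr (a j) (b j) xi = \sum_j propagator wv al be ga s0 t xi i j *
       Re (((chi (unit2 xi))%:M *m thermo_state (sqrtmx (A xi)) (Uh 0 xi) (Vh 0 xi) (thh 0 xi)) j 0).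
      by apply: eq_bigr => j _; have [-> _] := h3 j; rewrite /gk -!mulrA.
    by apply: le_trans r1 _; rewrite le_eqVlt; apply/orP; left; apply/eqP; ring.
  have -> : \sum_j gk i j xi * ftr (b j) (fun y => - a j y) xi = \sum_j propagator wv al be ga s0 t xi i j *
     Im (((chi (unit2 xi))%:M *m thermo_state (sqrtmx (A xi)) (Uh 0 xi) (Vh 0 xi) (thh 0 xi)) j 0).
    by apply: eq_bigr => j _; have [_ ->] := h3 j; rewrite /gk -!mulrA.
  by apply: le_trans r3 _; rewrite le_eqVlt; apply/orP; left; apply/eqP; ring.
have N40 : 0 <= 40 * N by rewrite mulr_ge0.
have D2e : 0 <= D2 * e by rewrite mulr_ge0// ltW.
have bound (p q : 'I_(2 + 2 + 1) -> plane R -> R) : (forall j, l1 (p j) (q j) <= 2 * N) ->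
    2 * (40 * N * (D1 * e)) + \sum_j D2 * e * l1 (p j) (q j) <= 2 * (40 * N * (D1 * e)) + 5 * (D2 * e * (2 * N)).
  move=> pq; rewrite lerD2l.
  apply: le_trans (_ : \sum_(j < 2 + 2 + 1) D2 * e * (2 * N) <= _).
    by apply: ler_sum => j _; rewrite ler_wpM2l.
  rewrite sumr_const card_ord -[_ *+ (2 + 2 + 1)]mulr_natl le_eqVlt; apply/orP; left; apply/eqP; ring.
have comp i : {ae leb2 R, forall x, `|Re (w x i 0)| <= 2 * (40 * N * (D1 * e)) + 5 * (D2 * e * (2 * N)) /\
                                    `|Im (w x i 0)| <= 2 * (40 * N * (D1 * e)) + 5 * (D2 * e * (2 * N))}.
  have fp := fourierL2_component i fW.
  have c1 := dispersive_component fp ia ib (igk i) (bgk i) k0' ik kD1 N40 (key i).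
  (* The imaginary part of w is the real part of -i w, whose data are b and - a. *)
  have key' : {ae leb2 R, forall xi,
    `|Im (W xi i 0) - \sum_j gk i j xi * ftr (b j) (fun y => - a j y) xi| <= 40 * N * (degenerate_decay c t xi * jap xi `^ (- r)) /\
    `|- Re (W xi i 0) - \sum_j gk i j xi * ftr (fun y => - a j y) (fun y => - b j y) xi| <=
       40 * N * (degenerate_decay c t xi * jap xi `^ (- r))}.
    apply: ae_imp (key i) => xi [h1 h2]; split => //.
    have -> : \sum_j gk i j xi * ftr (fun y => - a j y) (fun y => - b j y) xi = - \sum_j gk i j xi * ftr (a j) (b j) xi.
      by rewrite -sumrN; apply: eq_bigr => j _; rewrite ftrN// mulrN.
    by rewrite -opprD normrN.
  have c2 := dispersive_component (fourier_pair_rot fp) ib iNa (igk i) (bgk i) k0' ik kD1 N40 key'.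
  apply: ae_imp2 c1 c2 => x h1 h2; split.
    by apply: le_trans h1 (bound _ _ _) => j; exact: (l1N _ _ (ia j) (ib j) (aN j) (bN j)).
  by apply: le_trans h2 (bound _ _ _) => j; exact: (l1N _ _ (ib j) (iNa j) (bN j) (aNN j)).
apply: ae_imp (ae_ord comp) => x hx.
apply: le_trans (vnorm_le_sum _) _.
apply: (@le_trans _ _ (\sum_(j < 2 + 2 + 1) ((2 * (40 * N * (D1 * e)) + 5 * (D2 * e * (2 * N))) +
   (2 * (40 * N * (D1 * e)) + 5 * (D2 * e * (2 * N)))))).
  by apply: ler_sum => j _; have [h1 h2] := hx j; exact: lerD.
rewrite sumr_const card_ord -mulr_natl le_eqVlt; apply/orP; left; apply/eqP; ring.
Qed.

Lemma Lpnorm_infty_le n (f : plane R -> 'cV[C]_n) (M : R) : 0 <= M ->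
  {ae leb2 R, forall x, vnorm (f x) <= M} -> (Lpnorm +oo f <= M%:E)%E.
Proof.
(* The other branch in the definition of the norm has the value 0 and is covered by [0 <= M]. *)
move=> M0 h; rewrite /Lpnorm unlock; case: ifP => _; last by rewrite lee_fin.
by apply/ess_supP; apply: ae_imp h => x h; rewrite /= lee_fin ger0_norm ?vnorm_ge0.
Qed.

End dispersive_decay.

Theorem mainTheorem2 (R : realType) (kappa gamma lambda mu tau : R)
  (kappa_gt0 : 0 < kappa) (gamma_gt0 : 0 < gamma)
  (mu_gt0 : 0 < mu) (tau_gt0 : 0 < tau)
  (lambda_gt : - tau - 2 * mu < lambda) (lambda_lt : lambda < tau)
  (nondegenerate : (lambda + mu) * (tau - mu) <> 0)
  (gamma_diagonal : gamma ^+ 2 <> - (lambda + mu))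
  (gamma_axis : gamma ^+ 2 <> mu - tau) :
  has_dispersive_decay (elastic_symbol (cubic_stiffness tau lambda mu))
    kappa gamma 2^-1.
Proof.
move=> eta _; exists (circle R); split => //; first by apply: nearW.
move=> chi _ _ r r2.
have [D D0 H] := localized_state_decay kappa_gt0 gamma_gt0 mu_gt0 tau_gt0 lambda_gt lambda_lt r2.
exists D => U Ut theta sol t w0 w t0 s0 st _.
have e0 : 0 < (1 + t) `^ (- 2^-1) by rewrite powR_gt0// ltr_pwDl.
have De : 0 < D * (1 + t) `^ (- 2^-1) by exact: mulr_gt0.
(* The H^{1,r} norm is an infimum over all admissible g, so after division by the positive factor it
   is enough to compare with each g. *)
rewrite -lee_pdivrMl//; apply: le_ereal_inf_tmp => _ [g bes <-].
rewrite lee_pdivrMl//; have [_ _ [_ -> _ _]] := bessel_data bes.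
rewrite -EFinM; apply: Lpnorm_infty_le (H _ _ _ _ _ _ _ _ sol t0 s0 st bes).
by rewrite mulr_ge0 ?(ltW De)// Rintegral_ge0// => x _; exact: vnorm_ge0.
Qed.
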